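(* Let $W\subset\mathbb{R}^{d}$ be an unbounded set and let $\omega$ be a positive function on $W$. Suppose that the weight sequence $\{M_p\}_{p\in\mathbb{N}}$ satisfies $(M.1)$, $(M.2)$, and $(M.3)$. Let $\ast$ stand for $(M_p)$ (Beurling case) or $\{M_p\}$ (Roumieu case). An ultradistribution $f\in\mathcal{D}'^{\ast}(\mathbb{R}^{d})$ satisfies $$f(x+h)=O(\omega(h)),\quad h\in W,\quad\text{in }\mathcal{D}'^{\ast}(\mathbb{R}^{d}),$$ if and only if for each $R>0$ there are continuous functions $\{f_\alpha\}_{\alpha\in\mathbb{N}^{d}}$ defined on $W_R$ such that, for some $\ell>0$ in the Beurling case (for each $\ell>0$ in the Roumieu case), there exists $C_\ell>0$ such that $$|f_\alpha(x+h)|\le C_\ell\frac{\ell^{|\alpha|}}{M_\alpha}\,\omega(x),\qquad x\in W,\ |h|<R,\ \alpha\in\mathbb{N}^{d},$$ and the representation $$f=\sum_{\alpha\in\mathbb{N}^{d}}f_\alpha^{(\alpha)}\qquad\text{in }W_R$$ holds.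
   Context: $\{M_p\}_{p\in\mathbb{N}}$ is a sequence of positive real numbers ($0\in\mathbb{N}$) and $M_\alpha:=M_{|\alpha|}$ for multi-indices $\alpha\in\mathbb{N}^d$. Conditions: - $(M.1)$: $M_p^2\le M_{p-1}M_{p+1}$ for $p\ge1$. - $(M.2)$: $M_{p+q}\le AH^{p+q}M_pM_q$, $p,q\in\mathbb{N}$, for certain constants $A,H$. - $(M.3)$: $\sum_{p=q}^\infty M_{p-1}/M_p\le c_0\,q\,M_{q-1}/M_q$, $q\ge1$, for a certain constant $c_0$. Ultradistribution spaces. Let $\Omega\subseteq\mathbb{R}^d$ be open. For $K$ a (regular) compact set and $\ell>0$, $\mathcal{E}^{M_p,\ell}(K)$ is the space of smooth $\varphi$ with $\|\varphi\|_{\mathcal{E}^{M_p,\ell}(K)}=\sup_{\alpha\in\mathbb{N}^d}\sup_{x\in K}\frac{|\varphi^{(\alpha)}(x)|}{\ell^{|\alpha|}M_\alpha}<\infty$. Put $\mathcal{D}^{M_p,\ell}_K=\mathcal{E}^{M_p,\ell}(K)\cap\mathcal{D}_K$, where $\mathcal{D}_K$ is the space of smooth functions supported in $K$. Then $\mathcal{D}^{(M_p)}(\Omega)=\varinjlim_{K\Subset\Omega}\varprojlim_{\ell\to0^+}\mathcal{D}^{M_p,\ell}_K$ and $\mathcal{D}^{\{M_p\}}(\Omega)=\varinjlim_{K\Subset\Omega}\varinjlim_{\ell\to\infty}\mathcal{D}^{M_p,\ell}_K$. The strong dual of $\mathcal{D}^{\ast}(\Omega)$ is $\mathcal{D}'^{\ast}(\Omega)$.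 The relation $f(x+h)=O(\omega(h))$, $h\in W$, in $\mathcal{D}'^{\ast}(\mathbb{R}^d)$ means that for each $\varphi\in\mathcal{D}^{\ast}(\mathbb{R}^d)$, $\sup_{h\in W}\frac{|\langle f(x+h),\varphi(x)\rangle|}{\omega(h)}<\infty$, where $\langle f(x+h),\varphi(x)\rangle=\langle f(x),\varphi(x-h)\rangle$. $W_R:=W+B(0,R)$ is the open $R$-neighborhood of $W$. Equality ''in $W_R$'' means equality in $\mathcal{D}'^{\ast}(W_R)$. *)

(* Defs.v *)
From HB Require Import structures.
From mathcomp Require Import all_boot all_order all_algebra.
From mathcomp Require Import finmap.
From mathcomp Require Import all_classical all_reals all_analysis.
From mathcomp Require Import complex.

Set Implicit Arguments.
Unset Strict Implicit.
Unset Printing Implicit Defensive.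

Import Order.TTheory GRing.Theory Num.Theory.
Import numFieldNormedType.Exports.

Local Open Scope classical_set_scope.
Local Open Scope complex_scope.
Local Open Scope ring_scope.

Section WeightSequences.
Context {R : realType}.
Implicit Types M : nat -> R.

Definition weight_M1 M : Prop :=
  forall p, (1 <= p)%N -> M p ^+ 2 <= M p.-1 * M p.+1.

Definition weight_M2 M : Prop :=
  exists A H : R, forall p q, M (p + q)%N <= A * H ^+ (p + q) * M p * M q.

Definition weight_M3 M : Prop :=
  exists c0 : R, forall q, (1 <= q)%N ->
    (\sum_(q <= p <oo) (M p.-1 / M p)%:E <= (c0 * q%:R * (M q.-1 / M q))%:E)%E.

End WeightSequences.

Section Calculus.
Context {R : realType} {d : nat}.
Implicit Types (x : 'rV[R]_d) (phi : 'rV[R]_d -> R[i]).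

Definition multiindex := {ffun 'I_d -> nat}.

Definition mlength (a : multiindex) : nat := (\sum_(i < d) a i)%N.

(* The library norm on 'rV[R]_d is the sup norm. *)
Definition enorm x : R := Num.sqrt (\sum_(i < d) x 0 i ^+ 2).

Definition thicken (W : set 'rV[R]_d) (r : R) : set 'rV[R]_d :=
  [set y | exists2 x, W x & enorm (y - x) < r].

Definition Re_fun phi : 'rV[R]_d -> R := fun x => complex.Re (phi x).
Definition Im_fun phi : 'rV[R]_d -> R := fun x => complex.Im (phi x).

(* R[i] carries no topology over the scalar field R in the library, so the
   calculus of complex-valued functions is done componentwise. *)
Definition ccontinuous_on (A : set 'rV[R]_d) phi : Prop :=
  {within A, continuous (Re_fun phi)} /\ {within A, continuous (Im_fun phi)}.

Definition basis_vec (i : 'I_d) : 'rV[R]_d := delta_mx 0 i.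

Definition partial (i : 'I_d) phi : 'rV[R]_d -> R[i] :=
  fun x => 'D_(basis_vec i) (Re_fun phi) x +i* 'D_(basis_vec i) (Im_fun phi) x.

Definition has_partial (i : 'I_d) phi : Prop :=
  forall x, derivable (Re_fun phi) x (basis_vec i) /\
            derivable (Im_fun phi) x (basis_vec i).

(* All iterated partial derivatives, in any order, exist and are continuous. *)
Definition smooth phi : Prop :=
  forall s : seq 'I_d,
    ccontinuous_on setT (foldr partial phi s) /\
    forall i, has_partial i (foldr partial phi s).

Definition mderiv (a : multiindex) phi : 'rV[R]_d -> R[i] :=
  foldr (fun i g => iter (a i) (partial i) g) phi (enum 'I_d).

Definition supp phi : set 'rV[R]_d := closure [set x | phi x != 0].

End Calculus.

Arguments multiindex d : clear implicits.

(* Integral over R^d, as d nested one-dimensional Lebesgue integrals. It is only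
   applied to continuous compactly supported functions, for which it agrees with
   the d-dimensional Lebesgue integral by Fubini's theorem. *)
Fixpoint rintegral {R : realType} {d : nat} : ('rV[R]_d -> R) -> R :=
  match d return ('rV[R]_d -> R) -> R with
  | 0%N => fun g => g 0
  | d'.+1 => fun g =>
      Rintegral (@lebesgue_measure R) setT
        (fun t : R => @rintegral R d'
           (fun x : 'rV[R]_d' => g (row_mx (const_mx t : 'rV[R]_1) x)))
  end.

Definition cintegral {R : realType} {d : nat} (g : 'rV[R]_d -> R[i]) : R[i] :=
  rintegral (Re_fun g) +i* rintegral (Im_fun g).

(* Topologies on spaces of functions are given by their 0-neighbourhoods. For a
   subspace V of the space of all functions, a set system N encodes the
   0-neighbourhood filter of V in the sense that N U holds iff the trace of U
   on V is a 0-neighbourhood of V; elements of U outside V play no role. *)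
Section LocallyConvex.
Context {R : realType} {d : nat}.
Local Notation cfun := ('rV[R]_d -> R[i]).

Definition absolutely_convex (U : set cfun) : Prop :=
  forall (a b : R[i]) (phi psi : cfun), `|a| + `|b| <= 1 ->
    U phi -> U psi -> U (fun x => a * phi x + b * psi x).

(* Locally convex inductive limit: the finest locally convex topology making
   all inclusions of the steps continuous. A 0-neighbourhood base is formed by
   the absolutely convex sets whose trace on every step is a 0-neighbourhood. *)
Definition indlim_nbhs0 {I : Type} (P : set I) (N : I -> set_system cfun) :
    set_system cfun :=
  [set U | exists A : set cfun,
     [/\ absolutely_convex A, A `<=` U & forall i, P i -> N i A]].

Definition absorbs (U B : set cfun) : Prop :=
  exists2 r : R, 0 < r & forall phi, B phi -> U (fun x => r^-1%:C * phi x).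

End LocallyConvex.

Variant ultra_case := Beurling | Roumieu.

Section UltraSpaces.
Context {R : realType} {d : nat}.
Variable M : nat -> R.
Local Notation cfun := ('rV[R]_d -> R[i]).
Implicit Types (K Omega : set 'rV[R]_d) (phi : cfun) (star : ultra_case).

Definition ultranorm (l : R) K phi : \bar R :=
  ereal_sup [set r | exists (a : multiindex d) x, K x /\
    r = (Normc.normc (mderiv a phi x) / (l ^+ mlength a * M (mlength a)))%:E].

Definition D_step (l : R) K : set cfun :=
  [set phi | [/\ smooth phi, supp phi `<=` K & (ultranorm l K phi < +oo)%E]].

Definition D_step_nbhs0 (l : R) K : set_system cfun :=
  [set U | exists2 e : R, 0 < e &
     forall phi, D_step l K phi -> (ultranorm l K phi < e%:E)%E -> U phi].

Definition D_compact star K : set cfun :=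
  match star with
  | Beurling => \bigcap_(l in [set l : R | 0 < l]) D_step l K
  | Roumieu => \bigcup_(l in [set l : R | 0 < l]) D_step l K
  end.

(* In the projective limit (initial topology), a single norm ball suffices
   because the norms are monotone in l. *)
Definition D_compact_nbhs0 star K : set_system cfun :=
  match star with
  | Beurling => [set U | exists l e : R, [/\ 0 < l, 0 < e &
      forall phi, D_compact Beurling K phi ->
        (ultranorm l K phi < e%:E)%E -> U phi]]
  | Roumieu =>
      indlim_nbhs0 [set l : R | 0 < l] (fun l => D_step_nbhs0 l K)
  end.

Definition D_space star Omega : set cfun :=
  \bigcup_(K in [set K | compact K /\ K `<=` Omega]) D_compact star K.

Definition D_nbhs0 star Omega : set_system cfun :=
  indlim_nbhs0 [set K | compact K /\ K `<=` Omega] (D_compact_nbhs0 star).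

Definition D_bounded star Omega (B : set cfun) : Prop :=
  B `<=` D_space star Omega /\
  forall U, D_nbhs0 star Omega U -> absorbs U B.

(* Continuous linear functionals on D_space; values outside D_space are
   irrelevant. *)
Definition ultradistribution star Omega (f : cfun -> R[i]) : Prop :=
  (forall (a : R[i]) phi psi,
     D_space star Omega phi -> D_space star Omega psi ->
     f (fun x => a * phi x + psi x) = a * f phi + f psi) /\
  (forall e : R, 0 < e ->
     D_nbhs0 star Omega [set phi | Normc.normc (f phi) < e]).

Definition bigO_translates star (W : set 'rV[R]_d) (omega : 'rV[R]_d -> R)
    (f : cfun -> R[i]) : Prop :=
  forall phi, D_space star setT phi ->
    (ereal_sup [set (Normc.normc (f (fun x => phi (x - h)%R)) / omega h)%:E
               | h in W] < +oo)%E.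

Definition distr_deriv (a : multiindex d) (g phi : cfun) : R[i] :=
  (-1) ^+ mlength a * cintegral (fun x => g x * mderiv a phi x).

(* f = \sum_a T a in the strong dual of D_space star Omega: the net of finite
   partial sums converges to f uniformly on bounded sets. *)
Definition strong_dual_sum star Omega (T : multiindex d -> cfun -> R[i])
    (f : cfun -> R[i]) : Prop :=
  forall B, D_bounded star Omega B -> forall e : R, 0 < e ->
    exists A0 : {fset multiindex d}, forall A : {fset multiindex d},
      (A0 `<=` A)%fset -> forall phi, B phi ->
      Normc.normc (\sum_(a <- A) T a phi - f phi) < e.

Definition coeff_bound (W : set 'rV[R]_d) (omega : 'rV[R]_d -> R) (r : R)
    (g : multiindex d -> cfun) (l : R) : Prop :=
  exists2 C : R, 0 < C & forall x h (a : multiindex d), W x -> enorm h < r ->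
    Normc.normc (g a (x + h)) <= C * (l ^+ mlength a / M (mlength a)) * omega x.

Definition coeff_bound_case star (W : set 'rV[R]_d) (omega : 'rV[R]_d -> R)
    (r : R) (g : multiindex d -> cfun) : Prop :=
  match star with
  | Beurling => exists2 l : R, 0 < l & coeff_bound W omega r g l
  | Roumieu => forall l : R, 0 < l -> coeff_bound W omega r g l
  end.

End UltraSpaces.

(* Main.v *)
(* Let U_a f and V_a f be the averages of f over [x - a, x] with densities 1/a
   and 2(1 - s/a)/a at x - s.  Then f = U_a f + (a/2) (V_a f)', and U_a, V_a
   commute with differentiation.  Iterating this in each variable with widths
   a_0, ..., a_(n-1), starting from mollifiers tau_n that are infinite averages
   over boxes of widths beta_n, beta_(n+1), ..., gives
   tau_n = \sum_alpha D^alpha G_(n,alpha) with all kernels supported in one box.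
   For widths of order M_p / M_(p+1), (M.3) bounds the coefficients of
   G_(n,alpha) by l^|alpha| / M_alpha, and the differences
   G_(n+1,alpha) - G_(n,alpha) are summable in an ultradifferentiable norm for
   which, by uniform boundedness, the functionals f(x + h) / omega(h) are
   equicontinuous.  Hence f_alpha(y) = (-1)^|alpha| lim_n <f, G_(n,alpha)(. - y)>
   exists with the required bound, and f * tau_n -> f gives the representation.
   In the Roumieu case a_p is a sequence o(M_p / M_(p+1)) decreasing slowly
   enough to keep the differences summable for all the norms involved.
   Conversely, the coefficient bounds make the paired series converge
   geometrically, uniformly after division by omega(h). *)

Require Import Defs.
From HB Require Import structures.
From mathcomp Require Import all_boot all_order all_algebra.
From mathcomp Require Import finmap.
From mathcomp Require Import all_classical all_reals all_analysis.
From mathcomp Require Import complex.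
From mathcomp Require Import ring lra.
Import Order.TTheory GRing.Theory Num.Theory.
Import numFieldNormedType.Exports.
Local Open Scope classical_set_scope.
Local Open Scope complex_scope.
Local Open Scope ring_scope.

Set Implicit Arguments.
Unset Strict Implicit.
Unset Printing Implicit Defensive.

(** * Averaging operators on the line *)

(** Write [mu p] for [M p.+1 / M p]. The widths [a p] meet opposite demands. An average of width
    [a p] absorbs one derivative at the cost [4 / a p], so the increments of the kernels are small
    in a given norm only if [a p] is at least a multiple of [1 / mu p]; the coefficients are
    elementary symmetric polynomials in the [a p / 2] and want [a p] small. In the Beurling case one
    norm controls the functionals and a constant ratio serves; in the Roumieu case the ratio must
    tend to 0 while constants of unknown growth enter, whence the slow choice. The mollifier has its
    own widths [beta p], summable but eventually above every multiple of [1 / mu p]: every kernel is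
    then in the Beurling class and may be inserted into the functional in both cases. A word of
    length [n] uses [a 0] to [a (n - 1)] and the mollifier goes on with [beta n], so the costs of
    [j] derivatives multiply up to [M j]. Increments are measured on second primitives of the
    mollifiers, which are Lipschitz: passing to the next stage changes them by at most the widths
    involved, and the averages absorb the two surplus derivatives. *)

Section Deriv.
Context {R : realType}.

Lemma cont_cst {T : topologicalType} (c : R) : continuous (fun _ : T => c).
Proof. exact: cst_continuous. Qed.

Lemma cont_lin {T : topologicalType} c (f g : T -> R) :
  continuous f -> continuous g -> continuous (fun x => c * f x + g x).
Proof.
move=> cf cg x; apply: (@cvgD _ R); last exact: cg.
by apply: (@cvgM R); [exact: cst_continuous|exact: cf].
Qed.

Lemma cont_mul {T : topologicalType} (f g : T -> R) :
  continuous f -> continuous g -> continuous (fun x => f x * g x).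
Proof. by move=> cf cg x; apply: (@cvgM R); [exact: cf|exact: cg]. Qed.

Lemma cont_shift {V : normedModType R} (f : V -> R) h :
  continuous f -> continuous (fun x => f (x + h)).
Proof.
move=> cf x; apply: (@continuous_comp V V R (fun x => x + h) f); last exact: cf.
by apply: cvgD => //; exact: cst_continuous.
Qed.

Lemma cont_ballP {V : normedModType R} (f : V -> R) x : {for x, continuous f} <->
  forall e, 0 < e -> exists2 dl, 0 < dl & forall y, `|x - y| < dl -> `|f x - f y| <= e.
Proof.
split=> [cf e e0|H].
  have /cvgrPdist_le/(_ e e0)/nbhs_ballP[dl /= dl0 Hd] := cf.
  by exists dl => // y xy; apply: Hd; rewrite -ball_normE.
apply/cvgrPdist_le => e /H[dl dl0 Hd]; apply/nbhs_ballP; exists dl => //= y.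
by rewrite -ball_normE/=; exact: Hd.
Qed.

(** Differentiability as a first-order estimate free of division, with [t = 0] allowed: such
    estimates pass directly under integrals and uniform limits. [dd1P] and [ddP] identify them with
    the library derivative. *)
Definition dd1 (f : R -> R) (x df : R) : Prop :=
  forall e, 0 < e -> exists2 dl, 0 < dl &
    forall t, `|t| < dl -> `|f (x + t) - f x - t * df| <= e * `|t|.

Definition dd {V : normedModType R} (f : V -> R) (v x : V) (df : R) : Prop :=
  forall e, 0 < e -> exists2 dl, 0 < dl &
    forall t, `|t| < dl -> `|f (x + t *: v) - f x - t * df| <= e * `|t|.

Lemma ddP {V : normedModType R} (f : V -> R) (v x : V) (df : R) :
  dd f v x df <-> is_derive x v f df.
Proof.
split=> [H|[+ <-]].
- have C : (fun h => h^-1 *: ((f \o shift x) (h *: v) - f x)) @ 0^' --> df.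
    apply/cvgrPdist_le => e e0; have [dl dl0 Hd] := H _ e0.
    near=> t.
    have t0 : t != 0 by near: t; exact: nbhs_dnbhs_neq.
    have td : `|t| < dl.
      near: t; apply: dnbhs0_lt => //.
    have := Hd _ td; rewrite /= addrC [_ + x]addrC => Ht.
    rewrite -(ler_pM2r (_ : 0 < `|t|)) ?normr_gt0// -normrM.
    apply: le_trans Ht; rewrite -normrN le_eqVlt; apply/orP; left; apply/eqP.
    congr `| _ |; rewrite /GRing.scale/= mulrBl opprB mulrAC mulVf// mul1r.
    by rewrite [df * t]mulrC; ring.
  have D : derivable f x v by apply/cvg_ex; exists df; exact: C.
  by apply: DeriveDef => //; apply: cvg_lim => //; exact: C.
- rewrite /derivable => /cvgrPdist_le; rewrite -/(derive f x v) => H e e0.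
  have := H e e0 => /nbhs_ballP[dl /= dl0 Hd].
  exists dl => // t td.
  have [->|t0] := eqVneq t 0.
    by rewrite scale0r addr0 subrr mul0r subr0 normr0 mulr0.
  have := Hd t; rewrite /ball/= sub0r normrN => /(_ td t0).
  rewrite -(ler_pM2r (_ : 0 < `|t|)) ?normr_gt0// -normrM => Ht.
  apply: le_trans Ht; rewrite le_eqVlt; apply/orP; left; apply/eqP.
  rewrite -normrN; congr `| _ |; rewrite /GRing.scale/= mulrBl mulrAC mulVf// mul1r.
  by rewrite [x + _]addrC [derive f x v * t]mulrC; ring.
Unshelve. all: by end_near.
Qed.

Lemma dd1P (f : R -> R) (x df : R) : dd1 f x df <-> is_derive x 1 f df.
Proof.
rewrite -ddP; split=> H e e0; have [dl dl0 Hd] := H e e0; exists dl => // t td;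
  by have := Hd t td; rewrite /GRing.scale/= mulr1.
Qed.

Lemma dd_line {V : normedModType R} (f : V -> R) (v x : V) t df :
  dd f v (x + t *: v) df <-> dd1 (fun t => f (x + t *: v)) t df.
Proof.
split=> H e e0; have [dl dl0 Hd] := H e e0; exists dl => // s sd;
  by have := Hd s sd; rewrite scalerDl addrA.
Qed.

Lemma dd1_cont (f : R -> R) x df : dd1 f x df -> {for x, continuous f}.
Proof.
by move=> /dd1P[D _]; apply: differentiable_continuous; apply/derivable1_diffP.
Qed.

Lemma dd1_MVT_oo (f f' : R -> R) a b : (forall x, dd1 f x (f' x)) -> a < b ->
  exists2 c, a < c < b & f b - f a = f' c * (b - a).
Proof.
move=> H ab; have [x _||c] := @MVT R f f' a b ab.
- exact/dd1P.
- by apply: continuous_subspaceT => x'; apply: dd1_cont (H x').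
- by rewrite in_itv/=; exists c.
Qed.

Lemma dd1_MVT (f f' : R -> R) : (forall x, dd1 f x (f' x)) ->
  forall a b, exists2 c, Num.min a b <= c <= Num.max a b & f b - f a = f' c * (b - a).
Proof.
move=> H.
have K a b : a <= b -> exists2 c, a <= c <= b & f b - f a = f' c * (b - a).
  move=> ab; have [|x|c] := @MVT_segment R f f' a b ab.
  - by move=> x _; apply/dd1P.
  - by apply: continuous_subspaceT => x'; apply: dd1_cont (H x').
  - by rewrite in_itv/=; exists c.
move=> a b; have [ab|/ltW ba] := leP a b; first exact: K.
have [c cb E] := K _ _ ba; exists c => //.
by rewrite -opprB E -mulrN opprB.
Qed.

Lemma dd1_bound (f f' : R -> R) (C : R) : (forall x, dd1 f x (f' x)) ->
  (forall x, `|f' x| <= C) -> forall a b, `|f b - f a| <= C * `|b - a|.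
Proof.
move=> H HC a b; have [c _ ->] := dd1_MVT H a b.
by rewrite normrM ler_wpM2r.
Qed.

Lemma dd1_const (f : R -> R) : (forall x, dd1 f x 0) -> forall a b, f a = f b.
Proof.
move=> H a b; apply/eqP; rewrite -subr_eq0 -normr_le0.
apply: le_trans (dd1_bound (f' := fun=> 0) (C := 0) H _ b a) _; last by rewrite mul0r.
by move=> x; rewrite normr0.
Qed.

Lemma dd1D (f g : R -> R) x a b c :
  dd1 f x a -> dd1 g x b -> dd1 (fun y => c * f y + g y) x (c * a + b).
Proof.
by move=> /dd1P Hf /dd1P Hg; apply/dd1P.
Qed.

Lemma dd1_scale (f : R -> R) x a c : dd1 f x a -> dd1 (fun y => c * f y) x (c * a).
Proof.
move=> H; have := dd1D c H (_ : dd1 (fun=> 0) x 0); rewrite addr0.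
have -> : (fun y => c * f y + 0) = (fun y => c * f y).
  by apply/funext => y; rewrite addr0.
apply => e e0; exists 1 => // t _.
by rewrite mulr0 !subrr normr0 mulr_ge0// ltW.
Qed.

Lemma dd1B (f g : R -> R) x a b :
  dd1 f x a -> dd1 g x b -> dd1 (fun y => f y - g y) x (a - b).
Proof.
move=> Hf Hg; have := dd1D (-1) Hg Hf; rewrite mulN1r addrC.
suff -> : (fun y => f y - g y) = (fun y => -1 * g y + f y) by [].
by apply/funext => y; rewrite mulN1r addrC.
Qed.

Lemma dd1_affine (a b : R) x : dd1 (fun y => a * y + b) x a.
Proof.
move=> e e0; exists 1 => // t _.
have -> : a * (x + t) + b - (a * x + b) - t * a = 0 by ring.
by rewrite normr0 mulr_ge0// ltW.
Qed.

Lemma dd1_refl (f : R -> R) x h a : dd1 f (h - x) a -> dd1 (fun y => f (h - y)) x (- a).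
Proof.
move=> H e e0; have [dl dl0 Hd] := H e e0; exists dl => // t td.
have := Hd (- t); rewrite normrN => /(_ td).
by rewrite mulNr opprD addrA mulrN opprK.
Qed.

Lemma dd1_shift (f : R -> R) x h a : dd1 f (x + h) a -> dd1 (fun y => f (y + h)) x a.
Proof.
move=> H e e0; have [dl dl0 Hd] := H e e0; exists dl => // t td.
by rewrite [x + t + h]addrAC; exact: Hd.
Qed.

End Deriv.

Section Primitive.
Context {R : realType}.
Notation mu := (@lebesgue_measure R).

Lemma continuous_integrable_itv (f : R -> R) a b : continuous f ->
  mu.-integrable `[a, b] (EFin \o f).
Proof.
move=> cf; apply: continuous_compact_integrable; first exact: segment_compact.
exact: continuous_subspaceT.
Qed.

Lemma exists_primitive (f : R -> R) : continuous f ->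
  exists F : R -> R, forall x, dd1 F x (f x).
Proof.
move=> cf.
pose F a x := Rintegral mu `[a, x] f.
have HF a a' x : a' <= a -> a <= x -> F a' x = F a' a + F a x.
  move=> aa' ax; have := @Rintegral_itvB R f (BLeft a') (BRight x) a
    (continuous_integrable_itv _ _ cf).
  rewrite !bnd_simp => /(_ aa' ax) => E.
  rewrite -/(F a' x) -/(F a' a) in E.
  rewrite Rintegral_itv_obnd_cbnd in E; last first.
    apply: (integrableS _ _ _ (continuous_integrable_itv a x cf)) => //.
    exact: subset_itv_oc_cc.
  by rewrite /F -E addrC subrK.
(* An integral from a fixed base point is a primitive only to the right of that point, so the base
   point moves with [x]. Subtracting the value at 0 makes the result independent of any base point
   to the left of both 0 and [x]; near [x] the common base [a] serves. *)
exists (fun x => F (- `|x| - 1) x - F (- `|x| - 1) 0) => x.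
pose a : R := - `|x| - 2.
have D : dd1 (fun y => F a y) x (f x).
  apply/dd1P.
  have xn := ler_norm x; have xn' := ler_norm (- x); rewrite normrN in xn'.
  have [||||D E] := @continuous_FTC1 R f (BLeft a) x (`|x| + 1).
  - by lra.
  - exact: continuous_integrable_itv.
  - by rewrite /= lte_fin /a; lra.
  - exact: cf.
  by rewrite derive1E in E; exact: DeriveDef D E.
move=> e e0; have [dl dl0 Hd] := D e e0.
exists (Num.min dl 1); first by rewrite lt_min dl0 ltr01.
move=> t; rewrite lt_min => /andP[td t1].
have K y : `|y| <= `|x| + 1 ->
    F (- `|y| - 1) y - F (- `|y| - 1) 0 = F a y - F a 0.
  move=> yx; have yn := ler_norm y; have yn' := ler_norm (- y).
  rewrite normrN in yn'; have y0 := normr_ge0 y.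
  rewrite (HF (- `|y| - 1) a y) ?(HF (- `|y| - 1) a 0) /a; try lra.
rewrite (K (x + t)) ?(K x); last first.
- exact: (le_trans (ler_normD _ _) (lerD (lexx _) (ltW t1))).
- by rewrite lerDl.
have -> : F a (x + t) - F a 0 - (F a x - F a 0) - t * f x =
  F a (x + t) - F a x - t * f x by ring.
exact: Hd.
Qed.

Lemma Rintegral_primitive (h H : R -> R) (L : R) : 0 < L -> continuous h ->
  (forall x, L < `|x| -> h x = 0) -> (forall x, dd1 H x (h x)) ->
  Rintegral mu setT h = H L - H (- L).
Proof.
move=> L0 ch h0 HH.
have -> : Rintegral mu setT h = Rintegral mu `[- L, L] h.
  rewrite [RHS]Rintegral_mkcond; congr (Rintegral _ _ _).
  apply/funext => x; rewrite patchE; case: ifPn => //.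
  rewrite notin_setE/= in_itv/= => /negP; rewrite -ler_norml -ltNge.
  exact: h0.
rewrite /Rintegral (continuous_FTC2 (F := H)) //; first by rewrite ltrNl; lra.
- exact: continuous_subspaceT.
- split; first by move=> x _; have /dd1P[] := HH x.
  + by apply: cvg_at_right_filter; apply: dd1_cont (HH _).
  + by apply: cvg_at_left_filter; apply: dd1_cont (HH _).
- by move=> x _; rewrite derive1E; have /dd1P[_ ->] := HH x.
Qed.

End Primitive.

(* U_a is the mean over [x-a,x], V_a the mean with density 2(1-s/a)/a at x-s;
   both are written through an arbitrary primitive. *)
Section MeanOps.
Context {R : realType}.

Definition prim (f : R -> R) : R -> R :=
  xget (fun=> 0) [set F : R -> R | forall x, dd1 F x (f x)].

Lemma primP (f : R -> R) : continuous f -> forall x, dd1 (prim f) x (f x).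
Proof.
move=> /exists_primitive[F HF]; rewrite /prim.
by case: xgetP => [G _ HG //|] /(_ F).
Qed.

Definition opU (a : R) (f : R -> R) : R -> R :=
  fun x => (prim f x - prim f (x - a)) / a.

(** Integrating the density [2 * (1 - s / a) / a] by parts against [f (x - s)] gives this form: the
    boundary term is [2 / a] times a primitive of [f], the remaining integral is the mean of that
    primitive. *)
Definition opV (a : R) (f : R -> R) : R -> R :=
  fun x => 2 * (prim f x - opU a (prim f) x) / a.

Lemma cont_of_dd1 (f f' : R -> R) : (forall x, dd1 f x (f' x)) -> continuous f.
Proof. by move=> H x; apply: dd1_cont (H x). Qed.

Lemma prim_unique (f F G : R -> R) : (forall x, dd1 F x (f x)) ->
  (forall x, dd1 G x (f x)) -> forall x y, F x - F y = G x - G y.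
Proof.
move=> HF HG x y.
have := @dd1_const R (fun x => F x - G x) _ x y => /(_ _)E.
have : F x - G x = F y - G y.
  by apply: E => z; rewrite -(subrr (f z)); exact: dd1B.
lra.
Qed.

Lemma opUE a (f F : R -> R) x : continuous f -> (forall x, dd1 F x (f x)) ->
  opU a f x = (F x - F (x - a)) / a.
Proof.
by move=> cf HF; rewrite /opU; congr (_ / _); apply: prim_unique => //; exact: primP.
Qed.

Lemma opU_dd a (f : R -> R) x : continuous f ->
  dd1 (opU a f) x ((f x - f (x - a)) / a).
Proof.
move=> cf; rewrite mulrC.
suff -> : opU a f = (fun x => a^-1 * (prim f x - prim f (x - a))).
  apply: dd1_scale; apply: dd1B; first exact: primP.
  by apply: dd1_shift; exact: primP.
by apply/funext => y; rewrite mulrC.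
Qed.

Lemma opU_cont a (f : R -> R) : continuous f -> continuous (opU a f).
Proof. by move=> cf x; apply: dd1_cont (opU_dd a x cf). Qed.

Lemma prim_cont (f : R -> R) : continuous f -> continuous (prim f).
Proof. by move=> cf; apply: cont_of_dd1; exact: primP. Qed.

Lemma opU_lin a c (f g : R -> R) x : continuous f -> continuous g ->
  opU a (fun x => c * f x + g x) x = c * opU a f x + opU a g x.
Proof.
move=> cf cg.
have H y : dd1 (fun y => c * prim f y + prim g y) y (c * f y + g y).
  by apply: dd1D; exact: primP.
have ch : continuous (fun x => c * f x + g x).
  exact: cont_lin.
by rewrite (opUE a x ch H) /opU; ring.
Qed.

Lemma opU_cst a (c : R) x : a != 0 -> opU a (fun=> c) x = c.
Proof.
move=> a0; have cc : continuous (fun _ : R => c) by exact: cont_cst.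
rewrite (@opUE a _ (fun y => c * y)) //.
  by rewrite -mulrBr opprB addrC subrK mulfK.
move=> y e e0; exists 1 => // t _.
have -> : c * (y + t) - c * y - t * c = 0 by ring.
by rewrite normr0 mulr_ge0// ltW.
Qed.

Lemma opVE a (f F : R -> R) x : a != 0 -> continuous f ->
  (forall x, dd1 F x (f x)) -> opV a f x = 2 * (F x - opU a F x) / a.
Proof.
move=> a0 cf HF; have cF := cont_of_dd1 HF.
rewrite /opV.
have -> : prim f = (fun y => 1 * F y + (prim f 0 - F 0)).
  apply/funext => y; have := prim_unique (primP cf) HF y 0; lra.

rewrite opU_lin ?opU_cst//; first by rewrite !mul1r; congr (_ * _ / _); lra.
exact: cont_cst.
Qed.

Lemma opV_dd a (f : R -> R) x : continuous f ->
  dd1 (opV a f) x (2 * (f x - opU a f x) / a).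
Proof.
move=> cf; rewrite mulrAC.
have -> : opV a f = (fun x => (2 / a) * (prim f x - opU a (prim f) x)).
  by apply/funext => y; rewrite /opV mulrAC.
apply: dd1_scale; apply: dd1B; first exact: primP.
by apply: opU_dd; exact: prim_cont.
Qed.

Lemma opV_cont a (f : R -> R) : continuous f -> continuous (opV a f).
Proof. by move=> cf x; apply: dd1_cont (opV_dd a x cf). Qed.

Definition op (b : bool) (a : R) (f : R -> R) := if b then opV a f else opU a f.

(** The derivative of [op b a f] written in terms of [f] alone. This is how an averaging step
    absorbs one derivative, at the price [4 / a] of [dop_bound]. *)
Definition dop (b : bool) (a : R) (f : R -> R) x :=
  if b then 2 * (f x - opU a f x) / a else (f x - f (x - a)) / a.

Lemma op_dd b a (f : R -> R) x : continuous f -> dd1 (op b a f) x (dop b a f x).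
Proof. by case: b => cf; [exact: opV_dd|exact: opU_dd]. Qed.

Lemma op_cont b a (f : R -> R) : continuous f -> continuous (op b a f).
Proof. by case: b; [exact: opV_cont|exact: opU_cont]. Qed.

Lemma op_deriv b a (f f' : R -> R) x : a != 0 -> continuous f' ->
  (forall x, dd1 f x (f' x)) -> dop b a f x = op b a f' x.
Proof.
move=> a0 cf' H; case: b => /=; first by rewrite (opVE _ a0 cf' H).
by rewrite (opUE _ _ cf' H).
Qed.

Lemma op_dd_tower b a (f f' : R -> R) x : a != 0 -> continuous f' ->
  (forall x, dd1 f x (f' x)) -> dd1 (op b a f) x (op b a f' x).
Proof.
move=> a0 cf' H; rewrite -(op_deriv b x a0 cf' H); apply: op_dd.
exact: cont_of_dd1 H.
Qed.

Lemma opV_lin a c (f g : R -> R) x : a != 0 -> continuous f -> continuous g ->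
  opV a (fun x => c * f x + g x) x = c * opV a f x + opV a g x.
Proof.
move=> a0 cf cg.
have H y : dd1 (fun y => c * prim f y + prim g y) y (c * f y + g y).
  by apply: dd1D; exact: primP.
have ch : continuous (fun x => c * f x + g x).
  exact: cont_lin.
rewrite (opVE x a0 ch H) opU_lin; [|exact: prim_cont..].
by rewrite /opV; ring.
Qed.

Lemma op_lin b a c (f g : R -> R) x : a != 0 -> continuous f -> continuous g ->
  op b a (fun x => c * f x + g x) x = c * op b a f x + op b a g x.
Proof. by case: b => *; [exact: opV_lin|exact: opU_lin]. Qed.

(** Positivity and total mass 1 of the averaging kernels, condensed into one intermediate value; sup
    bounds, supports, Lipschitz constants and convexity of averages are all read off from it. For
    [opV], Rolle's theorem for [psi] on [[0, a]] gives [F x - F (x - t1) = k * t1], and the mean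
    value theorem for [F] finishes. *)
Lemma op_mean b a (f : R -> R) x : 0 < a -> continuous f ->
  exists2 xi, x - a <= xi <= x & op b a f x = f xi.
Proof.
move=> a0 cf; have FP := primP cf; have cF := prim_cont cf; have GP := primP cF.
have a0' : a != 0 by rewrite gt_eqF.
case: b => /=; last first.
  have [|c /andP[c1 c2] E] := dd1_MVT_oo FP (_ : x - a < x); first by rewrite gtrBl.
  by exists c; rewrite ?(ltW c1) ?(ltW c2)// /opU E opprB addrC subrK mulfK.
pose F := prim f; pose G := prim F; pose k := opV a f x.
(* Second order Taylor formula for [G] at [x] with step [- a]. *)
pose psi t := G (x - t) - (- F x * t + G x) - k / 2 * (t * t).
pose psi' t := - F (x - t) - (- F x) - k / 2 * (2 * t).
have dpsi t : dd1 psi t (psi' t).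
  apply: dd1B; last first.
    apply: dd1_scale => e e0; exists e => // s se.
    have -> : (t + s) * (t + s) - t * t - s * (2 * t) = s * s by ring.
    by rewrite normrM ler_wpM2r// ltW.
  by apply: dd1B; [apply: dd1_refl; exact: GP|exact: dd1_affine].
have [t1 /andP[t10 t1a] E] := dd1_MVT_oo dpsi a0.
have psi0 : psi 0 = 0 by rewrite /psi !subr0 !mulr0 add0r subrr subr0.
have psia : psi a = 0.
  by rewrite /psi /k /opV /opU -/F -/G; field.
have := E; rewrite psi0 psia subrr subr0 => /esym/eqP.
rewrite mulf_eq0 (negPf a0') orbF => /eqP Et1.
have [|c /andP[c1 c2] E2] := dd1_MVT_oo FP (_ : x - t1 < x); first by lra.
exists c; first by apply/andP; split; lra.
rewrite -/k; apply: (mulIf (_ : t1 != 0)); first by rewrite gt_eqF.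
by move: Et1 E2; rewrite /psi' -/F => Et1 E2; lra.
Qed.

Lemma op_bound b a (f : R -> R) C x : 0 < a -> continuous f ->
  (forall y, `|f y| <= C) -> `|op b a f x| <= C.
Proof. by move=> a0 cf H; have [xi _ ->] := op_mean b x a0 cf. Qed.

Lemma dop_bound b a (f : R -> R) C x : 0 < a -> continuous f ->
  (forall y, `|f y| <= C) -> `|dop b a f x| <= 4 / a * C.
Proof.
move=> a0 cf H; rewrite mulrAC; have C0 : 0 <= C := le_trans (normr_ge0 _) (H 0).
case: b => /=.
  rewrite normrM (gtr0_norm (_ : 0 < a^-1)) ?invr_gt0// ler_pM2r ?invr_gt0//.
  rewrite normrM ger0_norm//.
  have := op_bound false x a0 cf H => /= H'.
  apply: le_trans (ler_wpM2l _ (ler_normB _ _)) _ => //.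
  by have := H x; lra.
rewrite normrM (gtr0_norm (_ : 0 < a^-1)) ?invr_gt0// ler_pM2r ?invr_gt0//.
apply: le_trans (ler_normB _ _) _.
by have := H x; have := H (x - a); lra.
Qed.

Lemma op_split a (f f' : R -> R) x : a != 0 -> continuous f' ->
  (forall x, dd1 f x (f' x)) -> f x = op false a f x + a / 2 * op true a f' x.
Proof.
move=> a0 cf' H; rewrite -(op_deriv true x a0 cf' H) /=.
by field.
Qed.

Definition lip1 (f : R -> R) := forall x y, `|f x - f y| <= `|x - y|.

Lemma lip1_cont (f : R -> R) : lip1 f -> continuous f.
Proof.
move=> H x; apply/cvgrPdist_le => e e0.
apply/nbhs_ballP; exists e => //= y; rewrite /ball/= => /ltW.
exact: le_trans.
Qed.

Lemma op_shift b a (f : R -> R) h x : a != 0 -> continuous f ->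
  op b a (fun y => f (y + h)) x = op b a f (x + h).
Proof.
move=> a0 cf.
have K (g : R -> R) z : continuous g -> opU a (fun y => g (y + h)) z = opU a g (z + h).
  move=> cg; have H y : dd1 (fun y => prim g (y + h)) y (g (y + h)).
    by apply: dd1_shift; exact: primP.
  rewrite (opUE _ _ _ H) /opU 1?addrAC//.
  exact: cont_shift.
case: b => /=; last exact: K.
have H y : dd1 (fun y => prim f (y + h)) y (f (y + h)).
  by apply: dd1_shift; exact: primP.
rewrite (opVE _ a0 _ H); last first.
  exact: cont_shift.
by rewrite K; [|exact: prim_cont].
Qed.

Lemma op_lip1 b a (f : R -> R) : 0 < a -> lip1 f -> lip1 (op b a f).
Proof.
move=> a0 lf x y; have cf := lip1_cont lf.
have a0' : a != 0 by rewrite gt_eqF.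
have -> : op b a f y = op b a (fun z => f (z + (y - x))) x.
  by rewrite op_shift// addrC subrK.
have cs : continuous (fun z => f (z + (y - x))).
  exact: cont_shift.
rewrite addrC -mulN1r -op_lin//.
apply: op_bound => //.
  exact: cont_lin.
move=> z; rewrite mulN1r addrC; apply: le_trans (lf _ _) _.
by rewrite opprD addrA subrr add0r opprB.
Qed.

Lemma op_lip1_near b a (f : R -> R) x : 0 < a -> lip1 f -> `|op b a f x - f x| <= a.
Proof.
move=> a0 lf; have [xi /andP[h1 h2] ->] := op_mean b x a0 (lip1_cont lf).
by apply: le_trans (lf _ _) _; rewrite ler_norml; apply/andP; split; lra.
Qed.

End MeanOps.

Section CauchyRate.
Context {R : realType}.

Lemma cauchy_rate (u e : nat -> R) : (forall k j, `|u (k + j)%N - u k| <= e k) ->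
  e @ \oo --> 0 -> cvgn u /\ forall k, `|limn u - u k| <= e k.
Proof.
move=> H e0.
have cu : cvgn u.
  apply/cauchy_cvgP/cauchy_exP => eps eps0.
  have /cvgrPdist_lt/(_ _ eps0)[N _ HN] := e0.
  exists (u N); exists N => // n /= Nn.
  rewrite /ball/= distrC -(subnKC Nn); apply: le_lt_trans (H _ _) _.
  have := HN N (leqnn N); rewrite sub0r normrN; apply: le_lt_trans.
  exact: ler_norm.
split=> // k.
have cv : (fun n => `|u n - u k|) @ \oo --> `|limn u - u k|.
  by apply: cvg_norm; apply: cvgB => //; exact: cvg_cst.
rewrite -(cvg_lim _ cv)//; apply: limr_le; first exact: cvgP cv.
exists k => // n /= kn.
by rewrite -(subnKC kn); exact: H.
Qed.

Lemma le_of_eps (x y : R) : (forall e, 0 < e -> x <= y + e) -> x <= y.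
Proof. by move=> H; apply/ler_addgt0Pr. Qed.

Lemma eq_of_eps (x y : R) : (forall e, 0 < e -> `|x - y| <= e) -> x = y.
Proof.
move=> H; apply/eqP; rewrite -subr_eq0 -normr_le0.
by apply: le_of_eps => e /H; rewrite add0r.
Qed.

End CauchyRate.

(* [Tn n] is [max x 0] averaged over boxes of widths [beta n, beta n.+1, ..];
   its second derivative is the mollifier, and [Tt n k] its [k]-th derivative. *)
Section Base.
Context {R : realType}.
Variables (beta : nat -> R) (w : R).
Hypothesis beta0 : forall n, 0 < beta n.
Hypothesis beta_sum : series beta @ \oo --> w.

(** The total of the widths [beta n, beta n.+1, ...], which is the width of the support of the
    mollifier of stage [n] ([Tt_supp]). *)
Definition tl n := w - series beta n.

Lemma series_mono n k : series beta n <= series beta (n + k)%N.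
Proof.
elim: k => [|k IH]; first by rewrite addn0.
by rewrite addnS seriesSr; apply: le_trans IH _; rewrite lerDl ltW.
Qed.

Lemma series_le n : series beta n <= w.
Proof.
rewrite -(cvg_lim _ beta_sum)//; apply: limr_ge; first by apply/cvg_ex; exists w.
by exists n => // m /= nm; rewrite -(subnKC nm); exact: series_mono.
Qed.

Lemma tl_ge0 n : 0 <= tl n.
Proof. by rewrite subr_ge0 series_le. Qed.

Lemma tlS n : tl n.+1 = tl n - beta n.
Proof. by rewrite /tl seriesSr opprD addrA. Qed.

Lemma tl_cvg : tl @ \oo --> 0.
Proof. by rewrite -(subrr w); apply: cvgB => //; exact: cvg_cst. Qed.

Lemma tl_mono n k : tl (n + k)%N <= tl n.
Proof. by rewrite lerD2l lerN2 series_mono. Qed.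

Lemma tl_le n : tl n <= w.
Proof. by rewrite /tl gerBl; have := series_mono 0 n; rewrite add0n {1}/series/= big_geq. Qed.

Fixpoint rr n k : R -> R :=
  if k is k'.+1 then opU (beta n) (rr n.+1 k') else fun x => Num.max x 0.

Let b0 n : beta n != 0. Proof. by rewrite gt_eqF. Qed.

Lemma rr_lip n k : lip1 (rr n k).
Proof.
elim: k n => [|k IH] n; last exact: (@op_lip1 R false).
move=> x y; rewrite /= !maxEle.
have := normr_ge0 (x - y); have := ler_norm (x - y).
have := ler_norm (- (x - y)); rewrite normrN.
by case: (leP x 0) => ?; case: (leP y 0) => ? ? ? ?; rewrite ler_norml;
  apply/andP; split; lra.
Qed.

Lemma rr_cont n k : continuous (rr n k).
Proof. exact/lip1_cont/rr_lip. Qed.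

Lemma opU_dist a (f g : R -> R) e x : 0 < a -> continuous f -> continuous g ->
  (forall y, `|f y - g y| <= e) -> `|opU a f x - opU a g x| <= e.
Proof.
move=> a0 cf cg H.
have -> : opU a f x - opU a g x = op false a (fun x => -1 * g x + f x) x.
  by rewrite op_lin ?gt_eqF//= mulN1r addrC.
apply: op_bound => //; first exact: cont_lin.
by move=> y; rewrite mulN1r addrC.
Qed.

(** The additional average is the innermost one. It moves a 1-Lipschitz function by at most its
    width, and the outer averages preserve this bound. *)
Lemma rr_step n k x : `|rr n k.+1 x - rr n k x| <= beta (n + k)%N.
Proof.
elim: k n x => [|k IH] n x.
  by rewrite addn0; apply: (@op_lip1_near R false) => //; exact: (rr_lip n 0).
rewrite -addSnnS; apply: opU_dist => //; last first.
- exact: IH.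
- exact: rr_cont.
- exact: (@rr_cont n.+1 k.+1).
Qed.

Lemma rr_cauchy n k j x : `|rr n (k + j)%N x - rr n k x| <= tl (n + k)%N - tl (n + k + j)%N.
Proof.
elim: j => [|j IH]; first by rewrite !addn0 !subrr normr0.
rewrite !addnS tlS; have := rr_step n (k + j) x; rewrite -addnA => H.
have := ler_normD (rr n (k + j).+1 x - rr n (k + j) x) (rr n (k + j) x - rr n k x).
rewrite addrA subrK; move: IH; rewrite -addnA => IH H2; lra.
Qed.

Definition Tn n x := limn (fun k => rr n k x).

Lemma Tn_rate n : (forall x, cvgn (fun k => rr n k x)) /\
  forall x k, `|Tn n x - rr n k x| <= tl (n + k)%N.
Proof.
have K x : cvgn (fun k => rr n k x) /\ forall k, `|Tn n x - rr n k x| <= tl (n + k)%N.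
  apply: cauchy_rate => [k j|].
    by apply: le_trans (rr_cauchy _ _ _ _) _; rewrite gerBl tl_ge0.
  have := tl_cvg; rewrite -(cvg_shiftn n) => H.
  by under eq_fun do rewrite addnC.
by split=> x; have [] := K x.
Qed.

Lemma tl_small e n : 0 < e -> exists k, tl (n + k)%N < e.
Proof.
move=> e0; have /cvgrPdist_lt/(_ _ e0)[N _ HN] := tl_cvg.
exists N; have := HN (n + N)%N (leq_addl _ _); rewrite sub0r normrN.
by apply: le_lt_trans; exact: ler_norm.
Qed.

Lemma Tn_lip n : lip1 (Tn n).
Proof.
move=> x y; apply: le_of_eps => e e0.
have [k Hk] := @tl_small (e / 2) n ltac:(by rewrite divr_gt0).
have [_ H] := Tn_rate n; have H1 := H x k; have H2 := H y k.
have H3 := rr_lip n k x y; rewrite distrC in H2.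
have -> : Tn n x - Tn n y = (Tn n x - rr n k x) + (rr n k x - rr n k y) + (rr n k y - Tn n y) by ring.
have := ler_normD ((Tn n x - rr n k x) + (rr n k x - rr n k y)) (rr n k y - Tn n y).
have := ler_normD (Tn n x - rr n k x) (rr n k x - rr n k y); lra.
Qed.

Lemma Tn_cont n : continuous (Tn n).
Proof. exact/lip1_cont/Tn_lip. Qed.

(** Peeling off the outermost box of the infinite average is what makes the recursion [Tt] compute
    derivatives. *)
Lemma Tn_rec n x : Tn n x = opU (beta n) (Tn n.+1) x.
Proof.
apply: eq_of_eps => e e0.
have [k Hk] := @tl_small (e / 2) n.+1 ltac:(by rewrite divr_gt0).
have [_ H] := Tn_rate n; have := H x k.+1; rewrite addnS -addSn /= => H1.
have H2 : `|opU (beta n) (rr n.+1 k) x - opU (beta n) (Tn n.+1) x| <= tl (n.+1 + k)%N.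
  apply: opU_dist => //; [exact: rr_cont|exact: Tn_cont|].
  by move=> y; rewrite distrC; exact: (Tn_rate n.+1).2.
have := ler_normD (Tn n x - opU (beta n) (rr n.+1 k) x)
  (opU (beta n) (rr n.+1 k) x - opU (beta n) (Tn n.+1) x).
rewrite addrA subrK; lra.
Qed.

Lemma rr_slope n k y x : 0 <= y -> series beta (n + k)%N - series beta n <= y -> y <= x ->
  rr n k x - rr n k y = x - y.
Proof.
elim: k n x y => [|k IH] n x y y0 Hy yx.
  rewrite /= !maxEle; case: leP => h1; case: leP => h2; lra.
have Hs := series_mono n.+1 k.
rewrite addnS -addSn in Hy; have := seriesSr beta n => Es.
have -> : rr n k.+1 x - rr n k.+1 y =
   op false (beta n) (fun z => -1 * rr n.+1 k z + rr n.+1 k (z + (x - y))) y.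
  have cr := @rr_cont n.+1 k; rewrite op_lin ?op_shift//; last exact: cont_shift.
  by rewrite mulN1r addrC [y + (x - y)]addrC subrK.
set g := (fun z => _); have cg : continuous g.
  by apply: cont_lin; [|apply: cont_shift]; exact: rr_cont.
have [xi /andP[x1 x2] ->] := op_mean false y (beta0 n) cg; rewrite /g.
rewrite mulN1r addrC IH; lra.
Qed.

Lemma Tn_slope n y x : tl n <= y -> y <= x -> Tn n x - Tn n y = x - y.
Proof.
move=> ny yx; have y0 := le_trans (tl_ge0 n) ny.
apply: eq_of_eps => e e0.
have [k Hk] := @tl_small (e / 2) n ltac:(by rewrite divr_gt0).
have [_ H] := Tn_rate n; have H1 := H x k; have H2 := H y k.
have H3 : rr n k x - rr n k y = x - y.
  apply: rr_slope => //; apply: le_trans ny; rewrite /tl lerD2r; exact: series_le.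
rewrite distrC in H2.
have -> : Tn n x - Tn n y - (x - y) = (Tn n x - rr n k x) + (rr n k y - Tn n y).
  by rewrite -H3; ring.
have := ler_normD (Tn n x - rr n k x) (rr n k y - Tn n y); lra.
Qed.

Lemma rr_le0 n k x : x <= 0 -> rr n k x = 0.
Proof.
elim: k n x => [|k IH] n x x0 /=; first by rewrite maxEle x0.
have [xi /andP[x1 x2] E] := @op_mean R false (beta n) (rr n.+1 k) x (beta0 n) (@rr_cont _ _).
by rewrite /= in E; rewrite E IH//; exact: le_trans x2 x0.
Qed.

Lemma Tn_le0 n x : x <= 0 -> Tn n x = 0.
Proof.
move=> x0; apply: eq_of_eps => e e0.
have [k Hk] := @tl_small e n e0.
by have := (Tn_rate n).2 x k; rewrite rr_le0// => H; lra.
Qed.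

(** Two independent steps are needed because the mollifier [Tt n 2] is a second difference with the
    unequal steps [beta n] and [beta n.+1]. Convexity of [max x 0] survives averaging. *)
Lemma rr_convex n k x s t : 0 <= s -> 0 <= t ->
  0 <= rr n k (x + (s + t)) - rr n k (x + s) - rr n k (x + t) + rr n k x.
Proof.
move=> s0 t0; elim: k n x => [|k IH] n x.
  rewrite /= !maxEle.
  by case: (leP (x + (s + t)) 0); case: (leP (x + s) 0); case: (leP (x + t) 0); case: (leP x 0); lra.
set g := rr n.+1 k; have cg : continuous g by exact: rr_cont.
have cgh h : continuous (fun x => g (x + h)) by exact: cont_shift.
have -> : rr n k.+1 (x + (s + t)) - rr n k.+1 (x + s) - rr n k.+1 (x + t) + rr n k.+1 x =
  op false (beta n) (fun z => -1 * g (z + s) + (-1 * g (z + t) + (1 * g (z + (s + t)) + g z))) x.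
  rewrite !op_lin ?op_shift//=; last first.
  all: do ?apply: cont_lin => //.
  by rewrite /g; ring.
set h := (fun z => _); have ch : continuous h.
  by do ?apply: cont_lin.
have [xi _ ->] := op_mean false x (beta0 n) ch; rewrite /h.
by have := IH n.+1 xi; rewrite -/g; lra.
Qed.

Lemma Tn_convex n x s t : 0 <= s -> 0 <= t ->
  0 <= Tn n (x + (s + t)) - Tn n (x + s) - Tn n (x + t) + Tn n x.
Proof.
move=> s0 t0; apply: le_of_eps => e e0.
have [k Hk] := @tl_small (e / 4) n ltac:(by rewrite divr_gt0).
have H z : `|Tn n z - rr n k z| <= e / 4 by apply: le_trans ((Tn_rate n).2 z k) (ltW Hk).
have := rr_convex n k x s0 t0.
move: (H (x + (s + t))) (H (x + s)) (H (x + t)) (H x); rewrite !ler_norml.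
by do 4! move=> /andP[? ?]; lra.
Qed.

(** Differentiating a box average leaves a difference quotient of the averages inside it, so the
    [k]-th derivative uses up the widths [beta n] to [beta (n + k - 1)] and can be written without
    any derivative. *)
Fixpoint Tt n k : R -> R :=
  if k is k'.+1 then fun x => (Tt n.+1 k' x - Tt n.+1 k' (x - beta n)) / beta n
  else Tn n.

Lemma TtS n k x : Tt n k.+1 x = (Tt n.+1 k x - Tt n.+1 k (x - beta n)) / beta n.
Proof. by []. Qed.

Definition tower (g : nat -> R -> R) := forall k x, dd1 (g k) x (g k.+1 x).

Lemma Tt_tower n : tower (Tt n).
Proof.
move=> k; elim: k n => [|k IH] n x.
  rewrite (_ : Tt n 0 = opU (beta n) (Tn n.+1)); last by apply/funext => y; exact: Tn_rec.
  by apply: opU_dd; exact: Tn_cont.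
rewrite (_ : Tt n k.+1 = fun x => (beta n)^-1 * (Tt n.+1 k x - Tt n.+1 k (x - beta n))); last first.
  by apply/funext => y; rewrite mulrC.
rewrite [Tt n k.+2 x]/= mulrC; apply: dd1_scale; apply: dd1B; first exact: IH.
by apply: dd1_shift; exact: IH.
Qed.

(** The first derivative is at most 1 by the Lipschitz property; only the following ones cost
    [2 / beta]. Hence the shift between [k.+1] and the number of factors. *)
Lemma Tt_bound n k x : `|Tt n k.+1 x| <= \prod_(i < k) (2 / beta (n + i)%N).
Proof.
elim: k n x => [|k IH] n x.
  rewrite big_ord0 /= normrM (gtr0_norm (_ : 0 < (beta n)^-1)) ?invr_gt0//.
  rewrite ler_pdivrMr// mul1r; apply: le_trans (Tn_lip _ _ _) _.
  by rewrite opprB addrC subrK gtr0_norm.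
rewrite [Tt n k.+2]/= normrM (gtr0_norm (_ : 0 < (beta n)^-1)) ?invr_gt0//.
rewrite big_ord_recl addn0 mulrAC ler_pM2r ?invr_gt0//.
under eq_bigr do rewrite lift0 -addSnnS.
apply: le_trans (ler_normB _ _) _.
have := IH n.+1 x; have := IH n.+1 (x - beta n).
rewrite [Tt n.+1 k.+1]/=; lra.
Qed.

Lemma Tt1_lo n x : x <= 0 -> Tt n 1 x = 0.
Proof.
move=> x0; rewrite /= !Tn_le0 ?subrr ?mul0r//.
by apply: le_trans x0; rewrite gerBl ltW.
Qed.

Lemma Tt1_hi n x : tl n <= x -> Tt n 1 x = 1.
Proof.
move=> nx; have bn := beta0 n; rewrite /= Tn_slope; last 2 first.
- by rewrite tlS; lra.
- by lra.
by rewrite opprB addrC subrK divff.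
Qed.

Lemma Tt_supp n k x : x <= 0 \/ tl n <= x -> Tt n k.+2 x = 0.
Proof.
elim: k n x => [|k IH] n x Hx.
  rewrite TtS.
  have bn := beta0 n; have tn := tlS n.
  by case: Hx => Hx; [rewrite !Tt1_lo|rewrite !Tt1_hi]; rewrite ?subrr ?mul0r//; lra.
rewrite TtS.
have bn := beta0 n; have tn := tlS n.
by rewrite !IH ?subrr ?mul0r//; case: Hx => Hx; [left|right|left|right]; lra.
Qed.

Lemma Tt2_ge0 n x : 0 <= Tt n 2 x.
Proof.
rewrite /= -mulrBl -mulrA; apply: mulr_ge0; last by rewrite mulr_ge0// invr_ge0 ltW.
have := @Tn_convex n.+2 (x - beta n - beta n.+1) (beta n) (beta n.+1) (ltW (beta0 _)) (ltW (beta0 _)).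
have -> : x - beta n - beta n.+1 + (beta n + beta n.+1) = x by ring.
have -> : x - beta n - beta n.+1 + beta n = x - beta n.+1 by ring.
have -> : x - beta n - beta n.+1 + beta n.+1 = x - beta n by ring.
lra.
Qed.

End Base.

Section Words.
Context {R : realType}.
Variable a : nat -> R.
Hypothesis a_gt0 : forall p, 0 < a p.

Let a_neq0 p : a p != 0. Proof. by rewrite gt_eqF. Qed.

(* Words are read from the last stage to the first: the head of [s] is the
   stage of index [size s] minus one. *)
Fixpoint Aw (s : seq bool) (f : R -> R) : R -> R :=
  if s is b :: s' then Aw s' (op b (a (size s')) f) else f.

Fixpoint cw (s : seq bool) : R :=
  if s is b :: s' then (if b then a (size s') / 2 else 1) * cw s' else 1.

Lemma cw_ge0 s : 0 <= cw s.
Proof.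
elim: s => [|b s IH] //=; apply: mulr_ge0 => //.
by case: b => //; rewrite divr_ge0// ltW.
Qed.

Lemma tower_cont (g : nat -> R -> R) k : tower g -> continuous (g k).
Proof. by move=> tg x; apply: dd1_cont (tg k x). Qed.

Lemma op_tower b c (g : nat -> R -> R) : c != 0 -> tower g ->
  tower (fun k => op b c (g k)).
Proof. by move=> c0 tg k x; apply: op_dd_tower => //; exact: tower_cont. Qed.

Lemma Aw_tower s (g : nat -> R -> R) : tower g -> tower (fun k => Aw s (g k)).
Proof.
elim: s g => [|b s IH] g tg //=.
by apply: (IH (fun k => op b (a (size s)) (g k))); exact: op_tower.
Qed.

Lemma towerS (g : nat -> R -> R) i : tower g -> tower (fun k => g (i + k)%N).
Proof. by move=> tg k x; rewrite addnS; exact: tg. Qed.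

Lemma Aw_sup s (f : R -> R) C x : continuous f -> (forall y, `|f y| <= C) ->
  `|Aw s f x| <= C.
Proof.
elim: s f => [|b s IH] f cf H //=; apply: IH; first exact: op_cont.
by move=> y; apply: op_bound.
Qed.

(** Each stage can absorb one derivative through [dop_bound]. The stages of lowest index are used,
    so that exactly the widths [a p] with [p < j] appear; the other averages only preserve the sup
    bound. *)
Lemma Aw_bound s j (g : nat -> R -> R) C x : (j <= size s)%N -> tower g ->
  (forall y, `|g 0%N y| <= C) -> `|Aw s (g j) x| <= \prod_(p < j) (4 / a p) * C.
Proof.
elim: s j g C => [|b s IH] j g C /=.
  by rewrite leqn0 => /eqP -> _; rewrite big_ord0 mul1r.
rewrite leq_eqVlt => /orP[/eqP ->|js] tg H; last first.
  apply: (IH j (fun k => op b (a (size s)) (g k))) => //; first exact: op_tower.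
  by move=> y; apply: op_bound => //; exact: tower_cont.
rewrite big_ord_recr /= -mulrA.
have ct k := @tower_cont g k tg.
apply: (IH (size s) (fun k => op b (a (size s)) (g k.+1))) => //.
  by move=> k z; exact: (op_tower b (a_neq0 _) tg).
move=> y; rewrite -(op_deriv b y (a_neq0 _) (ct _) (tg 0%N)).
exact: dop_bound.
Qed.

(** The complementary case to [Aw_bound]: all stages are used up and the surplus of [i] derivatives
    stays on the base function. *)
Lemma Aw_bound2 s i (g : nat -> R -> R) C x : tower g ->
  (forall y, `|g i y| <= C) ->
  `|Aw s (g (i + size s)%N) x| <= \prod_(p < size s) (4 / a p) * C.
Proof.
move=> tg H; apply: (@Aw_bound s _ (fun k => g (i + k)%N)) => //; first exact: towerS.
by move=> y; rewrite addn0.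
Qed.

Lemma Aw_lin s c (f g : R -> R) x : continuous f -> continuous g ->
  Aw s (fun x => c * f x + g x) x = c * Aw s f x + Aw s g x.
Proof.
elim: s f g => [|b s IH] f g cf cg //=.
rewrite -IH; [|exact: op_cont..].
by congr (Aw s _ x); apply/funext => y; rewrite op_lin.
Qed.

Lemma Aw_supp s (f : R -> R) w : continuous f ->
  (forall x, x <= 0 \/ w <= x -> f x = 0) ->
  forall x, x <= 0 \/ w + series a (size s) <= x -> Aw s f x = 0.
Proof.
elim: s f w => [|b s IH] f w cf H x /=.
  by rewrite /series/= big_geq// addr0; exact: H.
rewrite seriesSr => Hx; apply: (IH _ (w + a (size s))); first exact: op_cont.
  move=> y Hy; have [xi /andP[x1 x2] ->] := op_mean b y (a_gt0 (size s)) cf.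
  by apply: H; case: Hy => Hy; [left|right]; lra.
by case: Hx => Hx; [left|right]; lra.
Qed.

End Words.

Section SumWords.
Context {R : realType}.

Lemma sum_tuple0 (F : seq bool -> R) : \sum_(s : 0.-tuple bool) F s = F [::].
Proof.
rewrite (big_pred1 [tuple]) // => t; apply/esym/eqP/val_inj/size0nil.
by rewrite size_tuple.
Qed.

Lemma sum_tupleS n (F : seq bool -> R) :
  \sum_(s : n.+1.-tuple bool) F s =
  \sum_(s : n.-tuple bool) (F (false :: s) + F (true :: s)).
Proof.
rewrite big_split /= (reindex (fun p : bool * n.-tuple bool => [tuple of p.1 :: p.2])) /=; last first.
  exists (fun t : n.+1.-tuple bool => (thead t, [tuple of behead t])).
    by move=> [b t] _; congr (_, _); apply: val_inj.
  by move=> t _; rewrite [RHS]tuple_eta.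
rewrite -(pair_big xpredT xpredT (fun (b : bool) (t : n.-tuple bool) => F (b :: t))) /=.
by rewrite big_bool addrC.
Qed.

Variable a : nat -> R.
Hypothesis a_gt0 : forall p, 0 < a p.

(** Iteration of [op_split]. The letter [true] chooses the averaged derivative, with factor [a / 2],
    so a word acts on the derivative whose order is its number of [true] letters. For [n] stages
    this is a finite exact identity. *)
Lemma words_id n (g : nat -> R -> R) x : tower g ->
  \sum_(s : n.-tuple bool) cw a s * Aw a s (g (count id s)) x = g 0%N x.
Proof.
elim: n g => [|n IH] g tg.
  by rewrite (sum_tuple0 (fun s => cw a s * Aw a s (g (count id s)) x)) /= mul1r.
have an : a n != 0 by rewrite gt_eqF.
rewrite (sum_tupleS n (fun s => cw a s * Aw a s (g (count id s)) x)) big_split /=.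
under eq_bigr do rewrite size_tuple mul1r add0n.
under [X in _ + X]eq_bigr do rewrite size_tuple -mulrA add1n.
rewrite -big_distrr /=.
rewrite (IH (fun k => opU (a n) (g k))); last exact: (op_tower false).
rewrite (IH (fun k => opV (a n) (g k.+1))); last first.
  by move=> k z; exact: (op_tower true).
by rewrite (op_split x an _ (tg 0%N))//; exact: tower_cont tg.
Qed.

(** The elementary symmetric polynomial of degree [k] in the numbers [a p / 2], [p < n]. *)
Definition ek n k : R := \sum_(s : n.-tuple bool | count id s == k) cw a s.

Lemma ek_ge0 n k : 0 <= ek n k.
Proof. by apply: sumr_ge0 => s _; exact: cw_ge0. Qed.

Lemma ek_mono n k : ek n k <= ek n.+1 k.
Proof.
rewrite /ek big_mkcond [leRHS]big_mkcond.
rewrite (sum_tupleS n (fun s => if count id s == k then cw a s else 0)) big_split /=.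
under [X in _ <= X + _]eq_bigr do rewrite mul1r.
rewrite -[X in _ <= X + _]/(\sum_(s : n.-tuple bool) (if count id s == k then cw a s else 0)).
rewrite lerDl; apply: sumr_ge0 => s _; case: ifP => // _.
by rewrite mulr_ge0 ?cw_ge0// divr_ge0// ltW.
Qed.

(** The product is the generating polynomial of the [ek n k], a sum of nonnegative terms of which
    one is retained. The choice of [rho] depending on [k] is made in [ek_bound]. *)
Lemma ek_pow n k rho : 0 <= rho ->
  rho ^+ k * ek n k <= \prod_(p < n) (1 + rho * a p / 2).
Proof.
move=> r0.
have -> : \prod_(p < n) (1 + rho * a p / 2) =
    \sum_(s : n.-tuple bool) rho ^+ count id s * cw a s.
  elim: n => [|n IH].
    by rewrite big_ord0 (sum_tuple0 (fun s => rho ^+ count id s * cw a s)) /= mul1r.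
  rewrite (sum_tupleS n (fun s => rho ^+ count id s * cw a s)) big_ord_recr /= IH.
  rewrite big_distrl /=; apply: eq_bigr => s _.
  by rewrite size_tuple add0n mul1r add1n exprS; ring.
rewrite /ek big_distrr /= [leRHS](bigID (fun s => count id (tval s) == k)) /=.
rewrite (eq_bigr (fun s : n.-tuple bool => rho ^+ count id s * cw a s)) ?lerDl; last first.
  by move=> s /eqP ->.
by apply: sumr_ge0 => s _; rewrite mulr_ge0 ?cw_ge0// exprn_ge0.
Qed.

End SumWords.

(** * Integration of continuous compactly supported functions *)

Section RowVectors.
Context {R : realType}.

Lemma normv_leP d (x : 'rV[R]_d) c : 0 <= c ->
  reflect (forall i, `|x 0 i| <= c) (`|x| <= c).
Proof.
move=> c0; rewrite /Num.norm/= mx_normrE; apply: (iffP idP) => [H i|H].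
  apply: le_trans H; exact: (@le_bigmax _ _ _ _ (fun ij => `|x ij.1 ij.2|) (0, i)).
by apply: bigmax_le => // -[i j] _ /=; rewrite (ord1 i); exact: H.
Qed.

Lemma normv_coord d (x : 'rV[R]_d) i : `|x 0 i| <= `|x|.
Proof. by have /normv_leP/(_ (lexx _)) := normr_ge0 x; apply. Qed.

Definition rcol d (t : R) (x : 'rV[R]_d) : 'rV[R]_(d.+1) :=
  row_mx (const_mx t : 'rV[R]_1) x.

Lemma rcol0 d t (x : 'rV[R]_d) : rcol t x 0 ord0 = t.
Proof.
rewrite /rcol mxE; case: splitP => j; last by [].
by rewrite mxE.
Qed.

Lemma rcolS d t (x : 'rV[R]_d) i : rcol t x 0 (lift ord0 i) = x 0 i.
Proof.
rewrite /rcol mxE; case: splitP => j /=; first by rewrite (ord1 j).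
by rewrite /bump leq0n add1n => -[ij]; congr (x _ _); apply: val_inj.
Qed.

Lemma rcol_ext d (y z : 'rV[R]_d.+1) : y 0 ord0 = z 0 ord0 ->
  (forall i, y 0 (lift ord0 i) = z 0 (lift ord0 i)) -> y = z.
Proof.
move=> H0 HS; apply/rowP => i.
by case: (unliftP ord0 i) => [j ->|->]; [exact: HS|exact: H0].
Qed.

Lemma rcolB d t t' (x x' : 'rV[R]_d) : rcol t x - rcol t' x' = rcol (t - t') (x - x').
Proof.
apply: rcol_ext => [|i].
  by rewrite rcol0 mxE [X in _ + X]mxE !rcol0.
by rewrite rcolS mxE [X in _ + X]mxE !rcolS 2!mxE.
Qed.

Lemma rcol_norm d t (x : 'rV[R]_d) c : 0 <= c ->
  (`|rcol t x| <= c) = (`|t| <= c) && (`|x| <= c).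
Proof.
move=> c0; apply/normv_leP/andP => // [H|[Ht /(normv_leP _ c0) Hx] i].
  split; first by have := H ord0; rewrite rcol0.
  by apply/normv_leP => // i; have := H (lift ord0 i); rewrite rcolS.
by case: (unliftP ord0 i) => [j ->|->]; rewrite ?rcol0 ?rcolS.
Qed.

Lemma rcol_line0 d t (x : 'rV[R]_d) s :
  rcol t x + s *: basis_vec ord0 = rcol (t + s) x.
Proof.
apply: rcol_ext => [|i].
  by rewrite rcol0 mxE [X in _ + X]mxE [X in _ * X]mxE rcol0 /= mulr1.
by rewrite rcolS mxE [X in _ + X]mxE [X in _ * X]mxE rcolS /= mulr0 addr0.
Qed.

Lemma rcol_lineS d t (x : 'rV[R]_d) s i :
  rcol t x + s *: basis_vec (lift ord0 i) = rcol t (x + s *: basis_vec i).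
Proof.
apply: rcol_ext => [|j].
  by rewrite rcol0 mxE [X in _ + X]mxE [X in _ * X]mxE rcol0 /= mulr0 addr0.
rewrite rcolS mxE [X in _ + X]mxE [X in _ * X]mxE rcolS [RHS]mxE.
by rewrite [X in _ = _ + X]mxE [X in _ = _ + _ * X]mxE /= (inj_eq lift_inj).
Qed.

End RowVectors.

Section Integral.
Context {R : realType}.

Definition CC d L (g : 'rV[R]_d -> R) :=
  continuous g /\ forall x, L < `|x| -> g x = 0.

Lemma ball_compact d L : compact [set x : 'rV[R]_d | `|x| <= L].
Proof.
apply: bounded_closed_compact.
  by exists L; split => [|c Lc x /= xL]; [exact: num_real|exact: le_trans xL (ltW Lc)].
have -> : [set x : 'rV[R]_d | `|x| <= L] = Num.norm @^-1` [set r | r <= L] by [].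
by apply: closed_comp => [x _|]; [exact: norm_continuous|exact: closed_le].
Qed.

Lemma CC_unif d L (g : 'rV[R]_d -> R) : CC L g -> forall e, 0 < e ->
  exists2 dl, 0 < dl & forall x y, `|x - y| <= dl -> `|g x - g y| <= e.
Proof.
move=> [cg g0] e e0.
have /compact_near_coveringP := @ball_compact d L.
move=> /(_ R (0^'+) (fun dl x => forall y, `|x - y| <= dl -> `|g x - g y| <= e)).
case.
  move=> x _; have /cont_ballP/(_ (e / 2) (divr_gt0 e0 (ltr0Sn _ _)))[dl dl0 Hd] := cg x.
  have d2 : 0 < dl / 2 by rewrite divr_gt0.
  exists (ball x (dl / 2), [set s | s < dl / 2]) => /=.
    split; first exact: nbhsx_ballx.
    exact: nbhs_right_lt.
  move=> [x' s] /= [Bx sd] y xy.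
  rewrite -ball_normE /= in Bx.
  have Hx' : `|g x - g x'| <= e / 2.
    by apply: Hd; apply: lt_trans Bx _; rewrite ltr_pdivrMr//; lra.
  have Hy : `|g x - g y| <= e / 2.
    apply: Hd; rewrite -(subrKA x'); apply: le_lt_trans (ler_normD _ _) _.
    lra.
  have -> : g x' - g y = (g x - g y) - (g x - g x') by ring.
  apply: le_trans (ler_normB _ _) _; lra.
move=> dl0 /= d00 Hdl.
have := @Hdl (dl0 / 2).
rewrite /= sub0r normrN (gtr0_norm (_ : 0 < dl0 / 2)) ?divr_gt0// => H.
exists (dl0 / 2); first by rewrite divr_gt0.
have {}H : [set x | `|x| <= L] `<=` (fun x => forall y, `|x - y| <= dl0 / 2 -> `|g x - g y| <= e).
  by apply: H; rewrite ?divr_gt0// ltr_pdivrMr//; rewrite /= in d00; lra.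
move=> x y xy; have [xL|xL] := leP `|x| L; first exact: H.
have [yL|yL] := leP `|y| L; last by rewrite !g0// subrr normr0 ltW.
by rewrite distrC; apply: H => //; rewrite distrC.
Qed.

Lemma cont_modulus d (g : 'rV[R]_d -> R) :
  (forall e, 0 < e -> exists2 dl, 0 < dl & forall x y, `|x - y| <= dl -> `|g x - g y| <= e) ->
  continuous g.
Proof.
move=> H x; apply/cont_ballP => e e0; have [dl dl0 Hd] := H e e0.
by exists dl => // y /ltW; exact: Hd.
Qed.

Lemma cont_modulus1 (g : R -> R) :
  (forall e, 0 < e -> exists2 dl, 0 < dl & forall x y, `|x - y| <= dl -> `|g x - g y| <= e) ->
  continuous g.
Proof.
move=> H x; apply/cont_ballP => e e0; have [dl dl0 Hd] := H e e0.
by exists dl => // y /ltW; exact: Hd.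
Qed.

Lemma CC_slice d L (g : 'rV[R]_d.+1 -> R) t : CC L g ->
  CC L (fun x => g (rcol t x)).
Proof.
move=> Hg; split.
  apply: cont_modulus => e e0; have [dl dl0 Hd] := CC_unif Hg e0.
  exists dl => // x y xy; apply: Hd.
  by rewrite rcolB subrr rcol_norm ?(ltW dl0)// normr0 (ltW dl0).
move=> x Lx; apply: Hg.2; rewrite ltNge; apply/negP => H.
have L0 := le_trans (normr_ge0 _) H.
by move: H; rewrite rcol_norm// => /andP[_]; rewrite leNgt Lx.
Qed.

(** Nested integrals are handled through finite sums: linearity, positivity and bounds are evident
    for them and pass to the limit, which avoids measurability of slices. The same sums later carry
    a functional under the integral sign. *)
Definition quad d (s : seq (R * 'rV[R]_d)) (g : 'rV[R]_d -> R) : R :=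
  \sum_(p <- s) p.1 * g p.2.

Definition good_quad d L (s : seq (R * 'rV[R]_d)) :=
  [/\ forall p, p \in s -> 0 <= p.1, \sum_(p <- s) p.1 <= (2 * L) ^+ d &
      forall p, p \in s -> `|p.2| <= L].

Lemma quad_bound d L s (g : 'rV[R]_d -> R) C : good_quad L s ->
  (forall x, `|x| <= L -> `|g x| <= C) -> 0 <= C -> `|quad s g| <= (2 * L) ^+ d * C.
Proof.
move=> [s0 s1 s2] H C0; rewrite /quad; apply: le_trans (ler_norm_sum _ _ _) _.
apply: le_trans (_ : \sum_(p <- s) p.1 * C <= _).
  rewrite big_seq [leRHS]big_seq; apply: ler_sum => p ps.
  by rewrite normrM (ger0_norm (s0 p ps)) ler_wpM2l ?s0// H// s2.
by rewrite -big_distrl/= ler_wpM2r.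
Qed.

Lemma quad_lin d s c (g h : 'rV[R]_d -> R) :
  quad s (fun x => c * g x + h x) = c * quad s g + quad s h.
Proof.
rewrite /quad big_distrr -big_split/=; apply: eq_bigr => p _; ring.
Qed.

Lemma quadB d s (g h : 'rV[R]_d -> R) :
  quad s g - quad s h = quad s (fun x => g x - h x).
Proof.
by rewrite /quad -sumrB; apply: eq_bigr => p _; rewrite mulrBr.
Qed.

Lemma rintegralS d (g : 'rV[R]_d.+1 -> R) :
  rintegral g = Rintegral (@lebesgue_measure R) setT
    (fun t => rintegral (fun x : 'rV[R]_d => g (rcol t x))).
Proof. by []. Qed.

Lemma riemann1 (h : R -> R) L e N : 0 < L -> continuous h ->
  (forall x, L < `|x| -> h x = 0) ->
  (forall x y, `|x - y| <= 2 * L / N.+1%:R -> `|h x - h y| <= e) ->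
  `|Rintegral (@lebesgue_measure R) setT h -
    \sum_(j < N.+1) (2 * L / N.+1%:R) * h (- L + 2 * L / N.+1%:R * j%:R)| <= 2 * L * e.
Proof.
move=> L0 ch h0 Hm; have [H HH] := exists_primitive ch.
rewrite (Rintegral_primitive L0 ch h0 HH).
set st := 2 * L / N.+1%:R; pose t (j : nat) := - L + st * j%:R.
have st0 : 0 < st by rewrite !divr_gt0 ?mulr_gt0.
have Et : H L - H (- L) = \sum_(j < N.+1) (H (t j.+1) - H (t j)).
  rewrite -(big_mkord xpredT (fun j => H (t j.+1) - H (t j))) telescope_sumr//.
  by congr (H _ - H _); rewrite /t /st ?mulr0 ?addr0// mulfVK ?pnatr_eq0//; ring.
rewrite Et -sumrB; apply: le_trans (ler_norm_sum _ _ _) _.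
have -> : 2 * L * e = \sum_(j < N.+1) st * e.
  rewrite sumr_const card_ord -[RHS]mulr_natr /st.
  have : N.+1%:R != 0 :> R by rewrite pnatr_eq0.
  by move: (N.+1%:R) => n n0; field.
apply: ler_sum => j _.
have tS : t j.+1 - t j = st by rewrite /t -natr1; ring.
have [|c /andP[c1 c2] ->] := dd1_MVT_oo HH (_ : t j < t j.+1); first by lra.
rewrite tS mulrC -mulrBr normrM gtr0_norm// ler_pM2l//; apply: Hm.
by rewrite -/st -/(t j) ler_norml; apply/andP; split; lra.
Qed.

(** The nodes and weights depend on the mesh [dl] only, not on [g]. This order of quantifiers lets
    [Lf_conv] use a single sum for a convolution and for all its derivatives. *)
Lemma quad_exists d L : 0 < L -> forall dl, 0 < dl ->
  exists2 s : seq (R * 'rV[R]_d), good_quad L s &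
  forall g e, CC L g -> 0 <= e -> (forall x y, `|x - y| <= dl -> `|g x - g y| <= e) ->
    `|rintegral g - quad s g| <= d%:R * e * (2 * L) ^+ d.
Proof.
move=> L0; have L2 : 0 < 2 * L by rewrite mulr_gt0.
elim: d => [|d IH] dl dl0.
  exists [:: (1, 0)].
    split; rewrite ?big_seq1//= => p; rewrite inE => /eqP -> //=.
    by rewrite normr0 ltW.
  by move=> g e _ _ _; rewrite /quad big_seq1 /= mul1r subrr normr0 !mul0r.
have [s [s0 s1 s2] Hs] := IH _ dl0.
have V0 : 0 < (2 * L) ^+ d by rewrite exprn_gt0.
pose N := Num.truncn (2 * L / dl); pose st := 2 * L / N.+1%:R.
have st0 : 0 < st by rewrite !divr_gt0.
have stdl : st <= dl.
  rewrite /st ler_pdivrMr// [leRHS]mulrC -ler_pdivrMr//.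
  by apply: ltW; apply: real_truncnS_gt; exact: num_real.
pose t (j : nat) := - L + st * j%:R.
have [iot iotE] : {s | s = iota 0 N.+1} by exists (iota 0 N.+1).
exists [seq (st * p.1, rcol (t j) p.2) | j <- iot, p <- s].
  have sumE : \sum_(p <- [seq (st * p.1, rcol (t j) p.2) | j <- iot, p <- s]) p.1
      = 2 * L * \sum_(p <- s) p.1.
    rewrite big_allpairs_dep /=.
    under eq_bigr do rewrite -big_distrr/=.
    rewrite big_const_seq count_predT iotE size_iota iter_addr_0 -[LHS]mulr_natr /st.
    have : N.+1%:R != 0 :> R by rewrite pnatr_eq0.
    by move: (N.+1%:R) (\sum_(p <- s) p.1) => n S n0; field.
  split.
  - move=> p /allpairsP[[j q] /= [_ qs ->]] /=.
    by apply: mulr_ge0; [exact: ltW|exact: s0].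
  - by rewrite sumE exprS ler_pM2l.
  - move=> p /allpairsP[[j q] /= [+ qs ->]] /=; rewrite iotE mem_iota add0n ltnS => /andP[_ jN].
    rewrite rcol_norm ?(ltW L0)// s2// andbT ler_norml /t.
    have : 0 <= st * j%:R by rewrite mulr_ge0// ltW.
    have : st * j%:R <= 2 * L.
      by rewrite /st [leLHS]mulrAC ler_pdivrMr// ler_pM2l// ler_nat leqW.
    by move=> *; apply/andP; split; lra.
move=> g e Hg e0 Hm.
pose h (u : R) := rintegral (fun x : 'rV[R]_d => g (rcol u x)).
(* Bounds for integrals are not yet available inside this induction, so the modulus of [h] is
   obtained by comparing the slices with quadratures of arbitrarily fine mesh. *)
have hlip u u' eta dlt : 0 < dlt -> 0 <= eta ->
    (forall x y, `|x - y| <= dlt -> `|g x - g y| <= eta) ->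
    `|u - u'| <= dlt -> `|h u - h u'| <= (2 * L) ^+ d * eta.
  move=> dlt0 eta0 Hdlt uu'; apply: le_of_eps => z z0.
  pose k := z / (2 * d.+1%:R * (2 * L) ^+ d).
  have k0 : 0 < k by rewrite divr_gt0// !mulr_gt0.
  have [dk dk0 Hk] := CC_unif Hg k0.
  have [q [q0 q1 q2] Hq] := IH _ dk0.
  have A v : `|h v - quad q (fun x => g (rcol v x))| <= z / 2.
    apply: le_trans (Hq _ k (CC_slice v Hg) (ltW k0) _) _.
      move=> x y xy; apply: Hk.
      by rewrite rcolB subrr rcol_norm ?(ltW dk0)// normr0 (ltW dk0).
    have -> : z / 2 = d.+1%:R * k * (2 * L) ^+ d.
      rewrite /k; have : d.+1%:R != 0 :> R by rewrite pnatr_eq0.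
      have : (2 * L) ^+ d != 0 by rewrite gt_eqF.
      by move: (d.+1%:R) ((2 * L) ^+ d) => n m m0 n0; field; rewrite n0 m0.
    by rewrite ler_pM2r// ler_pM2r// ler_nat.
  have B : `|quad q (fun x => g (rcol u x)) - quad q (fun x => g (rcol u' x))| <= (2 * L) ^+ d * eta.
    rewrite quadB; apply: (quad_bound (L := L)) => // x _.
    by apply: Hdlt; rewrite rcolB subrr rcol_norm ?(ltW dlt0)// normr0 (ltW dlt0) andbT.
  have := A u; have := A u'; rewrite distrC => A1 A2.
  have -> : h u - h u' = (h u - quad q (fun x => g (rcol u x))) +
     (quad q (fun x => g (rcol u x)) - quad q (fun x => g (rcol u' x))) +
     (quad q (fun x => g (rcol u' x)) - h u') by ring.
  apply: le_trans (ler_normD _ _) _.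
  apply: le_trans (lerD (ler_normD _ _) (lexx _)) _; lra.
have ch : continuous h.
  apply: cont_modulus1 => z z0.
  have k0 : 0 < z / (2 * L) ^+ d by rewrite divr_gt0.
  have [dk dk0 Hk] := CC_unif Hg k0; exists dk => // x y xy.
  apply: le_trans (hlip _ _ _ _ dk0 (ltW k0) Hk xy) _.
  by rewrite mulrC mulfVK// gt_eqF.
have h0 u : L < `|u| -> h u = 0.
  move=> Lu; have G0 x : g (rcol u x) = 0.
    apply: Hg.2; by rewrite ltNge rcol_norm ?(ltW L0)// negb_and -ltNge Lu.
  have := Hs (fun x => g (rcol u x)) 0 (CC_slice u Hg) (lexx _).
  rewrite mulr0 mul0r => H; apply/eqP; rewrite -normr_le0; apply: le_trans (H _).
    have -> : quad s (fun x => g (rcol u x)) = 0.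
      by rewrite /quad big1// => p _; rewrite G0 mulr0.
    by rewrite subr0.
  by move=> x y _; rewrite !G0 subrr normr0.
have R1 := @riemann1 h L ((2 * L) ^+ d * e) N L0 ch h0.
have {}R1 := R1 (fun x y xy => hlip x y e dl dl0 e0 Hm (le_trans xy stdl)).
rewrite rintegralS -/(h _).
set S := \sum_(j < _) _ in R1.
have R2 : `|S - quad [seq (st * p.1, rcol (t j) p.2) | j <- iot, p <- s] g|
   <= d%:R * e * (2 * L) ^+ d.+1.
  rewrite /quad big_allpairs_dep /= iotE -[iota 0 N.+1]/(index_iota 0 N.+1) big_mkord -sumrB.
  apply: le_trans (ler_norm_sum _ _ _) _.
  have -> : d%:R * e * (2 * L) ^+ d.+1 = \sum_(j < N.+1) st * (d%:R * e * (2 * L) ^+ d).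
    rewrite sumr_const card_ord -[RHS]mulr_natr /st exprS.
    have : N.+1%:R != 0 :> R by rewrite pnatr_eq0.
    by move: (N.+1%:R) => n n0; field.
  apply: ler_sum => j _.
  under eq_bigr do rewrite -mulrA.
  rewrite -big_distrr/= -mulrBr normrM gtr0_norm// ler_pM2l//.
  apply: Hs => //; first exact: CC_slice.
  by move=> x y xy; apply: Hm; rewrite rcolB subrr rcol_norm ?(ltW dl0)// normr0 (ltW dl0).
rewrite -(subrKA S); apply: le_trans (ler_normD _ _) _.
apply: le_trans (lerD R1 R2) _; rewrite -natr1 exprS.
rewrite le_eqVlt; apply/orP; left; apply/eqP; ring.
Qed.

End Integral.

Section IntegralTheory.
Context {R : realType}.

Lemma CC_lin d L c (g h : 'rV[R]_d -> R) : CC L g -> CC L h ->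
  CC L (fun x => c * g x + h x).
Proof.
move=> [cg g0] [ch h0]; split; first exact: cont_lin.
by move=> x xL; rewrite g0// h0// mulr0 addr0.
Qed.

Lemma CC0 d L : CC L (fun _ : 'rV[R]_d => 0).
Proof. by split=> //; exact: cont_cst. Qed.

Lemma CC_mono d L L' (g : 'rV[R]_d -> R) : L <= L' -> CC L g -> CC L' g.
Proof. by move=> LL' [cg g0]; split=> // x /(le_lt_trans LL'); exact: g0. Qed.

Lemma CC_mul d L (g h : 'rV[R]_d -> R) : continuous g -> CC L h ->
  CC L (fun x => g x * h x).
Proof.
move=> cg [ch h0]; split; first exact: cont_mul.
by move=> x xL; rewrite h0// mulr0.
Qed.

Lemma rint_approx d L (gs : seq ('rV[R]_d -> R)) : 0 < L ->
  (forall g, List.In g gs -> CC L g) -> forall e, 0 < e ->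
  exists2 s, good_quad L s & forall g, List.In g gs -> `|rintegral g - quad s g| <= e.
Proof.
move=> L0 Hgs e e0; pose k := e / (d.+1%:R * (2 * L) ^+ d).
have V0 : 0 < (2 * L) ^+ d by rewrite exprn_gt0// mulr_gt0.
have k0 : 0 < k by rewrite divr_gt0// mulr_gt0.
have [dl dl0 Hdl] : exists2 dl, 0 < dl & forall g, List.In g gs ->
    forall x y, `|x - y| <= dl -> `|g x - g y| <= k.
  elim: gs Hgs => [|g gs IH] H; first by exists 1.
  have [dl1 dl10 H1] := IH (fun h hh => H h (or_intror hh)).
  have [dl2 dl20 H2] := CC_unif (H g (or_introl erefl)) k0.
  exists (Num.min dl1 dl2); first by rewrite lt_min dl10.
  move=> h hh x y; rewrite le_min => /andP[xy1 xy2].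
  by case: hh => [<-|hh]; [exact: H2|exact: H1].
have [s gs_s Hs] := @quad_exists R d L L0 dl dl0.
exists s => // g gg; apply: le_trans (Hs g k (Hgs g gg) (ltW k0) (Hdl g gg)) _.
have -> : e = d.+1%:R * k * (2 * L) ^+ d.
  rewrite /k; have : d.+1%:R != 0 :> R by rewrite pnatr_eq0.
  have : (2 * L) ^+ d != 0 by rewrite gt_eqF.
  by move: (d.+1%:R) ((2 * L) ^+ d) => n m m0 n0; field; rewrite n0 m0.
by rewrite ler_pM2r// ler_pM2r// ler_nat.
Qed.

Lemma rint_lin d L c (g h : 'rV[R]_d -> R) : 0 < L -> CC L g -> CC L h ->
  rintegral (fun x => c * g x + h x) = c * rintegral g + rintegral h.
Proof.
move=> L0 Hg Hh; apply: eq_of_eps => e e0.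
pose k := e / (2 + `|c|).
have c0 : 0 < 2 + `|c| by rewrite ltr_wpDr.
have k0 : 0 < k by rewrite divr_gt0.
have [s _ Hs] := @rint_approx d L [:: g; h; (fun x => c * g x + h x)] L0
  (fun f ff => match ff with or_introl E => eq_ind g (CC L) Hg f E
   | or_intror (or_introl E) => eq_ind h (CC L) Hh f E
   | or_intror (or_intror (or_introl E)) => eq_ind _ (CC L) (CC_lin c Hg Hh) f E
   | or_intror (or_intror (or_intror F)) => match F with end end) k k0.
have H1 := Hs g (or_introl erefl).
have H2 := Hs h (or_intror (or_introl erefl)).
have := Hs _ (or_intror (or_intror (or_introl erefl))); rewrite quad_lin => H3.
set I := rintegral (fun x => _) in H3 *.
have -> : I - (c * rintegral g + rintegral h) =
  (I - (c * quad s g + quad s h)) - c * (rintegral g - quad s g) - (rintegral h - quad s h).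
  by ring.
apply: le_trans (ler_normB _ _) _; apply: le_trans (lerD (ler_normB _ _) (lexx _)) _.
rewrite normrM; have H4 : `|c| * `|rintegral g - quad s g| <= `|c| * k by rewrite ler_wpM2l.
have -> : e = k + `|c| * k + k.
  by rewrite /k; field; rewrite gt_eqF.
by lra.
Qed.

Lemma rint_bound d L (g : 'rV[R]_d -> R) C : 0 < L -> CC L g ->
  (forall x, `|g x| <= C) -> `|rintegral g| <= (2 * L) ^+ d * C.
Proof.
move=> L0 Hg HC; apply: le_of_eps => e e0.
have [s gs Hs] := @rint_approx d L [:: g] L0
  (fun f ff => match ff with or_introl E => eq_ind g (CC L) Hg f E
   | or_intror F => match F with end end) e e0.
have H1 := Hs g (or_introl erefl).
have H2 := quad_bound gs (fun x _ => HC x) (le_trans (normr_ge0 _) (HC 0)).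
rewrite -(subrK (quad s g) (rintegral g)); apply: le_trans (ler_normD _ _) _.
lra.
Qed.

Lemma rint_ge0 d L (g : 'rV[R]_d -> R) : 0 < L -> CC L g ->
  (forall x, 0 <= g x) -> 0 <= rintegral g.
Proof.
move=> L0 Hg g0; apply: le_of_eps => e e0.
have [s [s0 _ _] Hs] := @rint_approx d L [:: g] L0
  (fun f ff => match ff with or_introl E => eq_ind g (CC L) Hg f E
   | or_intror F => match F with end end) e e0.
have := Hs g (or_introl erefl); rewrite ler_norml => /andP[H1 _].
have H2 : 0 <= quad s g.
  by rewrite /quad big_seq; apply: sumr_ge0 => p ps; rewrite mulr_ge0// s0.
lra.
Qed.

Lemma rint0 d : rintegral (fun _ : 'rV[R]_d => 0) = 0 :> R.
Proof.
apply/eqP; rewrite -normr_le0; have := @rint_bound d 1 (fun=> 0) 0 ltr01 (CC0 d 1).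
by rewrite mulr0; apply => x; rewrite normr0.
Qed.

Lemma rintZ d L c (g : 'rV[R]_d -> R) : 0 < L -> CC L g ->
  rintegral (fun x => c * g x) = c * rintegral g.
Proof.
move=> L0 Hg; have := rint_lin c L0 Hg (CC0 d L); rewrite rint0 addr0 => <-.
by congr rintegral; apply/funext => x; rewrite addr0.
Qed.

Lemma rintB d L (g h : 'rV[R]_d -> R) : 0 < L -> CC L g -> CC L h ->
  rintegral (fun x => g x - h x) = rintegral g - rintegral h.
Proof.
move=> L0 Hg Hh; rewrite addrC -mulN1r -(rint_lin _ L0 Hh Hg).
by congr rintegral; apply/funext => x; rewrite mulN1r addrC.
Qed.

Lemma rint_sum d L (I : Type) (r : seq I) (P : pred I) (G : I -> 'rV[R]_d -> R) :
  0 < L -> (forall i, P i -> CC L (G i)) ->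
  CC L (fun x => \sum_(i <- r | P i) G i x) /\
  rintegral (fun x => \sum_(i <- r | P i) G i x) = \sum_(i <- r | P i) rintegral (G i).
Proof.
move=> L0 H; elim: r => [|i r [IH1 IH2]].
  under eq_fun do rewrite big_nil; rewrite big_nil; split; [exact: CC0|exact: rint0].
rewrite big_cons; under eq_fun do rewrite big_cons.
case: ifP => // Pi.
have E : (fun x => G i x + \sum_(j <- r | P j) G j x) =
         (fun x => 1 * G i x + \sum_(j <- r | P j) G j x).
  by apply/funext => x; rewrite mul1r.
rewrite E; split; first by apply: CC_lin => //; exact: H.
by rewrite (rint_lin _ L0 (H i Pi) IH1) mul1r IH2.
Qed.

(** For a direction other than the first, the inner integral vanishes by induction. For the first
    direction, the inner integrals of [g] form a compactly supported function of one variable whose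
    derivative is being integrated. *)
Lemma rint_partial0 d L (i : 'I_d) (g g' : 'rV[R]_d -> R) : 0 < L ->
  CC L g -> CC L g' -> (forall x, dd g (basis_vec i) x (g' x)) -> rintegral g' = 0.
Proof.
move=> L0; elim: d i g g' => [[]//|d IH] i g g' Hg Hg' D.
rewrite rintegralS; have L1 : 0 < L + 1 by rewrite addr_gt0.
have V0 : 0 < (2 * L) ^+ d by rewrite exprn_gt0// mulr_gt0.
case: (unliftP ord0 i) D => [j ->|->] D.
  under eq_Rintegral => t _.
    rewrite (IH j (fun x => g (rcol t x))).
    - over.
    - exact: CC_slice.
    - exact: CC_slice.
    move=> x e e0; have [dl dl0 Hd] := D (rcol t x) e e0.
    by exists dl => // s sd; rewrite -rcol_lineS; exact: Hd.
  rewrite (Rintegral_primitive (H := fun=> 0) L0) ?subrr//; first exact: cont_cst.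
  by move=> x e e0; exists 1 => // t _; rewrite mulr0 !subrr normr0 mulr_ge0// ltW.
pose H t := rintegral (fun x => g (rcol t x)).
have DH t : dd1 H t (rintegral (fun x => g' (rcol t x))).
  move=> e e0; pose k := e / (2 * L) ^+ d.
  have k0 : 0 < k by rewrite divr_gt0.
  have [dl dl0 Hd] := CC_unif Hg' k0; exists dl => // s sd.
  rewrite /H -(rintB L0); [|exact: CC_slice..].
  have C1 : CC L (fun x => g (rcol (t + s) x) - g (rcol t x)).
    have := CC_lin (-1) (CC_slice t Hg) (CC_slice (t + s) Hg).
    by under eq_fun do rewrite mulN1r addrC.
  rewrite -(rintZ _ L0 (CC_slice t Hg')) -(rintB L0)//; last first.
    by apply: CC_mul; [exact: cont_cst|exact: CC_slice].
  apply: le_trans (@rint_bound d L _ (k * `|s|) L0 _ _) _.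
  - have := CC_lin (- s) (CC_slice t Hg') C1.
    by under eq_fun do rewrite mulNr addrC.
  - move=> x.
    have Dl u : dd1 (fun u => g (rcol (t + u) x)) u (g' (rcol (t + u) x)).
      have := (@dd_line R _ g (basis_vec ord0) (rcol t x) u (g' (rcol (t + u) x))).1.
      rewrite rcol_line0 => /(_ (D _)).
      by under [X in dd1 X]eq_fun do rewrite rcol_line0.
    have [c /andP[c1 c2]] := dd1_MVT Dl 0 s.
    rewrite subr0 addr0 => ->; rewrite -[s * _]mulrC -mulrBl normrM ler_wpM2r//.
    apply: Hd; rewrite rcolB subrr rcol_norm ?(ltW dl0)// normr0 (ltW dl0) andbT.
    rewrite addrAC subrr add0r; apply: le_trans (ltW sd).
    move: c1 c2; rewrite minElt maxElt; case: (ltP 0 s) => s0 c1 c2.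
      by rewrite !ger0_norm//; lra.
    by rewrite !ler0_norm//; lra.
  - by rewrite le_eqVlt; apply/orP; left; apply/eqP; rewrite /k mulrA mulrC; field; rewrite gt_eqF.
have S0 t : L < `|t| -> (forall x, g (rcol t x) = 0) /\ (forall x, g' (rcol t x) = 0).
  move=> Lt; have K x : L < `|rcol t x|.
    by rewrite ltNge rcol_norm ?(ltW L0)// negb_and -ltNge Lt.
  by split=> x; [apply: Hg.2|apply: Hg'.2].
have ch : continuous (fun t => rintegral (fun x => g' (rcol t x))).
  apply: cont_modulus1 => e e0; pose k := e / (2 * L) ^+ d.
  have k0 : 0 < k by rewrite divr_gt0.
  have [dl dl0 Hd] := CC_unif Hg' k0; exists dl => // t s ts.
  rewrite -(rintB L0); [|exact: CC_slice..].
  apply: le_trans (@rint_bound d L _ k L0 _ _) _.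
  - have := CC_lin (-1) (CC_slice s Hg') (CC_slice t Hg').
    by under eq_fun do rewrite mulN1r addrC.
  - move=> x; apply: Hd.
    by rewrite rcolB subrr rcol_norm ?(ltW dl0)// normr0 (ltW dl0) andbT.
  - by rewrite /k mulrC mulfVK// gt_eqF.
have HZ t : L < `|t| -> H t = 0.
  by move=> /S0[E _]; rewrite /H; under eq_fun do rewrite E; exact: rint0.
(* The radius [L + 1] is taken because [H] is known to vanish only for [|t|] strictly larger than
   [L]. *)
rewrite (Rintegral_primitive (H := H) L1)//.
  by rewrite !HZ ?subrr// ?normrN gtr0_norm// ltrDl.
move=> x Lx; have [|_ E] := S0 x; first by apply: lt_trans Lx; rewrite ltrDl.
by under eq_fun do rewrite E; rewrite rint0.
Qed.

Lemma cont_prod (T : topologicalType) (I : Type) (r : seq I) (G : I -> T -> R) :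
  (forall i, continuous (G i)) -> continuous (fun x => \prod_(i <- r) G i x).
Proof.
move=> cG; elim: r => [|i r IH].
  by under eq_fun do rewrite big_nil; exact: cont_cst.
by under eq_fun do rewrite big_cons; exact: cont_mul.
Qed.

Lemma cont_coord d (f : R -> R) (i : 'I_d) : continuous f ->
  continuous (fun x : 'rV[R]_d => f (x 0 i)).
Proof.
move=> cf x; apply: (@continuous_comp _ _ _ (fun x : 'rV[R]_d => x 0 i) f); last exact: cf.
exact: coord_continuous.
Qed.

Lemma rint_tens d L (f F : 'I_d -> R -> R) : 0 < L ->
  (forall i t, dd1 (F i) t (f i t)) -> (forall i, continuous (f i)) ->
  (forall i t, L < `|t| -> f i t = 0) -> (forall i, F i L - F i (- L) = 1) ->
  CC L (fun x : 'rV[R]_d => \prod_i f i (x 0 i)) /\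
  rintegral (fun x : 'rV[R]_d => \prod_i f i (x 0 i)) = 1.
Proof.
move=> L0; elim: d f F => [|d IH] f F DF cf f0 F1.
  split; last by rewrite /= big_ord0.
  split; first by under eq_fun do rewrite big_ord0; exact: cont_cst.
  move=> x; rewrite ltNge => /negP[]; apply/normv_leP; [exact: ltW|by case=> m].
have [C1 I1] := IH (fun i => f (lift ord0 i)) (fun i => F (lift ord0 i))
  (fun i => DF _) (fun i => cf _) (fun i => f0 _) (fun i => F1 _).
split; last first.
  rewrite rintegralS.
  under eq_Rintegral => t _.
    under eq_fun => x.
      rewrite big_ord_recl rcol0; under eq_bigr do rewrite rcolS; over.
    rewrite (rintZ _ L0 C1) I1 mulr1; over.
  by rewrite (Rintegral_primitive (H := F ord0) L0)//; exact: f0.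
split; last first.
  move=> x; rewrite ltNge => /negP H; apply/eqP/negPn/negP => /prodf_neq0 P.
  apply: H; apply/normv_leP; first exact: ltW.
  by move=> i; rewrite leNgt; apply/negP => /(f0 i) /eqP; apply/negP/P.
by apply: cont_prod => i; exact: cont_coord.
Qed.

End IntegralTheory.

(** * Ultradifferentiable test functions and convolution *)

Section Smooth.
Context {R : realType} {d : nat}.
Local Notation V := 'rV[R]_d.
Implicit Types (u v : V -> R) (s : seq 'I_d).

Definition rpartial (i : 'I_d) u : V -> R := fun x => 'D_(basis_vec i) u x.

Definition rder s u : V -> R := foldr rpartial u s.

Definition rsmooth u : Prop := forall s, continuous (rder s u) /\
  forall i x, derivable (rder s u) x (basis_vec i).

Lemma dd_partial i u x a : dd u (basis_vec i) x a -> rpartial i u x = a.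
Proof. by move=> /ddP[]. Qed.

Lemma rsmooth_dd u s i x : rsmooth u ->
  dd (rder s u) (basis_vec i) x (rder (i :: s) u x).
Proof. by move=> /(_ s)[_ D]; apply/ddP; apply: DeriveDef. Qed.

Lemma rsmooth_cont u s : rsmooth u -> continuous (rder s u).
Proof. by move=> /(_ s)[]. Qed.

(** Smoothness is proved by naming all derivatives in advance: a continuous family indexed by words
    of directions and closed under one more derivative is the jet of its first member. This also
    computes the derivatives. *)
Lemma jetP (G : seq 'I_d -> V -> R) : (forall s, continuous (G s)) ->
  (forall s i x, dd (G s) (basis_vec i) x (G (i :: s) x)) ->
  rsmooth (G [::]) /\ forall s, rder s (G [::]) = G s.
Proof.
move=> cG DG.
have E s : rder s (G [::]) = G s.
  elim: s => //= i s ->; apply/funext => x; exact: dd_partial.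
by split=> // s; rewrite E; split=> // i x; have /ddP[] := DG s i x.
Qed.

Lemma ddD u v i x a b c : dd u (basis_vec i) x a -> dd v (basis_vec i) x b ->
  dd (fun y => c * u y + v y) (basis_vec i) x (c * a + b).
Proof.
move=> Hu Hv e e0; pose k := e / (`|c| + 1).
have c1 : 0 < `|c| + 1 by rewrite ltr_wpDl.
have k0 : 0 < k by rewrite divr_gt0.
have [du du0 Du] := Hu k k0; have [dv dv0 Dv] := Hv k k0.
exists (Num.min du dv); first by rewrite lt_min du0.
move=> t; rewrite lt_min => /andP[tu tv].
have -> : c * u (x + t *: basis_vec i) + v (x + t *: basis_vec i) - (c * u x + v x) - t * (c * a + b)
 = c * (u (x + t *: basis_vec i) - u x - t * a) + (v (x + t *: basis_vec i) - v x - t * b) by ring.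
apply: le_trans (ler_normD _ _) _; rewrite normrM.
apply: le_trans (lerD (ler_wpM2l (normr_ge0 c) (Du t tu)) (Dv t tv)) _.
rewrite le_eqVlt; apply/orP; left; apply/eqP.
by rewrite /k; field; rewrite gt_eqF.
Qed.

Lemma rsmooth_lin c u v : rsmooth u -> rsmooth v ->
  rsmooth (fun x => c * u x + v x) /\
  forall s, rder s (fun x => c * u x + v x) = fun x => c * rder s u x + rder s v x.
Proof.
move=> su sv; apply: (jetP (G := fun s x => c * rder s u x + rder s v x)).
  by move=> s; apply: cont_lin; exact: rsmooth_cont.
by move=> s i x; apply: ddD; exact: rsmooth_dd.
Qed.

Lemma rsmooth0 : rsmooth (fun=> 0) /\ forall s, rder s (fun=> 0) = fun=> 0.
Proof.
apply: (jetP (G := fun _ _ => 0)) => [s|s i x e e0]; first exact: cont_cst.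
by exists 1 => // t _; rewrite mulr0 !subrr normr0 mulr_ge0// ltW.
Qed.

Lemma rsmooth_scale c u : rsmooth u -> rsmooth (fun x => c * u x) /\
  forall s, rder s (fun x => c * u x) = fun x => c * rder s u x.
Proof.
move=> su; have [s0 E0] := rsmooth0.
have [] := rsmooth_lin c su s0.
have -> : (fun x => c * u x + 0) = (fun x => c * u x).
  by apply/funext => x; rewrite addr0.
by move=> A B; split=> // s; rewrite B E0; apply/funext => x; rewrite addr0.
Qed.

Lemma rsmoothB u v : rsmooth u -> rsmooth v ->
  rsmooth (fun x => u x - v x) /\
  forall s, rder s (fun x => u x - v x) = fun x => rder s u x - rder s v x.
Proof.
move=> su sv; have [] := rsmooth_lin (-1) sv su.
have -> : (fun x => -1 * v x + u x) = (fun x => u x - v x).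
  by apply/funext => x; rewrite mulN1r addrC.
by move=> A B; split=> // s; rewrite B; apply/funext => x; rewrite mulN1r addrC.
Qed.

Lemma rsmooth_sum (I : Type) (r : seq I) (c : I -> R) (u : I -> V -> R) :
  (forall i, rsmooth (u i)) -> rsmooth (fun x => \sum_(i <- r) c i * u i x) /\
  forall s, rder s (fun x => \sum_(i <- r) c i * u i x) =
    fun x => \sum_(i <- r) c i * rder s (u i) x.
Proof.
move=> su; elim: r => [|i r [IH1 IH2]].
  have [s0 E0] := rsmooth0.
  under eq_fun do rewrite big_nil; split=> // s.
  by rewrite E0; apply/funext => x; rewrite big_nil.
have -> : (fun x => \sum_(j <- i :: r) c j * u j x) =
   (fun x => c i * u i x + \sum_(j <- r) c j * u j x).
  by apply/funext => x; rewrite big_cons.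
have [A B] := rsmooth_lin (c i) (su i) IH1.
by split=> // s; rewrite B IH2; apply/funext => x; rewrite big_cons.
Qed.

Lemma rsmooth_shift u h : rsmooth u -> rsmooth (fun x => u (x - h)) /\
  forall s, rder s (fun x => u (x - h)) = fun x => rder s u (x - h).
Proof.
move=> su; apply: (jetP (G := fun s x => rder s u (x - h))).
  by move=> s; apply: cont_shift; exact: rsmooth_cont.
move=> s i x e e0; have [dl dl0 Hd] := rsmooth_dd s i (x - h) su e0.
by exists dl => // t td; rewrite [x + t *: _ - h]addrAC; exact: Hd.
Qed.

Lemma rsmooth_der u s : rsmooth u -> rsmooth (rder s u).
Proof.
by move=> su t; rewrite /rder -foldr_cat; exact: su.
Qed.

Lemma rder_cat s t u : rder (s ++ t) u = rder s (rder t u).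
Proof. by rewrite /rder foldr_cat. Qed.

Lemma norm_basis (i : 'I_d) : `|basis_vec i : V| <= 1.
Proof.
apply/normv_leP => // j; rewrite mxE /=; case: (j == i); rewrite ?normr1 ?normr0//.
Qed.

Lemma norm_line (i : 'I_d) (t : R) : `|t *: basis_vec i : V| <= `|t|.
Proof. by rewrite normrZ ler_piMr// norm_basis. Qed.

Lemma dd_line_all u v i x : (forall y, dd u (basis_vec i) y (v y)) ->
  forall t, dd1 (fun t => u (x + t *: basis_vec i)) t (v (x + t *: basis_vec i)).
Proof. by move=> H t; apply/dd_line; exact: H. Qed.

Lemma dd_swap u i j ui uj uij uji : (forall x, dd u (basis_vec i) x (ui x)) ->
  (forall x, dd u (basis_vec j) x (uj x)) ->
  (forall x, dd ui (basis_vec j) x (uji x)) ->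
  (forall x, dd uj (basis_vec i) x (uij x)) ->
  continuous uij -> continuous uji -> forall x, uij x = uji x.
Proof.
move=> Di Dj Dji Dij cij cji x.
(* Both mixed derivatives are limits of the same second difference. *)
have K (a b : 'I_d) va vba : (forall x, dd u (basis_vec a) x (va x)) ->
  (forall x, dd va (basis_vec b) x (vba x)) -> forall t, 0 < t ->
  exists2 z, `|z - x| <= 2 * t &
    u (x + t *: basis_vec a + t *: basis_vec b) - u (x + t *: basis_vec a)
    - u (x + t *: basis_vec b) + u x = t * t * vba z.
  move=> Da Dba t t0.
  pose p (s : R) := u (x + t *: basis_vec b + s *: basis_vec a) - u (x + s *: basis_vec a).
  pose p' (s : R) := va (x + t *: basis_vec b + s *: basis_vec a) - va (x + s *: basis_vec a).
  have Dp (s : R) : dd1 p s (p' s) by apply: dd1B; exact: dd_line_all.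
  have [s1 /andP[s10 s1t] E1] := dd1_MVT_oo Dp t0.
  have [s2 /andP[s20 s2t] E2] := dd1_MVT_oo (dd_line_all (x + s1 *: basis_vec a) Dba) t0.
  exists (x + s1 *: basis_vec a + s2 *: basis_vec b).
    have -> : x + s1 *: basis_vec a + s2 *: basis_vec b - x = s1 *: basis_vec a + s2 *: basis_vec b.
      by rewrite addrC !addrA addNr add0r.
    apply: le_trans (ler_normD _ _) _; rewrite mulr2n mulrDl mul1r.
    apply: lerD; apply: le_trans (norm_line _ _) _; rewrite gtr0_norm//; exact: ltW.
  move: E2; rewrite scale0r addr0 subr0 => E2.
  have -> : t * t * vba (x + s1 *: basis_vec a + s2 *: basis_vec b) = t * p' s1.
    by rewrite /p' [x + t *: _ + _]addrAC E2; ring.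
  move: E1; rewrite subr0 [RHS]mulrC => <-.
  by rewrite /p scale0r !addr0 [x + t *: basis_vec b + _]addrAC; ring.
apply: eq_of_eps => e e0; have e2 : 0 < e / 2 by rewrite divr_gt0.
have /cont_ballP/(_ _ e2)[d1 d10 H1] := cij x.
have /cont_ballP/(_ _ e2)[d2 d20 H2] := cji x.
pose t := Num.min d1 d2 / 4.
have m0 : 0 < Num.min d1 d2 by rewrite lt_min d10.
have t0 : 0 < t by rewrite divr_gt0.
have [z1 Hz1 E1] := K i j _ _ Di Dji t t0.
have [z2 Hz2 E2] := K j i _ _ Dj Dij t t0.
have tm : 2 * t < Num.min d1 d2 by rewrite /t; lra.
have Ez : uji z1 = uij z2.
  apply: (mulfI (_ : t * t != 0)); first by rewrite mulf_neq0// gt_eqF.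
  rewrite -E1 -E2 [x + t *: basis_vec i + _]addrAC; ring.
have B1 : `|uij x - uij z2| <= e / 2.
  by apply: H1; rewrite distrC; apply: le_lt_trans Hz2 _; apply: lt_le_trans tm _; rewrite ge_min lexx.
have B2 : `|uji x - uji z1| <= e / 2.
  by apply: H2; rewrite distrC; apply: le_lt_trans Hz1 _; apply: lt_le_trans tm _; rewrite ge_min lexx orbT.
have -> : uij x - uji x = (uij x - uij z2) - (uji x - uji z1) by rewrite Ez; ring.
apply: le_trans (ler_normB _ _) _; lra.
Qed.

Lemma rder_swap u i j s : rsmooth u -> rder (i :: j :: s) u = rder (j :: i :: s) u.
Proof.
move=> su; apply/funext => x.
apply: (dd_swap (u := rder s u) (ui := rder (i :: s) u) (uj := rder (j :: s) u) (i := i) (j := j)).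
- by move=> y; exact: rsmooth_dd.
- by move=> y; exact: rsmooth_dd.
- by move=> y; exact: (rsmooth_dd (i :: s)).
- by move=> y; exact: (rsmooth_dd (j :: s)).
- exact: (@rsmooth_cont u (i :: j :: s) su).
- exact: (@rsmooth_cont u (j :: i :: s) su).
Qed.

Lemma rder_move u i s t : rsmooth u -> rder (s ++ i :: t) u = rder (i :: s ++ t) u.
Proof.
move=> su; elim: s => [|j s IH] //=.
rewrite -[LHS]/(rpartial j (rder (s ++ i :: t) u)) IH.
exact: (rder_swap j i (s ++ t)).
Qed.

Lemma rder_perm u s t : rsmooth u -> perm_eq s t -> rder s u = rder t u.
Proof.
move=> su; elim: s t => [|i s IH] t.
  by rewrite perm_sym => /perm_nilP ->.
move=> st; have it : i \in t by rewrite -(perm_mem st) mem_head.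
case/splitPr: it st => t1 t2 st; rewrite rder_move//=; congr (rpartial i _); apply: IH.
rewrite -(perm_cons i); apply: perm_trans st _.
by rewrite -cat1s perm_catCA.
Qed.

Lemma rder_lip u s C : rsmooth u -> (forall i x, `|rder (i :: s) u x| <= C) ->
  forall x h, `|rder s u (x + h) - rder s u x| <= d%:R * C * `|h|.
Proof.
move=> su HC x h.
have K (r : seq 'I_d) : `|rder s u (x + \sum_(i <- r) h 0 i *: basis_vec i) - rder s u x|
    <= (size r)%:R * C * `|h|.
  elim: r => [|i r IH]; first by rewrite big_nil addr0 subrr normr0 !mul0r.
  rewrite big_cons [_ *: _ + _]addrC addrA.
  set y := x + _ in IH *; rewrite /= -natr1 !mulrDl mul1r.
  have -> : rder s u (y + h 0 i *: basis_vec i) - rder s u x =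
    (rder s u y - rder s u x) + (rder s u (y + h 0 i *: basis_vec i) - rder s u y) by ring.
  apply: le_trans (ler_normD _ _) _; apply: lerD; first exact: IH.
  have D t := dd_line_all y (fun z => rsmooth_dd s i z su) t.
  have := dd1_bound D (fun t => HC i _) 0 (h 0 i).
  rewrite scale0r addr0 subr0 => H; apply: le_trans H _.
  rewrite ler_wpM2l ?normv_coord//; exact: le_trans (normr_ge0 _) (HC i x).
have := K (index_enum _).
have -> : \sum_(i <- index_enum 'I_d) h 0 i *: basis_vec i = h by rewrite [RHS]row_sum_delta.
have -> // : size (index_enum 'I_d) = d.
by rewrite -[RHS]card_ord cardE enumT.
Qed.

End Smooth.

Section Support.
Context {R : realType} {d : nat}.
Local Notation V := 'rV[R]_d.
Implicit Types (u v : V -> R) (s : seq 'I_d).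

Definition supp_in L u : Prop := forall x, L < `|x| -> u x = 0.

Lemma rder_supp L u s : rsmooth u -> supp_in L u -> supp_in L (rder s u).
Proof.
move=> su u0; elim: s => [|i s IH] //= x Lx.
apply: dd_partial => e e0; exists (`|x| - L); first by rewrite subr_gt0.
move=> t tx; rewrite mulr0 subr0 IH; last first.
  have H2 := norm_line i t.
  have H3 := lerB_dist x (- (t *: (basis_vec i : V))); rewrite opprK normrN in H3.
  lra.
by rewrite IH// subrr normr0 mulr_ge0// ltW.
Qed.

Lemma rder_CC L u s : rsmooth u -> supp_in L u -> CC L (rder s u).
Proof. by move=> su u0; split; [exact: rsmooth_cont|exact: rder_supp]. Qed.

Lemma supp_in_shift L u h : supp_in L u -> supp_in (L + `|h|) (fun x => u (x - h)).
Proof. by move=> u0 x Lx; apply: u0; have := lerB_dist x h; lra. Qed.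

Lemma supp_in_lin L c u v : supp_in L u -> supp_in L v ->
  supp_in L (fun x => c * u x + v x).
Proof. by move=> u0 v0 x Lx; rewrite u0// v0// mulr0 addr0. Qed.

Lemma supp_in_mono L L' u : L <= L' -> supp_in L u -> supp_in L' u.
Proof. by move=> LL' u0 x /(le_lt_trans LL'); exact: u0. Qed.

Lemma rder_nil_supp u s x : rsmooth u -> (exists2 dl, 0 < dl &
  forall y, `|x - y| < dl -> u y = 0) -> rder s u x = 0.
Proof.
move=> su [dl dl0 H].
suff K : forall y, `|x - y| < dl -> rder s u y = 0 by apply: K; rewrite subrr normr0.
elim: s => [|i s IH] //= y xy.
apply: dd_partial => e e0; exists (dl - `|x - y|); first by rewrite subr_gt0.
move=> t tx; rewrite mulr0 subr0 !IH ?subrr ?normr0 ?mulr_ge0 ?(ltW e0)//.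
rewrite opprD addrA; have := ler_normB (x - y) (t *: (basis_vec i : V)).
have := norm_line i t; lra.
Qed.

End Support.

Section Tensor.
Context {R : realType} {d : nat}.
Local Notation V := 'rV[R]_d.
Implicit Types (s : seq 'I_d) (g : 'I_d -> nat -> R -> R).

Definition tens (f : 'I_d -> R -> R) : V -> R := fun x => \prod_i f i (x 0 i).

Lemma count_consE (i j : 'I_d) s : count_mem j (i :: s) = ((i == j) + count_mem j s)%N.
Proof. by []. Qed.

Lemma sum_count s : (\sum_i count_mem i s)%N = size s.
Proof.
elim: s => [|j s IH]; first by rewrite big1.
under eq_bigr do rewrite count_consE.
rewrite big_split/= IH -add1n; congr (_ + _)%N.
by rewrite (bigD1 j)//= eqxx big1// => i /negPf; rewrite eq_sym => ->.
Qed.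

Lemma tens_dd (f : 'I_d -> R -> R) f' i x : (forall t, dd1 (f i) t (f' t)) ->
  dd (tens f) (basis_vec i) x (tens (fun j => if j == i then f' else f j) x).
Proof.
move=> Df e e0.
pose P := \prod_(j | j != i) f j (x 0 j).
pose k := e / (`|P| + 1); have P0 : 0 < `|P| + 1 by rewrite ltr_wpDl.
have [|dl dl0 Hd] := Df (x 0 i) k; first by rewrite divr_gt0.
exists dl => // t /Hd Ht.
have E1 : tens f (x + t *: basis_vec i) = f i (x 0 i + t) * P.
  rewrite /tens (bigD1 i)//=; congr (f i _ * _).
    by rewrite mxE [X in _ + X]mxE [X in _ * X]mxE !eqxx mulr1.
  apply: eq_bigr => j ji; rewrite mxE [X in _ + X]mxE [X in _ * X]mxE /= (negPf ji).
  by rewrite mulr0 addr0.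
have E2 : tens f x = f i (x 0 i) * P by rewrite /tens (bigD1 i).
have E3 : tens (fun j => if j == i then f' else f j) x = f' (x 0 i) * P.
  rewrite /tens (bigD1 i)//= eqxx; congr (_ * _).
  by apply: eq_bigr => j /negPf ->.
rewrite E1 E2 E3.
have -> : f i (x 0 i + t) * P - f i (x 0 i) * P - t * (f' (x 0 i) * P) =
  P * (f i (x 0 i + t) - f i (x 0 i) - t * f' (x 0 i)) by ring.
rewrite normrM; apply: le_trans (ler_wpM2l (normr_ge0 _) Ht) _.
rewrite mulrA ler_wpM2r// /k mulrCA ler_piMr ?(ltW e0)//.
by rewrite ler_pdivrMr// mul1r lerDl.
Qed.

Lemma tens_jet g : (forall i, tower (g i)) ->
  rsmooth (tens (fun i => g i 0%N)) /\
  forall s, rder s (tens (fun i => g i 0%N)) = tens (fun i => g i (count_mem i s)).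
Proof.
move=> tg; apply: (jetP (G := fun s => tens (fun i => g i (count_mem i s)))).
  by move=> s; apply: cont_prod => i; apply: cont_coord; exact: tower_cont.
move=> s i x; have := tens_dd (f := fun j => g j (count_mem j s)) x (tg i _).
suff -> : tens (fun j => g j (count_mem j (i :: s))) =
  tens (fun j => if j == i then g i (count_mem i s).+1 else g j (count_mem j s)) by [].
apply/funext => y; apply: eq_bigr => j _ /=; rewrite [i == j]eq_sym.
by case: eqVneq => [->|].
Qed.

Lemma tens_supp f w : (forall i t, t <= 0 \/ w <= t -> f i t = 0) ->
  0 <= w -> supp_in w (tens f).
Proof.
move=> H w0 x; rewrite ltNge => /negP K; apply/eqP/negPn/negP => /prodf_neq0 P.
apply: K; apply/normv_leP => // i.
have Pi := P i isT; rewrite leNgt; apply/negP => wx.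
move/eqP: Pi; apply; apply: H.
move: wx; case: (leP 0 (x 0 i)) => h; last by left; exact: ltW.
by rewrite ger0_norm// => /ltW; right.
Qed.

End Tensor.

Section UltraBounds.
Context {R : realType} {d : nat}.
Variables (M : nat -> R).
Hypothesis M_gt0 : forall p, 0 < M p.
Local Notation V := 'rV[R]_d.
Implicit Types (u v : V -> R) (s : seq 'I_d).

(** The norm of level [l] in relational form and over the whole space, which avoids suprema in the
    extended reals. Words of directions replace multi-indices; by symmetry of derivatives the
    conditions agree ([rder_rmderiv]). *)
Definition ub l u c : Prop :=
  forall s x, `|rder s u x| <= c * (l ^+ size s * M (size s)).

Lemma ub_ge0 l u c : ub l u c -> 0 <= c.
Proof.
move=> H; have := le_trans (normr_ge0 _) (H [::] 0).
by rewrite /= expr0 mul1r pmulr_lge0.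
Qed.

Lemma ub_mono_l l l' u c : 0 <= l -> l <= l' -> ub l u c -> ub l' u c.
Proof.
move=> l0 ll' H s x; apply: le_trans (H s x) _.
rewrite ler_wpM2l ?(ub_ge0 H)// ler_wpM2r ?(ltW (M_gt0 _))//.
by rewrite lerXn2r// nnegrE (le_trans l0).
Qed.

Lemma ub_mono_c l u c c' : 0 <= l -> c <= c' -> ub l u c -> ub l u c'.
Proof.
move=> l0 cc' H s x; apply: le_trans (H s x) _; rewrite ler_wpM2r//.
by rewrite mulr_ge0 ?exprn_ge0// ltW.
Qed.

Lemma ub_lin l c u v a b : rsmooth u -> rsmooth v -> ub l u a -> ub l v b ->
  ub l (fun x => c * u x + v x) (`|c| * a + b).
Proof.
move=> su sv Hu Hv s x; have [_ ->] := rsmooth_lin c su sv.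
apply: le_trans (ler_normD _ _) _; rewrite normrM mulrDl -mulrA.
by apply: lerD => //; rewrite ler_wpM2l.
Qed.

Lemma ub_scale l c u a : rsmooth u -> ub l u a -> ub l (fun x => c * u x) (`|c| * a).
Proof.
move=> su Hu s x; have [_ ->] := rsmooth_scale c su.
by rewrite normrM -mulrA ler_wpM2l.
Qed.

Lemma ub_shift l u h a : rsmooth u -> ub l u a -> ub l (fun x => u (x - h)) a.
Proof. by move=> su Hu s x; have [_ ->] := rsmooth_shift h su. Qed.

Variables (A H : R).
Hypothesis H_ge1 : 1 <= H.
Hypothesis A_gt0 : 0 < A.
Hypothesis M2 : forall p q, M (p + q)%N <= A * H ^+ (p + q) * M p * M q.

Let H0 : 0 < H. Proof. exact: lt_le_trans ltr01 H_ge1. Qed.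

Lemma M_succ p : M p.+1 <= (A * H * M 1%N) * (H ^+ p * M p).
Proof.
have := M2 p 1; rewrite addn1 exprS => /le_trans; apply.
rewrite le_eqVlt; apply/orP; left; apply/eqP; ring.
Qed.

Definition lipc l : R := d%:R * (l * (A * H * M 1%N)).

Lemma lipc_ge0 l : 0 <= l -> 0 <= lipc l.
Proof. by move=> l0; rewrite !mulr_ge0// ltW. Qed.

(** A Lipschitz bound for a derivative consumes one more derivative; (M.2) trades [M p.+1] for
    [H ^+ p * M p]. This is why the level rises from [l] to [l * H] whenever translates are
    compared. *)
Lemma rder_lip_ub l u c s : 0 <= l -> rsmooth u -> ub l u c -> forall x h,
  `|rder s u (x + h) - rder s u x| <= lipc l * c * `|h| * ((l * H) ^+ size s * M (size s)).
Proof.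
move=> l0 su Hu x h; have c0 := ub_ge0 Hu.
pose C := c * (l ^+ (size s).+1 * M (size s).+1).
have := rder_lip (C := C) su (fun i y => Hu (i :: s) y) x h.
move/le_trans; apply; rewrite [leRHS]mulrAC ler_wpM2r//.
rewrite /lipc -!mulrA ler_wpM2l// /C.
have := M_succ (size s); move=> HM.
apply: le_trans (_ : c * (l ^+ (size s).+1 * ((A * H * M 1%N) * (H ^+ size s * M (size s)))) <= _).
  by rewrite ler_wpM2l// ler_wpM2l// exprn_ge0.
rewrite le_eqVlt; apply/orP; left; apply/eqP.
rewrite exprMn exprS; ring.
Qed.

Lemma ub_shift_diff l u c h : 0 <= l -> rsmooth u -> ub l u c ->
  ub (l * H) (fun x => u (x - h) - u x) (lipc l * c * `|h|).
Proof.
move=> l0 su Hu s x.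
have [ss E] := rsmooth_shift h su; have [_ ->] := rsmoothB ss su.
by rewrite E -(normrN h); exact: rder_lip_ub.
Qed.

End UltraBounds.

Section Conv.
Context {R : realType} {d : nat}.
Local Notation V := 'rV[R]_d.
Implicit Types (G u v phi eta : V -> R) (s : seq 'I_d).

Definition conv G eta : V -> R := fun x => rintegral (fun y => G (x - y) * eta y).

Lemma cont_refl {W : normedModType R} (g : W -> R) x : continuous g -> continuous (fun y => g (x - y)).
Proof.
move=> cg y; apply/cont_ballP => e e0.
have /cont_ballP/(_ e e0)[dl dl0 Hd] := cg (x - y).
exists dl => // z yz; apply: Hd.
by rewrite opprB addrC addrA subrK distrC.
Qed.

Lemma conv_CC G eta x L : continuous G -> CC L eta -> CC L (fun y => G (x - y) * eta y).
Proof. by move=> cG Ce; apply: CC_mul => //; exact: cont_refl. Qed.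

Lemma CC_bounded L eta : 0 < L -> CC L eta -> exists2 C, 0 < C & forall x, `|eta x| <= C.
Proof.
move=> L0 [ce e0]; have cpt := @ball_compact R d L.
have : bounded_set (eta @` [set x | `|x| <= L]).
  apply: compact_bounded; apply: continuous_compact => //.
  exact: continuous_subspaceT.
move=> [B [_ HB]]; exists (`|B| + 1); first by rewrite ltr_wpDl.
move=> x; have [xL|xL] := leP `|x| L; last by rewrite e0// normr0 addr_ge0.
apply: (HB (`|B| + 1)); first by rewrite (le_lt_trans (ler_norm B))// ltrDl.
by exists x.
Qed.

Lemma conv_bound G eta L C E x : 0 < L -> continuous G -> CC L eta ->
  (forall y, `|G y| <= C) -> (forall y, `|eta y| <= E) ->
  `|conv G eta x| <= (2 * L) ^+ d * (C * E).
Proof.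
move=> L0 cG Ce HG HE; apply: rint_bound => //; first exact: conv_CC.
by move=> y; rewrite normrM ler_pM.
Qed.

Lemma conv_jet G eta L LG : 0 < L -> rsmooth G -> supp_in LG G -> CC L eta ->
  rsmooth (conv G eta) /\ forall s, rder s (conv G eta) = conv (rder s G) eta.
Proof.
move=> L0 sG G0 Ce; have [E E0 HE] := CC_bounded L0 Ce.
have V0 : 0 < (2 * L) ^+ d by rewrite exprn_gt0// mulr_gt0.
have K0 : 0 < (2 * L) ^+ d * E by rewrite mulr_gt0.
apply: (jetP (G := fun s => conv (rder s G) eta)) => [s|s i x].
  have Cs := rder_CC s sG G0; have cs := rsmooth_cont (s := s) sG.
  apply: cont_modulus => e e0.
  have [|dl dl0 Hd] := CC_unif Cs (e := e / ((2 * L) ^+ d * E)); first by rewrite divr_gt0.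
  exists dl => // x y xy; rewrite /conv -(rintB L0); [|exact: conv_CC..].
  apply: le_trans (@rint_bound R d L _ (e / (2 * L) ^+ d) L0 _ _) _.
  - have := CC_lin (-1) (conv_CC y cs Ce) (conv_CC x cs Ce).
    by under eq_fun do rewrite mulN1r addrC.
  - move=> z; rewrite -mulrBl normrM.
    apply: le_trans (_ : e / ((2 * L) ^+ d * E) * E <= _).
      apply: ler_pM => //; apply: Hd.
      by rewrite opprB addrA subrK.
    by rewrite invfM mulrA mulfVK// gt_eqF.
  - by rewrite mulrC mulfVK// gt_eqF.
have Ci := rder_CC (i :: s) sG G0.
have cs := rsmooth_cont (s := s) sG; have cis := rsmooth_cont (s := i :: s) sG.
move=> e e0; pose k := e / ((2 * L) ^+ d * E).
have k0 : 0 < k by rewrite divr_gt0.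
have [dl dl0 Hd] := CC_unif Ci k0.
exists dl => // t td; rewrite /conv.
have CB : CC L (fun y => rder s G (x + t *: basis_vec i - y) * eta y - rder s G (x - y) * eta y).
  have := CC_lin (-1) (conv_CC x cs Ce) (conv_CC (x + t *: basis_vec i) cs Ce).
  by under eq_fun do rewrite mulN1r addrC.
have CZ : CC L (fun y => t * (rder (i :: s) G (x - y) * eta y)).
  by apply: CC_mul; [exact: cont_cst|exact: conv_CC].
rewrite -(rintB L0); [|exact: conv_CC..].
rewrite -(rintZ _ L0 (conv_CC x cis Ce)) -(rintB L0)//.
apply: le_trans (@rint_bound R d L _ (k * E * `|t|) L0 _ _) _.
- have := CC_lin (-1) CZ CB.
  by under eq_fun do rewrite mulN1r addrC.
- move=> y.
  have D r := dd_line_all (x - y) (fun z => rsmooth_dd s i z sG) r.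
  have [c /andP[c1 c2]] := dd1_MVT D 0 t.
  rewrite subr0 scale0r addr0 => Ec.
  have -> : rder s G (x + t *: basis_vec i - y) * eta y - rder s G (x - y) * eta y -
    t * (rder (i :: s) G (x - y) * eta y) =
    (rder s G (x - y + t *: basis_vec i) - rder s G (x - y) - t * rder (i :: s) G (x - y)) * eta y.
    by rewrite [x + _ - y]addrAC; ring.
  rewrite Ec [t * _]mulrC -mulrBl !normrM mulrAC ler_wpM2r//.
  apply: ler_pM => //; apply: Hd.
  rewrite addrAC subrr add0r; apply: le_trans (norm_line _ _) _.
  apply: le_trans (ltW td).
  move: c1 c2; rewrite minElt maxElt; case: (ltP 0 t) => t0 c1 c2.
    by rewrite !ger0_norm//; lra.
  by rewrite !ler0_norm//; lra.
- rewrite le_eqVlt; apply/orP; left; apply/eqP; rewrite /k.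
  have V0' : (2 * L) ^+ d != 0 by rewrite gt_eqF.
  have E0' : E != 0 by rewrite gt_eqF.
  by move: ((2 * L) ^+ d) V0' => W W0; field; rewrite W0 E0'.
Qed.

Lemma conv_supp G eta L LG : supp_in LG G -> CC L eta -> supp_in (LG + L) (conv G eta).
Proof.
move=> G0 Ce x Lx; rewrite /conv; have -> : (fun y => G (x - y) * eta y) = fun=> 0.
  apply/funext => y; have [yL|yL] := leP `|y| L; last by rewrite Ce.2// mulr0.
  by rewrite G0 ?mul0r//; have := lerB_dist x y; lra.
exact: rint0.
Qed.

Lemma dd_mul u v i x a b : dd u (basis_vec i) x a -> dd v (basis_vec i) x b ->
  dd (fun y => u y * v y) (basis_vec i) x (a * v x + u x * b).
Proof.
move=> /ddP Hu /ddP Hv; apply/ddP.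
have := @is_deriveM R _ u v x (basis_vec i) a b Hu Hv.
by rewrite /GRing.scale/= addrC [v x * a]mulrC.
Qed.

Lemma conv_parts1 G phi i L LG x : 0 < L -> rsmooth G -> supp_in LG G -> rsmooth phi ->
  supp_in L phi -> conv G (rder [:: i] phi) x = conv (rder [:: i] G) phi x.
Proof.
move=> L0 sG G0 sp p0.
have Cp := rder_CC [::] sp p0; have Cpi := rder_CC [:: i] sp p0.
have cG := rsmooth_cont (s := [::]) sG; have cGi := rsmooth_cont (s := [:: i]) sG.
apply/eqP; rewrite -subr_eq0 /conv -(rintB L0); [|exact: conv_CC..].
apply/eqP; apply: (@rint_partial0 R d L i (fun y => G (x - y) * phi y)) => //.
- exact: conv_CC.
- have := CC_lin (-1) (conv_CC x cGi Cp) (conv_CC x cG Cpi).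
  by under eq_fun do rewrite mulN1r addrC.
- move=> y.
  have D1 : dd (fun y => G (x - y)) (basis_vec i) y (- rder [:: i] G (x - y)).
    move=> e e0; have [dl dl0 Hd] := rsmooth_dd [::] i (x - y) sG e0.
    exists dl => // t td; have := Hd (- t); rewrite normrN => /(_ td).
    by rewrite scaleNr opprD addrA mulNr mulrN !opprK.
  have := dd_mul D1 (rsmooth_dd [::] i y sp).
  by rewrite /= mulNr addrC.
Qed.

Lemma conv_parts G phi s L LG x : 0 < L -> rsmooth G -> supp_in LG G -> rsmooth phi ->
  supp_in L phi -> conv G (rder s phi) x = conv (rder s G) phi x.
Proof.
move=> L0 sG G0 sp p0; elim: s G sG G0 => [|i s IH] G sG G0 //.
rewrite -[rder (i :: s) phi]/(rder [:: i] (rder s phi)).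
rewrite (conv_parts1 _ _ L0 sG G0 (rsmooth_der s sp) (rder_supp s sp p0)).
rewrite IH; [|exact: rsmooth_der|exact: rder_supp].
rewrite -rder_cat (rder_perm sG (t := i :: s))//.
by rewrite perm_catC.
Qed.

End Conv.

Section ConvApprox.
Context {R : realType} {d : nat}.
Local Notation V := 'rV[R]_d.

Lemma conv_approx (f F : R -> R) (psi : V -> R) w L e x : 0 < L -> 0 <= w ->
  continuous f -> (forall t, dd1 F t (f t)) -> (forall t, t <= 0 \/ w <= t -> f t = 0) ->
  (forall t, 0 <= f t) -> (forall a b, a <= 0 -> w <= b -> F b - F a = 1) ->
  CC L psi -> (forall h, `|h| <= w -> `|psi (x - h) - psi x| <= e) -> 0 <= e ->
  `|conv (tens (fun=> f)) psi x - psi x| <= e.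
Proof.
move=> L0 w0 cf DF f0 fge F1 Cp Hp e0.
pose L1 := `|x| + w + L.
have xn := normr_ge0 x; have L10 : 0 < L1 by rewrite ltr_wpDl// addr_ge0.
have xi i := normv_coord x i.
pose P (y : V) := \prod_(i < d) f (x 0 i - y 0 i).
have [CP IP] : CC L1 P /\ rintegral P = 1.
  apply: (@rint_tens R d L1 (fun i t => f (x 0 i - t)) (fun i t => -1 * F (x 0 i - t))) => //.
  - move=> i t; have := dd1_scale (-1) (dd1_refl (DF (x 0 i - t))).
    by rewrite mulN1r opprK.
  - by move=> i; exact: cont_refl.
  - move=> i t Lt; apply: f0; have := xi i; rewrite ler_norml => /andP[h1 h2].
    move: Lt; rewrite /L1; case: (leP 0 t) => t0.
      by rewrite ger0_norm// => ?; left; lra.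
    by rewrite ltr0_norm// => ?; right; lra.
  - move=> i; have := xi i; rewrite ler_norml => /andP[h1 h2].
    have := F1 (x 0 i - L1) (x 0 i - - L1); rewrite /L1 => H; rewrite -[RHS]H; [ring|lra|lra].
have P0 y : 0 <= P y by apply: prodr_ge0 => i _; exact: fge.
have PE y : tens (fun=> f) (x - y) = P y.
  by apply: eq_bigr => i _; rewrite mxE [X in _ + X]mxE.
have Pw y : P y != 0 -> `|x - y| <= w.
  move=> /prodf_neq0 Py; apply/normv_leP => // i; rewrite mxE [X in _ + X]mxE.
  have fi := Py i isT; rewrite leNgt; apply/negP => H.
  move/eqP: fi; apply; apply: f0; case: (leP (x 0 i - y 0 i) 0) => h; first by left.
  by right; rewrite gtr0_norm// in H; exact: ltW.
have Cp1 : CC L1 psi by apply: CC_mono Cp; rewrite /L1; lra.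
have CPp : CC L1 (fun y => P y * psi y) by apply: CC_mul => //; exact: CP.1.
have Hb y : `|P y * (psi y - psi x)| <= e * P y.
  have [->|Py] := eqVneq (P y) 0; first by rewrite mul0r mulr0 normr0.
  rewrite normrM (ger0_norm (P0 y)) mulrC ler_wpM2r//.
  have xy : x - (x - y) = y by rewrite opprB addrC subrK.
  by have := Hp (x - y) (Pw y Py); rewrite xy.
have E : conv (tens (fun=> f)) psi x - psi x = rintegral (fun y => P y * (psi y - psi x)).
  have := rint_lin (- psi x) L10 CP CPp; rewrite IP mulr1 => H.
  have -> : (fun y => P y * (psi y - psi x)) = (fun y => - psi x * P y + P y * psi y).
    by apply/funext => y; ring.
  rewrite H addrC; congr (_ + _); congr rintegral.
  by apply/funext => y; rewrite PE.
have CD : CC L1 (fun y => P y * (psi y - psi x)).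
  have := CC_lin (- psi x) CP CPp.
  by congr (CC _ _); apply/funext => y; ring.
have I1 : rintegral (fun y => e * P y) = e by rewrite (rintZ _ L10 CP) IP mulr1.
have CeP : CC L1 (fun y => e * P y) by apply: CC_mul => //; exact: cont_cst.
(* The integrand is compared with [e * P], which has integral [e]; a plain sup bound would bring in
   a volume factor. *)
rewrite E ler_norml; apply/andP; split.
  have := rint_lin 1 L10 CD CeP; rewrite I1 mul1r => H.
  rewrite -subr_ge0 opprK -H; apply: (rint_ge0 L10); first exact: CC_lin.
  by move=> y; have := Hb y; rewrite ler_norml => /andP[]; lra.
have := rint_lin (-1) L10 CD CeP; rewrite I1 mulN1r addrC => H.
rewrite -subr_ge0 -H; apply: (rint_ge0 L10); first exact: CC_lin.
by move=> y; have := Hb y; rewrite ler_norml => /andP[]; lra.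
Qed.

End ConvApprox.

(** * Real functionals on translates, convolutions and mollifications *)

Section Functional.
Context {R : realType} {d : nat}.
Variables (M : nat -> R) (A H : R).
Hypothesis M_gt0 : forall p, 0 < M p.
Hypothesis H_ge1 : 1 <= H.
Hypothesis A_gt0 : 0 < A.
Hypothesis M2 : forall p q, M (p + q)%N <= A * H ^+ (p + q) * M p * M q.
Local Notation V := 'rV[R]_d.
Implicit Types (u v G phi eta : V -> R) (s : seq 'I_d).

Let H0 : 0 < H. Proof. exact: lt_le_trans ltr01 H_ge1. Qed.

Definition levels star u : Prop :=
  match star with
  | Beurling => forall l, 0 < l -> exists c, ub M l u c
  | Roumieu => exists2 l, 0 < l & exists c, ub M l u c
  end.

(** Real-valued test functions with unspecified compact support. The kernels are built in the
    Beurling class, which [tcls_weaken] places in the class of either case. *)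
Definition tcls star u : Prop :=
  [/\ rsmooth u, exists L, supp_in L u & levels star u].

Lemma tcls_weaken star u : tcls Beurling u -> tcls star u.
Proof.
case: star => // -[su Lu lu]; split=> //.
by exists 1 => //; exact: lu.
Qed.

Lemma tcls_lin star c u v : tcls star u -> tcls star v -> tcls star (fun x => c * u x + v x).
Proof.
move=> [su [Lu u0] lu] [sv [Lv v0] lv]; have [ss _] := rsmooth_lin c su sv.
split=> //.
  exists (Num.max Lu Lv); apply: supp_in_lin.
    by apply: supp_in_mono u0; rewrite le_max lexx.
  by apply: supp_in_mono v0; rewrite le_max lexx orbT.
case: star lu lv => /=.
  move=> lu lv l l0; have [a Ha] := lu l l0; have [b Hb] := lv l l0.
  by exists (`|c| * a + b); exact: ub_lin.
move=> [lu lu0 [a Ha]] [lv lv0 [b Hb]].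
exists (Num.max lu lv); first by rewrite lt_max lu0.
exists (`|c| * a + b); apply: ub_lin => //.
  by apply: (ub_mono_l M_gt0 (ltW lu0)) Ha; rewrite le_max lexx.
by apply: (ub_mono_l M_gt0 (ltW lv0)) Hb; rewrite le_max lexx orbT.
Qed.

Lemma tcls0 star : tcls star (fun=> 0).
Proof.
apply: tcls_weaken; have [s0 E] := @rsmooth0 R d; split=> //; first by exists 0.
by move=> l _; exists 0 => s x; rewrite E normr0 mul0r.
Qed.

Lemma tcls_scale star c u : tcls star u -> tcls star (fun x => c * u x).
Proof.
move=> Hu; have := tcls_lin c Hu (tcls0 star).
by under eq_fun do rewrite addr0.
Qed.

Lemma tcls_sub star u v : tcls star u -> tcls star v -> tcls star (fun x => u x - v x).
Proof.
move=> Hu Hv; have := tcls_lin (-1) Hv Hu.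
by under eq_fun do rewrite mulN1r addrC.
Qed.

Lemma tcls_sum star (I : Type) (r : seq I) (c : I -> R) (u : I -> V -> R) :
  (forall i, tcls star (u i)) -> tcls star (fun x => \sum_(i <- r) c i * u i x).
Proof.
move=> Hu; elim: r => [|i r IH].
  by under eq_fun do rewrite big_nil; exact: tcls0.
under eq_fun do rewrite big_cons; exact: tcls_lin.
Qed.

Lemma tcls_shift star u h : tcls star u -> tcls star (fun x => u (x - h)).
Proof.
move=> [su [L u0] lu]; have [ss _] := rsmooth_shift h su; split=> //.
  by exists (L + `|h|); exact: supp_in_shift.
case: star lu => /= [lu l l0|[l l0 [c Hc]]].
  by have [c Hc] := lu l l0; exists c; exact: ub_shift.
by exists l => //; exists c; exact: ub_shift.
Qed.

Lemma ub_conv l G eta c L LG E : 0 < L -> rsmooth G -> supp_in LG G -> CC L eta ->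
  (forall x, `|eta x| <= E) -> ub M l G c -> ub M l (conv G eta) ((2 * L) ^+ d * E * c).
Proof.
move=> L0 sG G0 Ce HE HG s x; have [_ ->] := conv_jet L0 sG G0 Ce.
apply: le_trans (conv_bound x L0 (rsmooth_cont (s := s) sG) Ce (HG s) HE) _.
by rewrite le_eqVlt; apply/orP; left; apply/eqP; ring.
Qed.

Lemma tcls_conv G eta L : 0 < L -> tcls Beurling G -> CC L eta -> tcls Beurling (conv G eta).
Proof.
move=> L0 [sG [LG G0] lG] Ce; have [ss _] := conv_jet L0 sG G0 Ce; split=> //.
  by exists (LG + L); exact: conv_supp.
have [E _ HE] := CC_bounded L0 Ce.
move=> l l0; have [c Hc] := lG l l0.
by exists ((2 * L) ^+ d * E * c); exact: (ub_conv L0 sG G0 Ce HE Hc).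
Qed.

Variable star : ultra_case.
Variable Lf : (V -> R) -> R.

Definition Lbound Lb l K : Prop := 0 <= K /\
  forall u c, tcls star u -> supp_in Lb u -> ub M l u c -> `|Lf u| <= K * c.

(** Continuity on the limit spaces in terms of norms: over each ball, one norm controls the
    functional in the Beurling case and every norm does in the Roumieu case. *)
Definition Lcont : Prop := forall Lb,
  match star with
  | Beurling => exists2 l, 0 < l & exists K, Lbound Lb l K
  | Roumieu => forall l, 0 < l -> exists K, Lbound Lb l K
  end.

Definition Llin : Prop := forall c u v, tcls star u -> tcls star v ->
  Lf (fun x => c * u x + v x) = c * Lf u + Lf v.

Hypothesis hlin : Llin.
Hypothesis hcont : Lcont.

Lemma Lcont_weak Lb : exists2 l, 0 < l & exists K, Lbound Lb l K.
Proof.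
have := hcont Lb; case: star => //= Hc.
by exists 1 => //; exact: Hc.
Qed.

Lemma Lf_sub u v : tcls star u -> tcls star v -> Lf (fun x => u x - v x) = Lf u - Lf v.
Proof.
move=> Hu Hv; rewrite addrC -mulN1r -(hlin (-1) Hv Hu).
by congr Lf; apply/funext => x; rewrite mulN1r addrC.
Qed.

Lemma Lf0 : Lf (fun=> 0) = 0.
Proof.
have := Lf_sub (tcls0 star) (tcls0 star); rewrite [RHS]subrr.
by under eq_fun do rewrite subrr.
Qed.

Lemma Lf_sum (I : Type) (r : seq I) (c : I -> R) (u : I -> V -> R) :
  (forall i, tcls star (u i)) ->
  Lf (fun x => \sum_(i <- r) c i * u i x) = \sum_(i <- r) c i * Lf (u i).
Proof.
move=> Hu; elim: r => [|i r IH].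
  by under eq_fun do rewrite big_nil; rewrite big_nil Lf0.
under eq_fun do rewrite big_cons; rewrite big_cons -IH; apply: hlin => //.
exact: tcls_sum.
Qed.

Lemma Ltrans_cont G : tcls Beurling G -> continuous (fun y : V => Lf (fun x => G (x - y))).
Proof.
move=> HG; have [sG [LG G0] lG] := HG; move=> y; apply/cont_ballP => e e0.
have [l l0 [K [K0 HK]]] := Lcont_weak (LG + `|y| + 1).
(* Differences of translates are controlled a factor [H] above the level at which [G] is measured,
   so [G] is taken at level [l / H]. *)
have lH : 0 < l / H by rewrite divr_gt0.
have [c Hc] := lG _ lH; have c0 := ub_ge0 M_gt0 Hc.
set B := lipc (d := d) M A H (l / H).
have B0 : 0 <= B by apply: lipc_ge0 => //; exact: ltW.
pose C := K * (B * c) + 1.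
have C0 : 0 < C by rewrite ltr_wpDl// mulr_ge0// mulr_ge0.
exists (Num.min 1 (e / C)); first by rewrite lt_min ltr01 divr_gt0.
move=> z; rewrite lt_min => /andP[yz1 yze].
have [sy _] := rsmooth_shift y sG.
have HGs t := tcls_weaken star (tcls_shift t HG).
have -> : Lf (fun x => G (x - y)) - Lf (fun x => G (x - z)) =
   - Lf (fun x => G (x - z) - G (x - y)) by rewrite (Lf_sub (HGs z) (HGs y)) opprB.
rewrite normrN.
have E : (fun x => G (x - z) - G (x - y)) = (fun x => G (x - (z - y) - y) - G (x - y)).
  apply/funext => x; have -> // : x - (z - y) - y = x - z.
  by rewrite opprB addrA addrAC addrK.
rewrite E.
apply: le_trans (HK _ (B * c * `|z - y|) _ _ _) _.
- by rewrite -E; apply: tcls_sub; exact: HGs.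
- rewrite -E => x Lx.
  have z1 : `|z| <= `|y| + 1.
    have := ler_normD y (z - y); rewrite addrC subrK distrC; lra.
  have xz := lerB_dist x z; have xy := lerB_dist x y.
  by rewrite !G0 ?subrr//; lra.
- have := ub_shift_diff M_gt0 M2 (z - y) (ltW lH) sy (ub_shift y sG Hc).
  by rewrite mulfVK// gt_eqF.
rewrite mulrA; apply: le_trans (_ : C * `|z - y| <= _).
  by rewrite ler_wpM2r// lerDl.
by rewrite mulrC -ler_pdivlMr// distrC ltW.
Qed.

(** No vector-valued integral is needed. The finite sums [S] of translates of [G] approximate the
    convolution in the norm that controls [Lf], while [Lf S] is the quadrature, over the same nodes,
    of the integral on the right. *)
Lemma Lf_conv G eta L : 0 < L -> tcls Beurling G -> CC L eta ->
  Lf (conv G eta) = rintegral (fun y : V => Lf (fun x => G (x - y)) * eta y).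
Proof.
move=> L0 HG Ce; have [sG [LG G0] lG] := HG.
pose F (y : V) := Lf (fun x => G (x - y)).
have CF : CC L (fun y => F y * eta y) by apply: CC_mul => //; exact: Ltrans_cont.
have [E E0 HE] := CC_bounded L0 Ce.
have [l l0 [K [K0 HK]]] := Lcont_weak (LG + L).
have lH : 0 < l / H by rewrite divr_gt0.
have [c Hc] := lG _ lH; have c0 := ub_ge0 M_gt0 Hc.
have cG s : continuous (rder s G) := rsmooth_cont sG.
have V0 : 0 < (2 * L) ^+ d by rewrite exprn_gt0// mulr_gt0.
apply: eq_of_eps => e e0.
set B := lipc (d := d) M A H (l / H).
have B0 : 0 <= B by apply: lipc_ge0 => //; exact: ltW.
(* [k] bounds the oscillation of all integrands over the mesh. *)
pose W := (d%:R + 1) * (2 * L) ^+ d * (K + 1) * 2.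
have W0 : 0 < W by rewrite !mulr_gt0// ltr_wpDl.
pose k := e / W; have k0 : 0 < k by rewrite divr_gt0.
have k2 : 0 < k / (2 * (c + 1)) by rewrite divr_gt0// mulr_gt0// ltr_wpDl.
have [d1 d10 Hd1] := CC_unif Ce k2.
have k3 : 0 < e / (2 * ((d%:R + 1) * (2 * L) ^+ d)).
  by rewrite divr_gt0// !mulr_gt0// ltr_wpDl.
have [d2 d20 Hd2] := CC_unif CF k3.
pose d3 := k / (2 * (B * c * E + 1)).
have BcE : 0 <= B * c * E by apply: mulr_ge0; [exact: mulr_ge0|exact: ltW].
have d30 : 0 < d3 by rewrite divr_gt0// mulr_gt0// ltr_wpDl.
pose dl := Num.min d1 (Num.min d2 d3).
have dl0 : 0 < dl by rewrite !lt_min d10 d20 d30.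
have [q gq Hq] := @quad_exists R d L L0 dl dl0.
pose S (x : V) := \sum_(p <- q) (p.1 * eta p.2) * G (x - p.2).
have HGs t := tcls_weaken star (tcls_shift t HG).
have HS : tcls star S by apply: tcls_sum => p; exact: HGs.
have Hcv : tcls star (conv G eta) := tcls_weaken star (tcls_conv L0 HG Ce).
have LS : Lf S = quad q (fun y => F y * eta y).
  rewrite /S Lf_sum; last by move=> p; exact: HGs.
  by apply: eq_bigr => p _; rewrite -mulrA [eta _ * _]mulrC.
have A1 : `|rintegral (fun y => F y * eta y) - Lf S| <= e / 2.
  rewrite LS; apply: le_trans (Hq _ (e / (2 * ((d%:R + 1) * (2 * L) ^+ d))) CF _ _) _.
  - by rewrite ltW// divr_gt0// !mulr_gt0// ltr_wpDl.
  - by move=> x y xy; apply: Hd2; apply: le_trans xy _; rewrite /dl !ge_min lexx orbT.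
  have D0 : 0 <= d%:R :> R by [].
  move: (d%:R) D0 ((2 * L) ^+ d) V0 => n n0 m m0.
  have -> : e / 2 = (n + 1) * (e / (2 * ((n + 1) * m))) * m.
    by field; rewrite !gt_eqF// ltr_wpDl.
  rewrite ler_pM2r// ler_wpM2r// ?lerDl//.
  by rewrite ltW// divr_gt0// !mulr_gt0// ltr_wpDl.
have A2 : `|Lf (conv G eta) - Lf S| <= e / 2.
  rewrite -(Lf_sub Hcv HS).
  apply: le_trans (HK _ (d%:R * k * (2 * L) ^+ d) _ _ _) _.
  - exact: tcls_sub.
  - move=> x Lx; rewrite (conv_supp G0 Ce Lx) sub0r; apply/eqP; rewrite oppr_eq0; apply/eqP.
    rewrite /S big_seq big1// => p pq; rewrite G0 ?mulr0//.
    by case: gq => _ _ /(_ p pq); have := lerB_dist x p.2; lra.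
  - move=> s x.
    have [sS ES] := rsmooth_sum q (fun p => p.1 * eta p.2) (fun p => (rsmooth_shift p.2 sG).1).
    have [sC EC] := conv_jet L0 sG G0 Ce.
    have [_ ->] := rsmoothB sC sS.
    rewrite ES EC /conv.
    have -> : \sum_(p <- q) p.1 * eta p.2 * rder s (fun x => G (x - p.2)) x =
       quad q (fun y => rder s G (x - y) * eta y).
      apply: eq_bigr => p _; have [_ ->] := rsmooth_shift p.2 sG.
      by rewrite -mulrA [eta _ * _]mulrC.
    set m := l ^+ size s * M (size s).
    have m0 : 0 < m by rewrite mulr_gt0// exprn_gt0.
    apply: le_trans (Hq _ (k * m) (conv_CC x (cG s) Ce) _ _) _.
    + by rewrite mulr_ge0// ltW.
    + move=> y z yz.
      have -> : rder s G (x - y) * eta y - rder s G (x - z) * eta z =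
        (rder s G (x - y) - rder s G (x - z)) * eta y + rder s G (x - z) * (eta y - eta z) by ring.
      apply: le_trans (ler_normD _ _) _; rewrite !normrM.
      have P1 : `|rder s G (x - y) - rder s G (x - z)| <= B * c * `|y - z| * m.
        have := rder_lip_ub M_gt0 M2 s (ltW lH) sG Hc (x - z) (z - y).
        rewrite mulfVK ?gt_eqF// addrA subrK -/m => H1.
        by rewrite [X in X <= _]distrC [X in _ * X * m]distrC in H1 *; rewrite distrC.
      have P2 : `|rder s G (x - z)| <= c * m.
        apply: le_trans (Hc s _) _; rewrite ler_wpM2l// ler_wpM2r ?(ltW (M_gt0 _))//.
        rewrite lerXn2r ?nnegrE ?(ltW lH) ?(ltW l0)//.
        by rewrite ler_pdivrMr// ler_peMr// ltW.
      have yz3 : `|y - z| <= d3 by apply: le_trans yz _; rewrite /dl !ge_min lexx !orbT.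
      have P3 : `|eta y - eta z| <= k / (2 * (c + 1)).
        by apply: Hd1; apply: le_trans yz _; rewrite /dl !ge_min lexx.
      have P4 : `|rder s G (x - y) - rder s G (x - z)| * `|eta y| <= k / 2 * m.
        apply: le_trans (_ : (B * c * d3 * m) * E <= _).
          apply: ler_pM => //; apply: le_trans P1 _.
          by rewrite ler_wpM2r ?(ltW m0)// ler_wpM2l// mulr_ge0.
        have -> : B * c * d3 * m * E = (B * c * E) * d3 * m by ring.
        rewrite ler_pM2r// /d3.
        move: (B * c * E) BcE => b b0.
        have -> : b * (k / (2 * (b + 1))) = k / 2 * (b / (b + 1)).
          by field; rewrite gt_eqF// ltr_wpDl.
        apply: ler_piMr; first by rewrite divr_ge0// ltW.
        by rewrite ler_pdivrMr ?ltr_wpDl// mul1r lerDl.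
      have P5 : `|rder s G (x - z)| * `|eta y - eta z| <= k / 2 * m.
        apply: le_trans (_ : c * m * (k / (2 * (c + 1))) <= _); first exact: ler_pM.
        have -> : c * m * (k / (2 * (c + 1))) = k / 2 * m * (c / (c + 1)).
          by field; rewrite gt_eqF// ltr_wpDl.
        apply: ler_piMr; first by apply: mulr_ge0; [rewrite divr_ge0// ltW|exact: ltW].
        by rewrite ler_pdivrMr ?ltr_wpDl// mul1r lerDl.
      by lra.
    + by rewrite le_eqVlt; apply/orP; left; apply/eqP; ring.
  have D0 : 0 <= d%:R :> R by [].
  rewrite /k /W; move: (d%:R) D0 ((2 * L) ^+ d) V0 => n n0 m m0.
  have -> : K * (n * (e / ((n + 1) * m * (K + 1) * 2)) * m) =
    e / 2 * ((n / (n + 1)) * (K / (K + 1))).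
    by field; rewrite !gt_eqF// ltr_wpDl.
  apply: ler_piMr; first by rewrite divr_ge0// ltW.
  apply: mulr_ile1; rewrite ?divr_ge0 ?addr_ge0//.
    by rewrite ler_pdivrMr ?ltr_wpDl// mul1r lerDl.
  by rewrite ler_pdivrMr ?ltr_wpDl// mul1r lerDl.
rewrite -(subrKA (Lf S)); apply: le_trans (ler_normD _ _) _.
rewrite [X in _ + X]distrC; lra.
Qed.

Lemma Lf_moll phi : tcls star phi -> exists2 K, 0 <= K &
  forall (g : nat -> R -> R) (F : R -> R) w, tower g -> 0 <= w -> w <= 1 ->
    (forall t, dd1 F t (g 0%N t)) -> (forall t, t <= 0 \/ w <= t -> g 0%N t = 0) ->
    (forall t, 0 <= g 0%N t) -> (forall a b, a <= 0 -> w <= b -> F b - F a = 1) ->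
    tcls Beurling (tens (fun=> g 0%N) : V -> R) ->
    `|Lf (conv (tens (fun=> g 0%N)) phi) - Lf phi| <= K * w.
Proof.
move=> Hp; have [sp [L p0] lp] := Hp.
pose L1 := `|L| + 1; have L10 : 0 < L1 by rewrite ltr_wpDl.
have p1 : supp_in L1 phi.
  by apply: supp_in_mono p0; apply: le_trans (ler_norm L) _; rewrite lerDl.
(* The functional must be bounded a factor [H] above a level of [phi]. In the Beurling case its
   level is prescribed and [phi] has all levels; in the Roumieu case the level of [phi] is
   prescribed and the functional is bounded at every level. *)
have [l l0 [c [Hc [K [K0 HK]]]]] : exists2 l, 0 < l & exists c,
    ub M l phi c /\ exists K, Lbound (1 + L1) (l * H) K.
  move: lp (hcont (1 + L1)); rewrite /Lbound; case: star => /=.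
    move=> lp [l l0 HK]; have lH : 0 < l / H by rewrite divr_gt0.
    exists (l / H) => //; have [c Hc] := lp _ lH; exists c; split=> //.
    by rewrite mulfVK// gt_eqF.
  move=> [l l0 [c Hc]] HK; exists l => //; exists c; split=> //.
  by apply: HK; rewrite mulr_gt0.
have c0 := ub_ge0 M_gt0 Hc.
set B := lipc (d := d) M A H l.
have B0 : 0 <= B by apply: lipc_ge0 => //; exact: ltW.
exists (K * (B * c)); first by apply: mulr_ge0 => //; exact: mulr_ge0.
move=> g F w tg w0 w1 DF g0 gge F1 Hg; have [sg [Lg g0'] lg] := Hg.
have Cp := rder_CC [::] sp p1.
have Hcv := tcls_weaken star (tcls_conv L10 Hg Cp).
rewrite -(Lf_sub Hcv Hp) -[X in _ <= X]mulrA; apply: HK.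
- exact: tcls_sub.
- move=> x Lx; rewrite p1 ?subr0; last by apply: le_lt_trans Lx; rewrite lerDr.
  have gw : supp_in 1 (tens (fun=> g 0%N) : V -> R).
    by apply: (supp_in_mono w1); apply: tens_supp => // _; exact: g0.
  exact: (conv_supp gw Cp).
move=> s x; have [sC EC] := conv_jet L10 sg g0' Cp.
have [_ ->] := rsmoothB sC sp; rewrite EC.
(* With the derivatives moved from the mollifier to [phi], the estimate depends on the mollifier
   only through its width. *)
rewrite -(conv_parts s x L10 sg g0' sp p1).
have lM0 : 0 <= (l * H) ^+ size s * M (size s).
  by apply: mulr_ge0; [apply: exprn_ge0; apply: mulr_ge0; exact: ltW|exact: ltW].
apply: (conv_approx L10 w0 (tower_cont (k := 0) tg) DF g0 gge F1 (rder_CC s sp p1)).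
- move=> h hw; apply: le_trans (rder_lip_ub M_gt0 M2 s (ltW l0) sp Hc x (- h)) _.
  apply: ler_wpM2r; first exact: lM0.
  by rewrite normrN; apply: ler_wpM2l => //; exact: mulr_ge0.
by apply: mulr_ge0; [apply: mulr_ge0 => //; exact: mulr_ge0|exact: lM0].
Qed.

End Functional.

(** * Uniform boundedness *)

Section JetLimit.
Context {R : realType} {d : nat}.
Local Notation V := 'rV[R]_d.
Variables (S : nat -> V -> R) (e : seq 'I_d -> nat -> R).
Hypothesis S_smooth : forall n, rsmooth (S n).
Hypothesis e_cvg : forall s, e s @ \oo --> 0.
Hypothesis S_cauchy : forall s n j x, `|rder s (S (n + j)%N) x - rder s (S n) x| <= e s n.

Definition jlim s (x : V) := limn (fun n => rder s (S n) x).

Lemma jlim_rate s n x : `|jlim s x - rder s (S n) x| <= e s n.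
Proof.
have [|_] := @cauchy_rate R (fun n => rder s (S n) x) (e s) _ (e_cvg s); last by apply.
by move=> k j; exact: S_cauchy.
Qed.

Lemma e_small s eps : 0 < eps -> exists n, e s n < eps.
Proof.
move=> eps0; have /cvgrPdist_lt/(_ _ eps0)[N _ HN] := e_cvg s.
exists N; have := HN N (leqnn N); rewrite sub0r normrN.
by apply: le_lt_trans; exact: ler_norm.
Qed.

Lemma jlim_cont s : continuous (jlim s).
Proof.
move=> x; apply/cont_ballP => eps eps0; have e4 : 0 < eps / 4 by rewrite divr_gt0.
have [n Hn] := e_small s e4.
have /cont_ballP/(_ _ e4)[dl dl0 Hd] := @rsmooth_cont R d (S n) s (S_smooth n) x.
exists dl => // y xy; have := Hd y xy; have := jlim_rate s n x; have := jlim_rate s n y.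
rewrite distrC => h1 h2 h3.
have -> : jlim s x - jlim s y = (jlim s x - rder s (S n) x) +
  (rder s (S n) x - rder s (S n) y) + (rder s (S n) y - jlim s y) by ring.
apply: le_trans (ler_normD _ _) _; apply: le_trans (lerD (ler_normD _ _) (lexx _)) _; lra.
Qed.

Lemma e_small_ge s eps k : 0 < eps -> exists2 n, (k <= n)%N & e s n < eps.
Proof.
move=> eps0; have /cvgrPdist_lt/(_ _ eps0)[N _ HN] := e_cvg s.
exists (k + N)%N; first exact: leq_addr.
have := HN (k + N)%N (leq_addl _ _); rewrite sub0r normrN.
by apply: le_lt_trans; exact: ler_norm.
Qed.

Lemma jlim_dd s i x : dd (jlim s) (basis_vec i) x (jlim (i :: s) x).
Proof.
move=> eps eps0; have e4 : 0 < eps / 4 by rewrite divr_gt0.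
have [n Hn] := e_small (i :: s) e4.
have [dl dl0 Hd] := rsmooth_dd s i x (S_smooth n) e4.
exists dl => // t td; have H1 := Hd t td; have H2 := jlim_rate (i :: s) n x.
(* The error must be of order [|t|], which uniform convergence of the functions alone does not give;
   the mean value bound for [S m - S n] uses convergence of the next derivative. *)
have H3 : `|(jlim s (x + t *: basis_vec i) - rder s (S n) (x + t *: basis_vec i)) -
            (jlim s x - rder s (S n) x)| <= eps / 4 * `|t|.
  have K m : (n <= m)%N -> `|(rder s (S m) (x + t *: basis_vec i) - rder s (S n) (x + t *: basis_vec i)) -
            (rder s (S m) x - rder s (S n) x)| <= eps / 4 * `|t|.
    move=> nm; have [sd Ed] := rsmoothB (S_smooth m) (S_smooth n).
    have D := dd_line_all x (fun z => rsmooth_dd s i z sd).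
    have := dd1_bound (C := eps / 4) D _ 0 t.
    rewrite !scale0r !addr0 subr0 !Ed; apply=> r.
    by apply: le_trans (ltW Hn); rewrite -(subnKC nm).
  apply: le_of_eps => z z0; have z2 : 0 < z / 2 by rewrite divr_gt0.
  have [m nm Hm] := e_small_ge s n z2.
  have K1 := jlim_rate s m (x + t *: basis_vec i); have K2 := jlim_rate s m x.
  have K3 := K m nm.
  set a := jlim s (x + _) in K1 *; set b := jlim s x in K2 *.
  set a1 := rder s (S m) (x + _) in K1 K3 *; set b1 := rder s (S m) x in K2 K3 *.
  have -> : a - rder s (S n) (x + t *: basis_vec i) - (b - rder s (S n) x) =
     (a - a1) - (b - b1) + (a1 - rder s (S n) (x + t *: basis_vec i) - (b1 - rder s (S n) x)) by ring.
  apply: le_trans (ler_normD _ _) _; apply: le_trans (lerD (ler_normB _ _) (lexx _)) _; lra.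
have t0 := normr_ge0 t.
have H4 : `|t * (rder (i :: s) (S n) x - jlim (i :: s) x)| <= eps / 4 * `|t|.
  by rewrite normrM mulrC ler_wpM2r// distrC (le_trans H2)// ltW.
set a := jlim s (x + _) in H3 *; set a1 := rder s (S n) (x + _) in H1 H3 *.
have -> : a - jlim s x - t * jlim (i :: s) x =
   (a - a1 - (jlim s x - rder s (S n) x)) + (a1 - rder s (S n) x - t * rder (i :: s) (S n) x)
   + t * (rder (i :: s) (S n) x - jlim (i :: s) x) by ring.
apply: le_trans (ler_normD _ _) _; apply: le_trans (lerD (ler_normD _ _) (lexx _)) _.
have : 0 <= eps * `|t| by rewrite mulr_ge0// ltW.
lra.
Qed.

Lemma jlim_smooth : rsmooth (jlim [::]) /\ forall s, rder s (jlim [::]) = jlim s.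
Proof. by apply: (jetP (G := jlim)); [exact: jlim_cont|exact: jlim_dd]. Qed.

End JetLimit.

Section BanachSteinhaus.
Context {R : realType} {d : nat}.
Variables (M : nat -> R).
Hypothesis M_gt0 : forall p, 0 < M p.
Local Notation V := 'rV[R]_d.
Variable lam : nat -> R.
Hypothesis lam_gt0 : forall k, 0 < lam k.
Hypothesis lam_mono : forall k j, lam (k + j)%N <= lam k.
Variable L : R.

(** A complete space covering both cases: levels [lam k] tending to 0 give the Fréchet space of the
    Beurling case over a ball, a constant [lam] gives the Banach space of a single level. *)
Definition vcls (u : V -> R) : Prop :=
  [/\ rsmooth u, supp_in L u & forall k, exists c, ub M (lam k) u c].

Lemma vcls_lin c u v : vcls u -> vcls v -> vcls (fun x => c * u x + v x).
Proof.
move=> [su u0 lu] [sv v0 lv]; split.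
- exact: (rsmooth_lin c su sv).1.
- exact: supp_in_lin.
move=> k; have [a Ha] := lu k; have [b Hb] := lv k.
by exists (`|c| * a + b); exact: ub_lin.
Qed.

Lemma vcls0 : vcls (fun=> 0).
Proof.
have [s0 E] := @rsmooth0 R d; split=> // k; exists 0 => s x.
by rewrite E normr0 mul0r.
Qed.

Lemma vclsD u v : vcls u -> vcls v -> vcls (fun x => u x + v x).
Proof.
move=> Hu Hv; have := vcls_lin 1 Hu Hv.
by under eq_fun do rewrite mul1r.
Qed.

Lemma vclsB u v : vcls u -> vcls v -> vcls (fun x => u x - v x).
Proof.
move=> Hu Hv; have := vcls_lin (-1) Hv Hu.
by under eq_fun do rewrite mulN1r addrC.
Qed.

Lemma vcls_scale c u : vcls u -> vcls (fun x => c * u x).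
Proof.
move=> Hu; have := vcls_lin c Hu vcls0.
by under eq_fun do rewrite addr0.
Qed.

Fixpoint psum (u : nat -> V -> R) n : V -> R :=
  if n is n'.+1 then fun x => psum u n' x + u n' x else fun=> 0.

Lemma psumS u n : psum u n.+1 = fun x => psum u n x + u n x.
Proof. by []. Qed.

Lemma psum_vcls u n : (forall i, vcls (u i)) -> vcls (psum u n).
Proof.
by move=> Hu; elim: n => [|n IH]; [exact: vcls0|exact: vclsD].
Qed.

Lemma ub_lam k j (u : V -> R) c : ub M (lam (k + j)%N) u c -> ub M (lam k) u c.
Proof. by apply: ub_mono_l => //; exact: ltW. Qed.

Lemma vcls_complete (u : nat -> V -> R) : (forall i, vcls (u i)) ->
  (forall i, ub M (lam i) (u i) (2^-1 ^+ i)) ->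
  exists2 w, vcls w & forall m, ub M (lam m) (fun x => w x - psum u m x) (2 * 2^-1 ^+ m).
Proof.
move=> Hu Hb.
have sP n : rsmooth (psum u n) by have [] := psum_vcls n Hu.
have PS n s x : rder s (psum u n.+1) x = rder s (psum u n) x + rder s (u n) x.
  have su : rsmooth (u n) by have [] := Hu n.
  have [_ /(_ s) E] := rsmooth_lin 1 su (sP n).
  have -> : psum u n.+1 = (fun x => 1 * u n x + psum u n x).
    by apply/funext => y; rewrite mul1r addrC.
  by rewrite E mul1r addrC.
pose e (s : seq 'I_d) n := 2 * 2^-1 ^+ n * (lam n ^+ size s * M (size s)).
have B s n j x : `|rder s (psum u (n + j)%N) x - rder s (psum u n) x| <=
    2 * (2^-1 ^+ n - 2^-1 ^+ (n + j)%N) * (lam n ^+ size s * M (size s)).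
  elim: j => [|j IH]; first by rewrite addn0 !subrr normr0 mulr0 mul0r.
  rewrite addnS PS.
  have -> : rder s (psum u (n + j)) x + rder s (u (n + j)%N) x - rder s (psum u n) x =
    (rder s (psum u (n + j)) x - rder s (psum u n) x) + rder s (u (n + j)%N) x by ring.
  apply: le_trans (ler_normD _ _) _.
  have := ub_lam (Hb (n + j)%N) s x => H.
  apply: le_trans (lerD IH H) _.
  rewrite -mulrDl exprS; apply: ler_wpM2r.
    by apply: mulr_ge0; [apply: exprn_ge0; exact: ltW|exact: ltW].
  by move: (2^-1 ^+ n) (2^-1 ^+ (n + j)) => a b; lra.
have SC s n j x : `|rder s (psum u (n + j)%N) x - rder s (psum u n) x| <= e s n.
  apply: le_trans (B s n j x) _; apply: ler_wpM2r.
    by apply: mulr_ge0; [apply: exprn_ge0; exact: ltW|exact: ltW].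
  by apply: ler_wpM2l => //; rewrite gerBl exprn_ge0// invr_ge0.
have half_cvg : (fun n : nat => (2^-1 : R) ^+ n) @ \oo --> 0.
  by apply: cvg_expr; rewrite ger0_norm ?invf_lt1 ?invr_ge0// ltr1n.
have EC s : e s @ \oo --> 0.
  have B0 : (fun n => 2 * (2^-1 ^+ n) * (lam 0 ^+ size s * M (size s))) @ \oo --> (0 : R).
    have <- : 2 * 0 * (lam 0 ^+ size s * M (size s)) = 0 by rewrite mulr0 mul0r.
    by apply: cvgMr_tmp; exact: cvgMl_tmp.
  apply: (squeeze_cvgr _ (cvg_cst (0:R)) B0); apply: nearW => n.
  have l0 := lam_mono 0 n; rewrite add0n in l0.
  have h0 : 0 <= (2^-1 : R) ^+ n by rewrite exprn_ge0// invr_ge0.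
  apply/andP; split.
    by rewrite /e !mulr_ge0// ?exprn_ge0 ?(ltW (lam_gt0 _)) ?(ltW (M_gt0 _)).
  apply: ler_wpM2l; first by rewrite mulr_ge0.
  apply: ler_wpM2r; first exact: ltW.
  by rewrite lerXn2r// nnegrE ltW.
have [sw Ew] := jlim_smooth sP EC SC.
have JR s n x := jlim_rate EC SC s n x.
have bw m : ub M (lam m) (fun x => jlim (psum u) [::] x - psum u m x) (2 * 2^-1 ^+ m).
  by move=> s x; have [_ ->] := rsmoothB sw (sP m); rewrite Ew; exact: JR.
exists (jlim (psum u) [::]) => //; split=> //.
  move=> x Lx; apply: eq_of_eps => eps eps0; rewrite subr0.
  have [n Hn] := e_small EC [::] eps0.
  have := JR [::] n x; have [_ P0 _] := psum_vcls n Hu.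
  by rewrite /= P0// subr0 => /le_trans; apply; exact: ltW.
move=> k; have [_ _ /(_ k)[c Hc]] := psum_vcls k Hu.
exists (2 * 2^-1 ^+ k + `|1| * c).
have [sd _] := rsmoothB sw (sP k).
have := ub_lin 1 (sP k) sd Hc (bw k).
have -> : (fun x => 1 * psum u k x + (jlim (psum u) [::] x - psum u k x)) = jlim (psum u) [::].
  by apply/funext => x; ring.
by rewrite addrC.
Qed.

Variables (I : Type) (T : I -> (V -> R) -> R).
Hypothesis T_lin : forall h c u v, vcls u -> vcls v ->
  T h (fun x => c * u x + v x) = c * T h u + T h v.
Hypothesis T_cont : forall h, exists kK : nat * R, 0 <= kK.2 /\
  forall u c, vcls u -> ub M (lam kK.1) u c -> `|T h u| <= kK.2 * c.
Hypothesis T_bnd : forall u, vcls u -> exists B, forall h, `|T h u| <= B.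

Let T_scale h c u : vcls u -> T h (fun x => c * u x) = c * T h u.
Proof.
move=> Hu.
have T0 : T h (fun=> 0) = 0.
  have := T_lin h (-1) vcls0 vcls0.
  have -> : (fun x : V => -1 * 0 + 0) = (fun=> 0 : R) by apply/funext => x; ring.
  by move=> E; lra.
have := T_lin h c Hu vcls0; rewrite T0 addr0 => <-.
by congr (T h); apply/funext => x; rewrite addr0.
Qed.

Let TD h u v : vcls u -> vcls v -> T h (fun x => u x + v x) = T h u + T h v.
Proof.
move=> Hu Hv; have := T_lin h 1 Hu Hv; rewrite mul1r => <-.
by congr (T h); apply/funext => x; rewrite mul1r.
Qed.

Let TB h u v : vcls u -> vcls v -> T h (fun x => u x - v x) = T h u - T h v.
Proof.
move=> Hu Hv; have := T_lin h (-1) Hv Hu; rewrite mulN1r addrC => <-.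
by congr (T h); apply/funext => x; rewrite mulN1r addrC.
Qed.

(** A gliding hump in place of Baire's theorem. If no level works, there are humps [u n] negligible
    for the functionals chosen earlier and large for their own one; the functionals are then
    unbounded at the sum of the humps. *)
Lemma banach_steinhaus : exists2 k, True & exists2 K, 0 <= K &
  forall h u c, vcls u -> ub M (lam k) u c -> `|T h u| <= K * c.
Proof.
apply: contrapT => Hno.
(* By homogeneity, a bound [N] on all functions of level size [eps] would already be the estimate
   that is assumed to fail. *)
have big k N eps : 0 < eps -> exists hu : I * (V -> R),
    [/\ vcls hu.2, ub M (lam k) hu.2 eps & N < `|T hu.1 hu.2|].
  move=> eps0; apply: contrapT => Hn; apply: Hno; exists k => //.
  have HN h u : vcls u -> ub M (lam k) u eps -> `|T h u| <= N.
    move=> Hu Hb; rewrite leNgt; apply/negP => lt; apply: Hn.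
    by exists (h, u).
  have u0 : ub M (lam k) (fun _ : V => 0 : R) eps.
    have [_ E0] := @rsmooth0 R d.
    move=> s x; rewrite E0 normr0 mulr_ge0 ?(ltW eps0)// mulr_ge0 ?exprn_ge0 ?(ltW (lam_gt0 _))//.
    exact: ltW.
  case: (pselect (inhabited I)) => [[h0]|nI]; last first.
    by exists 0 => // h; exfalso; apply: nI.
  have N0 : 0 <= N := le_trans (normr_ge0 _) (HN h0 _ vcls0 u0).
  exists (N / eps); first by rewrite divr_ge0// ltW.
  move=> h u c Hu Hb; have c0 := ub_ge0 M_gt0 Hb.
  have [su _ _] := Hu.
  suff K c' : c < c' -> `|T h u| <= N / eps * c'.
    apply: le_of_eps => z z0; pose N1 := N / eps + 1.
    have N10 : 0 < N1 by rewrite ltr_wpDl// divr_ge0// ltW.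
    apply: le_trans (K (c + z / N1) _) _; first by rewrite ltrDl divr_gt0.
    rewrite mulrDr lerD2l mulrA ler_pdivrMr// mulrC ler_wpM2l ?(ltW z0)//.
    by rewrite lerDl.
  move=> cc'; have c'0 : 0 < c' := le_lt_trans c0 cc'.
  have Hs := vcls_scale (eps / c') Hu.
  have ec : 0 < eps / c' by rewrite divr_gt0.
  have := HN h _ Hs; rewrite T_scale// normrM gtr0_norm// => H.
  have {}H : eps / c' * `|T h u| <= N.
    apply: H; have := ub_scale (eps / c') su Hb; rewrite gtr0_norm//.
    apply: ub_mono_c => //; first exact: ltW.
    by rewrite -[leRHS](mulfVK (_ : c' != 0)) ?gt_eqF// ler_pM2l// ltW.
  rewrite -(ler_pM2l ec); apply: le_trans H _.
  by rewrite le_eqVlt; apply/orP; left; apply/eqP; field; rewrite !gt_eqF.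
have [kK HkK] := choice T_cont.
(* Gliding hump: a state records the partial sum and the continuity data of the functionals
   used so far. *)
pose state := ((V -> R) * (nat * R))%type.
(* Division by [1 + pn.1.2.2] makes the hump of index [m] contribute at most [2^-1 ^+ m] to each
   earlier functional. The lower bound leaves more than [n + 1] once the partial sum before the hump
   and a tail of size at most 1 are taken off. *)
have step (pn : state * nat) : exists hu : I * (V -> R), vcls pn.1.1 -> 0 <= pn.1.2.2 ->
  [/\ vcls hu.2, ub M (lam (pn.2 + pn.1.2.1)%N) hu.2 (2^-1 ^+ pn.2 / (1 + pn.1.2.2)) &
   forall h, pn.2%:R + 2 + `|T h pn.1.1| < `|T hu.1 hu.2|].
  case: pn => [[S [kk KK]] n] /=.
  case: (pselect (vcls S /\ 0 <= KK)) => [[HS K0]|nS]; last first.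
    have [hu _] := big 0%N 0 1 ltr01.
    by exists hu => HS K0; exfalso; apply: nS.
  have [B HB] := T_bnd HS.
  have [|hu [h1 h2 h3]] := big (n + kk)%N (n%:R + 2 + B) (2^-1 ^+ n / (1 + KK)).
    by rewrite divr_gt0// ?exprn_gt0 ?invr_gt0// ltr_pwDl.
  exists hu => _ _; split=> // h; apply: le_lt_trans h3.
  by rewrite lerD2l.
have [pick Hpick] := choice step.
(* Sums of the indices and of the continuity constants stand in for their maxima: they dominate
   those of every functional chosen so far. *)
pose next (st : state) n : state := let hu := pick (st, n) in
  ((fun x => st.1 x + hu.2 x), ((st.2.1 + (kK hu.1).1)%N, st.2.2 + (kK hu.1).2)).
pose fix st n : state := if n is n'.+1 then next (st n') n' else ((fun=> 0), (0%N, 0)).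
pose hu n := pick (st n, n).
have inv n : vcls (st n).1 /\ 0 <= (st n).2.2.
  elim: n => [|n [IH1 IH2]] /=; first by split=> //; exact: vcls0.
  have [h1 _ _] := Hpick (st n, n) IH1 IH2.
  split; first exact: vclsD.
  by rewrite addr_ge0// (HkK _).1.
have P n := Hpick (st n, n) (inv n).1 (inv n).2.
pose u n := (hu n).2.
have Pv n : vcls (u n) by have [] := P n.
have stE n : (st n).1 = psum u n.
  by elim: n => [//|n IH] /=; rewrite -IH.
have kk_mono n j : ((st n).2.1 <= (st (n + j)%N).2.1)%N.
  elim: j => [|j IH]; first by rewrite addn0.
  by rewrite addnS /=; apply: leq_trans IH _; exact: leq_addr.
have KK_mono n j : (st n).2.2 <= (st (n + j)%N).2.2.
  elim: j => [|j IH]; first by rewrite addn0.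
  by rewrite addnS /=; apply: le_trans IH _; rewrite lerDl (HkK _).1.
have Pu n : ub M (lam n) (u n) (2^-1 ^+ n).
  have [_ H _] := P n; apply: (ub_lam (j := (st n).2.1)).
  apply: ub_mono_c H => //; first exact: ltW.
  rewrite ler_pdivrMr; last by rewrite ltr_pwDl// (inv n).2.
  by rewrite ler_peMr ?exprn_ge0 ?invr_ge0// lerDl (inv n).2.
have [w Hw wb] := vcls_complete Pv Pu.
have [B HB] := T_bnd Hw.
pose n := (Num.truncn B).+1.
have nB : B < n%:R by apply: real_truncnS_gt; exact: num_real.
have [_ _ /(_ (hu n).1) Hbig] := P n.
rewrite stE /= -/(hu n) -/(u n) in Hbig.
set h := (hu n).1 in Hbig.
have small j : `|T h (u (n.+1 + j)%N)| <= 2^-1 ^+ (n.+1 + j)%N.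
  set m := (n.+1 + j)%N.
  have [_ Hm _] := P m.
  have k1 : ((kK h).1 <= (st m).2.1)%N.
    by apply: leq_trans (kk_mono n.+1 j); rewrite /= leq_addl.
  have K1 : (kK h).2 <= (st m).2.2.
    by apply: le_trans (KK_mono n.+1 j); rewrite /= lerDr (inv n).2.
  have Hm' : ub M (lam (kK h).1) (u m) (2^-1 ^+ m / (1 + (st m).2.2)).
    apply: (ub_lam (j := (m + (st m).2.1 - (kK h).1)%N)).
    by rewrite subnKC//; apply: leq_trans k1 _; exact: leq_addl.
  apply: le_trans ((HkK h).2 _ _ (Pv m) Hm') _.
  have K0 := (inv m).2.
  rewrite mulrCA ler_piMr ?exprn_ge0 ?invr_ge0// ler_pdivrMr ?ltr_pwDl//.
  by rewrite mul1r; apply: le_trans K1 _; rewrite lerDr.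
have tail j : `|T h (psum u (n.+1 + j)%N) - T h (psum u n.+1)| <= 1 - 2^-1 ^+ j.
  elim: j => [|j IH]; first by rewrite addn0 expr0 !subrr normr0.
  rewrite addnS psumS TD; [|exact: psum_vcls|exact: Pv].
  rewrite addrAC; apply: le_trans (ler_normD _ _) _.
  apply: le_trans (lerD IH (small j)) _.
  rewrite exprD [2^-1 ^+ j.+1]exprS; have : (2^-1 : R) ^+ n.+1 <= 2^-1.
    by rewrite exprS ler_piMr ?invr_ge0// exprn_ile1 ?invr_ge0// invf_le1// ler1n.
  have : 0 <= (2^-1 : R) ^+ j by rewrite exprn_ge0// invr_ge0.
  move: (2^-1 ^+ n.+1) (2^-1 ^+ j) => a b b0 ha.
  have : a * b <= 2^-1 * b by rewrite ler_wpM2r.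
  lra.
have far eps : 0 < eps -> exists j, `|T h w - T h (psum u (n.+1 + j)%N)| <= eps.
  move=> eps0.
  have [K0 HK] := HkK h.
  have e1 : 0 < eps / (2 * (1 + (kK h).2)) by rewrite divr_gt0// mulr_gt0// ltr_pwDl.
  have half_cvg : (fun n : nat => (2^-1 : R) ^+ n) @ \oo --> 0.
    by apply: cvg_expr; rewrite ger0_norm ?invf_lt1 ?invr_ge0// ltr1n.
  have /cvgrPdist_lt/(_ _ e1)[N _ HN] := half_cvg.
  exists (N + (kK h).1)%N; set m := (n.+1 + _)%N.
  have Nm : (N <= m)%N by rewrite /m addnCA leq_addr.
  have km : ((kK h).1 <= m)%N by rewrite /m !addnA leq_addl.
  have := HN m Nm; rewrite sub0r normrN ger0_norm ?exprn_ge0 ?invr_ge0// => Hm.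
  rewrite -TB//; last exact: psum_vcls.
  apply: le_trans (HK _ (2 * 2^-1 ^+ m) _ _) _.
  - by apply: vclsB => //; exact: psum_vcls.
  - by apply: (ub_lam (j := (m - (kK h).1)%N)); rewrite subnKC.
  have {}Hm : 2^-1 ^+ m <= eps / (2 * (1 + (kK h).2)) by exact: ltW.
  apply: le_trans (_ : (kK h).2 * (2 * (eps / (2 * (1 + (kK h).2)))) <= _).
    by rewrite ler_wpM2l// ler_wpM2l.
  move: (kK h).2 K0 => x x0.
  have -> : x * (2 * (eps / (2 * (1 + x)))) = eps * (x / (1 + x)).
    by field; rewrite gt_eqF// ltr_pwDl.
  by rewrite ler_piMr ?(ltW eps0)// ler_pdivrMr ?ltr_pwDl// mul1r lerDr.
have H1 : `|T h w - T h (psum u n.+1)| <= 1.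
  apply: le_of_eps => eps eps0; have [j Hj] := far _ eps0.
  rewrite -(subrKA (T h (psum u (n.+1 + j)%N))) addrC.
  apply: le_trans (ler_normD _ _) _; apply: lerD => //.
  by apply: le_trans (tail j) _; rewrite gerBl exprn_ge0// invr_ge0.
have := HB h; have E : T h (psum u n.+1) = T h (psum u n) + T h (u n).
  by rewrite psumS TD//; exact: psum_vcls.
rewrite E in H1 => H2.
have H3 : `|T h (u n)| <= `|T h w| + `|T h w - (T h (psum u n) + T h (u n))| + `|T h (psum u n)|.
  move: (T h (u n)) (T h w) (T h (psum u n)) => a b c.
  have {1}-> : a = b - (b - (c + a)) - c by ring.
  by apply: le_trans (ler_normB _ _) _; apply: lerD => //; exact: ler_normB.
lra.
Qed.

End BanachSteinhaus.

(** * Weight sequences and kernel bounds *)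

Section Slow.
Context {R : realType}.
Variables (s : nat -> R) (S : R).
Hypothesis s_gt0 : forall n, 0 < s n.
Hypothesis s_sum : series s @ \oo --> S.

Let r n := tl s S n.

Lemma tl_gt0 n : 0 < tl s S n.
Proof. by have := tl_ge0 s_gt0 s_sum n.+1; rewrite tlS; have := s_gt0 n; lra. Qed.

(** The classical weight that tends to infinity yet keeps a convergent positive series convergent:
    with tails [r n], the quotient [s n / sqrt (r n)] is at most [2 * (sqrt (r n) - sqrt (r n.+1))],
    which telescopes. *)
Definition slow n : R := (Num.sqrt (tl s S n))^-1.

Lemma slow_gt0 n : 0 < slow n.
Proof. by rewrite invr_gt0 sqrtr_gt0 tl_gt0. Qed.

Lemma slow_mono n k : slow n <= slow (n + k)%N.
Proof.
rewrite lef_pV2 ?posrE ?sqrtr_gt0 ?tl_gt0//.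
by rewrite ler_wsqrtr// tl_mono.
Qed.

Lemma slow_unbounded C : exists n0, forall n, (n0 <= n)%N -> C <= slow n.
Proof.
pose C1 := `|C| + 1; have C10 : 0 < C1 by rewrite ltr_wpDl.
have e0 : 0 < (C1 ^-1) ^+ 2 by rewrite exprn_gt0// invr_gt0.
have [k Hk] := tl_small s_sum 0 e0; rewrite add0n in Hk.
exists k => n kn; rewrite -(subnKC kn); apply: le_trans (slow_mono k _).
apply: (@le_trans _ _ C1); first by apply: le_trans (ler_norm C) _; rewrite lerDl.
rewrite -[C1]invrK lef_pV2 ?posrE ?invr_gt0 ?sqrtr_gt0 ?tl_gt0//.
rewrite -(ger0_norm (_ : 0 <= C1^-1)) ?invr_ge0 ?(ltW C10)// -sqrtr_sqr.
by rewrite ler_wsqrtr// ltW.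
Qed.

Lemma slow_sum N : \sum_(n < N) slow n * s n <= 2 * Num.sqrt S.
Proof.
have E n : slow n * s n <= 2 * (Num.sqrt (tl s S n) - Num.sqrt (tl s S n.+1)).
  have t1 := tl_gt0 n; have t2 := tl_gt0 n.+1.
  rewrite /slow mulrC ler_pdivrMr ?sqrtr_gt0//.
  have -> : s n = tl s S n - tl s S n.+1 by rewrite tlS; ring.
  have E1 := sqr_sqrtr (ltW t1); have E2 := sqr_sqrtr (ltW t2).
  move: E1 E2; set x := Num.sqrt _; set y := Num.sqrt _ => <- <-.
  have : 0 <= (x - y) ^+ 2 by exact: sqr_ge0.
  by rewrite !expr2; lra.
have H : \sum_(n < N) slow n * s n <= 2 * (Num.sqrt (tl s S 0) - Num.sqrt (tl s S N)).
  elim: N => [|N IH]; first by rewrite big_ord0 subrr mulr0.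
  by rewrite big_ord_recr /=; apply: le_trans (lerD IH (E N)) _; lra.
apply: le_trans H _; rewrite ler_wpM2l//.
have -> : tl s S 0 = S by rewrite /tl /series/= big_geq// subr0.
by rewrite gerBl sqrtr_ge0.
Qed.

(** The diagonal choice for the Roumieu case. The constants [Gam j] of the successive norms may grow
    in any manner; passing to the index [j] late enough keeps the weighted sum finite while [J]
    still tends to infinity. *)
Lemma slow_choice (Gam : nat -> R) : (forall j, 0 <= Gam j) -> exists J : nat -> nat,
  [/\ forall n m, (n <= m)%N -> (J n <= J m)%N,
      forall j, exists n0, forall n, (n0 <= n)%N -> (j <= J n)%N &
      exists B, forall N, \sum_(n < N) Gam (J n) * s n <= B].
Proof.
move=> G0; pose P n (j : nat) := Gam j <= slow n.
(* If no index qualifies the maximum is 0, although [Gam 0] may exceed [slow n]; this accounts for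
   the separate term [Gam 0 * S] in the bound. *)
pose J n := \max_(j < n.+1 | P n j) (j : nat).
exists J; split.
- move=> n m nm; apply/bigmax_leqP => j Pj.
  have jm : (j < m.+1)%N by apply: leq_trans (ltn_ord j) _.
  apply: (@leq_bigmax_cond _ (fun j : 'I_m.+1 => P m j) (fun j => j : nat) (Ordinal jm)).
  by rewrite /P /=; apply: le_trans Pj _; rewrite -(subnKC nm); exact: slow_mono.
- move=> j; have [n0 Hn] := slow_unbounded (Gam j).
  exists (n0 + j)%N => n nn.
  have jn : (j < n.+1)%N by rewrite ltnS; apply: leq_trans nn; exact: leq_addl.
  apply: (@leq_bigmax_cond _ (fun j : 'I_n.+1 => P n j) (fun j => j : nat) (Ordinal jn)).
  by apply: Hn; apply: leq_trans nn; exact: leq_addr.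
exists (Gam 0%N * S + 2 * Num.sqrt S) => N.
have HJ n : Gam (J n) <= Gam 0%N + slow n.
  have [->|[j Pj ->]] : J n = 0%N \/ exists2 j : 'I_n.+1, P n j & J n = j.
    rewrite /J; elim/big_ind : _ => [|x y Hx Hy|j Pj]; [by left| |by right; exists j].
    by rewrite /maxn; case: ifP.
    by rewrite lerDl ltW// slow_gt0.
  by apply: le_trans Pj _; rewrite lerDr.
apply: le_trans (_ : \sum_(n < N) (Gam 0%N * s n + slow n * s n) <= _).
  by apply: ler_sum => n _; rewrite -mulrDl ler_wpM2r// ltW.
rewrite big_split /= -big_distrr /=; apply: lerD; last exact: slow_sum.
rewrite ler_wpM2l//; have := series_le s_gt0 s_sum N.
by rewrite /series/= big_mkord.
Qed.

End Slow.

Section BoundedSeries.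
Context {R : realType}.

Lemma bounded_series (s : nat -> R) B : (forall n, 0 < s n) ->
  (forall N, \sum_(n < N) s n <= B) -> exists S : R, series s @ \oo --> S.
Proof.
move=> s0 HB.
suff c : cvgn (series s) by exists (limn (series s)).
apply: nondecreasing_is_cvgn.
  by apply/nondecreasing_seqP => n; rewrite seriesSr lerDl; exact: ltW.
by exists B => _ [n _ <-]; rewrite /series/= big_mkord.
Qed.

End BoundedSeries.

Section Weights.
Context {R : realType}.
Variables (M : nat -> R) (A H c0 : R).
Hypothesis M_gt0 : forall p, 0 < M p.
Hypothesis M1 : weight_M1 M.
Hypothesis H_ge1 : 1 <= H.
Hypothesis A_gt0 : 0 < A.
Hypothesis M2 : forall p q, M (p + q)%N <= A * H ^+ (p + q) * M p * M q.
Hypothesis M3 : forall q, (1 <= q)%N ->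
    (\sum_(q <= p <oo) (M p.-1 / M p)%:E <= (c0 * q%:R * (M q.-1 / M q))%:E)%E.

(** The quotient sequence with its index lowered by one. (M.1) makes it nondecreasing, and (M.3) at
    [q.+1] bounds the sum of its reciprocals from [q] on ([mu_tail]). *)
Definition mu p : R := M p.+1 / M p.

Lemma mu_gt0 p : 0 < mu p.
Proof. by rewrite divr_gt0. Qed.

Lemma muE p : M p.+1 = M p * mu p.
Proof. by rewrite /mu mulrC mulfVK// gt_eqF. Qed.

Lemma mu_step p : mu p <= mu p.+1.
Proof.
have := M1 (ltn0Sn p); rewrite /= expr2 => h.
rewrite /mu ler_pdivrMr// mulrAC ler_pdivlMr// mulrC [leRHS]mulrC; lra.
Qed.

Lemma mu_mono p q : (p <= q)%N -> mu p <= mu q.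
Proof.
move=> /subnKC <-; elim: (q - p)%N => [|k IH]; first by rewrite addn0.
by rewrite addnS; apply: le_trans IH (mu_step _).
Qed.

Lemma mu_prod p j : \prod_(i < j) mu (p + i)%N = M (p + j)%N / M p.
Proof.
elim: j => [|j IH]; first by rewrite big_ord0 addn0 divff// gt_eqF.
by rewrite big_ord_recr /= IH addnS muE mulrAC.
Qed.

Lemma M_logconv p q : M p * M q <= M 0 * M (p + q)%N.
Proof.
elim: q => [|q IH]; first by rewrite addn0 mulrC.
rewrite addnS !muE [M p * _]mulrA [M 0 * _]mulrA; apply: ler_pM.
- by apply: mulr_ge0; exact: ltW.
- by rewrite ltW// mu_gt0.
- exact: IH.
- by apply: mu_mono; exact: leq_addl.
Qed.

Lemma M_prod_le (I : Type) (r : seq I) (g : I -> nat) :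
  (\prod_(i <- r) M (g i)) * M 0 <= M 0 ^+ size r * M (\sum_(i <- r) g i)%N.
Proof.
elim: r => [|i r IH]; first by rewrite !big_nil /= expr0 !mul1r.
rewrite !big_cons /= exprS -mulrA.
apply: le_trans (ler_wpM2l (ltW (M_gt0 _)) IH) _.
rewrite mulrCA [M 0 * _]mulrC -[leRHS]mulrA.
by rewrite ler_wpM2l ?exprn_ge0 ?(ltW (M_gt0 _))// M_logconv.
Qed.

(** Each application of (M.2) costs a factor [H] per unit of total order; over the [d] coordinates
    this is the origin of [H ^+ d] in [Qfac]. *)
Lemma M_prod_ge (I : Type) (r : seq I) (g : I -> nat) :
  M (\sum_(i <- r) g i)%N <=
  M 0 * A ^+ size r * (H ^+ size r) ^+ (\sum_(i <- r) g i) * \prod_(i <- r) M (g i).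
Proof.
have H0 : 0 < H by exact: lt_le_trans ltr01 H_ge1.
elim: r => [|i r IH]; first by rewrite !big_nil /= !expr0 !mulr1.
rewrite !big_cons /=; set S := (\sum_(j <- r) g j)%N in IH *.
apply: le_trans (M2 _ _) _.
apply: le_trans (ler_wpM2l _ IH) _.
  by rewrite !mulr_ge0 ?exprn_ge0// ltW.
rewrite [A ^+ _.+1]exprS.
have E : (H ^+ size r) ^+ S <= (H ^+ size r) ^+ (g i + S).
  by rewrite ler_weXn2l ?leq_addl// exprn_ege1.
rewrite [H ^+ _.+1]exprS exprMn.
set P := \prod_(j <- r) _; have P0 : 0 <= P by apply: prodr_ge0 => j _; exact: ltW.
have -> : A * H ^+ (g i + S) * M (g i) * (M 0 * A ^+ size r * (H ^+ size r) ^+ S * P) =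
  (A * H ^+ (g i + S) * M (g i) * M 0 * A ^+ size r * P) * (H ^+ size r) ^+ S by ring.
have -> : M 0 * (A * A ^+ size r) * (H ^+ (g i + S) * (H ^+ size r) ^+ (g i + S)) * (M (g i) * P) =
  (A * H ^+ (g i + S) * M (g i) * M 0 * A ^+ size r * P) * (H ^+ size r) ^+ (g i + S) by ring.
by apply: ler_wpM2l => //; rewrite !mulr_ge0 ?exprn_ge0// ltW.
Qed.

Lemma mu_tail q n : \sum_(i < n) (mu (q + i)%N)^-1 <= c0 * q.+1%:R / mu q.
Proof.
have := M3 (ltn0Sn q); rewrite /= => h3.
have nn p : (0 <= (M p.-1 / M p)%:E)%E by rewrite lee_fin divr_ge0// ltW.
have h := nneseries_lim_ge (q.+1 + n)%N (fun p _ _ => nn p) : (_ <= \sum_(q.+1 <= p <oo | xpredT p) (M p.-1 / M p)%:E)%E.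
have := le_trans h h3; rewrite sumEFin lee_fin => h4.
have -> : c0 * q.+1%:R / mu q = c0 * q.+1%:R * (M q / M q.+1) by rewrite /mu invf_div.
apply: le_trans h4.
have -> : \sum_(q.+1 <= i < q.+1 + n) (M i.-1 / M i) = \sum_(i < n) (M (i + q)%N / M (i + q).+1).
  rewrite -{1}[q.+1]add0n big_addn addKn big_mkord.
  by apply: eq_bigr => i _; rewrite addnS.
by apply: ler_sum => i _; rewrite /mu invf_div addnC.
Qed.

(** The product is split at [k]. For [p < k] the ratio is at least 1, each factor is at most
    [2 * mu k / mu p], and the quotients multiply to [M k / M 0]. For [p >= k], [1 + x <= expR x]
    and (M.3) bounds the sum of the exponents by [c0 * k.+1]. *)
Lemma mu_prod_exp k n :
  \prod_(p < n) (1 + mu k / mu p) <=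
  2 ^+ k * mu k ^+ k * M 0 / M k * expR (c0 * k.+1%:R).
Proof.
have pos p : 0 <= mu k / mu p by rewrite divr_ge0 ?ltW ?mu_gt0.
have one p : 1 <= 1 + mu k / mu p by rewrite lerDl.
have P1 : \prod_(p < n) (1 + mu k / mu p) <= \prod_(p < k + n) (1 + mu k / mu p).
  rewrite addnC big_split_ord /= ler_peMr//; last first.
    by elim/big_ind : _ => // x y h1 h2; rewrite mulr_ege1.
  by apply: prodr_ge0 => p _; rewrite (le_trans ler01).
apply: le_trans P1 _; rewrite big_split_ord /=; apply: ler_pM.
- by apply: prodr_ge0 => p _; rewrite (le_trans ler01).
- by apply: prodr_ge0 => p _; rewrite (le_trans ler01).
- apply: le_trans (_ : \prod_(p < k) (2 * mu k / mu p) <= _).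
    apply: ler_prod => p _; rewrite (le_trans ler01)//=.
    have : 1 <= mu k / mu p.
      by rewrite ler_pdivlMr ?mu_gt0// mul1r; apply: mu_mono; exact: ltnW.
    by rewrite -mulrA; lra.
  rewrite big_split /= prodr_const card_ord prodfV exprMn.
  have -> : \prod_(p < k) mu p = M k / M 0 by exact: (mu_prod 0 k).
  by rewrite invf_div mulrA.
- apply: le_trans (_ : \prod_(i < n) expR (mu k / mu (k + i)%N) <= _).
    apply: ler_prod => i _; rewrite (le_trans ler01)//=.
    exact: expR_ge1Dx.
  rewrite -expR_sum ler_expR -big_distrr /=.
  have := mu_tail k n; rewrite ler_pdivlMr ?mu_gt0// mulrC; exact.
Qed.

(** Take [rho = mu k / eps] in [ek_pow]: the powers of [mu k] cancel against [mu_prod_exp] and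
    [1 / M k] is left. The first [p0] widths, which may exceed [eps / mu p], only cost the constant
    [(C0 / eps) ^+ p0]. The bound is uniform in [n]. *)
Lemma ek_bound (a : nat -> R) C0 eps p0 n k : (forall p, 0 < a p) ->
  0 < eps -> eps <= C0 -> (forall p, a p <= C0 / mu p) ->
  (forall p, (p0 <= p)%N -> a p <= eps / mu p) ->
  ek a n k <= (C0 / eps) ^+ p0 * (M 0 * expR c0) * ((eps * (2 * expR c0)) ^+ k / M k).
Proof.
move=> a0 e0 eC aC ae.
have mk := mu_gt0 k; have r0 : 0 < mu k / eps by rewrite divr_gt0.
have Ce : 1 <= C0 / eps by rewrite ler_pdivlMr// mul1r.
have Hp := ek_pow a0 n k (ltW r0).
have P1 : \prod_(p < n) (1 + mu k / eps * a p / 2) <=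
    (C0 / eps) ^+ p0 * \prod_(p < n) (1 + mu k / mu p).
  apply: le_trans (_ : \prod_(p < n) ((if (p < p0)%N then C0 / eps else 1) * (1 + mu k / mu p)) <= _).
    apply: ler_prod => p _.
    have h0 : 0 <= mu k / eps * a p by rewrite mulr_ge0 ?ltW.
    have h2 : 0 <= mu k / mu p by rewrite divr_ge0// ltW// mu_gt0.
    apply/andP; split; first by lra.
    case: ltnP => pp.
      have : mu k / eps * a p <= C0 / eps * (mu k / mu p).
        have -> : C0 / eps * (mu k / mu p) = mu k / eps * (C0 / mu p) by ring.
        by rewrite ler_wpM2l// ltW.
      lra.
    have : mu k / eps * a p <= mu k / mu p.
      have -> : mu k / mu p = mu k / eps * (eps / mu p).
        by field; rewrite !gt_eqF// mu_gt0.
      by rewrite ler_wpM2l ?(ltW r0)// ae.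
    lra.
  rewrite big_split /=; apply: ler_wpM2r.
    by apply: prodr_ge0 => p _; rewrite addr_ge0// divr_ge0// ltW// mu_gt0.
  clear Hp; elim: n => [|n IH]; first by rewrite big_ord0 exprn_ege1.
  have K m : \prod_(p < m) (if (p < p0)%N then C0 / eps else 1) <= (C0 / eps) ^+ (minn m p0).
    elim: m => [|m IHm]; first by rewrite big_ord0 min0n.
    rewrite big_ord_recr /=; case: ltnP => mp.
      rewrite (minn_idPl mp) exprSr; rewrite (minn_idPl (ltnW mp)) in IHm.
      by apply: ler_wpM2r => //; exact: le_trans ler01 Ce.
    by rewrite mulr1 (minn_idPr (leqW mp)); rewrite (minn_idPr mp) in IHm.
  apply: le_trans (K n.+1) _; by rewrite ler_weXn2l ?geq_minr.
have Hp2 := le_trans Hp (le_trans P1 (ler_wpM2l (exprn_ge0 p0 (le_trans ler01 Ce)) (mu_prod_exp k n))).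
rewrite -(ler_pM2l (exprn_gt0 k r0)); apply: le_trans Hp2 _.
rewrite le_eqVlt; apply/orP; left; apply/eqP.
have -> : expR (c0 * k.+1%:R) = expR c0 * expR c0 ^+ k.
  by rewrite -natr1 mulrDr mulr1 expRD mulrC expRM_natr.
have -> : (mu k / eps) ^+ k = mu k ^+ k / eps ^+ k by rewrite expr_div_n.
have -> : (eps * (2 * expR c0)) ^+ k = eps ^+ k * (2 ^+ k * expR c0 ^+ k).
  by rewrite exprMn exprMn.
have := exprn_gt0 k e0; have := M_gt0 k.
move: (eps ^+ k) (M k) (mu k ^+ k) ((C0 / eps) ^+ p0) (2 ^+ k) (expR c0 ^+ k) (expR c0) => x y z t u v e y0 x0.
by field; rewrite !gt_eqF.
Qed.

End Weights.

Ltac nonneg := repeat (first [ by [] | exact: ltW | apply: exprn_ge0 | apply: mulr_ge0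
  | apply: addr_ge0 | rewrite invr_ge0 ]).

(** * Derivative bounds for the one-dimensional kernels *)

Section Kernel.
Context {R : realType}.
Variables (M : nat -> R) (A H : R).
Hypothesis M_gt0 : forall p, 0 < M p.
Hypothesis M1 : weight_M1 M.
Hypothesis H_ge1 : 1 <= H.
Hypothesis A_gt0 : 0 < A.
Hypothesis M2 : forall p q, M (p + q)%N <= A * H ^+ (p + q) * M p * M q.
Variables (a beta : nat -> R) (w : R).
Hypothesis a_gt0 : forall p, 0 < a p.
Hypothesis beta_gt0 : forall p, 0 < beta p.
Hypothesis beta_sum : series beta @ \oo --> w.
Hypothesis a_le : forall p, a p <= beta p.

Let mu := mu M.
Let H0 : 0 < H. Proof. exact: lt_le_trans ltr01 H_ge1. Qed.
Let mu0 p : 0 < mu p. Proof. exact: mu_gt0. Qed.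
Let M00 : M 0 != 0. Proof. by rewrite gt_eqF. Qed.

Lemma a_series n : series a n <= w.
Proof.
apply: le_trans (series_le beta_gt0 beta_sum n).
by rewrite /series/=; apply: ler_sum.
Qed.

Lemma prod_mu (k : R) j p : 0 < k ->
  \prod_(i < j) (k * mu (p + i)%N) = k ^+ j * (M (p + j)%N / M p).
Proof. by move=> k0; rewrite big_split /= prodr_const card_ord mu_prod. Qed.

(** The mollifier starts at index [size s], where the averages stop. Derivatives up to that order
    are absorbed by the averages and give [M N / M 0]; the surplus falls on the mollifier and gives
    [M (N + i) / M N]; the quotients join. The order is [j.+1] because the first derivative of [Tn]
    is free. *)
Lemma Aw_Tt_bound kap s j x : 0 < kap ->
  (forall p, (p < size s)%N -> kap / mu p <= a p) -> (forall p, kap / mu p <= beta p) ->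
  `|Aw a s (Tt beta (size s) j.+1) x| <= (4 / kap) ^+ j * (M j / M 0).
Proof.
move=> k0 Ka Kb; set N := size s.
have tT := Tt_tower beta_gt0 beta_sum N.
have k4 : 0 < 4 / kap by rewrite divr_gt0.
have P1 m : (m <= N)%N -> \prod_(p < m) (4 / a p) <= (4 / kap) ^+ m * (M m / M 0).
  move=> mN; have := prod_mu m 0 k4; rewrite add0n => <-.
  apply: ler_prod => p _; rewrite divr_ge0 ?(ltW (a_gt0 _))//= add0n.
  rewrite -mulrA ler_pM2l// -[leRHS]invrK lef_pV2 ?posrE ?invr_gt0 ?mulr_gt0 ?invr_gt0//.
  by rewrite invfM invrK; apply: Ka; exact: leq_trans (ltn_ord p) mN.
have [jN|Nj] := leqP j N.
  have := @Aw_bound R a a_gt0 s j (fun k => Tt beta N (1 + k)%N) 1 x jN (towerS 1 tT).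
  rewrite mulr1 => H1; apply: le_trans (H1 _) (P1 j jN).
  by move=> y; have := Tt_bound beta_gt0 beta_sum N 0 y; rewrite big_ord0.
have -> : j = (j - N + N)%N by rewrite subnK// ltnW.
move: (j - N)%N => i {j Nj}; rewrite -addSn.
apply: le_trans (Aw_bound2 a_gt0 s x tT (fun y => Tt_bound beta_gt0 beta_sum N i y)) _.
have P2 : \prod_(q < i) (2 / beta (N + q)%N) <= (4 / kap) ^+ i * (M (N + i)%N / M N).
  rewrite -prod_mu//; apply: ler_prod => p _; rewrite divr_ge0 ?(ltW (beta_gt0 _))//=.
  rewrite ler_pdivrMr// -mulrA mulrC.
  have := Kb (N + p)%N; rewrite ler_pdivrMr// => Hk.
  rewrite mulrA ler_pdivlMr// [leRHS](_ : _ = 4 * (beta (N + p)%N * mu (N + p)%N)); last ring.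
  have : 0 < kap by []. lra.
apply: le_trans (_ : ((4 / kap) ^+ N * (M N / M 0)) * ((4 / kap) ^+ i * (M (N + i)%N / M N)) <= _).
  apply: ler_pM => //; last exact: P1.
  - by apply: prodr_ge0 => p _; rewrite divr_ge0 ?(ltW (a_gt0 _)).
  - by apply: prodr_ge0 => p _; rewrite divr_ge0 ?(ltW (beta_gt0 _)).
rewrite le_eqVlt; apply/orP; left; apply/eqP.
rewrite exprD addnC; field; rewrite ?M00 ?gt_eqF//.
Qed.

Definition h1 : R := A * H * M 1%N.
(** Twice the constant of [Msucc2] plus four times that of [Msucc1]: the two cases of [Aw_diff]
    under one constant. *)
Definition Gam1 (kap : R) : R :=
  2 * (4 / kap) ^+ 2 * h1 ^+ 2 * H / M 0 + 4 * (4 / kap) * h1 / M 0.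
(** The level reached with widths [kap / mu p]. The factor [4 / kap] is the cost of a derivative,
    [H ^+ 2] pays for the two surplus derivatives in [Msucc2], and the remaining 2 buys the decay
    [2^-1 ^+ j] in [Msucc1]. *)
Definition lv (kap : R) : R := 8 * H ^+ 2 / kap.

Let h1_gt0 : 0 < h1. Proof. by rewrite !mulr_gt0. Qed.

Lemma Gam1_gt0 kap : 0 < kap -> 0 < Gam1 kap.
Proof.
move=> k0; have k4 : 0 < 4 / kap by rewrite divr_gt0.
apply: addr_gt0; apply: divr_gt0 => //; apply: mulr_gt0 => //; apply: mulr_gt0 => //.
- by apply: mulr_gt0 => //; exact: exprn_gt0.
- by rewrite exprn_gt0.
Qed.

Lemma lv_gt0 kap : 0 < kap -> 0 < lv kap.
Proof. by move=> k0; rewrite divr_gt0// mulr_gt0// exprn_gt0. Qed.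

Lemma Msucc1 kap j : 0 < kap ->
  (4 / kap) ^+ j.+1 * (M j.+1 / M 0) <=
  (4 / kap) * h1 / M 0 * 2^-1 ^+ j * (lv kap ^+ j * M j).
Proof.
move=> k0; have k4 : 0 < 4 / kap by rewrite divr_gt0.
have HM := M_succ M2 j; rewrite -/h1 in HM.
rewrite exprS mulrA; apply: le_trans (_ : (4 / kap) * (4 / kap) ^+ j * (h1 * (H ^+ j * M j)) / M 0 <= _).
  rewrite ler_pM2r ?invr_gt0// ler_wpM2l//.
  by rewrite mulr_ge0 ?exprn_ge0 ?(ltW k4).
have E : lv kap ^+ j = 2 ^+ j * (4 / kap) ^+ j * H ^+ j * H ^+ j.
  by rewrite -!exprMn /lv; congr (_ ^+ j); rewrite expr2; ring.
rewrite E exprVn.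
have -> : 4 / kap * h1 / M 0 / 2 ^+ j * (2 ^+ j * (4 / kap) ^+ j * H ^+ j * H ^+ j * M j) =
  (4 / kap * (4 / kap) ^+ j * (h1 * (H ^+ j * M j)) / M 0) * H ^+ j.
  have : 2 ^+ j != 0 :> R by rewrite expf_neq0.
  move: (2 ^+ j) ((4 / kap) ^+ j) (H ^+ j) (4 / kap) => x y z t x0; by field; rewrite x0 M00.
rewrite ler_peMr ?exprn_ege1//.
by nonneg.
Qed.

Lemma Msucc2 kap j : 0 < kap ->
  (4 / kap) ^+ j.+2 * (M j.+2 / M 0) <=
  (4 / kap) ^+ 2 * h1 ^+ 2 * H / M 0 * (lv kap ^+ j * M j).
Proof.
move=> k0; have k4 : 0 < 4 / kap by rewrite divr_gt0.
have HM1 := M_succ M2 j; have HM2 := M_succ M2 j.+1; rewrite -/h1 in HM1 HM2.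
have HM : M j.+2 <= h1 * (H ^+ j.+1 * (h1 * (H ^+ j * M j))).
  apply: le_trans HM2 _; rewrite ler_pM2l// ler_pM2l ?exprn_gt0//.
have E : lv kap ^+ j = 2 ^+ j * (4 / kap) ^+ j * H ^+ j * H ^+ j.
  by rewrite -!exprMn /lv; congr (_ ^+ j); rewrite expr2; ring.
rewrite mulrA; apply: le_trans (_ : (4 / kap) ^+ j.+2 * (h1 * (H ^+ j.+1 * (h1 * (H ^+ j * M j)))) / M 0 <= _).
  by rewrite ler_pM2r ?invr_gt0// ler_wpM2l// exprn_ge0// ltW.
rewrite E.
have -> : (4 / kap) ^+ 2 * h1 ^+ 2 * H / M 0 * (2 ^+ j * (4 / kap) ^+ j * H ^+ j * H ^+ j * M j) =
  (4 / kap) ^+ j.+2 * (h1 * (H ^+ j.+1 * (h1 * (H ^+ j * M j)))) / M 0 * 2 ^+ j.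
  rewrite !exprS expr0.
  by move: (2 ^+ j) ((4 / kap) ^+ j) (H ^+ j) (4 / kap) => x y z t; ring.
rewrite ler_peMr ?exprn_ege1// ?ler1n//.
by nonneg.
Qed.

Lemma Aw_lv kap s j x : 0 < kap ->
  (forall p, (p < size s)%N -> kap / mu p <= a p) -> (forall p, kap / mu p <= beta p) ->
  `|Aw a s (Tt beta (size s) j.+2) x| <= Gam1 kap * (lv kap ^+ j * M j).
Proof.
move=> k0 Ka Kb; have k4 : 0 < 4 / kap by rewrite divr_gt0.
apply: le_trans (Aw_Tt_bound j.+1 x k0 Ka Kb) _; apply: le_trans (Msucc1 j k0) _.
apply: ler_wpM2r; first by have lk := lv_gt0 k0; nonneg.
have c0 : 0 <= (4 / kap) * h1 / M 0 by nonneg.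
apply: le_trans (_ : (4 / kap) * h1 / M 0 <= _).
  by rewrite ler_piMr// exprn_ile1 ?invr_ge0// invf_le1// ler1n.
have : 0 <= 2 * (4 / kap) ^+ 2 * h1 ^+ 2 * H / M 0.
  by nonneg.
rewrite /Gam1.
have -> : 4 * (4 / kap) * h1 / M 0 = 4 * ((4 / kap) * h1 / M 0) by rewrite !mulrA.
lra.
Qed.

(** The size of the change from stage [n] to stage [n.+1]: [beta n] is for derivatives that the
    stages can absorb, [2^-1 ^+ n] for those of higher order. *)
Definition incr n : R := beta n + 2^-1 ^+ n.

(** If [j.+2 <= n], the [n] averages absorb all derivatives, and at order 0 both functions arise
    from the Lipschitz function [Tn beta n.+1] by one average, hence differ by at most
    [a n + beta n]. If [j.+2 > n], both terms are estimated separately and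
    [2^-1 ^+ j <= 2 * 2^-1 ^+ n] supplies the smallness. *)
Lemma Aw_diff kap s b j x : 0 < kap ->
  (forall p, (p <= size s)%N -> kap / mu p <= a p) -> (forall p, kap / mu p <= beta p) ->
  `|Aw a (b :: s) (Tt beta (size s).+1 j.+2) x - Aw a s (Tt beta (size s) j.+2) x| <=
   incr (size s) * (Gam1 kap * (lv kap ^+ j * M j)).
Proof.
move=> k0 Ka Kb; set n := size s; have k4 : 0 < 4 / kap by rewrite divr_gt0.
have an : a n != 0 by rewrite gt_eqF.
have tT m := Tt_tower beta_gt0 beta_sum m.
have cT m k : continuous (Tt beta m k) := tower_cont (tT m).
set W := lv kap ^+ j * M j.
have W0 : 0 <= W by have lk := lv_gt0 k0; nonneg.
have Ka' p : (p < n)%N -> kap / mu p <= a p by move=> pn; apply: Ka; exact: ltnW.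
set X := 2 * (4 / kap) ^+ 2 * h1 ^+ 2 * H / M 0.
set Y := (4 / kap) * h1 / M 0.
have X0 : 0 <= X by nonneg.
have Y0 : 0 <= Y by nonneg.
have GE : Gam1 kap = X + 4 * Y by rewrite /Gam1 /X /Y; ring.
have b0 := beta_gt0 n.
have h20 : 0 <= (2^-1 : R) ^+ n by rewrite exprn_ge0// invr_ge0.
have [jn|nj] := leqP j.+2 n.
  pose g k := fun y => op b (a n) (Tt beta n.+1 k) y - Tt beta n k y.
  have tg : tower g.
    move=> k y; apply: dd1B; last exact: tT.
    exact: (op_tower b an (tT n.+1)).
  have gb y : `|g 0%N y| <= 2 * beta n.
    rewrite /g /=; have -> : Tn beta n y = op false (beta n) (Tn beta n.+1) y by exact: (Tn_rec beta_gt0 beta_sum).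
    have l1 := Tn_lip beta_gt0 beta_sum n.+1.
    have h1' := op_lip1_near b y (a_gt0 n) l1.
    have h2' := op_lip1_near false y (beta_gt0 n) l1; rewrite distrC in h2'.
    rewrite -(subrKA (Tn beta n.+1 y)); apply: le_trans (ler_normD _ _) _.
    have := a_le n; lra.
  have E : Aw a (b :: s) (Tt beta n.+1 j.+2) x - Aw a s (Tt beta n j.+2) x = Aw a s (g j.+2) x.
    have cO : continuous (op b (a n) (Tt beta n.+1 j.+2)) by apply: op_cont; exact: cT.
    have := Aw_lin a_gt0 s (-1) x (@cT n j.+2) cO.
    rewrite mulN1r addrC => <-; congr (Aw a s _ x).
    by apply/funext => y; rewrite /g mulN1r addrC.
  rewrite E; apply: le_trans (Aw_bound a_gt0 x jn tg gb) _.
  have P1 : \prod_(p < j.+2) (4 / a p) <= (4 / kap) ^+ j.+2 * (M j.+2 / M 0).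
    have := prod_mu j.+2 0 k4; rewrite add0n => <-.
    apply: ler_prod => p _; rewrite divr_ge0 ?(ltW (a_gt0 _))//= add0n.
    rewrite -mulrA ler_pM2l// -[leRHS]invrK lef_pV2 ?posrE ?invr_gt0 ?mulr_gt0 ?invr_gt0//.
    by rewrite invfM invrK; apply: Ka'; exact: leq_trans (ltn_ord p) jn.
  have := le_trans P1 (Msucc2 j k0); rewrite -/W => P2.
  apply: le_trans (ler_wpM2r (_ : 0 <= 2 * beta n) P2) _; first by rewrite mulr_ge0// ltW.
  have -> : (4 / kap) ^+ 2 * h1 ^+ 2 * H / M 0 * W * (2 * beta n) = beta n * (X * W).
    by rewrite /X; ring.
  rewrite /incr GE mulrDl ler_wpDr//.
    by rewrite mulr_ge0// mulr_ge0// addr_ge0// mulr_ge0.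
  by rewrite ler_pM2l// ler_wpM2r// lerDl mulr_ge0.
have B1 := Aw_Tt_bound (s := b :: s) j.+1 x k0 Ka Kb.
have B2 := Aw_Tt_bound j.+1 x k0 Ka' Kb.
apply: le_trans (ler_normB _ _) _; apply: le_trans (lerD B1 B2) _.
have P := Msucc1 j k0; rewrite -/W -/Y in P.
have jn2 : (2^-1 : R) ^+ j <= 2 * 2^-1 ^+ n.
  have -> : (2^-1 : R) ^+ j = 2 * 2^-1 ^+ j.+1 by rewrite exprS mulrA mulfV// mul1r.
  by rewrite ler_pM2l// ler_wiXn2l ?invr_ge0 ?invf_le1 ?ler1n.
apply: le_trans (lerD P P) _.
apply: le_trans (_ : 2^-1 ^+ n * (4 * Y * W) <= _).
  have := ler_wpM2r (mulr_ge0 Y0 W0) jn2.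
  move: (2^-1 ^+ j) (2^-1 ^+ n) => u v huv.
  have -> : Y * u * W + Y * u * W = 2 * (u * (Y * W)) by ring.
  have -> : v * (4 * Y * W) = 2 * (2 * v * (Y * W)) by ring.
  by rewrite ler_pM2l.
rewrite GE; apply: ler_pM => //; first by rewrite mulr_ge0// mulr_ge0.
  by rewrite /incr lerDr ltW.
by rewrite ler_wpM2r// lerDr.
Qed.

Lemma Aw_Tt_supp s n j x : x <= 0 \/ 2 * w <= x -> Aw a s (Tt beta n j.+2) x = 0.
Proof.
move=> Hx; have tT m := Tt_tower beta_gt0 beta_sum m.
have cT : continuous (Tt beta n j.+2) := tower_cont (tT n).
apply: (Aw_supp a_gt0 (w := w) cT).
  move=> y Hy; apply: (Tt_supp beta_gt0 beta_sum); case: Hy => Hy; [by left|right].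
  exact: le_trans (tl_le w beta_gt0 n) Hy.
by case: Hx => Hx; [left|right] => //; have := a_series (size s); lra.
Qed.

Hypothesis beta_big : forall kap, exists p0, forall p, (p0 <= p)%N -> kap / mu p <= beta p.

Lemma prod_if_le (C : R) (P : nat -> bool) p0 m : 1 <= C -> (forall i, P i -> (i < p0)%N) ->
  \prod_(i < m) (if P i then C else 1) <= C ^+ p0.
Proof.
move=> C1 HP; have C0 : 0 <= C := le_trans ler01 C1.
have K : \prod_(i < m) (if P i then C else 1) <= C ^+ (minn m p0).
  elim: m => [|m IHm]; first by rewrite big_ord0 min0n.
  rewrite big_ord_recr /=; have [mp|mp] := ltnP m p0.
    rewrite (minn_idPl mp) exprSr; rewrite (minn_idPl (ltnW mp)) in IHm.
    apply: ler_pM => //.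
    - by apply: prodr_ge0 => i _; case: ifP.
    - by case: ifP.
    - by case: ifP.
  case: ifP => [/HP|_]; first by rewrite ltnNge mp.
  by rewrite mulr1 (minn_idPr (leqW mp)); rewrite (minn_idPr mp) in IHm.
by apply: le_trans K _; rewrite ler_weXn2l// geq_minr.
Qed.

(** A qualitative bound at a fixed stage, used to place the kernels in the Beurling class. The
    averages are discarded and all derivatives fall on the mollifier, whose widths eventually exceed
    every multiple of [1 / mu p]; the value of [kap] makes [2 * H / kap] equal to [l]. *)
Lemma Aw_all_levels n l : 0 < l -> exists C, forall s j x,
  `|Aw a s (Tt beta n j.+2) x| <= C * (l ^+ j * M j).
Proof.
move=> l0; pose kap := 2 * H / l; have k0 : 0 < kap by rewrite divr_gt0// mulr_gt0.
have [p0 Hp0] := beta_big kap.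
(* Finitely many widths may be too small; they only cost a constant. *)
have [D D1 HD] : exists2 D, 1 <= D & forall p, kap / mu p <= (if (p < p0)%N then D else 1) * beta p.
  elim: p0 Hp0 => [|p1 IH] Hp.
    by exists 1 => // p; rewrite ltn0 mul1r; exact: Hp.
  pose D1 := 1 + \sum_(p < p1.+1) (kap / mu p / beta p).
  have nn p : 0 <= kap / mu p / beta p by rewrite divr_ge0 ?(ltW (beta_gt0 _))// divr_ge0 ?ltW.
  exists D1; first by rewrite /D1 lerDl; apply: sumr_ge0.
  move=> p; case: ltnP => pp; last by rewrite mul1r; exact: Hp.
  rewrite -ler_pdivrMr// /D1 (bigD1 (Ordinal pp))//= addrCA lerDl addr_ge0//.
  exact: sumr_ge0.
have Bt j : \prod_(i < j.+1) (2 / beta (n + i)%N) <=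
    D ^+ p0 * ((2 / kap) ^+ j.+1 * (M (n + j.+1)%N / M n)).
  have k2 : 0 < 2 / kap by rewrite divr_gt0.
  apply: le_trans (_ : \prod_(i < j.+1) ((if (n + i < p0)%N then D else 1) * (2 / kap * mu (n + i)%N)) <= _).
    apply: ler_prod => i _; rewrite divr_ge0 ?(ltW (beta_gt0 _))//=.
    have := HD (n + i)%N; move: (beta_gt0 (n + i)%N) (mu0 (n + i)%N).
    set c := if _ then _ else _; move: (beta (n + i)%N) (mu (n + i)%N) c => b m c bp mp.
    rewrite ler_pdivrMr// => h; rewrite ler_pdivrMr//.
    have -> : c * (2 / kap * m) * b = 2 * ((c * b * m) / kap) by ring.
    by rewrite ler_peMr// ler_pdivlMr// mul1r.
  rewrite big_split /= prod_mu//; apply: ler_wpM2r.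
    by rewrite mulr_ge0 ?exprn_ge0 ?(ltW k2)// divr_ge0 ?(ltW (M_gt0 _)).
  apply: (prod_if_le (P := fun i => (n + i < p0)%N)) => // i.
  by apply: leq_ltn_trans; exact: leq_addl.
exists (D ^+ p0 * (2 / kap * (A * H ^+ n.+1 * M n.+1 / M n))) => s j x.
have tT m := Tt_tower beta_gt0 beta_sum m.
have cT : continuous (Tt beta n j.+2) := tower_cont (tT n).
apply: le_trans (Aw_sup a_gt0 s x cT (fun y => Tt_bound beta_gt0 beta_sum n j.+1 y)) _.
apply: le_trans (Bt j) _; rewrite -[leRHS]mulrA ler_wpM2l ?exprn_ge0 ?(le_trans ler01)//.
have := M2 n.+1 j; rewrite addSnnS => HM.
have k2 : 0 < 2 / kap by rewrite divr_gt0.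
apply: le_trans (_ : (2 / kap) ^+ j.+1 * (A * H ^+ (n + j.+1) * M n.+1 * M j / M n) <= _).
  by rewrite ler_wpM2l ?exprn_ge0 ?(ltW k2)// ler_pM2r ?invr_gt0.
rewrite -addSnnS exprD exprS.
have -> : l ^+ j = (2 / kap) ^+ j * H ^+ j.
  by rewrite -exprMn /kap; congr (_ ^+ j); field; rewrite !gt_eqF.
by rewrite le_eqVlt; apply/orP; left; apply/eqP; ring.
Qed.

End Kernel.

Section TensorBounds.
Context {R : realType} {d : nat}.
Variables (M : nat -> R).
Hypothesis M_gt0 : forall p, 0 < M p.
Hypothesis M1 : weight_M1 M.
Local Notation V := 'rV[R]_d.

Definition Mc : R := M 0 ^+ d / M 0.

Lemma prodM_le (s : seq 'I_d) : \prod_(i < d) M (count_mem i s) <= Mc * M (size s).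
Proof.
have := M_prod_le M_gt0 M1 (index_enum 'I_d) (fun i => count_mem i s).
have -> : size (index_enum 'I_d) = d by rewrite -[RHS]card_ord cardE enumT.
rewrite sum_count => h; rewrite /Mc mulrAC ler_pdivlMr//.
Qed.

Lemma prod_level (C l : R) s :
  \prod_(i < d) (C * (l ^+ count_mem i s * M (count_mem i s))) =
  C ^+ d * l ^+ size s * \prod_(i < d) M (count_mem i s).
Proof.
rewrite big_split /= prodr_const card_ord big_split /=.
by rewrite -[\prod_(i < d) l ^+ _](big_morph (fun n => l ^+ n) (exprD l) (expr0 l)) sum_count mulrA.
Qed.

Lemma tens_ub l C (g : 'I_d -> nat -> R -> R) : 0 <= l -> 0 <= C ->
  (forall i, tower (g i)) -> (forall i j x, `|g i j x| <= C * (l ^+ j * M j)) ->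
  ub M l (tens (fun i => g i 0%N)) (C ^+ d * Mc).
Proof.
move=> l0 C0 tg Hg s x; have [_ ->] := tens_jet tg.
rewrite /tens normr_prod.
apply: le_trans (_ : \prod_(i < d) (C * (l ^+ count_mem i s * M (count_mem i s))) <= _).
  by apply: ler_prod => i _; rewrite normr_ge0 /=.
rewrite prod_level.
have := ler_wpM2l (mulr_ge0 (exprn_ge0 d C0) (exprn_ge0 (size s) l0)) (prodM_le s).
by move/le_trans; apply; rewrite le_eqVlt; apply/orP; left; apply/eqP; ring.
Qed.

Lemma prod_diff (I : Type) (r : seq I) (x y Y : I -> R) e : 0 <= e ->
  (forall i, `|x i| <= Y i) -> (forall i, `|y i| <= Y i) -> (forall i, `|x i - y i| <= e * Y i) ->
  `|\prod_(i <- r) x i - \prod_(i <- r) y i| <= (size r)%:R * e * \prod_(i <- r) Y i.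
Proof.
move=> e0 Hx Hy Hxy; elim: r => [|i r IH]; first by rewrite !big_nil subrr normr0 !mul0r.
have Y0 j : 0 <= Y j := le_trans (normr_ge0 _) (Hx j).
have Py : `|\prod_(j <- r) y j| <= \prod_(j <- r) Y j.
  by rewrite normr_prod; apply: ler_prod => j _; rewrite normr_ge0 /=.
rewrite !big_cons /= -natr1.
have -> : x i * \prod_(j <- r) x j - y i * \prod_(j <- r) y j =
  x i * (\prod_(j <- r) x j - \prod_(j <- r) y j) + (x i - y i) * \prod_(j <- r) y j by ring.
apply: le_trans (ler_normD _ _) _; rewrite !normrM.
apply: le_trans (_ : Y i * ((size r)%:R * e * \prod_(j <- r) Y j) + e * Y i * \prod_(j <- r) Y j <= _).
  by apply: lerD; apply: ler_pM.
by rewrite le_eqVlt; apply/orP; left; apply/eqP; ring.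
Qed.

Lemma tens_diff_ub l C e (g g' : 'I_d -> nat -> R -> R) : 0 <= l -> 0 <= C -> 0 <= e ->
  (forall i, tower (g i)) -> (forall i, tower (g' i)) ->
  (forall i j x, `|g i j x| <= C * (l ^+ j * M j)) ->
  (forall i j x, `|g' i j x| <= C * (l ^+ j * M j)) ->
  (forall i j x, `|g i j x - g' i j x| <= e * (C * (l ^+ j * M j))) ->
  ub M l (fun x => tens (fun i => g i 0%N) x - tens (fun i => g' i 0%N) x) (d%:R * (C ^+ d * Mc) * e).
Proof.
move=> l0 C0 e0 tg tg' Hg Hg' Hd s x.
have [s1 E1] := tens_jet tg; have [s2 E2] := tens_jet tg'.
have [_ ->] := rsmoothB s1 s2; rewrite E1 E2 /tens.
have := @prod_diff _ (index_enum 'I_d) (fun i => g i (count_mem i s) (x 0 i))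
  (fun i => g' i (count_mem i s) (x 0 i)) (fun i => C * (l ^+ count_mem i s * M (count_mem i s))) e e0
  (fun i => Hg _ _ _) (fun i => Hg' _ _ _) (fun i => Hd _ _ _).
have -> : size (index_enum 'I_d) = d by rewrite -[RHS]card_ord cardE enumT.
move/le_trans; apply; rewrite prod_level.
have := ler_wpM2l (mulr_ge0 (mulr_ge0 (ler0n R d) e0) (mulr_ge0 (exprn_ge0 d C0) (exprn_ge0 (size s) l0))) (prodM_le s).
rewrite -mulrA => /le_trans; apply.
by rewrite le_eqVlt; apply/orP; left; apply/eqP; ring.
Qed.

End TensorBounds.

(** * Representation of a real functional *)

Section MultiIndex.
Context {R : realType} {d : nat}.
Implicit Types (al : multiindex d).

Definition aseq al : seq 'I_d := flatten [seq nseq (al i) i | i <- enum 'I_d].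

Lemma count_aseq al i : count_mem i (aseq al) = al i.
Proof.
rewrite /aseq count_flatten -map_comp.
rewrite (eq_map (g := fun j => if j == i then al j else 0%N)); last first.
  by move=> j /=; rewrite count_nseq /=; case: eqP => _; rewrite ?mul1n ?mul0n.
rewrite sumnE big_map -big_mkcond /= big_enum_cond /=.
by rewrite (big_pred1 i) // => j; rewrite eq_sym.
Qed.

Lemma size_aseq al : size (aseq al) = mlength al.
Proof. by rewrite -sum_count; apply: eq_bigr => i _; exact: count_aseq. Qed.

Definition rmderiv al (u : 'rV[R]_d -> R) := rder (aseq al) u.

(** The multi-indices with entries at most [n], as a finite type: a product of [d] one-dimensional
    sums expands over it, and a finite set of multi-indices embeds into it for large [n]. *)
Definition ofb n (b : {ffun 'I_d -> 'I_n.+1}) : multiindex d := [ffun i => (b i : nat)].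

Lemma ofb_inj n : injective (@ofb n).
Proof.
move=> b c /ffunP E; apply/ffunP => i; apply: val_inj.
by have := E i; rewrite !ffunE.
Qed.

Lemma ofb_surj n al : (forall i, (al i <= n)%N) -> exists b : {ffun 'I_d -> 'I_n.+1}, ofb b = al.
Proof.
move=> H; exists [ffun i => inord (al i)]; apply/ffunP => i; rewrite !ffunE inordK//.
exact: H.
Qed.

Lemma sum_fset_box n (A : {fset multiindex d}) (T : multiindex d -> R) :
  (forall al, al \in A -> forall i, (al i <= n)%N) ->
  \sum_(al <- A) T al = \sum_(b : {ffun 'I_d -> 'I_n.+1} | ofb b \in A) T (ofb b).
Proof.
move=> HA; rewrite -(big_filter _ (fun b : {ffun 'I_d -> 'I_n.+1} => ofb b \in A)).
rewrite -(big_map (@ofb n) xpredT T); apply: perm_big; apply: uniq_perm.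
- exact: fset_uniq.
- by rewrite map_inj_uniq ?filter_uniq ?index_enum_uniq//; exact: ofb_inj.
move=> al; apply/idP/mapP => [Aal|[b + ->]]; last by rewrite mem_filter => /andP[].
have [b Eb] := ofb_surj (HA al Aal); exists b => //.
by rewrite mem_filter Eb Aal mem_index_enum.
Qed.

Lemma geom_le n (q : R) : 0 <= q -> q <= 2^-1 -> \sum_(k < n) q ^+ k <= 2.
Proof.
move=> q0 q2.
have : \sum_(k < n) q ^+ k <= \sum_(k < n) (2^-1 : R) ^+ k.
  by apply: ler_sum => k _; rewrite lerXn2r ?nnegrE// invr_ge0.
move/le_trans; apply.
suff : \sum_(k < n) (2^-1 : R) ^+ k <= 2 - 2 * 2^-1 ^+ n.
  by move/le_trans; apply; rewrite gerBl mulr_ge0// exprn_ge0// invr_ge0.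
elim: n => [|n IH]; first by rewrite big_ord0 expr0; lra.
by rewrite big_ord_recr /= exprS; move: (2^-1 ^+ n) IH => z; lra.
Qed.

Lemma box_geom n : \sum_(b : {ffun 'I_d -> 'I_n.+1}) (2^-1 : R) ^+ mlength (ofb b) <= 2 ^+ d.
Proof.
have E (b : {ffun 'I_d -> 'I_n.+1}) : (2^-1 : R) ^+ mlength (ofb b) = \prod_i (2^-1 : R) ^+ (b i).
  rewrite /mlength (big_morph (fun n => (2^-1 : R) ^+ n) (exprD _) (expr0 _)).
  by apply: eq_bigr => i _; rewrite ffunE.
rewrite (eq_bigr _ (fun b _ => E b)) -(bigA_distr_bigA (fun _ (k : 'I_n.+1) => (2^-1 : R) ^+ k)).
rewrite prodr_const card_ord lerXn2r ?nnegrE//.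
  by apply: sumr_ge0 => k _; rewrite exprn_ge0// invr_ge0.
by apply: geom_le; rewrite ?invr_ge0.
Qed.

(** [4^-1] is split as [2^-1 * 2^-1]: one factor gives the smallness [2^-1 ^+ m], the other is
    summable over all multi-indices with sum at most [2 ^+ d]. Hence the ratio [4^-1] required of
    all terms later. *)
Lemma box_tail n m (P : pred {ffun 'I_d -> 'I_n.+1}) :
  (forall b, P b -> (m <= mlength (ofb b))%N) ->
  \sum_(b : {ffun 'I_d -> 'I_n.+1} | P b) (4^-1 : R) ^+ mlength (ofb b) <= 2^-1 ^+ m * 2 ^+ d.
Proof.
move=> HP; have h4 : (4^-1 : R) = 2^-1 * 2^-1 by rewrite -invfM -natrM.
apply: le_trans (_ : \sum_(b : {ffun 'I_d -> 'I_n.+1} | P b) 2^-1 ^+ m * (2^-1 : R) ^+ mlength (ofb b) <= _).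
  apply: ler_sum => b /HP mb; rewrite h4 exprMn ler_wpM2r ?exprn_ge0 ?invr_ge0//.
  by rewrite ler_wiXn2l ?invr_ge0 ?invf_le1 ?ler1n.
rewrite -big_distrr /= ler_wpM2l ?exprn_ge0 ?invr_ge0//.
apply: le_trans (box_geom n); rewrite [leRHS](bigID P) /= lerDl.
by apply: sumr_ge0 => b _; rewrite exprn_ge0// invr_ge0.
Qed.

End MultiIndex.

Lemma cont_sum {R : realType} (T : topologicalType) (I : Type) (r : seq I) (G : I -> T -> R) :
  (forall i, continuous (G i)) -> continuous (fun x => \sum_(i <- r) G i x).
Proof.
move=> cG; elim: r => [|i r IH].
  by under eq_fun do rewrite big_nil; exact: cont_cst.
under eq_fun do rewrite big_cons -[G i _]mul1r.
exact: cont_lin.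
Qed.

Section Enorm.
Context {R : realType} {d : nat}.

Lemma normv_enorm (h : 'rV[R]_d) : `|h| <= enorm h.
Proof.
apply/normv_leP => [|i]; first exact: sqrtr_ge0.
rewrite -sqrtr_sqr /enorm ler_wsqrtr// (bigD1 i)//= lerDl.
by apply: sumr_ge0 => j _; exact: sqr_ge0.
Qed.

Lemma enorm_cont : continuous (@enorm R d).
Proof.
move=> x; apply: (@continuous_comp _ _ _ (fun x : 'rV[R]_d => \sum_(i < d) x 0 i ^+ 2) Num.sqrt); last first.
  exact: sqrt_continuous.
have K (i : 'I_d) : continuous (fun x : 'rV[R]_d => x 0 i ^+ 2).
  have c2 : continuous (fun t : R => t ^+ 2) by move=> t; exact: exprn_continuous.
  exact: (cont_coord c2).
exact: (cont_sum K).
Qed.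

Lemma enorm_ball (x y : 'rV[R]_d) r : enorm (y - x) < r ->
  exists2 dl, 0 < dl & forall z, `|y - z| < dl -> enorm (z - x) < r.
Proof.
move=> h; have c := cont_shift (h := - x) enorm_cont.
have /cont_ballP/(_ ((r - enorm (y - x)) / 2))[|dl dl0 Hd] := c y.
  by rewrite divr_gt0// subr_gt0.
by exists dl => // z /Hd; rewrite ler_norml => /andP[h1 h2]; lra.
Qed.

End Enorm.

Section MonotoneTail.
Context {R : realType}.

Lemma mono_tail (D : nat -> R) B : (forall n, D n <= D n.+1) -> (forall n, D n <= B) ->
  exists2 e : nat -> R, e @ \oo --> 0 & forall n k, D (n + k)%N - D n <= e n.
Proof.
move=> Dm DB; have cD : cvgn D.
  apply: nondecreasing_is_cvgn; first exact/nondecreasing_seqP.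
  by exists B => _ [n _ <-].
exists (fun n => limn D - D n).
  by rewrite -(subrr (limn D)); apply: cvgB => //; exact: cvg_cst.
move=> n k; rewrite lerD2r; apply: nondecreasing_cvgn_le => //.
exact/nondecreasing_seqP.
Qed.

End MonotoneTail.

(** * Limits of the kernels under a real functional *)

Section Core.
Context {R : realType} {d : nat}.
Variables (M : nat -> R) (A H : R).
Hypothesis M_gt0 : forall p, 0 < M p.
Hypothesis M1 : weight_M1 M.
Hypothesis H_ge1 : 1 <= H.
Hypothesis A_gt0 : 0 < A.
Hypothesis M2 : forall p q, M (p + q)%N <= A * H ^+ (p + q) * M p * M q.
Variables (a beta : nat -> R) (w : R).
Hypothesis a_gt0 : forall p, 0 < a p.
Hypothesis beta_gt0 : forall p, 0 < beta p.
Hypothesis beta_sum : series beta @ \oo --> w.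
Hypothesis a_le : forall p, a p <= beta p.
Hypothesis beta_big : forall kap, exists p0, forall p, (p0 <= p)%N -> kap / mu M p <= beta p.
Local Notation V := 'rV[R]_d.
Implicit Types (u : V -> R) (al : multiindex d) (y : V).

Variables (star : ultra_case) (Lf : (V -> R) -> R).
Hypothesis hlin : Llin M star Lf.
Hypothesis hcont : Lcont M star Lf.

Variables (W : set V) (omega : V -> R) (r : R).
Hypothesis omega_gt0 : forall x, W x -> 0 < omega x.

(** The seminorm in which the kernels converge: values of [Lf] on translates to points of the
    [r]-neighbourhood of [W], measured by [omega] at the base point in [W]. *)
Definition Qb u (c : R) : Prop := forall x h, W x -> enorm h < r ->
  `|Lf (fun z => u (z - (x + h)))| <= c * omega x.

Lemma Qb_lin k u v c c' : tcls M star u -> tcls M star v -> Qb u c -> Qb v c' ->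
  Qb (fun x => k * u x + v x) (`|k| * c + c').
Proof.
move=> tu tv Hu Hv x h Wx hr.
have -> : Lf (fun z => k * u (z - (x + h)) + v (z - (x + h))) =
  k * Lf (fun z => u (z - (x + h))) + Lf (fun z => v (z - (x + h))).
  by apply: hlin; exact: tcls_shift.
apply: le_trans (ler_normD _ _) _; rewrite normrM mulrDl -mulrA.
by apply: lerD; [rewrite ler_wpM2l//; exact: Hu|exact: Hv].
Qed.

Lemma Qb_sum (I : Type) (s : seq I) (P : pred I) (k : I -> R) (u : I -> V -> R) c :
  (forall i, tcls M star (u i)) -> (forall i, P i -> 0 <= k i) -> (forall i, P i -> Qb (u i) c) ->
  Qb (fun x => \sum_(i <- s | P i) k i * u i x) ((\sum_(i <- s | P i) k i) * c).
Proof.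
move=> tu k0 Hu; elim: s => [|i s IH].
  under eq_fun do rewrite big_nil; rewrite big_nil mul0r => x h Wx hr.
  by rewrite (Lf0 hlin) normr0 mul0r.
have ts : tcls M star (fun x => \sum_(j <- s | P j) k j * u j x).
  have := tcls_sum M_gt0 [seq j <- s | P j] k tu.
  by under eq_fun do rewrite big_filter.
rewrite big_cons; under eq_fun do rewrite big_cons.
case: ifP => // Pi; rewrite mulrDl -{2}(ger0_norm (k0 i Pi)).
exact: Qb_lin (Hu i Pi) IH.
Qed.

Lemma Qb_add u v c c' : tcls M star u -> tcls M star v -> Qb u c -> Qb v c' ->
  Qb (fun x => u x + v x) (c + c').
Proof.
move=> tu tv Hu Hv; have := Qb_lin 1 tu tv Hu Hv; rewrite normr1 mul1r.
by under eq_fun do rewrite mul1r.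
Qed.

Definition gw n s j := Aw a s (Tt beta n j.+2).
Definition wt n (sg : 'I_d -> seq bool) : V -> R := tens (fun i => gw n (sg i) 0).

Lemma gw_tower n s : tower (gw n s).
Proof.
have tT := Tt_tower beta_gt0 beta_sum n.
exact: (Aw_tower a_gt0 s (towerS 2 tT)).
Qed.

Definition gsum n k j x : R :=
  \sum_(s : n.-tuple bool | count id s == k) cw a s * gw n s j x.

Lemma tower_sum (I : Type) (s : seq I) (P : pred I) (k : I -> R) (g : I -> nat -> R -> R) :
  (forall i, tower (g i)) -> tower (fun j x => \sum_(i <- s | P i) k i * g i j x).
Proof.
move=> tg; elim: s => [|i s IH] j x.
  under [X in dd1 X]eq_fun do rewrite big_nil; rewrite big_nil => e e0.
  by exists 1 => // t _; rewrite mulr0 !subrr normr0 mulr_ge0// ltW.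
rewrite big_cons; under [X in dd1 X]eq_fun do rewrite big_cons.
case: (P i); [exact: (dd1D (k i) (tg i j x) (IH j x))|exact: IH].
Qed.

Lemma gsum_tower n k : tower (gsum n k).
Proof. by apply: tower_sum => s; exact: gw_tower. Qed.

Lemma w_ge0 : 0 <= w.
Proof. exact: le_trans (@tl_ge0 R beta w beta_gt0 beta_sum 0%N) (@tl_le R beta w beta_gt0 0%N). Qed.

Lemma gw_supp n s j x : x <= 0 \/ 2 * w <= x -> gw n s j x = 0.
Proof. exact: (Aw_Tt_supp a_gt0 beta_gt0 beta_sum a_le). Qed.

Lemma tens_tcls (g : 'I_d -> nat -> R -> R) : (forall i, tower (g i)) ->
  (forall i x, x <= 0 \/ 2 * w <= x -> g i 0%N x = 0) ->
  (forall l, 0 < l -> exists C, forall i j x, `|g i j x| <= C * (l ^+ j * M j)) ->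
  tcls M Beurling (tens (fun i => g i 0%N) : V -> R).
Proof.
move=> tg g0 Hg; split; first by have [] := @tens_jet R d g tg.
  by exists (2 * w); apply: tens_supp => //; rewrite mulr_ge0 ?w_ge0.
move=> l l0; have [C HC] := Hg l l0.
exists (`|C| ^+ d * Mc (d := d) M); apply: tens_ub => //; first exact: ltW.
move=> i j x; apply: le_trans (HC i j x) _; rewrite ler_wpM2r ?ler_norm//.
by rewrite mulr_ge0 ?exprn_ge0 ?(ltW l0) ?(ltW (M_gt0 _)).
Qed.

Lemma wt_tcls n sg : tcls M Beurling (wt n sg).
Proof.
apply: (tens_tcls (g := fun i => gw n (sg i))).
- by move=> i; exact: gw_tower.
- by move=> i x; exact: gw_supp.
move=> l l0.
have [C HC] := Aw_all_levels M_gt0 H_ge1 M2 a_gt0 beta_gt0 beta_sum beta_big n l0.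
by exists C => i j x; exact: HC.
Qed.

(* The undecomposed mollifier is the sum over [al] of the [al]-th derivatives of [Gn n al]. *)
Definition Gn n al : V -> R := tens (fun i => gsum n (al i) 0).

Lemma Gn_tcls n al : tcls M Beurling (Gn n al).
Proof.
apply: (tens_tcls (g := fun i => gsum n (al i))).
- by move=> i; exact: gsum_tower.
- by move=> i x Hx; apply: big1 => s _; rewrite gw_supp// mulr0.
move=> l l0.
have [C HC] := Aw_all_levels M_gt0 H_ge1 M2 a_gt0 beta_gt0 beta_sum beta_big n l0.
exists (\sum_(s : n.-tuple bool) cw a s * C) => i j x.
apply: le_trans (ler_norm_sum _ _ _) _; rewrite big_distrl /=.
have nn s : 0 <= cw a s * C * (l ^+ j * M j).
  by rewrite -mulrA mulr_ge0 ?cw_ge0//; exact: le_trans (normr_ge0 _) (HC [::] j 0).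
apply: le_trans (_ : \sum_(s : n.-tuple bool | count id s == al i) cw a s * C * (l ^+ j * M j) <= _).
  apply: ler_sum => s _; rewrite normrM (ger0_norm (cw_ge0 a_gt0 s)) -mulrA.
  by apply: ler_wpM2l; [exact: cw_ge0|exact: HC].
rewrite [leRHS](bigID (fun s : n.-tuple bool => count id s == al i)) /= lerDl.
by apply: sumr_ge0 => s _; exact: nn.
Qed.

(** The sum of the coefficients in the expansion of [Gn n al] over words, one word per coordinate
    ([En_expand]). It increases with [n], and its bound becomes the decay of the coefficient
    functions. *)
Definition En n al : R := \prod_i ek a n (al i).

Let fam n al := family (fun i : 'I_d => [pred s : n.-tuple bool | count id s == al i]).

Lemma Gn_expand n al x : Gn n al x =
  \sum_(sg in fam n al) (\prod_i cw a (sg i)) * wt n (fun i => sg i) x.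
Proof.
rewrite /Gn /tens /gsum (bigA_distr_big_dep _ _) /=.
by apply: eq_bigr => sg _; rewrite big_split.
Qed.

Lemma En_expand n al : En n al = \sum_(sg in fam n al) (\prod_i cw a (sg i)).
Proof. by rewrite /En /ek (bigA_distr_big_dep _ _). Qed.

Variables (B0 : R) (delta : nat -> R) (Bd : R).
Hypothesis HQ0 : Qb (wt 0 (fun=> [::])) B0.
Hypothesis HQ : forall n (sg : 'I_d -> n.-tuple bool) (b : 'I_d -> bool),
  Qb (fun x => wt n.+1 (fun i => b i :: sg i) x - wt n (fun i => sg i) x) (delta n).
Hypothesis delta_ge0 : forall n, 0 <= delta n.
Hypothesis delta_sum : forall N, \sum_(n < N) delta n <= Bd.

Definition BB := B0 + Bd.

Hypothesis B0_ge0 : 0 <= B0.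

Lemma BB_ge0 : 0 <= BB.
Proof. by have := delta_sum 0; rewrite big_ord0 => h; rewrite addr_ge0. Qed.

Lemma Qb_mono u c c' : c <= c' -> Qb u c -> Qb u c'.
Proof.
move=> cc' Hu x h Wx hr; apply: le_trans (Hu x h Wx hr) _.
by rewrite ler_wpM2r// ltW// omega_gt0.
Qed.

(** Removing the heads of all [d] words at once leads back through the stages to the empty words;
    the increments along the way sum to at most [Bd], uniformly in the words. *)
Lemma Qb_wt n (sg : 'I_d -> n.-tuple bool) : Qb (wt n (fun i => sg i)) BB.
Proof.
suff K : Qb (wt n (fun i => sg i)) (B0 + \sum_(k < n) delta k).
  by apply: Qb_mono K; rewrite lerD2l.
elim: n sg => [|n IH] sg.
  rewrite big_ord0 addr0; have -> : (fun i => tval (sg i)) = (fun=> [::]); last exact: HQ0.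
  by apply/funext => i; rewrite tuple0.
rewrite big_ord_recr /= addrA addrC.
pose sg' i := [tuple of behead (sg i)]; pose b i := thead (sg i).
have E i : tval (sg i) = b i :: sg' i by rewrite [sg i in LHS]tuple_eta.
have -> : wt n.+1 (fun i => sg i) = (fun x =>
  (wt n.+1 (fun i => b i :: sg' i) x - wt n (fun i => sg' i) x) + wt n (fun i => sg' i) x).
  apply/funext => x; rewrite subrK; congr (wt _ _ x).
  by apply/funext => i; exact: E.
apply: Qb_add; [|exact: tcls_weaken _ (wt_tcls _ _)|exact: HQ|exact: IH].
by apply: tcls_sub => //; apply: tcls_weaken; exact: wt_tcls.
Qed.

Lemma cwprod_ge0 n (sg : {ffun 'I_d -> n.-tuple bool}) : 0 <= \prod_i cw a (sg i).
Proof. by apply: prodr_ge0 => i _; exact: cw_ge0. Qed.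

Lemma Qb_Gn n al : Qb (Gn n al) (En n al * BB).
Proof.
have -> : Gn n al = (fun x => \sum_(sg in fam n al) (\prod_i cw a (sg i)) * wt n (fun i => sg i) x).
  by apply/funext => x; exact: Gn_expand.
rewrite En_expand; apply: Qb_sum => [sg|sg _|sg _].
- exact: tcls_weaken _ (wt_tcls _ _).
- exact: cwprod_ge0.
- exact: Qb_wt.
Qed.

Let ext n (sg : {ffun 'I_d -> n.-tuple bool}) : {ffun 'I_d -> n.+1.-tuple bool} :=
  [ffun i => [tuple of false :: sg i]].
Let res n (sg : {ffun 'I_d -> n.+1.-tuple bool}) : {ffun 'I_d -> n.-tuple bool} :=
  [ffun i => [tuple of behead (sg i)]].

Lemma sum_ext n al (F : {ffun 'I_d -> n.+1.-tuple bool} -> R) :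
  \sum_(sg in fam n.+1 al) F sg =
  \sum_(sg in fam n al) F (ext sg) +
  \sum_(sg in fam n.+1 al | ~~ [forall i, ~~ thead (sg i)]) F sg.
Proof.
rewrite (bigID (fun sg : {ffun 'I_d -> n.+1.-tuple bool} => [forall i, ~~ thead (sg i)])) /=.
congr (_ + _).
rewrite (reindex_onto (@ext n) (@res n)) /=; last first.
  move=> sg /andP[_ /forallP Hs]; apply/ffunP => i; rewrite !ffunE; apply: val_inj => /=.
  by rewrite [sg i in RHS]tuple_eta /= (negPf (Hs i)).
apply: eq_bigl => sg.
have -> : res (ext sg) == sg by apply/eqP/ffunP => i; rewrite !ffunE; apply: val_inj.
rewrite andbT; apply/andP/idP => [[/familyP Hf _]|/familyP Hf].
  by apply/familyP => i; have := Hf i; rewrite !inE ffunE.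
split; first by apply/familyP => i; have := Hf i; rewrite !inE ffunE.
by apply/forallP => i; rewrite ffunE theadE.
Qed.

Lemma cw_ext n (sg : {ffun 'I_d -> n.-tuple bool}) :
  \prod_i cw a (ext sg i) = \prod_i cw a (sg i).
Proof. by apply: eq_bigr => i _; rewrite ffunE /= mul1r. Qed.

(** Words whose new letters are all [false] carry the coefficients of stage [n] and are matched with
    the old words, leaving increments bounded by [delta n]. The words with some new [true] letter
    have total coefficient [En n.+1 al - En n al], which telescopes in [n]. *)
Lemma Qb_GnS n al : Qb (fun x => Gn n.+1 al x - Gn n al x)
  (En n al * delta n + (En n.+1 al - En n al) * BB).
Proof.
have E x : Gn n.+1 al x - Gn n al x =
  (\sum_(sg in fam n al) (\prod_i cw a (sg i)) *
     (wt n.+1 (fun i => false :: sg i) x - wt n (fun i => sg i) x)) +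
  \sum_(sg in fam n.+1 al | ~~ [forall i, ~~ thead (sg i)])
     (\prod_i cw a (sg i)) * wt n.+1 (fun i => sg i) x.
  rewrite !Gn_expand sum_ext addrAC; congr (_ + _).
  rewrite -sumrB; apply: eq_bigr => sg _; rewrite cw_ext mulrBr; congr (_ * wt _ _ x - _).
  by apply/funext => i; rewrite ffunE.
have -> : En n.+1 al - En n al =
  \sum_(sg in fam n.+1 al | ~~ [forall i, ~~ thead (sg i)]) (\prod_i cw a (sg i)).
  rewrite !En_expand (sum_ext al (fun sg => \prod_i cw a (sg i))).
  have -> : \sum_(sg in fam n al) \prod_i cw a (ext sg i) = \sum_(sg in fam n al) \prod_i cw a (sg i).
    by apply: eq_bigr => sg _; exact: cw_ext.
  by rewrite addrC addrA addNr add0r.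
pose S1 (x : V) := \sum_(sg in fam n al) (\prod_i cw a (sg i)) *
     (wt n.+1 (fun i => false :: sg i) x - wt n (fun i => sg i) x).
pose S2 (x : V) := \sum_(sg in fam n.+1 al | ~~ [forall i, ~~ thead (sg i)])
     (\prod_i cw a (sg i)) * wt n.+1 (fun i => sg i) x.
have -> : (fun x => Gn n.+1 al x - Gn n al x) = (fun x => S1 x + S2 x).
  by apply/funext => x; exact: E.
rewrite En_expand.
have tw m s : tcls M star (wt m s) by apply: tcls_weaken; exact: wt_tcls.
have td (sg : {ffun 'I_d -> n.-tuple bool}) :
  tcls M star (fun x => wt n.+1 (fun i => false :: sg i) x - wt n (fun i => sg i) x).
  by apply: tcls_sub.
apply: (@Qb_add S1 S2).
- rewrite (_ : S1 = (fun x => \sum_(sg <- [seq sg <- index_enum {ffun 'I_d -> n.-tuple bool} | sg \in fam n al]) (\prod_i cw a (sg i)) *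
     (wt n.+1 (fun i => false :: sg i) x - wt n (fun i => sg i) x))); first exact: tcls_sum.
  by apply/funext => x; rewrite big_filter.
- rewrite (_ : S2 = (fun x => \sum_(sg <- [seq sg <- index_enum {ffun 'I_d -> n.+1.-tuple bool} | (sg \in fam n.+1 al) && ~~ [forall i, ~~ thead (sg i)]]) (\prod_i cw a (sg i)) * wt n.+1 (fun i => sg i) x)); first exact: tcls_sum.
  by apply/funext => x; rewrite big_filter.
- apply: Qb_sum.
  + by move=> sg; exact: td.
  + by move=> sg _; exact: cwprod_ge0.
  + by move=> sg _; exact: (HQ sg (fun=> false)).
- apply: Qb_sum.
  + by move=> sg; exact: tw.
  + by move=> sg _; exact: cwprod_ge0.
  + by move=> sg _; exact: Qb_wt.
Qed.

Variable Ebar : multiindex d -> R.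
Hypothesis HE : forall n al, En n al <= Ebar al.

Lemma En_ge0 n al : 0 <= En n al.
Proof. by apply: prodr_ge0 => i _; exact: ek_ge0. Qed.

Lemma En_mono n al : En n al <= En n.+1 al.
Proof. by apply: ler_prod => i _; rewrite ek_ge0//=; exact: ek_mono. Qed.

Lemma Ebar_ge0 al : 0 <= Ebar al.
Proof. exact: le_trans (En_ge0 0 al) (HE 0 al). Qed.

Definition Fn n al y : R := Lf (fun z => Gn n al (z - y)).

(** The increments are dominated by those of a bounded nondecreasing sequence [D]: the [delta i] are
    summable and the differences of [En] telescope below [Ebar al]. The rate is uniform in the point
    after division by [omega]. *)
Lemma Fn_rate al : exists2 e : nat -> R, e @ \oo --> 0 & forall n k x h,
  W x -> enorm h < r -> `|Fn (n + k) al (x + h) - Fn n al (x + h)| <= e n * omega x.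
Proof.
pose D n := \sum_(i < n) (En i al * delta i + (En i.+1 al - En i al) * BB).
have Dm n : D n <= D n.+1.
  rewrite /D big_ord_recr /= lerDl addr_ge0//; first by rewrite mulr_ge0// En_ge0.
  by rewrite mulr_ge0 ?BB_ge0// subr_ge0 En_mono.
have DB n : D n <= Ebar al * Bd + Ebar al * BB.
  rewrite /D big_split /=; apply: lerD.
    apply: le_trans (_ : \sum_(i < n) Ebar al * delta i <= _).
      by apply: ler_sum => i _; rewrite ler_wpM2r.
    by rewrite -big_distrr /=; apply: ler_wpM2l; [exact: Ebar_ge0|exact: delta_sum].
  rewrite -big_distrl /=; apply: ler_wpM2r; first exact: BB_ge0.
  rewrite -(big_mkord xpredT (fun i => En i.+1 al - En i al)) telescope_sumr//.
  by apply: le_trans (HE n al); rewrite gerBl En_ge0.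
have [e e0 He] := mono_tail Dm DB; exists e => // n k x h Wx hr.
suff K : `|Fn (n + k) al (x + h) - Fn n al (x + h)| <= (D (n + k)%N - D n) * omega x.
  by apply: le_trans K _; rewrite ler_wpM2r// ltW// omega_gt0.
elim: k => [|k IH]; first by rewrite addn0 !subrr normr0 mul0r.
rewrite addnS; have := Qb_GnS (n + k) al Wx hr.
have tg m : tcls M star (fun z => Gn m al (z - (x + h))).
  by apply: tcls_shift; exact: tcls_weaken (Gn_tcls _ _).
rewrite (Lf_sub hlin (tg _) (tg _)) -/(Fn _ _ _) -/(Fn _ _ _) => Hk.
rewrite -(subrKA (Fn (n + k) al (x + h))); apply: le_trans (ler_normD _ _) _.
apply: le_trans (lerD Hk IH) _; rewrite -mulrDl [D _.+1]/D big_ord_recr /= -/(D _).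
by rewrite le_eqVlt; apply/orP; left; apply/eqP; ring.
Qed.

Definition Fal al y : R := limn (fun n => Fn n al y).

Lemma Fal_rate al : exists2 e : nat -> R, e @ \oo --> 0 & forall n x h,
  W x -> enorm h < r -> `|Fal al (x + h) - Fn n al (x + h)| <= e n * omega x.
Proof.
have [e e0 He] := Fn_rate al; exists e => // n x h Wx hr.
have [|_] := @cauchy_rate R (fun n => Fn n al (x + h)) (fun n => e n * omega x)
   (fun k j => He k j x h Wx hr); last by apply.
by rewrite -(mul0r (omega x)); exact: cvgMr_tmp.
Qed.

Lemma cvg_small (e : nat -> R) eps N : e @ \oo --> 0 -> 0 < eps ->
  exists2 n, (N <= n)%N & forall m, (n <= m)%N -> e m < eps.
Proof.
move=> e0 eps0; have /cvgrPdist_lt/(_ _ eps0)[n0 _ Hn] := e0.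
exists (N + n0)%N; first exact: leq_addr.
move=> m nm; have := Hn m (leq_trans (leq_addl _ _) nm); rewrite sub0r normrN.
by apply: le_lt_trans; exact: ler_norm.
Qed.

Lemma Fn_bound n al x h : W x -> enorm h < r -> `|Fn n al (x + h)| <= En n al * BB * omega x.
Proof. exact: Qb_Gn. Qed.

Lemma Fal_bound al e x h : (forall n, En n al <= e) -> W x -> enorm h < r ->
  `|Fal al (x + h)| <= e * BB * omega x.
Proof.
move=> He' Wx hr; apply: le_of_eps => eps eps0; have [e1 e0 He] := Fal_rate al.
have o0 := omega_gt0 Wx.
have [n _ Hn] := cvg_small 0 e0 (divr_gt0 eps0 o0).
have := He n x h Wx hr; have := Hn n (leqnn n); rewrite ltr_pdivlMr// => h1 h2.
rewrite -(subrK (Fn n al (x + h)) (Fal al (x + h))) addrC.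
apply: le_trans (ler_normD _ _) _; apply: lerD; last exact: le_trans h2 (ltW h1).
apply: le_trans (Fn_bound n al Wx hr) _.
by rewrite ler_wpM2r ?(ltW o0)// ler_wpM2r ?BB_ge0.
Qed.

Lemma Fn_cont n al : continuous (Fn n al).
Proof. by apply: (Ltrans_cont M_gt0 H_ge1 A_gt0 M2 hlin hcont); exact: Gn_tcls. Qed.

Lemma Fal_cont al y : thicken W r y -> {for y, continuous (Fal al)}.
Proof.
move=> [x Wx yx]; apply/cont_ballP => eps eps0; have [e e0 He] := Fal_rate al.
have o0 := omega_gt0 Wx; have e3 : 0 < eps / 3 by rewrite divr_gt0.
have [n _ Hn] := cvg_small 0 e0 (divr_gt0 e3 o0).
have := Hn n (leqnn n); rewrite ltr_pdivlMr// => hn.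
have near z : enorm (z - x) < r -> `|Fal al z - Fn n al z| <= eps / 3.
  move=> zx; have := He n x (z - x) Wx zx; rewrite [x + _]addrC subrK => h.
  exact: le_trans h (ltW hn).
have [d1 d10 H1] := enorm_ball yx.
have /cont_ballP/(_ _ e3)[d2 d20 H2] := @Fn_cont n al y.
exists (Num.min d1 d2); first by rewrite lt_min d10.
move=> z; rewrite lt_min => /andP[z1 z2].
have h1 := near y yx; have h2 := near z (H1 z z1); have h3 := H2 z z2.
rewrite distrC in h2.
have -> : Fal al y - Fal al z = (Fal al y - Fn n al y) + (Fn n al y - Fn n al z) + (Fn n al z - Fal al z) by ring.
apply: le_trans (ler_normD _ _) _; apply: le_trans (lerD (ler_normD _ _) (lexx _)) _; lra.
Qed.

(** The form in which compactness of the support inside [thicken W r] is used: where [u] does not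
    vanish locally, a point of [W] with controlled value of [omega] is near. The bound [Om] comes
    from [cover_compact]. *)
Definition covered u Om : Prop := 0 < Om /\ forall y,
  (exists2 dl, 0 < dl & forall z, `|y - z| < dl -> u z = 0) \/
  (exists2 x, W x & enorm (y - x) < r /\ omega x <= Om).

Lemma gsum_diag n x : \sum_(k < n.+1) gsum n k k x = Tt beta n 2 x.
Proof.
have tT := Tt_tower beta_gt0 beta_sum n.
have := words_id a_gt0 n x (towerS 2 tT); rewrite /= => <-.
rewrite /gsum (exchange_big_dep xpredT) //=; apply: eq_bigr => s _.
have sn : (count id s < n.+1)%N by rewrite ltnS -{2}(size_tuple s) count_size.
by rewrite (big_pred1 (Ordinal sn)).
Qed.

(** The derivatives on [u] are moved to [Gn n al] inside the convolution; expanding the product over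
    the coordinates, the sum over the box is the mollifier by [words_id]. No sign appears, since
    convolution commutes with derivatives. *)
Lemma Lf_conv_sum n u L : 0 < L -> rsmooth u -> supp_in L u ->
  Lf (conv (tens (fun=> Tt beta n 2)) u) =
  \sum_(b : {ffun 'I_d -> 'I_n.+1}) rintegral (fun y => Fn n (ofb b) y * rmderiv (ofb b) u y).
Proof.
move=> L0 su u0.
have CC_al al : CC L (rmderiv al u) by exact: rder_CC.
have E : conv (tens (fun=> Tt beta n 2)) u =
  (fun x => \sum_(b : {ffun 'I_d -> 'I_n.+1}) 1 * conv (Gn n (ofb b)) (rmderiv (ofb b) u) x).
  apply/funext => x.
  have K b : conv (Gn n (ofb b)) (rmderiv (ofb b) u) x =
     conv (tens (fun i => gsum n (ofb b i) (ofb b i))) u x.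
    have [sG [LG G0] _] := Gn_tcls n (ofb b).
    rewrite /rmderiv (conv_parts _ _ L0 sG G0 su u0).
    have [_ ->] := tens_jet (g := fun i => gsum n (ofb b i)) (fun i => gsum_tower n (ofb b i)).
    by congr (conv _ u x); congr tens; apply/funext => i; rewrite count_aseq.
  rewrite (eq_bigr (fun b : {ffun 'I_d -> 'I_n.+1} =>
     conv (tens (fun i => gsum n (b i) (b i))) u x)); last first.
    move=> b _; rewrite mul1r K; congr (conv _ u x); congr tens.
    by apply/funext => i; rewrite ffunE.
  rewrite /conv; have cT (b : {ffun 'I_d -> 'I_n.+1}) :
     continuous (tens (fun i => gsum n (b i) (b i)) : V -> R).
    by apply: cont_prod => i; apply: cont_coord; exact: tower_cont (gsum_tower _ _).
  have [_ <-] := @rint_sum R d L _ (index_enum {ffun 'I_d -> 'I_n.+1}) xpredT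
    (fun b y => tens (fun i => gsum n (b i) (b i)) (x - y) * u y) L0
    (fun b _ => conv_CC x (cT b) (rder_CC [::] su u0)).
  congr rintegral; apply/funext => y; rewrite -big_distrl /=; congr (_ * _).
  rewrite /tens -(bigA_distr_bigA (fun (i : 'I_d) (k : 'I_n.+1) => gsum n k k ((x - y) 0 i))).
  by apply: eq_bigr => i _; rewrite gsum_diag.
have tc b : tcls M star (conv (Gn n (ofb b)) (rmderiv (ofb b) u)).
  by apply: tcls_weaken; exact: (tcls_conv L0 (Gn_tcls _ _) (CC_al _)).
rewrite E (Lf_sum M_gt0 hlin)//; apply: eq_bigr => b _; rewrite mul1r.
by rewrite (Lf_conv M_gt0 H_ge1 A_gt0 M2 hlin hcont L0 (Gn_tcls _ _) (CC_al _)).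
Qed.

Lemma moll_tcls n : tcls M Beurling (tens (fun=> Tt beta n 2) : V -> R).
Proof. exact: (wt_tcls n (fun=> [::])). Qed.

Lemma Lf_conv_cvg u : tcls M star u -> forall eps, 0 < eps ->
  exists n0, forall n, (n0 <= n)%N ->
    `|Lf (conv (tens (fun=> Tt beta n 2)) u) - Lf u| <= eps.
Proof.
move=> tu eps eps0; have [K K0 HK] := Lf_moll M_gt0 H_ge1 A_gt0 M2 hlin hcont tu.
pose z := Num.min 1 (eps / (K + 1)).
have K1 : 0 < K + 1 by rewrite ltr_wpDl.
have z0 : 0 < z by rewrite lt_min ltr01 divr_gt0.
have [n0 _ Hn] := cvg_small 0 (tl_cvg beta_sum) z0.
exists n0 => n /Hn; rewrite lt_min => /andP[t1 t2].
have tT := Tt_tower beta_gt0 beta_sum n.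
apply: le_trans (HK (fun k => Tt beta n (2 + k)%N) (Tt beta n 1) (tl beta w n) _ _ _ _ _ _ _ _) _.
- exact: towerS.
- exact: tl_ge0.
- exact: ltW.
- by move=> t; exact: (tT 1%N).
- by move=> t; exact: (Tt_supp beta_gt0 beta_sum).
- by move=> t; exact: (Tt2_ge0 beta_gt0 beta_sum).
- by move=> b c b0 ec; rewrite (Tt1_hi beta_gt0 beta_sum ec) (Tt1_lo beta_gt0 beta_sum n b0) subr0.
- exact: moll_tcls.
apply: le_trans (_ : K * (eps / (K + 1)) <= _); first by rewrite ler_wpM2l// ltW.
by rewrite mulrCA ler_piMr ?(ltW eps0)// ler_pdivrMr// mul1r lerDl.
Qed.

(** Three errors: replacing limits by stage [n] on the finite set [B], the terms of the box outside
    [B], and the mollification of [u]. *)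
Lemma core_rep u Om C : tcls M star u -> covered u Om ->
  (forall n al y, En n al * `|rmderiv al u y| <= C * 4^-1 ^+ mlength al) ->
  forall eps, 0 < eps -> exists m : nat, forall B : {fset multiindex d},
    (forall al, (mlength al < m)%N -> al \in B) ->
    `|\sum_(al <- B) rintegral (fun y => Fal al y * rmderiv al u y) - Lf u| <= eps.
Proof.
move=> tu [Om0 Hcov] HC eps eps0; have [su [L' u0'] _] := tu.
pose L := `|L'| + 1; have L0 : 0 < L by rewrite ltr_wpDl.
have u0 : supp_in L u.
  by apply: supp_in_mono u0'; apply: le_trans (ler_norm _) _; rewrite lerDl.
have CCu al : CC L (rmderiv al u) by exact: rder_CC.
have CCF n al : CC L (fun y => Fn n al y * rmderiv al u y).
  by apply: CC_mul => //; exact: Fn_cont.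
have C0 : 0 <= C.
  have := HC 0%N [ffun=> 0%N] 0; have -> : mlength [ffun=> 0%N] = 0%N.
    by move=> n; rewrite /mlength big1// => i _; rewrite ffunE.
  by rewrite expr0 mulr1; apply: le_trans; rewrite mulr_ge0 ?En_ge0.
have V0 : 0 < (2 * L) ^+ d by rewrite exprn_gt0// mulr_gt0.
pose T al := rintegral (fun y => Fal al y * rmderiv al u y); pose Tn n al := rintegral (fun y => Fn n al y * rmderiv al u y).
have near al eps1 : 0 < eps1 -> exists n0, forall n, (n0 <= n)%N -> forall y,
    `|Fal al y * rmderiv al u y - Fn n al y * rmderiv al u y| <= eps1.
  move=> e10; have [e e0 He] := Fal_rate al; have [D D0 HD] := CC_bounded L0 (CCu al).
  have q0 : 0 < eps1 / (Om * D) by rewrite divr_gt0// mulr_gt0.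
  have [n0 _ Hn] := cvg_small 0 e0 q0; exists n0 => n /Hn hn y.
  case: (Hcov y) => [Z|[x Wx [yx xO]]].
    by rewrite /rmderiv (rder_nil_supp (aseq al) su Z) !mulr0 subrr normr0 ltW.
  have := He n x (y - x) Wx yx; rewrite [x + _]addrC subrK => h.
  rewrite -mulrBl normrM.
  have e1 : `|Fal al y - Fn n al y| <= eps1 / (Om * D) * Om.
    apply: le_trans h _; apply: le_trans (_ : eps1 / (Om * D) * omega x <= _).
      by rewrite ler_wpM2r ?ltW ?omega_gt0.
    by rewrite ler_wpM2l// ltW// divr_gt0// mulr_gt0.
  apply: le_trans (ler_pM _ _ e1 (HD y)) _ => //.
  by rewrite le_eqVlt; apply/orP; left; apply/eqP; field; rewrite !gt_eqF.
have CCT al : CC L (fun y => Fal al y * rmderiv al u y).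
  split; last by move=> x Lx; rewrite (CCu al).2// mulr0.
  move=> x; apply/cont_ballP => e1 e10; have e13 : 0 < e1 / 3 by rewrite divr_gt0.
  have [n Hn] := near al _ e13.
  have /cont_ballP/(_ _ e13)[dl dl0 Hd] := (CCF n al).1 x.
  exists dl => // y xy; have h1 := Hn n (leqnn n) x; have h2 := Hn n (leqnn n) y; have h3 := Hd y xy.
  rewrite distrC in h2.
  rewrite -(subrKA (Fn n al x * rmderiv al u x)) -[X in _ + X](subrKA (Fn n al y * rmderiv al u y)).
  apply: le_trans (ler_normD _ _) _; apply: le_trans (lerD (lexx _) (ler_normD _ _)) _; lra.
have nearT al eps1 : 0 < eps1 -> exists n0, forall n, (n0 <= n)%N -> `|T al - Tn n al| <= eps1.
  move=> e10; have e2 : 0 < eps1 / (2 * L) ^+ d by rewrite divr_gt0.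
  have [n0 Hn] := near al _ e2; exists n0 => n /Hn hn.
  rewrite /T /Tn -(rintB L0)//; apply: le_trans (@rint_bound R d L _ (eps1 / (2 * L) ^+ d) L0 _ _) _.
  - have := CC_lin (-1) (CCF n al) (CCT al).
    by under eq_fun do rewrite mulN1r addrC.
  - exact: hn.
  - by rewrite mulrC mulfVK// gt_eqF.
pose C1 := (2 * L) ^+ d * (BB * Om * C).
have C10 : 0 <= C1 by rewrite !mulr_ge0 ?BB_ge0// ltW.
have Tn_bound n al : `|Tn n al| <= C1 * 4^-1 ^+ mlength al.
  rewrite /C1 -mulrA; apply: (rint_bound L0) => // y.
  have q0 : 0 <= (4^-1 : R) ^+ mlength al by rewrite exprn_ge0// invr_ge0.
  case: (Hcov y) => [Z|[x Wx [yx xO]]].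
    rewrite /rmderiv (rder_nil_supp (aseq al) su Z) mulr0 normr0.
    by rewrite !mulr_ge0 ?BB_ge0// ltW.
  have := Fn_bound n al Wx yx; rewrite addrC subrK => h; rewrite normrM.
  apply: le_trans (_ : (En n al * BB * Om) * `|rmderiv al u y| <= _).
    apply: ler_wpM2r => //; apply: le_trans h _.
    by rewrite ler_wpM2l// mulr_ge0 ?En_ge0 ?BB_ge0.
  have -> : En n al * BB * Om * `|rmderiv al u y| = BB * Om * (En n al * `|rmderiv al u y|) by ring.
  by rewrite -[leRHS]mulrA ler_wpM2l// mulr_ge0 ?BB_ge0// ltW.
have e3 : 0 < eps / 3 by rewrite divr_gt0.
have half_cvg : (fun n : nat => (2^-1 : R) ^+ n) @ \oo --> 0.
  by apply: cvg_expr; rewrite ger0_norm ?invf_lt1 ?invr_ge0// ltr1n.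
have q1 : 0 < eps / 3 / (C1 * 2 ^+ d + 1).
  by rewrite divr_gt0// ltr_wpDl// mulr_ge0// exprn_ge0.
(* [Tn_bound] holds at every stage, so [m] is fixed before [B] and before the stage [n]. *)
have [m _ Hm] := cvg_small 0 half_cvg q1.
have {}Hm : C1 * (2^-1 ^+ m * 2 ^+ d) <= eps / 3.
  have := ltW (Hm m (leqnn m)); rewrite ler_pdivlMr; last by rewrite ltr_wpDl// mulr_ge0// exprn_ge0.
  apply: le_trans; rewrite mulrCA ler_wpM2l ?exprn_ge0 ?invr_ge0//.
  by rewrite lerDl.
exists m => B HB; change (`|\sum_(al <- B) T al - Lf u| <= eps).
(* The stage is chosen after [B]: it must be late enough for the box of side [n] to contain [B] and
   for the finitely many terms of [B] to be near their limits. *)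
have [N HN] : exists N, forall n, (N <= n)%N ->
   (forall al, al \in B -> forall i, (al i <= n)%N) /\
   `|\sum_(al <- B) T al - \sum_(al <- B) Tn n al| <= eps / 3.
  have K (s : seq (multiindex d)) e1 : 0 < e1 -> exists N, forall n, (N <= n)%N ->
   (forall al, al \in s -> forall i, (al i <= n)%N) /\
   `|\sum_(al <- s) T al - \sum_(al <- s) Tn n al| <= e1.
    elim: s e1 => [|al s IH] e1 e10.
      by exists 0%N => n _; split=> //; rewrite !big_nil subrr normr0 ltW.
    have e12 : 0 < e1 / 2 by rewrite divr_gt0.
    have [N1 H1] := IH _ e12; have [N2 H2] := nearT al _ e12.
    exists (N1 + N2 + mlength al)%N => n nn; split.
      move=> be; rewrite inE => /orP[/eqP -> i|sb i].
        apply: leq_trans (leq_trans (leq_addl _ _) nn).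
        by rewrite /mlength (bigD1 i)//= leq_addr.
      apply: (H1 n _).1 => //; apply: leq_trans nn; rewrite -addnA; exact: leq_addr.
    rewrite !big_cons opprD addrACA; apply: le_trans (ler_normD _ _) _.
    have h1 : (N1 <= n)%N by apply: leq_trans nn; rewrite -addnA; exact: leq_addr.
    have h2 : (N2 <= n)%N by apply: leq_trans nn; rewrite addnAC; exact: leq_addl.
    have := (H1 n h1).2; have := H2 n h2; lra.
  exact: K.
have [n1 Hn1] := Lf_conv_cvg tu e3.
pose n := (N + n1)%N.
have [Hbox Hsum] := HN n (leq_addr _ _).
have HL := Hn1 n (leq_addl _ _).
rewrite (Lf_conv_sum n L0 su u0) in HL.
set S := \sum_(b : _) _ in HL.
have Hmid : `|\sum_(al <- B) Tn n al - S| <= eps / 3.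
  rewrite (sum_fset_box _ Hbox) /S.
  rewrite [X in _ - X](bigID (fun b : {ffun 'I_d -> 'I_n.+1} => ofb b \in B)) /= opprD addrA subrr sub0r normrN.
  apply: le_trans (ler_norm_sum _ _ _) _; apply: le_trans Hm.
  apply: le_trans (_ : \sum_(b : {ffun 'I_d -> 'I_n.+1} | ofb b \notin B) C1 * 4^-1 ^+ mlength (ofb b) <= _).
    by apply: ler_sum => b _; exact: Tn_bound.
  rewrite -big_distrr /= ler_wpM2l//; apply: box_tail => b bB.
  by rewrite leqNgt; apply: contra bB; exact: HB.
rewrite -(subrKA (\sum_(al <- B) Tn n al)) -[X in _ + X](subrKA S).
apply: le_trans (ler_normD _ _) _; apply: le_trans (lerD (lexx _) (ler_normD _ _)) _; lra.
Qed.

End Core.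

Definition for_levels {R : realType} (star : ultra_case) (P : R -> Prop) : Prop :=
  match star with
  | Beurling => exists2 l, 0 < l & P l
  | Roumieu => forall l, 0 < l -> P l
  end.

(** * Equicontinuity of the translates *)

Section Equicontinuity.
Context {R : realType} {d : nat}.
Variables (M : nat -> R).
Hypothesis M_gt0 : forall p, 0 < M p.
Local Notation V := 'rV[R]_d.
Variables (star : ultra_case) (Lf : (V -> R) -> R).
Hypothesis hlin : Llin M star Lf.
Hypothesis hcont : Lcont M star Lf.
Variables (W : set V) (omega : V -> R).
Hypothesis omega_gt0 : forall x, W x -> 0 < omega x.
Hypothesis hO : forall u, tcls M star u ->
  exists B, forall h, W h -> `|Lf (fun x => u (x - h))| <= B * omega h.

Definition equicont r L l : Prop := exists2 K, 0 <= K & forall u c, tcls M Beurling u ->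
  supp_in L u -> ub M l u c -> Qb Lf W omega r u (K * c).

(** Uniform boundedness for the functionals [Lf (u (x - h)) / omega h] indexed by [h] in [W]. The
    further translation by less than [r] is put into the test function, which explains the support
    radius [L + |r|]. In the Roumieu case each level [l] is treated separately as a Banach space. *)
Lemma equicontinuous r L : for_levels star (equicont r L).
Proof.
suff BS (lam : nat -> R) : (forall k, 0 < lam k) -> (forall k j, lam (k + j)%N <= lam k) ->
    (forall u : V -> R, vcls M lam (L + `|r|) u -> tcls M star u) ->
    (forall Lb, exists2 k, True & exists K, Lbound M star Lf Lb (lam k) K) ->
    exists k, equicont r L (lam k).
  have inv0 k : 0 < k.+1%:R^-1 :> R by rewrite invr_gt0.
  case: star hcont BS => /= hc BS.
    have small (l : R) : 0 < l -> exists k : nat, k.+1%:R^-1 <= l.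
      move=> l0; have [k _ Hk] := cvg_small 0 (@cvg_harmonic R) l0.
      by exists k; exact: ltW (Hk k (leqnn k)).
    have [||||k Hk] := BS (fun k => k.+1%:R^-1).
    - exact: inv0.
    - by move=> k j; rewrite lef_pV2 ?posrE// ler_nat ltnS leq_addr.
    - move=> u [su u0 lu]; split=> //; first by exists (L + `|r|).
      move=> l l0; have [k kl] := small l l0; have [c Hc] := lu k.
      by exists c; apply: ub_mono_l Hc => //; exact: ltW.
    - move=> Lb; have [l l0 [K [K0 HK]]] := hc Lb; have [k kl] := small l l0.
      exists k => //; exists K; split=> // u c tu u0 uc; apply: HK => //.
      by apply: ub_mono_l uc => //; exact: ltW.
    - by exists k.+1%:R^-1.
  move=> l l0; have [||||k //] := BS (fun=> l).
  - by [].
  - by [].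
  - move=> u [su u0 lu]; split=> //; first by exists (L + `|r|).
    by exists l => //; exact: lu 0%N.
  - by move=> Lb; exists 0%N => //; exact: hc.
move=> lam0 lamM Hv Hc.
pose T (h : {h | W h}) (u : V -> R) := Lf (fun x => u (x - sval h)) / omega (sval h).
have ts h (u : V -> R) : vcls M lam (L + `|r|) u -> tcls M star (fun x => u (x - h)).
  by move=> vu; apply: tcls_shift; exact: Hv.
have [|||k _ [K K0 HK]] := @banach_steinhaus R d M M_gt0 lam lam0 lamM (L + `|r|) _ T.
- move=> [h Wh] c u v vu vv; rewrite /T /=.
  by rewrite (hlin c (ts h u vu) (ts h v vv)) mulrDl mulrA.
- move=> [h Wh]; have [k _ [K [K0 HK]]] := Hc (L + `|r| + `|h|).
  have o0 := omega_gt0 Wh.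
  exists (k, K / omega h); split; first by rewrite divr_ge0// ltW.
  move=> u c vu uc; rewrite /T /= normrM normfV (gtr0_norm o0) mulrAC.
  rewrite ler_pM2r ?invr_gt0//; have [su u0 _] := vu; apply: HK.
  + exact: ts.
  + exact: supp_in_shift.
  + exact: ub_shift.
- move=> u vu; have [B HB] := hO (Hv u vu); exists B => -[h Wh]; rewrite /T /=.
  by rewrite normrM normfV (gtr0_norm (omega_gt0 Wh)) ler_pdivrMr ?omega_gt0//; exact: HB.
exists k; exists K => // u c [su [_ _] lu] u0 uc x h Wx hr.
have vu : vcls M lam (L + `|r|) (fun z => u (z - h)).
  have [ss _] := rsmooth_shift h su; split=> //.
    have hs := @supp_in_shift R d L u h u0; apply: (supp_in_mono _ hs); rewrite lerD2l.
    by apply: le_trans (normv_enorm h) _; apply: le_trans (ltW hr) (ler_norm r).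
  by move=> j; have [b Hb] := lu _ (lam0 j); exists b; exact: ub_shift.
have uc' := @ub_shift R d M (lam k) u h c su uc.
have := HK (exist _ x Wx) _ c vu uc'; rewrite /T /=.
rewrite normrM normfV (gtr0_norm (omega_gt0 Wx)) ler_pdivrMr ?omega_gt0//.
by under eq_fun do rewrite -addrA -opprD.
Qed.

End Equicontinuity.

(** * Choice of the widths and decay of the coefficients *)

Section Widths.
Context {R : realType} {d : nat}.
Variables (M : nat -> R) (A H c0 : R).
Hypothesis M_gt0 : forall p, 0 < M p.
Hypothesis M1 : weight_M1 M.
Hypothesis H_ge1 : 1 <= H.
Hypothesis A_gt0 : 0 < A.
Hypothesis M2 : forall p q, M (p + q)%N <= A * H ^+ (p + q) * M p * M q.
Hypothesis M3 : forall q, (1 <= q)%N ->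
    (\sum_(q <= p <oo) (M p.-1 / M p)%:E <= (c0 * q%:R * (M q.-1 / M q))%:E)%E.

Let mu0 p : 0 < mu M p. Proof. exact: mu_gt0. Qed.

(** By (M.3) the reciprocals of [mu] are summable; multiplying them by [c] plus their own slow
    weight keeps the sum finite and exceeds every multiple of [1 / mu p] in the end. *)
Lemma widths (c : R) : 0 < c -> exists beta : nat -> R, exists w : R,
  [/\ forall p, 0 < beta p, series beta @ \oo --> w, forall p, c / mu M p <= beta p &
      forall kap, exists p0, forall p, (p0 <= p)%N -> kap / mu M p <= beta p].
Proof.
move=> cc; pose s p := (mu M p)^-1; have s0 p : 0 < s p by rewrite invr_gt0.
have [S HS] : exists S : R, series s @ \oo --> S.
  exact: (bounded_series s0 (fun N => mu_tail M_gt0 M3 0 N)).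
pose beta p := (c + slow s S p) * s p.
have b0 p : 0 < beta p by rewrite mulr_gt0// addr_gt0// (slow_gt0 s0 HS).
have [w Hw] : exists w : R, series beta @ \oo --> w.
  apply: (bounded_series (B := c * S + 2 * Num.sqrt S) b0) => N.
  under eq_bigr do rewrite /beta mulrDl; rewrite big_split /= -big_distrr /=.
  apply: lerD; last exact: (slow_sum s0 HS).
  apply: ler_wpM2l; first exact: ltW.
  by have := series_le s0 HS N; rewrite /series/= big_mkord.
exists beta, w; split=> //.
  by move=> p; rewrite /beta (ler_pM2r (s0 p)) lerDl ltW// (slow_gt0 s0 HS).
move=> kap; have [p0 Hp] := slow_unbounded s0 HS kap; exists p0 => p /Hp h.
by rewrite /beta (ler_pM2r (s0 p)); apply: le_trans h _; rewrite lerDr ltW.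
Qed.

Definition Edec (a : nat -> R) (q : R) : Prop :=
  exists2 C, 0 <= C & forall n (al : multiindex d), En a n al <= C * (q ^+ mlength al / M (mlength al)).

(** The loss from widths [eps / mu p] to the coefficient rate: [2 * expR c0] comes from [ek_bound]
    in each coordinate, [H ^+ d] from merging the [d] weights into one by (M.2). *)
Definition Qfac : R := 2 * expR c0 * H ^+ d.

Lemma Qfac_gt0 : 0 < Qfac.
Proof.
by rewrite !mulr_gt0 ?expR_gt0 ?exprn_gt0//; exact: lt_le_trans ltr01 H_ge1.
Qed.

Lemma Edec_bound (a : nat -> R) C0 eps p0 : (forall p, 0 < a p) ->
  0 < eps -> eps <= C0 -> (forall p, a p <= C0 / mu M p) ->
  (forall p, (p0 <= p)%N -> a p <= eps / mu M p) -> Edec a (eps * Qfac).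
Proof.
move=> a0 e0 eC aC ae.
pose Cc := (C0 / eps) ^+ p0 * (M 0 * expR c0); pose q := eps * (2 * expR c0).
have Cc0 : 0 <= Cc.
  by rewrite !mulr_ge0 ?exprn_ge0 ?divr_ge0 ?expR_ge0 ?(ltW e0) ?(ltW (M_gt0 _))// (le_trans (ltW e0)).
have q0 : 0 < q by rewrite !mulr_gt0 ?expR_gt0.
exists (Cc ^+ d * (M 0 * A ^+ d)).
  by rewrite !mulr_ge0 ?exprn_ge0 ?(ltW A_gt0) ?(ltW (M_gt0 _)).
move=> n al; have nn p k : 0 <= ek a p k by exact: ek_ge0.
apply: le_trans (_ : \prod_i (Cc * (q ^+ al i / M (al i))) <= _).
  by apply: ler_prod => i _; rewrite nn /=; exact: (ek_bound M_gt0 M1 M3 n _ a0 e0 eC aC ae).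
rewrite big_split /= prodr_const card_ord big_split /= prodfV.
rewrite -[\prod_(i < d) q ^+ _](big_morph (fun n => q ^+ n) (exprD q) (expr0 q)) -/(mlength al).
rewrite -!mulrA; apply: ler_wpM2l; first exact: exprn_ge0.
have := M_prod_ge M_gt0 H_ge1 A_gt0 M2 (index_enum 'I_d) al.
rewrite -/(mlength al); have -> : size (index_enum 'I_d) = d by rewrite -[RHS]card_ord cardE enumT.
set P := \prod_(i < d) M (al i) => HP.
have P0 : 0 < P by apply: prodr_gt0 => i _.
rewrite [eps * Qfac](_ : _ = q * H ^+ d); last by rewrite /q /Qfac; ring.
rewrite [(q * _) ^+ _]exprMn ler_pdivrMr//.
have -> : M 0 * (A ^+ d * (q ^+ mlength al * (H ^+ d) ^+ mlength al / M (mlength al))) * P =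
   q ^+ mlength al * ((M 0 * A ^+ d * (H ^+ d) ^+ mlength al * P) / M (mlength al)) by ring.
rewrite ler_peMr ?exprn_ge0 ?(ltW q0)//.
by rewrite ler_pdivlMr// mul1r.
Qed.

End Widths.

(** * Representation of a real functional in the two cases *)

Section RealRep.
Context {R : realType} {d : nat}.
Variables (M : nat -> R) (A H c0 : R).
Hypothesis M_gt0 : forall p, 0 < M p.
Hypothesis M1 : weight_M1 M.
Hypothesis H_ge1 : 1 <= H.
Hypothesis A_gt0 : 0 < A.
Hypothesis M2 : forall p q, M (p + q)%N <= A * H ^+ (p + q) * M p * M q.
Hypothesis M3 : forall q, (1 <= q)%N ->
    (\sum_(q <= p <oo) (M p.-1 / M p)%:E <= (c0 * q%:R * (M q.-1 / M q))%:E)%E.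
Local Notation V := 'rV[R]_d.
Variables (star : ultra_case) (Lf : (V -> R) -> R).
Hypothesis hlin : Llin M star Lf.
Hypothesis hcont : Lcont M star Lf.
Variables (W : set V) (omega : V -> R) (r : R).
Hypothesis omega_gt0 : forall x, W x -> 0 < omega x.

Definition rcoeff_bound (F : multiindex d -> V -> R) (l : R) : Prop :=
  exists2 C, 0 <= C & forall x h (al : multiindex d), W x -> enorm h < r ->
    `|F al (x + h)| <= C * (l ^+ mlength al / M (mlength al)) * omega x.

Definition real_rep (F : multiindex d -> V -> R) : Prop :=
  [/\ forall al y, thicken W r y -> {for y, continuous (F al)},
      for_levels star (rcoeff_bound F) &
      forall u Om, tcls M star u -> covered W omega r u Om -> forall eps, 0 < eps ->
        exists m : nat, forall B : {fset multiindex d},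
          (forall al, (mlength al < m)%N -> al \in B) ->
          `|\sum_(al <- B) rintegral (fun y => F al y * rmderiv al u y) - Lf u| <= eps].

Let mu0 p : 0 < mu M p. Proof. exact: mu_gt0. Qed.

Section Assemble.
Variables (a beta : nat -> R) (w : R).
Hypothesis a_gt0 : forall p, 0 < a p.
Hypothesis beta_gt0 : forall p, 0 < beta p.
Hypothesis beta_sum : series beta @ \oo --> w.
Hypothesis a_le : forall p, a p <= beta p.
Hypothesis beta_big : forall kap, exists p0, forall p, (p0 <= p)%N -> kap / mu M p <= beta p.

(* A comparison sequence for which the widths [a] are large enough from the start. *)
Variables (M' : nat -> R) (A' E : R).
Hypothesis M'_gt0 : forall p, 0 < M' p.
Hypothesis A'_gt0 : 0 < A'.
Hypothesis M'2 : forall p q, M' (p + q)%N <= A' * H ^+ (p + q) * M' p * M' q.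
Hypothesis E_ge0 : 0 <= E.
Hypothesis M'_le : forall p, M' p <= E * M p.

Let C1 (kap : R) : R := Gam1 M' A' H kap * E.
Let G (kap : R) : R := C1 kap ^+ d * Mc (d := d) M.

Let C1_ge0 kap : 0 < kap -> 0 <= C1 kap.
Proof. by move=> k0; rewrite mulr_ge0 ?(ltW (Gam1_gt0 M'_gt0 H_ge1 A'_gt0 k0)). Qed.

Let level_le kap j : 0 < kap ->
  Gam1 M' A' H kap * (lv H kap ^+ j * M' j) <= C1 kap * (lv H kap ^+ j * M j).
Proof.
move=> k0; rewrite -mulrA; apply: ler_wpM2l; first exact: ltW (Gam1_gt0 M'_gt0 H_ge1 A'_gt0 k0).
rewrite mulrCA; apply: ler_wpM2l; last exact: M'_le.
exact: exprn_ge0 (ltW (lv_gt0 H_ge1 k0)).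
Qed.

Lemma tens_level_ge0 kap : 0 < kap -> 0 <= G kap.
Proof.
move=> k0; rewrite mulr_ge0 ?exprn_ge0 ?C1_ge0//.
by rewrite divr_ge0 ?exprn_ge0 ?(ltW (M_gt0 _)).
Qed.

Lemma wt_ub kap n (sg : 'I_d -> seq bool) : 0 < kap -> (forall i, size (sg i) = n) ->
  (forall p, (p < n)%N -> kap / mu M' p <= a p) -> (forall p, kap / mu M' p <= beta p) ->
  ub M (lv H kap) (wt a beta n sg) (G kap).
Proof.
move=> k0 ssg Ka Kb.
apply: (tens_ub M_gt0 M1 (g := fun i => gw a beta n (sg i))).
- exact: ltW (lv_gt0 H_ge1 k0).
- exact: C1_ge0.
- by move=> i; exact: (gw_tower a_gt0 beta_gt0 beta_sum).
move=> i j x; apply: le_trans (level_le j k0); have := @Aw_lv R M' A' H M'_gt0 H_ge1 A'_gt0 M'2 a beta w a_gt0 beta_gt0 beta_sum kap (sg i) j x k0.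
by rewrite ssg; apply.
Qed.

Lemma wt_diff_ub kap n (sg : 'I_d -> n.-tuple bool) (b : 'I_d -> bool) : 0 < kap ->
  (forall p, (p <= n)%N -> kap / mu M' p <= a p) -> (forall p, kap / mu M' p <= beta p) ->
  ub M (lv H kap) (fun x => wt a beta n.+1 (fun i => b i :: sg i) x - wt a beta n (fun i => sg i) x)
    (d%:R * G kap * incr beta n).
Proof.
move=> k0 Ka Kb.
apply: (tens_diff_ub M_gt0 M1 (g := fun i => gw a beta n.+1 (b i :: sg i))
  (g' := fun i => gw a beta n (sg i))).
- exact: ltW (lv_gt0 H_ge1 k0).
- exact: C1_ge0.
- by rewrite addr_ge0 ?(ltW (beta_gt0 _))// exprn_ge0// invr_ge0.
- by move=> i; exact: (gw_tower a_gt0 beta_gt0 beta_sum).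
- by move=> i; exact: (gw_tower a_gt0 beta_gt0 beta_sum).
- move=> i j x; apply: le_trans (level_le j k0); have := @Aw_lv R M' A' H M'_gt0 H_ge1 A'_gt0 M'2 a beta w a_gt0 beta_gt0 beta_sum kap (b i :: sg i) j x k0.
  by rewrite [size _]/= size_tuple; apply.
- move=> i j x; apply: le_trans (level_le j k0); have := @Aw_lv R M' A' H M'_gt0 H_ge1 A'_gt0 M'2 a beta w a_gt0 beta_gt0 beta_sum kap (sg i) j x k0.
  by rewrite size_tuple; apply=> // p /ltnW; exact: Ka.
move=> i j x; apply: le_trans (ler_wpM2l _ (level_le j k0)); last first.
  by rewrite addr_ge0 ?(ltW (beta_gt0 _))// exprn_ge0// invr_ge0.
have := @Aw_diff R M' A' H M'_gt0 H_ge1 A'_gt0 M'2 a beta w a_gt0 beta_gt0 beta_sum a_le kap (sg i) (b i) j x k0.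
by rewrite size_tuple; apply.
Qed.

Lemma wt_supp n sg : supp_in (2 * w) (wt a beta n sg : V -> R).
Proof.
apply: tens_supp => [i x|]; first exact: (gw_supp a_gt0 beta_gt0 beta_sum a_le).
by rewrite mulr_ge0// (w_ge0 beta_gt0 beta_sum).
Qed.

Variables (kap K : nat -> R) (Bd : R).
Hypothesis kap_gt0 : forall n, 0 < kap n.
Hypothesis kap_a : forall n p, (p <= n)%N -> kap n / mu M' p <= a p.
Hypothesis kap_b : forall n p, kap n / mu M' p <= beta p.
Hypothesis K_ge0 : forall n, 0 <= K n.
Hypothesis HK : forall n u c, tcls M Beurling u -> supp_in (2 * w) u ->
  ub M (lv H (kap n)) u c -> Qb Lf W omega r u (K n * c).
Hypothesis Bd_sum : forall N,
  \sum_(n < N) K n * (d%:R * G (kap n)) * incr beta n <= Bd.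
Hypothesis En_dec : for_levels star (Edec (d := d) M a).

(** Stage [n] is estimated in the norm of level [lv H (kap n)], with its own continuity constant
    [K n]. This leaves both cases open: a constant [kap], or one that decreases with the stage. *)
Lemma assemble : real_rep (fun al => Fal a beta Lf al).
Proof.
pose delta n := K n * (d%:R * G (kap n) * incr beta n).
have incr0 n : 0 <= incr beta n by rewrite addr_ge0 ?(ltW (beta_gt0 _))// exprn_ge0// invr_ge0.
have delta0 n : 0 <= delta n.
  apply: mulr_ge0 => //; apply: mulr_ge0 => //; apply: mulr_ge0; first exact: ler0n.
  exact: tens_level_ge0.
have tw n sg : tcls M Beurling (wt a beta n sg : V -> R).
  exact: (wt_tcls M_gt0 M1 H_ge1 M2 a_gt0 beta_gt0 beta_sum a_le beta_big).
pose B0 := K 0 * G (kap 0).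
have B00 : 0 <= B0 by rewrite mulr_ge0//; exact: tens_level_ge0.
have HQ0 : Qb Lf W omega r (wt a beta 0 (fun=> [::])) B0.
  apply: HK; [exact: tw|exact: wt_supp|].
  by apply: wt_ub.
have HQ n (sg : 'I_d -> n.-tuple bool) (b : 'I_d -> bool) : Qb Lf W omega r
    (fun x => wt a beta n.+1 (fun i => b i :: sg i) x - wt a beta n (fun i => sg i) x) (delta n).
  apply: HK.
  - by apply: tcls_sub => //; exact: tw.
  - by move=> x Lx; rewrite !wt_supp// subrr.
  - by apply: wt_diff_ub => // p; exact: kap_a.
have dsum N : \sum_(n < N) delta n <= Bd.
  by under eq_bigr do rewrite /delta mulrA.
have [Eb HE] : exists Eb : multiindex d -> R, forall n al, En a n al <= Eb al.
  have [q [C C0 HC]] : exists q, Edec (d := d) M a q.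
    by case: star En_dec => [[q _ Hq]|Hq]; [exists q|exists 1; exact: Hq].
  by exists (fun al => C * (q ^+ mlength al / M (mlength al))).
have BB0 : 0 <= BB B0 Bd.
  by rewrite /BB addr_ge0//; have := dsum 0%N; rewrite big_ord0.
have coef l : 0 < l -> Edec (d := d) M a l -> rcoeff_bound (fun al => Fal a beta Lf al) l.
  move=> l0 [C C0 HC]; exists (C * BB B0 Bd); first exact: mulr_ge0.
  move=> x h al Wx hr.
  have := @Fal_bound R d M A H M_gt0 M1 H_ge1 M2 a beta w a_gt0 beta_gt0 beta_sum a_le beta_big
    star Lf hlin W omega r omega_gt0 B0 delta Bd HQ0 HQ delta0 dsum B00 Eb HE al _ x h
    (fun n => HC n al) Wx hr.
  by move/le_trans; apply; rewrite le_eqVlt; apply/orP; left; apply/eqP; ring.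
split.
- move=> al y ty.
  exact: (@Fal_cont R d M A H M_gt0 M1 H_ge1 A_gt0 M2 a beta w a_gt0 beta_gt0 beta_sum a_le beta_big
    star Lf hlin hcont W omega r omega_gt0 B0 delta Bd HQ0 HQ delta0 dsum B00 Eb HE).
- case: star En_dec => /= [[l l0 hl]|hl].
    by exists l => //; exact: coef.
  by move=> l l0; apply: coef => //; exact: hl.
move=> u Om tu cu eps eps0.
(* The rate [q] of the coefficients and a level [l] of [u] are to satisfy [q * l <= 4^-1]. In the
   Beurling case [q] is given and [u] has every level; in the Roumieu case [l] is given and every
   rate is available. *)
have [q [l [C [c [q0 [l0 [C0 [HC [uc ql]]]]]]]]] : exists q, exists l, exists C, exists c, 0 < q /\ 0 < l /\ 0 <= C /\
    (forall n (al : multiindex d), En a n al <= C * (q ^+ mlength al / M (mlength al))) /\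
    ub M l u c /\ q * l <= 4^-1.
  have [_ _ lu] := tu.
  case: star En_dec lu => /= [[q q0 [C C0 HC]] lu|hq [l l0 [c uc]]].
    have l0 : 0 < (4 * q)^-1 by rewrite invr_gt0 mulr_gt0.
    have [c uc] := lu _ l0; exists q, (4 * q)^-1, C, c; do ![split=> //].
    by rewrite invfM mulrCA mulfV ?mulr1 ?gt_eqF.
  have q0 : 0 < (4 * l)^-1 by rewrite invr_gt0 mulr_gt0.
  have [C C0 HC] := hq _ q0; exists (4 * l)^-1, l, C, c; do ![split=> //].
  by rewrite invfM -mulrA mulVf ?mulr1 ?gt_eqF.
apply: (@core_rep R d M A H M_gt0 M1 H_ge1 A_gt0 M2 a beta w a_gt0 beta_gt0 beta_sum a_le beta_big
    star Lf hlin hcont W omega r omega_gt0 B0 delta Bd HQ0 HQ delta0 dsum B00 Eb HE u Om (C * c) tu cu) => //.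
move=> n al y; have Mm := M_gt0 (mlength al).
have := uc (aseq al) y; rewrite size_aseq => hu.
have c_ge0 : 0 <= c := ub_ge0 M_gt0 uc.
apply: le_trans (ler_pM _ _ (HC n al) hu) _ => //.
  by apply: prodr_ge0 => i _; exact: ek_ge0.
have -> : C * (q ^+ mlength al / M (mlength al)) * (c * (l ^+ mlength al * M (mlength al))) =
   C * c * (q * l) ^+ mlength al.
  by rewrite exprMn; field; rewrite gt_eqF.
apply: ler_wpM2l; first exact: mulr_ge0.
by rewrite lerXn2r ?nnegrE ?invr_ge0// mulr_ge0// ltW.
Qed.

End Assemble.

Lemma incr_sum (beta : nat -> R) (w : R) N : (forall p, 0 < beta p) -> series beta @ \oo --> w ->
  \sum_(n < N) incr beta n <= w + 2.
Proof.
move=> b0 bs; rewrite big_split /=; apply: lerD.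
  by have := series_le b0 bs N; rewrite /series/= big_mkord.
by apply: geom_le; rewrite ?invr_ge0.
Qed.

Hypothesis hO : forall u, tcls M star u ->
  exists B, forall h, W h -> `|Lf (fun x => u (x - h))| <= B * omega h.

Lemma real_rep_Beurling : star = Beurling -> exists F, real_rep F.
Proof.
move=> sB; have [beta [w [b0 bs bmu bbig]]] := widths M_gt0 M3 ltr01.
have := equicontinuous M_gt0 hlin hcont omega_gt0 hO r (2 * w).
rewrite sB => -[l l0 [K K0 HK]].
have H0 : 0 < H := lt_le_trans ltr01 H_ge1.
(* Inverse to [lv]: the kernels are estimated exactly in the norm of level [l] that controls the
   functionals. *)
pose kap := 8 * H ^+ 2 / l; have k0 : 0 < kap by rewrite divr_gt0// mulr_gt0// exprn_gt0.
have lvE : lv H kap = l by rewrite /lv /kap invf_div mulrCA mulfV ?mulr1// gt_eqF// mulr_gt0// exprn_gt0.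
have [p0 Hp0] := bbig kap.
(* [beta p] dominates [kap / mu M p] only from [p0] on. The sequence [M'] has quotients enlarged by
   [D] before [p0], so that [a p = kap / mu M' p] is at most [1 / mu M p <= beta p] there, while
   [M'] stays within the factor [D ^+ p0] of [M]. *)
pose D := 1 + kap; have D1 : 1 <= D by rewrite lerDl ltW.
have D0 : 0 < D := lt_le_trans ltr01 D1.
pose M' p := D ^+ minn p p0 * M p.
have M'0 p : 0 < M' p by rewrite mulr_gt0// exprn_gt0.
have M'le p : M' p <= D ^+ p0 * M p by rewrite ler_pM2r// ler_weXn2l// geq_minr.
have M'ge p : M p <= M' p by rewrite ler_peMl ?(ltW (M_gt0 p))// exprn_ege1.
have muM' p : mu M' p = (if (p < p0)%N then D else 1) * mu M p.
  rewrite /mu /M'; have Dn : D ^+ p0 != 0 by rewrite expf_neq0// gt_eqF.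
  have Dp : D ^+ p != 0 by rewrite expf_neq0// gt_eqF.
  have Mp : M p != 0 by rewrite gt_eqF.
  case: ltnP => pp.
    by rewrite (minn_idPl pp) exprS; field; rewrite Mp Dp.
  by have pp1 := leqW pp; rewrite (minn_idPr pp1); field; rewrite Mp Dn.
have muM'0 p : 0 < mu M' p by exact: mu_gt0.
pose a p := kap / mu M' p.
have ab p : a p <= beta p.
  rewrite /a muM'; case: ltnP => pp; last by rewrite mul1r; exact: Hp0.
  apply: le_trans (bmu p); rewrite invfM mulrA ler_pM2r ?invr_gt0//.
  by rewrite ler_pdivrMr// mul1r /D lerDr.
have aM p : a p <= kap / mu M p.
  rewrite /a muM' invfM mulrA ler_pM2r ?invr_gt0//; case: ltnP => _; last by rewrite invr1 mulr1.
  by rewrite ler_piMr ?(ltW k0)// invf_le1.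
have a0 p : 0 < a p by rewrite divr_gt0.
exists (fun al => Fal a beta Lf al).
pose E := D ^+ p0; have E1 : 1 <= E by rewrite exprn_ege1.
pose G := (Gam1 M' (E * A) H kap * E) ^+ d * Mc (d := d) M.
have EA : 0 < E * A by rewrite mulr_gt0// (lt_le_trans ltr01 E1).
have G0 : 0 <= G by exact: (tens_level_ge0 M'0 EA (le_trans ler01 E1)).
apply: (@assemble a beta w a0 b0 bs ab bbig M' (E * A) E M'0 EA _ (le_trans ler01 E1) M'le
   (fun=> kap) (fun=> K) (K * (d%:R * G) * (w + 2))).
- move=> p q; apply: le_trans (M'le _) _.
  apply: le_trans (ler_wpM2l (le_trans ler01 E1) (M2 p q)) _.
  have HE : 0 <= E * A * H ^+ (p + q) by rewrite mulr_ge0 ?exprn_ge0 ?(ltW EA) ?(ltW H0).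
  rewrite -[leRHS]mulrA (_ : E * (A * H ^+ (p + q) * M p * M q) = E * A * H ^+ (p + q) * (M p * M q)); last by ring.
  apply: ler_wpM2l => //.
  by apply: ler_pM; rewrite ?(ltW (M_gt0 _)).
- by [].
- by [].
- move=> _ p; exact: ab.
- by [].
- by move=> n u c tu u0; rewrite lvE; exact: HK.
- move=> N; rewrite -big_distrr /=; apply: ler_wpM2l; last exact: incr_sum.
  by apply: mulr_ge0 => //; apply: mulr_ge0; [exact: ler0n|exact: G0].
rewrite sB; exists (kap * Qfac (d := d) H c0); first by rewrite mulr_gt0// Qfac_gt0.
exact: (@Edec_bound R d M A H c0 M_gt0 M1 H_ge1 A_gt0 M2 M3 a kap kap 0 a0 k0 (lexx _) aM (fun p _ => aM p)).
Qed.

Lemma real_rep_Roumieu : star = Roumieu -> exists F, real_rep F.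
Proof.
move=> sR; have [beta [w [b0 bs bmu bbig]]] := widths M_gt0 M3 ltr01.
have := equicontinuous M_gt0 hlin hcont omega_gt0 hO r (2 * w).
rewrite sR => HK.
pose kap (j : nat) : R := j.+1%:R^-1; have k0 j : 0 < kap j by rewrite invr_gt0.
pose P (j : nat) (K : R) := 0 <= K /\ forall (u : V -> R) (c : R), tcls M Beurling u ->
  supp_in (2 * w) u -> ub M (lv H (kap j)) u c -> Qb Lf W omega r u (K * c).
have [j|K HKj] := @choice _ _ P.
  by have [K K0 Hj] := HK _ (lv_gt0 H_ge1 (k0 j)); exists K.
have s0 n : 0 < incr beta n by rewrite addr_gt0// exprn_gt0// invr_gt0.
have [S HS] := bounded_series s0 (fun N => incr_sum N b0 bs).
pose G j := (Gam1 M A H (kap j) * 1) ^+ d * Mc (d := d) M.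
have M_le p : M p <= 1 * M p by rewrite mul1r.
have G0 j : 0 <= G j by exact: (tens_level_ge0 M_gt0 A_gt0 ler01).
(* [K j] comes from uniform boundedness at the level of [kap j], and nothing is known about its
   growth. Monotonicity of [J] makes [kap (J n)] a lower ratio for all widths used up to stage
   [n]. *)
have [|J [Jm Ju [Bd HBd]]] := slow_choice s0 HS (Gam := fun j => K j * (d%:R * G j)).
  by move=> j; apply: mulr_ge0; [exact: (HKj j).1|apply: mulr_ge0; [exact: ler0n|exact: G0]].
pose a p := kap (J p) / mu M p; have a0 p : 0 < a p by rewrite divr_gt0.
have k1 j : kap j <= 1 by rewrite invf_le1// ler1n.
have a1 p : a p <= 1 / mu M p by rewrite ler_pM2r ?invr_gt0.
have ab p : a p <= beta p by apply: le_trans (bmu p).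
exists (fun al => Fal a beta Lf al).
apply: (@assemble a beta w a0 b0 bs ab bbig M A 1 M_gt0 A_gt0 M2 ler01 M_le
   (fun n => kap (J n)) (fun n => K (J n)) Bd).
- by [].
- move=> n p pn; rewrite ler_pM2r ?invr_gt0// lef_pV2 ?posrE// ler_nat ltnS; exact: Jm.
- by move=> n p; apply: le_trans (bmu p); rewrite ler_pM2r ?invr_gt0.
- by move=> n; exact: (HKj _).1.
- by move=> n; exact: (HKj _).2.
- exact: HBd.
rewrite sR => q q0; have Q0 := @Qfac_gt0 R d H c0 H_ge1.
pose eps := q / Qfac (d := d) H c0; have e0 : 0 < eps by rewrite divr_gt0.
have -> : q = eps * Qfac (d := d) H c0 by rewrite /eps mulfVK// gt_eqF.
(* Since [J] tends to infinity, the widths fall below [eps / mu M p] from some index on for each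
   [eps]; this gives every rate of decay. *)
have [j _ Hj] := cvg_small 0 (@cvg_harmonic R) e0.
have [p0 Hp0] := Ju j.
apply: (@Edec_bound R d M A H c0 M_gt0 M1 H_ge1 A_gt0 M2 M3 a (1 + eps) eps p0 a0 e0).
- by rewrite lerDr.
- by move=> p; apply: le_trans (a1 p) _; rewrite ler_pM2r ?invr_gt0// lerDl ltW.
by move=> p /Hp0 Jp; rewrite ler_pM2r ?invr_gt0//; exact: ltW (Hj _ Jp).
Qed.

Lemma real_rep_exists : exists F, real_rep F.
Proof.
by case E : star; [exact: real_rep_Beurling|exact: real_rep_Roumieu].
Qed.

End RealRep.

(** * Complex test functions and ultradistributions *)

Section RintShift.
Context {R : realType}.

Lemma CC_int d L (g : 'rV[R]_d.+1 -> R) : 0 < L -> CC L g ->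
  continuous (fun t => rintegral (fun x => g (rcol t x))) /\
  forall t, L < `|t| -> rintegral (fun x => g (rcol t x)) = 0.
Proof.
move=> L0 Hg; have V0 : 0 < (2 * L) ^+ d by rewrite exprn_gt0// mulr_gt0.
split.
  apply: cont_modulus1 => e e0; pose k := e / (2 * L) ^+ d.
  have k0 : 0 < k by rewrite divr_gt0.
  have [dl dl0 Hd] := CC_unif Hg k0; exists dl => // t s ts.
  rewrite -(rintB L0); [|exact: CC_slice..].
  apply: le_trans (@rint_bound R d L _ k L0 _ _) _.
  - have := CC_lin (-1) (CC_slice s Hg) (CC_slice t Hg).
    by under eq_fun do rewrite mulN1r addrC.
  - move=> x; apply: Hd.
    by rewrite rcolB subrr rcol_norm ?(ltW dl0)// normr0 (ltW dl0) andbT.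
  - by rewrite /k mulrC mulfVK// gt_eqF.
move=> t Lt; have E x : g (rcol t x) = 0.
  by apply: Hg.2; rewrite ltNge rcol_norm ?(ltW L0)// negb_and -ltNge Lt.
by under eq_fun do rewrite E; exact: rint0.
Qed.

(** Both integrals are increments of one primitive over intervals containing the support; outside
    the support the primitive is constant. *)
Lemma Rintegral_shift (h : R -> R) L t0 : 0 < L -> continuous h ->
  (forall t, L < `|t| -> h t = 0) ->
  Rintegral (@lebesgue_measure R) setT (fun t => h (t - t0)) =
  Rintegral (@lebesgue_measure R) setT h.
Proof.
move=> L0 ch h0; pose P := prim h; have DP := primP ch.
have L1 : 0 < L + 1 by rewrite addr_gt0.
have L2 : 0 < L + 1 + `|t0| by rewrite ltr_wpDr.
have n0 := ler_norm t0; have n1 := ler_norm (- t0); rewrite normrN in n1.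
have a0 := normr_ge0 t0.
rewrite (Rintegral_primitive (H := P) L1 ch _ DP); last first.
  by move=> t Lt; apply: h0; apply: lt_trans Lt; rewrite ltrDl.
have DS t : dd1 (fun t => P (t - t0)) t (h (t - t0)) by exact: dd1_shift.
rewrite (Rintegral_primitive (H := fun t => P (t - t0)) L2 _ _ DS); last first.
- move=> t Lt; apply: h0; have := ler_normB (t - t0) (- t0); rewrite opprK subrK normrN => hh.
  lra.
- exact: cont_shift.
have flat x y : L < x <= y \/ x <= y < - L -> P y = P x.
  move=> xy; have [c /andP[c1 c2] E] := dd1_MVT DP x y.
  apply/eqP; rewrite -subr_eq0 E h0 ?mul0r//.
  move: c1 c2; have xy' : x <= y by case: xy => /andP[] //; lra.
  rewrite (min_idPl xy') (max_idPr xy') => c1 c2; case: xy => /andP[x1 x2].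
    by have := ler_norm c; lra.
  by have := ler_norm (- c); rewrite normrN; lra.
rewrite (@flat (L + 1) (L + 1 + `|t0| - t0)); last by left; apply/andP; split; lra.
by rewrite (@flat (- (L + 1 + `|t0|) - t0) (- (L + 1))) //; right; apply/andP; split; lra.
Qed.

Lemma rint_shift d L (g : 'rV[R]_d -> R) h : 0 < L -> CC L g ->
  rintegral (fun x => g (x - h)) = rintegral g.
Proof.
move=> L0; elim: d g h => [g h _|d IH g h Hg].
  by rewrite /=; congr g; apply/rowP => -[].
pose t0 := h 0 ord0; pose h' : 'rV[R]_d := \row_i h 0 (lift ord0 i).
have hE : h = rcol t0 h'.
  by apply: rcol_ext => [|i]; rewrite ?rcol0 ?rcolS ?mxE.
rewrite !rintegralS; have [cI I0] := CC_int L0 Hg.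
rewrite -(Rintegral_shift t0 L0 cI I0); apply: eq_Rintegral => t _.
rewrite -(IH _ h' (CC_slice _ Hg)); congr rintegral; apply/funext => x.
by rewrite hE rcolB.
Qed.

End RintShift.

Section ComplexCalculus.
Context {R : realType} {d : nat}.
Local Notation V := 'rV[R]_d.
Local Notation cfun := (V -> R[i]).
Implicit Types (phi : cfun) (K : set V).

Lemma normc_ge_Re (z : R[i]) : `|complex.Re z| <= Normc.normc z.
Proof. by case: z => a b /=; rewrite -sqrtr_sqr ler_wsqrtr// lerDl sqr_ge0. Qed.

Lemma normc_ge_Im (z : R[i]) : `|complex.Im z| <= Normc.normc z.
Proof. by case: z => a b /=; rewrite -sqrtr_sqr ler_wsqrtr// lerDr sqr_ge0. Qed.

Lemma normc_le_sum (z : R[i]) : Normc.normc z <= `|complex.Re z| + `|complex.Im z|.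
Proof.
case: z => a b /=; have nn : 0 <= `|a| + `|b| by rewrite addr_ge0.
rewrite -[leRHS]ger0_norm// -sqrtr_sqr ler_wsqrtr// sqrrD !real_normK ?num_real//.
by rewrite lerD2r lerDl mulrn_wge0// mulr_ge0.
Qed.

Lemma Re_foldr s phi : Re_fun (foldr partial phi s) = rder s (Re_fun phi).
Proof. by elim: s => //= i s <-. Qed.

Lemma Im_foldr s phi : Im_fun (foldr partial phi s) = rder s (Im_fun phi).
Proof. by elim: s => //= i s <-. Qed.

Lemma smoothP phi : smooth phi <-> rsmooth (Re_fun phi) /\ rsmooth (Im_fun phi).
Proof.
split=> [H|[H1 H2] s]; first split=> s; first 2 last.
- split; first by split; apply: continuous_subspaceT; rewrite ?Re_foldr ?Im_foldr; [exact: (H1 s).1|exact: (H2 s).1].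
  by move=> i x; rewrite ?Re_foldr ?Im_foldr; split; [exact: (H1 s).2|exact: (H2 s).2].
- have [[c1 _] D] := H s; rewrite -Re_foldr; split; first exact: (continuous_subspace_setT _).2 c1.
  by move=> i x; have [] := D i x.
- have [[_ c1] D] := H s; rewrite -Im_foldr; split; first exact: (continuous_subspace_setT _).2 c1.
  by move=> i x; have [] := D i x.
Qed.

Lemma mderivE (a : multiindex d) phi : mderiv a phi = foldr partial phi (aseq a).
Proof.
rewrite /mderiv /aseq; elim: (enum 'I_d) => //= i s ->.
by rewrite foldr_cat; elim: (a i) => //= n ->.
Qed.

Lemma Re_mderiv a phi x : complex.Re (mderiv a phi x) = rmderiv a (Re_fun phi) x.
Proof. by rewrite mderivE /rmderiv -Re_foldr. Qed.

Lemma Im_mderiv a phi x : complex.Im (mderiv a phi x) = rmderiv a (Im_fun phi) x.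
Proof. by rewrite mderivE /rmderiv -Im_foldr. Qed.

Lemma rder_rmderiv s (u : V -> R) : rsmooth u ->
  exists2 a : multiindex d, rder s u = rmderiv a u & mlength a = size s.
Proof.
move=> su; exists [ffun i => count_mem i s].
  apply: rder_perm => //; rewrite /perm_eq; apply/allP => i _ /=.
  by rewrite count_aseq ffunE.
by rewrite /mlength -[RHS]sum_count; apply: eq_bigr => i _; rewrite ffunE.
Qed.

Lemma supp_zero phi y : ~ supp phi y -> exists2 dl, 0 < dl & forall z, `|y - z| < dl -> phi z = 0.
Proof.
move=> ny; have : nbhs y (~` supp phi) by apply: open_nbhs_nbhs; split=> //; apply: closed_openC; exact: closed_closure.
move=> /nbhs_ballP[dl dl0 H]; exists dl => // z yz; apply/eqP/negPn/negP => pz.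
by apply: (H z); [rewrite -ball_normE|exact: subset_closure].
Qed.

Lemma compact_radius K : compact K -> exists2 L, 0 < L & forall y, K y -> `|y| <= L.
Proof.
move=> /compact_bounded[L [_ HL]]; exists (`|L| + 1); first by rewrite ltr_wpDl.
by move=> y; apply: HL; apply: le_lt_trans (ler_norm L) _; rewrite ltrDl.
Qed.

Variable M : nat -> R.
Hypothesis M_gt0 : forall p, 0 < M p.

Definition cub l K phi c : Prop := forall (a : multiindex d) x, K x ->
  Normc.normc (mderiv a phi x) <= c * (l ^+ mlength a * M (mlength a)).

Lemma ultranorm_le l K phi c : 0 < l -> cub l K phi c -> (ultranorm M l K phi <= c%:E)%E.
Proof.
move=> l0 H; apply: ge_ereal_sup => _ [a [x [Kx ->]]].
by rewrite lee_fin ler_pdivrMr ?mulr_gt0 ?exprn_gt0//; exact: H.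
Qed.

Lemma cub_ultranorm l K phi c : 0 < l -> (ultranorm M l K phi <= c%:E)%E -> cub l K phi c.
Proof.
move=> l0 H a x Kx; rewrite -ler_pdivrMr ?mulr_gt0 ?exprn_gt0// -lee_fin; apply: le_trans H.
by apply: ereal_sup_ubound; exists a, x.
Qed.

Lemma ultranorm_fin l K phi : 0 < l -> (ultranorm M l K phi < +oo)%E -> exists2 c, 0 <= c & cub l K phi c.
Proof.
move=> l0; case E : (ultranorm _ _ _ _) => [c| |]// _.
  exists `|c| => //; apply: cub_ultranorm => //; rewrite E lee_fin; exact: ler_norm.
by exists 0 => //; apply: cub_ultranorm => //; rewrite E leNye.
Qed.

Lemma cub_ub l K phi c : 0 < l -> smooth phi -> supp phi `<=` K -> 0 <= c -> cub l K phi c ->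
  ub M l (Re_fun phi) c /\ ub M l (Im_fun phi) c.
Proof.
move=> l0 /smoothP[s1 s2] sK c0 Hc.
have key (pr : R[i] -> R) (u : V -> R) : rsmooth u -> (forall y, u y = pr (phi y)) -> pr 0 = 0 ->
    (forall a x, rmderiv a u x = pr (mderiv a phi x)) -> (forall z, `|pr z| <= Normc.normc z) -> ub M l u c.
  move=> su uE pr0 mE prN s x; have [a -> <-] := rder_rmderiv s su.
  have [Kx|nKx] := pselect (K x); first by rewrite mE; apply: le_trans (prN _) _; exact: Hc.
  have [dl dl0 Hd] := supp_zero (fun h => nKx (sK x h)).
  rewrite /rmderiv rder_nil_supp ?normr0//.
    by rewrite !mulr_ge0 ?exprn_ge0 ?(ltW l0) ?(ltW (M_gt0 _)).
  by exists dl => // z /Hd; rewrite uE => ->.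
split; [apply: (key (@complex.Re R) (Re_fun phi)) => //|apply: (key (@complex.Im R) (Im_fun phi)) => //].
- by move=> a x; rewrite Re_mderiv.
- exact: normc_ge_Re.
- by move=> a x; rewrite Im_mderiv.
- exact: normc_ge_Im.
Qed.

Lemma ub_cub l K phi c1 c2 : ub M l (Re_fun phi) c1 -> ub M l (Im_fun phi) c2 -> cub l K phi (c1 + c2).
Proof.
move=> H1 H2 a x _; apply: le_trans (normc_le_sum _) _.
rewrite Re_mderiv Im_mderiv mulrDl; apply: lerD; rewrite -size_aseq.
  exact: H1.
exact: H2.
Qed.

Lemma supp_Re_Im K L phi : supp phi `<=` K -> (forall y, K y -> `|y| <= L) ->
  supp_in L (Re_fun phi) /\ supp_in L (Im_fun phi).
Proof.
move=> sK KL; have Z x : L < `|x| -> phi x = 0.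
  move=> Lx; apply/eqP/negPn/negP => px; have : K x by apply: sK; exact: subset_closure.
  by move=> /KL; rewrite leNgt Lx.
by split=> x /Z E; rewrite /Re_fun /Im_fun E.
Qed.

Lemma D_compact_tcls star K phi : compact K -> D_compact M star K phi ->
  [/\ tcls M star (Re_fun phi), tcls M star (Im_fun phi) & supp phi `<=` K].
Proof.
move=> /compact_radius[L L0 KL].
have base l : 0 < l -> D_step M l K phi -> [/\ smooth phi, supp phi `<=` K &
    exists c, ub M l (Re_fun phi) c /\ ub M l (Im_fun phi) c].
  move=> l0 [sp sK /(ultranorm_fin l0)[c c0 Hc]]; split=> //.
  by exists c; exact: (cub_ub l0 sp sK c0 Hc).
case: star => /= [H|[l l0 /(base l l0)[sp sK [c [H1 H2]]]]]; last first.
  have [u1 u2] := supp_Re_Im sK KL; have [s1 s2] := (smoothP phi).1 sp.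
  by split=> //; split=> //; [exists L|exists l => //; exists c|exists L|exists l => //; exists c].
have [sp sK _] := base 1 ltr01 (H 1 ltr01).
have [u1 u2] := supp_Re_Im sK KL; have [s1 s2] := (smoothP phi).1 sp.
split=> //; split=> //; [by exists L| |by exists L|] => l l0.
  by have [_ _ [c [H1 H2]]] := base l l0 (H l l0); exists c.
by have [_ _ [c [H1 H2]]] := base l l0 (H l l0); exists c.
Qed.

Lemma tcls_D_compact star K phi : tcls M star (Re_fun phi) -> tcls M star (Im_fun phi) ->
  supp phi `<=` K -> D_compact M star K phi.
Proof.
move=> [s1 _ l1] [s2 _ l2] sK; have sp : smooth phi by apply/smoothP.
have base l c1 c2 : 0 < l -> ub M l (Re_fun phi) c1 -> ub M l (Im_fun phi) c2 -> D_step M l K phi.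
  move=> l0 h1 h2; split=> //.
  by apply: le_lt_trans (ultranorm_le l0 (ub_cub (K := K) h1 h2)) _; rewrite ltry.
case: star l1 l2 => /= [l1 l2 l l0|[l l0 [c1 h1]] [l' l'0 [c2 h2]]].
  by have [c1 h1] := l1 l l0; have [c2 h2] := l2 l l0; exact: base h1 h2.
exists (Num.max l l'); first by rewrite /= lt_max l0.
apply: (base _ c1 c2); first by rewrite lt_max l0.
  by apply: ub_mono_l h1; rewrite ?le_max ?lexx// ltW.
by apply: ub_mono_l h2; rewrite ?le_max ?lexx ?orbT// ltW.
Qed.

(** The bridge between the complex spaces and the real classes: membership is reduced to the real
    and imaginary parts and a compact set carrying the support. *)
Lemma D_spaceP star Omega phi : D_space M star Omega phi <->
  [/\ tcls M star (Re_fun phi), tcls M star (Im_fun phi) &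
      exists K, [/\ compact K, K `<=` Omega & supp phi `<=` K]].
Proof.
split=> [[K [cK KO] /(D_compact_tcls cK)[h1 h2 sK]]|[h1 h2 [K [cK KO sK]]]].
  by split=> //; exists K.
by exists K => //; exact: tcls_D_compact.
Qed.

End ComplexCalculus.

Section Functional.
Context {R : realType} {d : nat}.
Local Notation V := 'rV[R]_d.
Local Notation cfun := (V -> R[i]).
Variable M : nat -> R.
Hypothesis M_gt0 : forall p, 0 < M p.
Variable star : ultra_case.

Definition emb (u : V -> R) : cfun := fun x => (u x)%:C.

Lemma ball_supp L (phi : cfun) : (forall x, L < `|x| -> phi x = 0) ->
  supp phi `<=` [set x | `|x| <= L].
Proof.
move=> H; have cK : closed [set x : V | `|x| <= L].
  by apply: compact_closed; [exact: norm_hausdorff|exact: ball_compact].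
rewrite /supp [X in _ `<=` X](closure_id _).1//; apply: closure_subset => x /= px.
by rewrite leNgt; apply: contra px => /H ->.
Qed.

Lemma emb_D u : tcls M star u -> D_space M star setT (emb u).
Proof.
move=> tu; apply/(D_spaceP M_gt0); split=> //; first exact: tcls0.
have [_ [L u0] _] := tu; exists [set x | `|x| <= L]; split=> //; first exact: ball_compact.
by apply: ball_supp => x /u0 E; rewrite /emb E.
Qed.

(** This and [D_nbhs0_intro] translate the nested inductive and projective limits into norm
    conditions on each compact set, with the quantifier over levels that belongs to the case. *)
Lemma D_nbhs0_levels Omega K U : compact K -> K `<=` Omega -> D_nbhs0 M star Omega U ->
  for_levels star (fun l => exists2 e, 0 < e & forall phi : cfun, D_compact M star K phi ->
    (ultranorm M l K phi < e%:E)%E -> U phi).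
Proof.
move=> cK KO [A [_ AU HA]]; have := HA K (conj cK KO).
case: star => /= [[l [e [l0 e0 H]]]|[A' [_ A'A HA']] l l0].
  by exists l => //; exists e => // phi Dp he; apply: AU; exact: H.
have [e e0 H] := HA' l l0; exists e => // phi [l' l'0 [sp sK _]] he.
by apply: AU; apply: A'A; apply: H => //; split=> //; apply: lt_trans he _; rewrite ltry.
Qed.

(** An absolutely convex set is its own witness in the limit over compact sets and, in the Roumieu
    case, also in the inner limit over levels. *)
Lemma D_nbhs0_intro Omega U : absolutely_convex U ->
  (forall K, compact K -> K `<=` Omega ->
    for_levels star (fun l => exists2 e, 0 < e & forall phi : cfun, D_compact M star K phi ->
    (ultranorm M l K phi < e%:E)%E -> U phi)) -> D_nbhs0 M star Omega U.
Proof.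
move=> aU HU; exists U; split=> // K [cK KO]; have := HU K cK KO.
case: star => /= [[l l0 [e e0 H]]|H]; first by exists l, e.
exists U; split=> // l l0; have [e e0 He] := H l l0; exists e => // phi Dp.
by apply: He; exists l.
Qed.

Variable f : cfun -> R[i].
Hypothesis hf : ultradistribution M star setT f.

Lemma D_lin Omega (a : R[i]) (phi psi : cfun) : D_space M star Omega phi -> D_space M star Omega psi ->
  D_space M star Omega (fun x => a * phi x + psi x).
Proof.
move=> /(D_spaceP M_gt0)[p1 p2 [K [cK KO sK]]] /(D_spaceP M_gt0)[q1 q2 [K' [cK' KO' sK']]].
apply/(D_spaceP M_gt0); case: a => a b.
have E1 : Re_fun (fun x => (a +i* b) * phi x + psi x) =
    (fun x => a * Re_fun phi x + ((- b) * Im_fun phi x + Re_fun psi x)).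
  by apply/funext => x; rewrite /Re_fun /Im_fun; case: (phi x) (psi x) => [? ?] [? ?] /=; ring.
have E2 : Im_fun (fun x => (a +i* b) * phi x + psi x) =
    (fun x => a * Im_fun phi x + (b * Re_fun phi x + Im_fun psi x)).
  by apply/funext => x; rewrite /Re_fun /Im_fun; case: (phi x) (psi x) => [? ?] [? ?] /=; ring.
split; [by rewrite E1; do 2 apply: tcls_lin => //|by rewrite E2; do 2 apply: tcls_lin => //|].
exists (K `|` K'); split; [exact: compactU|by move=> x []; [exact: KO|exact: KO']|].
have cU : closed (K `|` K') by apply: compact_closed; [exact: norm_hausdorff|exact: compactU].
rewrite /supp [X in _ `<=` X](closure_id _).1//; apply: closure_subset => x /= px.
have [Kx|nK] := pselect (K x); first by left.
right; apply: sK'; apply: subset_closure => /=; apply: contra px => /eqP ->.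
suff -> : phi x = 0 by rewrite mulr0 addr0.
by apply/eqP/negPn/negP => pp; apply: nK; apply: sK; exact: subset_closure.
Qed.

Lemma D0 (Omega : set V) : D_space M star Omega (fun=> 0).
Proof.
apply/(D_spaceP M_gt0); split; [exact: tcls0|exact: tcls0|].
exists set0; split=> //; first exact: compact0.
by rewrite /supp (_ : [set x | _] = set0) ?closure0// -subset0 => x /=; rewrite eqxx.
Qed.

Lemma f0 : f (fun=> 0) = 0.
Proof.
have := hf.1 1 _ _ (D0 setT) (D0 setT) => /=.
have -> : (fun _ : V => 1 * 0 + 0) = (fun=> 0) :> cfun by apply/funext => x; rewrite mulr0 addr0.
by rewrite mul1r => /eqP; rewrite -subr_eq subrr => /eqP.
Qed.

Lemma f_scale a (phi : cfun) : D_space M star setT phi -> f (fun x => a * phi x) = a * f phi.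
Proof.
move=> Dp; have := hf.1 a _ _ Dp (D0 setT); rewrite f0 addr0 => <-.
by congr f; apply/funext => x; rewrite addr0.
Qed.

(** Complex linearity determines [f] from its values on real test functions; since these values are
    complex, the real theory is applied to their real and imaginary parts separately. *)
Lemma f_Re_Im (phi : cfun) : D_space M star setT phi ->
  f phi = (0 +i* 1) * f (emb (Im_fun phi)) + f (emb (Re_fun phi)).
Proof.
move=> /(D_spaceP M_gt0)[p1 p2 _]; rewrite -(hf.1 _ _ _ (emb_D p2) (emb_D p1)).
congr f; apply/funext => x; rewrite /emb /Re_fun /Im_fun; case: (phi x) => a b /=.
by apply/eqP; rewrite eq_complex /=; apply/andP; split; apply/eqP; ring.
Qed.

Lemma f_emb_lin c u v : tcls M star u -> tcls M star v ->
  f (emb (fun x => c * u x + v x)) = c%:C * f (emb u) + f (emb v).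
Proof.
move=> tu tv; rewrite -(hf.1 _ _ _ (emb_D tu) (emb_D tv)); congr f; apply/funext => x.
by rewrite /emb rmorphD rmorphM.
Qed.

Lemma f_emb_cont (Lb : R) : for_levels star (fun l => exists2 K, 0 <= K &
  forall u c, tcls M star u -> supp_in Lb u -> ub M l u c -> Normc.normc (f (emb u)) <= K * c).
Proof.
pose K := [set x : V | `|x| <= Lb]; have cK : compact K := @ball_compact R d Lb.
have N := D_nbhs0_levels cK (@subsetT _ K) (hf.2 1 ltr01).
suff key l : 0 < l -> (exists2 e, 0 < e & forall phi : cfun, D_compact M star K phi ->
    (ultranorm M l K phi < e%:E)%E -> Normc.normc (f phi) < 1) ->
  exists2 K, 0 <= K &
  forall u c, tcls M star u -> supp_in Lb u -> ub M l u c -> Normc.normc (f (emb u)) <= K * c.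
  by case: star N key => /= [[l l0 H] key|H key l l0]; [exists l => //|]; apply: key => //; exact: H.
move=> l0 [e e0 He]; exists (2 / e); first by rewrite divr_ge0// ltW.
move=> u c tu u0 uc; apply: le_of_eps => eps eps0.
have c0 : 0 <= c := ub_ge0 M_gt0 uc.
(* The summand with [eps] keeps [c'] positive when [c = 0]; after rescaling into the neighbourhood
   where [f] is below 1 it reappears as exactly the error [eps]. *)
pose c' := c + eps * e / 2; have c'0 : 0 < c' by rewrite ltr_wpDl// divr_gt0// mulr_gt0.
pose t := e / (2 * c'); have t0 : 0 < t by rewrite divr_gt0// mulr_gt0.
have ttu : tcls M star (fun x => t * u x) by exact: tcls_scale.
have sE : supp (emb (fun x => t * u x)) `<=` K.
  by apply: ball_supp => x /u0 E; rewrite /emb E mulr0.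
have [su _ _] := tu.
have ub1 : ub M l (Re_fun (emb (fun x => t * u x))) (t * c).
  have := ub_scale t su uc; rewrite (gtr0_norm t0); exact.
have ub2 : ub M l (Im_fun (emb (fun x => t * u x))) 0.
  by have [_ E] := @rsmooth0 R d; move=> s x; rewrite E normr0 mul0r.
have Dp : D_compact M star K (emb (fun x => t * u x)).
  by apply: tcls_D_compact => //; exact: tcls0.
have := He _ Dp.
have -> : f (emb (fun x => t * u x)) = t%:C * f (emb u).
  by rewrite -(f_scale _ (emb_D tu)); congr f; apply/funext => x; rewrite /emb rmorphM.
rewrite Normc.normcM /= expr0n /= addr0 sqrtr_sqr (gtr0_norm t0) => h.
have : t * Normc.normc (f (emb u)) < 1.
  apply: h; apply: le_lt_trans (ultranorm_le M_gt0 l0 (ub_cub (K := K) ub1 ub2)) _.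
  rewrite lte_fin addr0 /t; apply: le_lt_trans (_ : e / 2 < e); last by lra.
  rewrite mulrAC ler_pdivrMr ?mulr_gt0//.
  have -> : e / 2 * (2 * c') = e * c' by field.
  by rewrite ler_pM2l// /c' lerDl ltW// divr_gt0// mulr_gt0.
rewrite mulrC -ltr_pdivlMr// mul1r => /ltW/le_trans; apply.
rewrite /t invf_div /c' le_eqVlt; apply/orP; left; apply/eqP; field.
by rewrite gt_eqF.
Qed.

Lemma ReLlin : Llin M star (fun u => complex.Re (f (emb u))).
Proof.
move=> c u v tu tv; rewrite f_emb_lin//; case: (f _) (f _) => [? ?] [? ?] /=; ring.
Qed.

Lemma ImLlin : Llin M star (fun u => complex.Im (f (emb u))).
Proof.
move=> c u v tu tv; rewrite f_emb_lin//; case: (f _) (f _) => [? ?] [? ?] /=; ring.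
Qed.

Lemma part_cont (pr : R[i] -> R) : (forall z, `|pr z| <= Normc.normc z) ->
  Lcont M star (fun u => pr (f (emb u))).
Proof.
move=> hpr Lb; have := f_emb_cont Lb; rewrite /Lbound; case: star => /= [[l l0 [K K0 H]]|H l l0].
  by exists l => //; exists K; split=> // u c tu u0 uc; apply: le_trans (hpr _) _; exact: H.
have [K K0 HK] := H l l0.
by exists K; split=> // u c tu u0 uc; apply: le_trans (hpr _) _; exact: HK.
Qed.

Lemma ReLcont : Lcont M star (fun u => complex.Re (f (emb u))).
Proof. exact: (part_cont (@normc_ge_Re R)). Qed.

Lemma ImLcont : Lcont M star (fun u => complex.Im (f (emb u))).
Proof. exact: (part_cont (@normc_ge_Im R)). Qed.

Lemma bigO_parts W (omega : V -> R) (pr : R[i] -> R) :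
  (forall x, W x -> 0 < omega x) -> (forall z, `|pr z| <= Normc.normc z) ->
  bigO_translates M star W omega f ->
  forall u, tcls M star u -> exists B, forall h, W h ->
    `|pr (f (emb (fun x => u (x - h))))| <= B * omega h.
Proof.
move=> om hpr hO u tu; have := hO _ (emb_D tu).
set S := ereal_sup _ => hS.
have [B HB] : exists B : R, (S <= B%:E)%E.
  by case: S hS => [B| |]// _; [exists B|exists 0; rewrite leNye].
exists B => h Wh; apply: le_trans (hpr _) _; rewrite -ler_pdivrMr ?om// -lee_fin.
by apply: le_trans HB; apply: ereal_sup_ubound; exists h.
Qed.

End Functional.

Section Pairing.
Context {R : realType} {d : nat}.
Local Notation V := 'rV[R]_d.
Local Notation cfun := (V -> R[i]).

Lemma CC_shift L (g : V -> R) h : CC L g -> CC (L + `|h|) (fun x => g (x - h)).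
Proof.
move=> [cg g0]; split; first exact: cont_shift.
move=> x Lx; apply: g0; have := ler_normB (x - h) (- h); rewrite opprK subrK normrN => hh.
lra.
Qed.

Definition vanish (Om : set V) (u : V -> R) : Prop := forall y, Om y \/
  exists2 dl, 0 < dl & forall z, `|y - z| < dl -> u z = 0.

(** The coefficient is known to be continuous only at points of [Om]; at the other points the
    derivatives of [u] vanish nearby, so the product is continuous everywhere and the integral
    theory applies. *)
Lemma CC_gmul (Om : set V) L (G u : V -> R) a : (forall y, Om y -> {for y, continuous G}) ->
  rsmooth u -> supp_in L u -> vanish Om u -> CC L (fun y => G y * rmderiv a u y).
Proof.
move=> cG su u0 uOm; have [cu z0] := rder_CC (aseq a) su u0; split; last first.
  by move=> x Lx; rewrite /rmderiv z0// mulr0.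
move=> y; have [Oy|[dl dl0 Hd]] := uOm y.
  exact: (continuousM (cG y Oy) (cu y)).
apply/cont_ballP => e e0; exists dl => // z yz.
have Z t : `|y - t| < dl -> rmderiv a u t = 0.
  move=> yt; apply: rder_nil_supp => //; exists (dl - `|y - t|); first by rewrite subr_gt0.
  move=> z' tz; apply: Hd; rewrite -(subrKA t); apply: le_lt_trans (ler_normD _ _) _; lra.
by rewrite !Z ?subrr ?normr0// !mulr0 subrr normr0 ltW.
Qed.

Definition pairing (G : V -> R) (a : multiindex d) (u : V -> R) : R :=
  rintegral (fun y => G y * rmderiv a u y).

Definition adm (Om : set V) (u : V -> R) : Prop :=
  [/\ rsmooth u, exists L, supp_in L u & vanish Om u].

Lemma adm_lin Om c u v : adm Om u -> adm Om v -> adm Om (fun x => c * u x + v x).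
Proof.
move=> [su [L u0] uO] [sv [L' v0] vO]; split; first exact: (rsmooth_lin c su sv).1.
  exists (Num.max L L') => x; rewrite gt_max => /andP[Lx L'x].
  by rewrite u0// v0// mulr0 addr0.
move=> y; case: (uO y) => [Oy|[d1 d10 H1]]; first by left.
case: (vO y) => [Oy|[d2 d20 H2]]; first by left.
right; exists (Num.min d1 d2); first by rewrite lt_min d10.
by move=> z; rewrite lt_min => /andP[z1 z2]; rewrite H1// H2// mulr0 addr0.
Qed.

Lemma pairing_lin (Om : set V) (G : V -> R) a c (u v : V -> R) : (forall y, Om y -> {for y, continuous G}) ->
  adm Om u -> adm Om v ->
  pairing G a (fun x => c * u x + v x) = c * pairing G a u + pairing G a v.
Proof.
move=> cG [su [L u0] uO] [sv [L' v0] vO].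
pose L1 := Num.max `|L| `|L'| + 1.
have m0 : `|L| <= Num.max `|L| `|L'| by rewrite le_max lexx.
have m1 : `|L'| <= Num.max `|L| `|L'| by rewrite le_max lexx orbT.
have n0 := ler_norm L; have n1 := ler_norm L'; have n2 := normr_ge0 L.
have L10 : 0 < L1 by rewrite /L1; lra.
have u0' : supp_in L1 u by apply: supp_in_mono u0; rewrite /L1; lra.
have v0' : supp_in L1 v by apply: supp_in_mono v0; rewrite /L1; lra.
rewrite -(rint_lin _ L10 (CC_gmul a cG su u0' uO) (CC_gmul a cG sv v0' vO)).
congr rintegral; apply/funext => x; have [_ E] := rsmooth_lin c su sv.
by rewrite /rmderiv E; ring.
Qed.

Definition cpairing (G : V -> R) a (phi : cfun) : R[i] :=
  pairing G a (Re_fun phi) +i* pairing G a (Im_fun phi).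

Definition cadm Om (phi : cfun) := adm Om (Re_fun phi) /\ adm Om (Im_fun phi).

Lemma adm0 Om : adm Om (fun=> 0).
Proof.
have [s0 _] := @rsmooth0 R d; split=> //; first by exists 0.
by move=> y; right; exists 1.
Qed.

Lemma pairing0 (Om : set V) (G : V -> R) a : (forall y, Om y -> {for y, continuous G}) -> pairing G a (fun=> 0) = 0.
Proof.
move=> cG; have := pairing_lin a 1 cG (adm0 Om) (adm0 Om).
by under eq_fun do rewrite mulr0 addr0; lra.
Qed.

Lemma cpairing_lin (Om : set V) (G : V -> R) a (b c : R[i]) (phi psi : cfun) :
  (forall y, Om y -> {for y, continuous G}) -> cadm Om phi -> cadm Om psi ->
  cpairing G a (fun x => b * phi x + c * psi x) = b * cpairing G a phi + c * cpairing G a psi.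
Proof.
move=> cG [p1 p2] [q1 q2]; case: b c => b1 b2 [c1 c2].
have E1 : Re_fun (fun x => (b1 +i* b2) * phi x + (c1 +i* c2) * psi x) =
    (fun x => b1 * Re_fun phi x + ((- b2) * Im_fun phi x + (c1 * Re_fun psi x + ((- c2) * Im_fun psi x + 0)))).
  by apply/funext => x; rewrite /Re_fun /Im_fun; case: (phi x) (psi x) => [? ?] [? ?] /=; ring.
have E2 : Im_fun (fun x => (b1 +i* b2) * phi x + (c1 +i* c2) * psi x) =
    (fun x => b1 * Im_fun phi x + (b2 * Re_fun phi x + (c1 * Im_fun psi x + (c2 * Re_fun psi x + 0)))).
  by apply/funext => x; rewrite /Re_fun /Im_fun; case: (phi x) (psi x) => [? ?] [? ?] /=; ring.
have z := adm0 Om; have P0 := pairing0 a cG.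
rewrite /cpairing E1 E2.
rewrite !(pairing_lin a _ cG) ?P0//; do ?apply: adm_lin => //.
by apply/eqP; rewrite eq_complex /=; apply/andP; split; apply/eqP; ring.
Qed.

Lemma normc_sign n (z : R[i]) : Normc.normc ((-1) ^+ n * z) = Normc.normc z.
Proof.
rewrite -signr_odd; case: (odd n); rewrite ?expr0 ?expr1 ?mul1r ?mulN1r//.
by case: z => a b /=; rewrite !sqrrN.
Qed.

(* Shifting the test function by [h] is the same as shifting the coefficient by [-h]; this
   keeps the domain of integration, and hence the constants, independent of [h]. *)
Lemma distr_derivE (Om : set V) a (g phi : cfun) (h : V) :
  (forall y, Om y -> {for y, continuous (Re_fun g)} /\ {for y, continuous (Im_fun g)}) ->
  cadm [set y | Om (y + h)] phi ->
  distr_deriv a g (fun x : V => phi (x - h)) = (-1) ^+ mlength a *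
    (cpairing (fun y : V => Re_fun g (y + h)) a phi + (0 +i* 1) * cpairing (fun y : V => Im_fun g (y + h)) a phi).
Proof.
move=> cg [[su [L u0] uO] [sv [L' v0] vO]].
pose L1 := Num.max `|L| `|L'| + 1.
have m0 : `|L| <= Num.max `|L| `|L'| by rewrite le_max lexx.
have m1 : `|L'| <= Num.max `|L| `|L'| by rewrite le_max lexx orbT.
have n0 := ler_norm L; have n1 := ler_norm L'; have n2 := normr_ge0 L.
have L10 : 0 < L1 by rewrite /L1; lra.
have u0' : supp_in L1 (Re_fun phi) by apply: supp_in_mono u0; rewrite /L1; lra.
have v0' : supp_in L1 (Im_fun phi) by apply: supp_in_mono v0; rewrite /L1; lra.
have sh (G : V -> R) (y : V) : {for y + h, continuous G} -> {for y, continuous (fun y : V => G (y + h))}.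
  move=> /cont_ballP H; apply/cont_ballP => e e0; have [dl dl0 Hd] := H e e0.
  by exists dl => // z yz; apply: Hd; rewrite opprD addrACA subrr addr0.
have c1 (y : V) : Om (y + h) -> {for y, continuous (fun y : V => Re_fun g (y + h))} by move=> /cg[? _]; exact: sh.
have c2 (y : V) : Om (y + h) -> {for y, continuous (fun y : V => Im_fun g (y + h))} by move=> /cg[_ ?]; exact: sh.
have C11 := CC_gmul a c1 su u0' uO; have C12 := CC_gmul a c1 sv v0' vO.
have C21 := CC_gmul a c2 su u0' uO; have C22 := CC_gmul a c2 sv v0' vO.
rewrite /distr_deriv /cintegral; congr (_ * _).
have [_ Eu] := rsmooth_shift h su; have [_ Ev] := rsmooth_shift h sv.
have L20 : 0 < L1 + `|h| by rewrite ltr_wpDr.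
have X1 : Re_fun (fun x => g x * mderiv a (fun x : V => phi (x - h)) x) = fun x =>
   (fun y : V => Re_fun g (y + h) * rmderiv a (Re_fun phi) y) (x - h) -
   (fun y : V => Im_fun g (y + h) * rmderiv a (Im_fun phi) y) (x - h).
  apply/funext => x; rewrite /= subrK /rmderiv.
  have := Re_mderiv a (fun x : V => phi (x - h)) x; have := Im_mderiv a (fun x : V => phi (x - h)) x.
  rewrite /rmderiv [Re_fun (fun x : V => phi (x - h))](_ : _ = fun x => Re_fun phi (x - h))//.
  rewrite [Im_fun (fun x : V => phi (x - h))](_ : _ = fun x => Im_fun phi (x - h))// Eu Ev => <- <-.
  by rewrite /Re_fun /Im_fun; case: (g x) (mderiv _ _ x) => [? ?] [? ?].
have X2 : Im_fun (fun x => g x * mderiv a (fun x : V => phi (x - h)) x) = fun x =>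
   1 * (fun y : V => Re_fun g (y + h) * rmderiv a (Im_fun phi) y) (x - h) +
   (fun y : V => Im_fun g (y + h) * rmderiv a (Re_fun phi) y) (x - h).
  apply/funext => x; rewrite /= subrK /rmderiv mul1r.
  have := Re_mderiv a (fun x : V => phi (x - h)) x; have := Im_mderiv a (fun x : V => phi (x - h)) x.
  rewrite /rmderiv [Re_fun (fun x : V => phi (x - h))](_ : _ = fun x => Re_fun phi (x - h))//.
  rewrite [Im_fun (fun x : V => phi (x - h))](_ : _ = fun x => Im_fun phi (x - h))// Eu Ev => <- <-.
  by rewrite /Re_fun /Im_fun; case: (g x) (mderiv _ _ x) => [? ?] [? ?].
rewrite X1 X2 (rintB L20 (CC_shift h C11) (CC_shift h C22)) (rint_lin _ L20 (CC_shift h C12) (CC_shift h C21)).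
rewrite (rint_shift h L10 C11) (rint_shift h L10 C12) (rint_shift h L10 C21) (rint_shift h L10 C22).
by apply/eqP; rewrite eq_complex /=; apply/andP; split; apply/eqP; rewrite /pairing; ring.
Qed.

End Pairing.

(** * Estimates for the terms of the series *)

Section Terms.
Context {R : realType} {d : nat}.
Local Notation V := 'rV[R]_d.
Local Notation cfun := (V -> R[i]).
Variable M : nat -> R.
Hypothesis M_gt0 : forall p, 0 < M p.
Variables (W : set V) (omega : V -> R).
Implicit Types (phi : cfun) (K Omega : set V).

Lemma thicken_open r : open (thicken W r).
Proof.
rewrite openE => y [x Wx yx]; have [dl dl0 Hd] := enorm_ball yx.
apply/nbhs_ballP; exists dl => //= z yz; exists x => //; apply: Hd.
by move: yz; rewrite -ball_normE.
Qed.

Lemma ccontinuous_at r (g : cfun) : ccontinuous_on (thicken W r) g <->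
  forall y, thicken W r y -> {for y, continuous (Re_fun g)} /\ {for y, continuous (Im_fun g)}.
Proof.
rewrite /ccontinuous_on !continuous_open_subspace; try exact: thicken_open.
split=> [[c1 c2] y ty|H]; first by split; [apply: c1|apply: c2]; rewrite inE.
by split=> y; rewrite inE => /H[].
Qed.

Lemma cadmP star Omega K phi : tcls M star (Re_fun phi) -> tcls M star (Im_fun phi) ->
  supp phi `<=` K -> K `<=` Omega -> cadm Omega phi.
Proof.
move=> [s1 L1 _] [s2 L2 _] sK KO.
have van y : Omega y \/ exists2 dl, 0 < dl & forall z, `|y - z| < dl -> phi z = 0.
  have [Ky|nK] := pselect (K y); first by left; exact: KO.
  by right; apply: supp_zero => h; apply: nK; exact: sK.
split; split=> // y; case: (van y) => [Oy|[dl dl0 Hd]]; [by left| |by left|]; right;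
  by exists dl => // z /Hd E; rewrite /Re_fun /Im_fun E.
Qed.

(** [omega] has no regularity, so the bound comes from compactness: near each point of [K] one base
    point in [W] serves, and only a bounded range of their values is needed. *)
Lemma cover_compact r K : (forall x, W x -> 0 < omega x) -> compact K -> K `<=` thicken W r ->
  exists2 Om, 0 < Om & forall y, K y -> exists2 x, W x & enorm (y - x) < r /\ omega x <= Om.
Proof.
move=> om /compact_near_coveringP cK KW.
pose P (n : nat) (y : V) := exists2 x, W x & enorm (y - x) < r /\ omega x <= n%:R.
have [|N _ HN] := cK nat \oo P _.
  move=> y /KW[x Wx yx]; have [dl dl0 Hd] := enorm_ball yx.
  pose n := (Num.truncn (omega x)).+1.
  exists ([set z : V | `|y - z| < dl], [set m : nat | (n <= m)%N]) => /=.
    split; last by exists n.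
    by apply/nbhs_ballP; exists dl => //= z; rewrite -ball_normE.
  move=> [z m] /= [yz nm]; exists x => //; split; first exact: Hd.
  apply: le_trans (_ : n%:R <= _); last by rewrite ler_nat.
  by apply: ltW; apply: truncnS_gt.
exists N.+1%:R => // y Ky; have [x Wx [yx ox]] := HN N (leqnn N) y Ky.
by exists x => //; split=> //; apply: le_trans ox _; rewrite ler_nat.
Qed.

Definition coeff_le r (g : multiindex d -> cfun) C l : Prop :=
  forall x h (a : multiindex d), W x -> enorm h < r ->
    Normc.normc (g a (x + h)) <= C * (l ^+ mlength a / M (mlength a)) * omega x.

(** With the translation moved onto the coefficient, the volume and the norm of [phi] do not depend
    on [h]; only [Om] does. The factor 4 counts the real pairings into which a complex one
    splits. *)
Lemma term_bound star r (g : multiindex d -> cfun) lf l C c Om K L phi (h : V) : 0 < L ->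
  (forall y, K y -> `|y| <= L) -> 0 < lf -> 0 < l -> 0 <= C -> 0 <= c -> 0 <= Om ->
  (forall a, ccontinuous_on (thicken W r) (g a)) -> coeff_le r g C lf ->
  tcls M star (Re_fun phi) -> tcls M star (Im_fun phi) -> supp phi `<=` K -> cub M l K phi c ->
  (forall y, K y -> exists2 x, W x & enorm (y + h - x) < r /\ omega x <= Om) ->
  forall a, Normc.normc (distr_deriv a (g a) (fun x => phi (x - h))) <=
    4 * ((2 * L) ^+ d * (C * Om * c)) * (lf * l) ^+ mlength a.
Proof.
move=> L0 KL lf0 l0 C0 c0 Om0 cg Hg t1 t2 sK Hc cov a.
have [s1 _ _] := t1; have [s2 _ _] := t2.
have KO : K `<=` [set y | thicken W r (y + h)].
  by move=> y /cov[x Wx [yx _]]; exists x.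
have cgy y := (ccontinuous_at r (g a)).1 (cg a) y.
have ca : cadm [set y | thicken W r (y + h)] phi := cadmP t1 t2 sK KO.
rewrite (distr_derivE a cgy ca) normc_sign.
have Mm := M_gt0 (mlength a).
have sp : smooth phi by apply/smoothP.
have [u1 u2] := supp_Re_Im sK KL.
have [ub1 ub2] := cub_ub M_gt0 l0 sp sK c0 Hc.
pose B := C * Om * c * (lf * l) ^+ mlength a.
have lfn : 0 <= lf ^+ mlength a by exact: exprn_ge0 (ltW lf0).
have key (pr : R[i] -> R) (u : V -> R) : (forall z, `|pr z| <= Normc.normc z) ->
    (forall y, thicken W r y -> {for y, continuous (fun y => pr (g a y))}) ->
    adm [set y | thicken W r (y + h)] u -> supp_in L u -> ub M l u c ->
    (forall y, phi y = 0 -> u y = 0) ->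
    `|pairing (fun y : V => pr (g a (y + h))) a u| <= (2 * L) ^+ d * B.
  move=> hpr cpr [su _ uO] uL uc uz; apply: rint_bound => //.
    have cG (y : V) : thicken W r (y + h) -> {for y, continuous (fun y : V => pr (g a (y + h)))}.
      move=> ty; apply/cont_ballP => e e0.
      have /cont_ballP/(_ e e0)[dl dl0 Hd] := cpr _ ty.
      by exists dl => // z yz; apply: Hd; rewrite opprD addrACA subrr addr0.
    exact: (CC_gmul a cG su uL uO).
  move=> y; have [Ky|nK] := pselect (K y); last first.
    have [dl dl0 Hd] := supp_zero (fun h => nK (sK y h)).
    rewrite /rmderiv rder_nil_supp ?mulr0 ?normr0//.
      by rewrite /B !mulr_ge0 ?exprn_ge0 ?mulr_ge0 ?(ltW lf0) ?(ltW l0).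
    by exists dl => // z /Hd; exact: uz.
  have [x Wx [yx ox]] := cov y Ky; rewrite normrM.
  have e1 : `|pr (g a (y + h))| <= C * (lf ^+ mlength a / M (mlength a)) * Om.
    apply: le_trans (hpr _) _; have := Hg x (y + h - x) a Wx yx.
    rewrite [x + _]addrC subrK => /le_trans; apply.
    by apply: ler_wpM2l => //; rewrite mulr_ge0// divr_ge0// ltW.
  have := uc (aseq a) y; rewrite size_aseq => e2.
  apply: le_trans (ler_pM _ _ e1 e2) _ => //.
  rewrite /B exprMn le_eqVlt; apply/orP; left; apply/eqP; field.
  by rewrite gt_eqF.
have [a1 a2] := ca.
have cR y : thicken W r y -> {for y, continuous (fun y => complex.Re (g a y))} by move=> /cgy[].
have cI y : thicken W r y -> {for y, continuous (fun y => complex.Im (g a y))} by move=> /cgy[].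
have zR y : phi y = 0 -> Re_fun phi y = 0 by move=> E; rewrite /Re_fun E.
have zI y : phi y = 0 -> Im_fun phi y = 0 by move=> E; rewrite /Im_fun E.
have k11 := key _ _ (@normc_ge_Re R) cR a1 u1 ub1 zR.
have k12 := key _ _ (@normc_ge_Re R) cR a2 u2 ub2 zI.
have k21 := key _ _ (@normc_ge_Im R) cI a1 u1 ub1 zR.
have k22 := key _ _ (@normc_ge_Im R) cI a2 u2 ub2 zI.
apply: le_trans (normc_le_sum _) _.
rewrite -mulrA -[_ * _ * (lf * l) ^+ _]mulrA -/B.
rewrite /cpairing /=; move: k11 k12 k21 k22; rewrite /Re_fun /Im_fun.
move: (pairing _ _ _) (pairing _ _ _) (pairing _ _ _) (pairing _ _ _) ((2 * L) ^+ d * B) => x y z t P.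
rewrite !ler_norml => /andP[? ?] /andP[? ?] /andP[? ?] /andP[? ?].
have : `|t + (0 * y - 1 * x)| <= 2 * P by rewrite ler_norml; apply/andP; split; lra.
have : `|z + (0 * x + 1 * y)| <= 2 * P by rewrite ler_norml; apply/andP; split; lra.
lra.
Qed.

Lemma low_fset m : exists A0 : {fset multiindex d}, forall al, (mlength al < m)%N -> al \in A0.
Proof.
exists (seq_fset tt [seq ofb b | b <- index_enum {ffun 'I_d -> 'I_m.+1}]) => al am.
rewrite seq_fsetE; have [|b <-] := @ofb_surj d m al; last by apply: map_f; exact: mem_index_enum.
move=> i; apply: leq_trans (ltnW am); rewrite /mlength (bigD1 i)//=; exact: leq_addr.
Qed.

Lemma fset_tail m (A : {fset multiindex d}) : (forall al, al \in A -> (m <= mlength al)%N) ->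
  \sum_(al <- A) (4^-1 : R) ^+ mlength al <= 2^-1 ^+ m * 2 ^+ d.
Proof.
move=> HA; have [n Hn] : exists n, forall al, al \in A -> forall i, (al i <= n)%N.
  exists (\sum_(al <- A) mlength al)%N => al Aal i.
  rewrite (big_rem al)//=; apply: leq_trans (leq_addr _ _).
  by rewrite /mlength (bigD1 i)//=; exact: leq_addr.
rewrite (sum_fset_box (n := n) _ Hn); apply: box_tail => b; exact: HA.
Qed.

Lemma normc_sum (s : seq (multiindex d)) (T : multiindex d -> R[i]) :
  Normc.normc (\sum_(a <- s) T a) <= \sum_(a <- s) Normc.normc (T a).
Proof.
elim: s => [|a s IH]; first by rewrite !big_nil Normc.normc0.
by rewrite !big_cons; apply: le_trans (le_normcD _ _) _; rewrite lerD2l.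
Qed.

Lemma complex_sum (s : seq (multiindex d)) (x y : multiindex d -> R) :
  \sum_(a <- s) (x a +i* y a) = (\sum_(a <- s) x a) +i* (\sum_(a <- s) y a).
Proof. by elim: s => [|a s IH]; rewrite ?big_nil// !big_cons IH. Qed.

End Terms.

Section Convergence.
Context {R : realType} {d : nat}.
Local Notation V := 'rV[R]_d.
Local Notation cfun := (V -> R[i]).
Variable M : nat -> R.
Hypothesis M_gt0 : forall p, 0 < M p.
Variables (star : ultra_case) (W : set V) (omega : V -> R) (r : R).
Hypothesis omega_gt0 : forall x, W x -> 0 < omega x.
Variable g : multiindex d -> cfun.
Hypothesis cg : forall a, ccontinuous_on (thicken W r) (g a).
Hypothesis Hg : coeff_bound_case M star W omega r g.
Let Omega := thicken W r.
Let T a phi := distr_deriv a (g a) phi.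

Lemma D_cadm phi : D_space M star Omega phi -> cadm Omega phi.
Proof. by move=> /(D_spaceP M_gt0)[t1 t2 [K [_ KO sK]]]; exact: (cadmP t1 t2 sK KO). Qed.

Lemma term_pairing a phi : cadm Omega phi -> T a phi = (-1) ^+ mlength a *
    (cpairing (Re_fun (g a)) a phi + (0 +i* 1) * cpairing (Im_fun (g a)) a phi).
Proof.
move=> cp; have cp0 : cadm [set y | Omega (y + 0)] phi.
  by rewrite (_ : [set _ | _] = Omega)//; apply/funext => y /=; rewrite addr0.
have := distr_derivE a ((ccontinuous_at W r (g a)).1 (cg a)) cp0.
rewrite [X in cpairing X _ _](_ : _ = Re_fun (g a)); last by apply/funext => y; rewrite addr0.
rewrite [X in _ * cpairing X _ _](_ : _ = Im_fun (g a)); last by apply/funext => y; rewrite addr0.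
by rewrite (_ : (fun x => phi (x - 0)) = phi)//; apply/funext => y; rewrite subr0.
Qed.

Lemma term_lin a b c (phi psi : cfun) : D_space M star Omega phi -> D_space M star Omega psi ->
  T a (fun x => b * phi x + c * psi x) = b * T a phi + c * T a psi.
Proof.
move=> D1 D2; have cp := D_cadm D1; have cq := D_cadm D2.
have cs : cadm Omega (fun x => b * phi x + c * psi x).
  apply: D_cadm; apply: (D_lin M_gt0) => //.
  have := D_lin M_gt0 c D2 (D0 M_gt0 star Omega).
  by under eq_fun do rewrite addr0.
rewrite !term_pairing//.
have c1 y : Omega y -> {for y, continuous (Re_fun (g a))}.
  by move=> /((ccontinuous_at W r (g a)).1 (cg a))[].
have c2 y : Omega y -> {for y, continuous (Im_fun (g a))}.
  by move=> /((ccontinuous_at W r (g a)).1 (cg a))[].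
rewrite (cpairing_lin a b c c1 cp cq) (cpairing_lin a b c c2 cp cq); ring.
Qed.

(** Coefficient rates and test function levels carry the same quantifier in each case, and
    [l = 4^-1 / lf] passes from one to the other. A product of at most [4^-1] is what makes the
    terms geometric. *)
Lemma levels_product (P Q : R -> Prop) :
  (forall lf l, 0 < lf -> 0 < l -> lf * l <= 4^-1 -> P lf -> Q l) -> for_levels star P -> for_levels star Q.
Proof.
move=> H; case: star => /= [[lf lf0 Hl]|HP l l0].
  exists (4^-1 / lf); first by rewrite divr_gt0// invr_gt0.
  by apply: (H lf) => //; rewrite ?divr_gt0 ?invr_gt0// mulrC mulfVK// gt_eqF.
have lf0 : 0 < 4^-1 / l by rewrite divr_gt0// invr_gt0.
by apply: (H (4^-1 / l)) => //; [rewrite mulfVK// gt_eqF|exact: HP].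
Qed.

Let Hg' : for_levels star (fun lf => exists2 C, 0 < C & coeff_le M W omega r g C lf).
Proof. by move: Hg; rewrite /coeff_bound_case; case: star. Qed.

(** A bounded set is absorbed by this neighbourhood, which turns boundedness into geometric decay
    uniform over the set. Membership in the space is included because absolute convexity rests on
    the linearity of the terms. *)
Lemma geometric_nbhs : D_nbhs0 M star Omega [set phi | D_space M star Omega phi /\
  forall a, Normc.normc (T a phi) <= 4^-1 ^+ mlength a].
Proof.
apply: D_nbhs0_intro => [a b phi psi ab [D1 H1] [D2 H2]|K cK KO].
  have nn n : 0 <= (4^-1 : R) ^+ n by rewrite exprn_ge0// invr_ge0.
  have ab' : Normc.normc a + Normc.normc b <= 1.
    by rewrite -lecR rmorphD; exact: ab.
  split.
    apply: (D_lin M_gt0) => //; have := D_lin M_gt0 b D2 (D0 M_gt0 star Omega).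
    by under eq_fun do rewrite addr0.
  move=> al; rewrite term_lin//; apply: le_trans (le_normcD _ _) _.
  rewrite (Normc.normcM a) (Normc.normcM b); have h1 := H1 al; have h2 := H2 al.
  have na : 0 <= Normc.normc a by exact: le_trans (normr_ge0 _) (normc_ge_Re a).
  have nb : 0 <= Normc.normc b by exact: le_trans (normr_ge0 _) (normc_ge_Re b).
  apply: le_trans (lerD (ler_wpM2l na h1) (ler_wpM2l nb h2)) _.
  by rewrite -mulrDl ler_piMl.
have [L L0 KL] := compact_radius cK; have [Om Om0 cov] := cover_compact omega_gt0 cK KO.
have key lf l C : 0 < lf -> 0 < l -> 0 < C -> lf * l <= 4^-1 -> coeff_le M W omega r g C lf ->
   exists2 e, 0 < e & forall phi : cfun, D_compact M star K phi -> (ultranorm M l K phi < e%:E)%E ->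
    D_space M star Omega phi /\ forall a, Normc.normc (T a phi) <= 4^-1 ^+ mlength a.
  move=> lf0 l0 C0 ll HC; pose Z := 4 * ((2 * L) ^+ d * (C * Om)).
  have Z0 : 0 < Z by rewrite !mulr_gt0// exprn_gt0// mulr_gt0.
  exists Z^-1; first by rewrite invr_gt0.
  move=> phi Dp he; have DS : D_space M star Omega phi by exists K.
  split=> // a; have [t1 t2 sK] := D_compact_tcls M_gt0 cK Dp.
  have Hc := cub_ultranorm M_gt0 l0 (ltW he).
  have Zi : 0 <= Z^-1 by rewrite invr_ge0 ltW.
  have cov0 y : K y -> exists2 x, W x & enorm (y + 0 - x) < r /\ omega x <= Om.
    by rewrite addr0; exact: cov.
  have := term_bound M_gt0 L0 KL lf0 l0 (ltW C0) Zi (ltW Om0) cg HC t1 t2 sK Hc cov0 a.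
  have -> : (fun x : V => phi (x - 0)) = phi by apply/funext => x; rewrite subr0.
  move/le_trans; apply.
  have -> : 4 * ((2 * L) ^+ d * (C * Om * Z^-1)) = Z / Z by rewrite /Z; ring.
  rewrite mulfV ?gt_eqF// mul1r lerXn2r ?nnegrE ?invr_ge0//.
  by rewrite mulr_ge0// ltW.
apply: levels_product Hg' => lf l lf0 l0 ll [C C0 HC]; exact: key HC.
Qed.

Lemma term_tail B : D_bounded M star Omega B ->
  exists2 rho, 0 < rho & forall phi a, B phi -> Normc.normc (T a phi) <= rho * 4^-1 ^+ mlength a.
Proof.
move=> [BD HB]; have [rho rho0 H] := HB _ geometric_nbhs; exists rho => // phi a Bphi.
have [_ /(_ a)] := H phi Bphi; have Dp := BD phi Bphi.
have := term_lin a (rho^-1%:C) 0 Dp Dp.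
have -> : (fun x => rho^-1%:C * phi x + 0 * phi x) = (fun x => rho^-1%:C * phi x).
  by apply/funext => x; rewrite mul0r addr0.
rewrite mul0r addr0 => ->; rewrite Normc.normcM /= expr0n /= addr0 sqrtr_sqr.
by rewrite gtr0_norm ?invr_gt0// ler_pdivrMl.
Qed.

(** Pointwise convergence becomes uniform through the common geometric tail. [A0] depends on the
    tail only; for a given [phi] the set [A] is enlarged by an [A1] that makes the sum close to
    [f phi], and the added terms belong to the tail. *)
Lemma uniform_sum (f : cfun -> R[i]) :
  (forall phi, D_space M star Omega phi -> forall eps, 0 < eps -> exists m,
    forall A : {fset multiindex d}, (forall al, (mlength al < m)%N -> al \in A) ->
      Normc.normc (\sum_(a <- A) T a phi - f phi) <= eps) ->
  strong_dual_sum M star Omega T f.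
Proof.
move=> Hf B BB e e0; have [rho rho0 Hrho] := term_tail BB.
have q0 : 0 < e / 2 / (rho * 2 ^+ d) by rewrite divr_gt0 ?divr_gt0// mulr_gt0// exprn_gt0.
have half_cvg : (fun n : nat => (2^-1 : R) ^+ n) @ \oo --> 0.
  by apply: cvg_expr; rewrite ger0_norm ?invf_lt1 ?invr_ge0// ltr1n.
have [m0 _ Hm0] := cvg_small 0 half_cvg q0.
have {}Hm0 : rho * (2^-1 ^+ m0 * 2 ^+ d) < e / 2.
  have := Hm0 m0 (leqnn _); rewrite ltr_pdivlMr; last by rewrite mulr_gt0// exprn_gt0.
  by rewrite mulrCA.
have [A0 HA0] := @low_fset d m0; exists A0 => A /fsubsetP A0A phi Bphi.
have e4 : 0 < e / 4 by rewrite divr_gt0.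
have [m Hm] := Hf phi (BB.1 phi Bphi) _ e4; have [A1 HA1] := @low_fset d m.
have sub al : (mlength al < m)%N -> al \in (A `|` A1)%fset.
  by move=> /HA1 h; rewrite in_fsetU h orbT.
have := Hm _ sub; rewrite (_ : \sum_(a <- (A `|` A1)%fset) T a phi =
   \sum_(a <- A) T a phi + \sum_(a <- (A1 `\` A)%fset) T a phi); last first.
  rewrite -big_cat; apply: perm_big; apply: uniq_perm; first exact: fset_uniq.
    rewrite cat_uniq !fset_uniq andbT /=; apply/hasPn => a /=.
    by rewrite in_fsetD => /andP[].
  by move=> a; rewrite mem_cat in_fsetD in_fsetU; case: (a \in A).
move=> H.
have tail : Normc.normc (\sum_(a <- (A1 `\` A)%fset) T a phi) < e / 2.
  apply: le_lt_trans Hm0; apply: le_trans (normc_sum _ _) _.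
  apply: le_trans (_ : \sum_(a <- (A1 `\` A)%fset) rho * 4^-1 ^+ mlength a <= _).
    by apply: ler_sum => a _; exact: Hrho.
  rewrite -big_distrr /= ler_pM2l//; apply: fset_tail => a.
  by rewrite in_fsetD => /andP[aA _]; rewrite leqNgt; apply: contra aA => /HA0/A0A.
have -> : \sum_(a <- A) T a phi - f phi =
  (\sum_(a <- A) T a phi + \sum_(a <- (A1 `\` A)%fset) T a phi - f phi) - \sum_(a <- (A1 `\` A)%fset) T a phi.
  by rewrite addrAC addrK.
by apply: le_lt_trans (le_normcD _ _) _; rewrite normcN; lra.
Qed.

End Convergence.

Section Equivalence.
Context {R : realType} {d : nat}.
Local Notation V := 'rV[R]_d.
Local Notation cfun := (V -> R[i]).
Variables (star : ultra_case) (M : nat -> R) (W : set V) (omega : V -> R) (f : cfun -> R[i]).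
Hypothesis M_gt0 : forall p, 0 < M p.
Hypothesis omega_gt0 : forall h, W h -> 0 < omega h.
Hypothesis hf : ultradistribution M star setT f.

Lemma pairing_scale (Om : set V) s (F : V -> R) a u : (forall y, Om y -> {for y, continuous F}) ->
  adm Om u -> pairing (fun y => s * F y) a u = s * pairing F a u.
Proof.
move=> cF [su [L u0] uO]; pose L1 := `|L| + 1.
have L10 : 0 < L1 by rewrite ltr_wpDl.
have u0' : supp_in L1 u.
  by apply: supp_in_mono u0; apply: le_trans (ler_norm L) _; rewrite lerDl.
rewrite /pairing -(rintZ s L10 (CC_gmul a cF su u0' uO)).
by congr rintegral; apply/funext => y; rewrite mulrA.
Qed.

Lemma covered_part r K Om phi (pr : R[i] -> R) : pr 0 = 0 -> 0 < Om -> supp phi `<=` K ->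
  (forall y, K y -> exists2 x, W x & enorm (y - x) < r /\ omega x <= Om) ->
  covered W omega r (fun x => pr (phi x)) Om.
Proof.
move=> pr0 Om0 sK cov; split=> // y; have [Ky|nK] := pselect (K y); first by right; exact: cov.
left; have [dl dl0 Hd] := supp_zero (fun h => nK (sK y h)).
by exists dl => // z /Hd ->.
Qed.

Section Representation.
Variable r : R.
Variables F1 F2 : multiindex d -> V -> R.
Hypothesis rep1 : real_rep M star (fun u => complex.Re (f (emb u))) W omega r F1.
Hypothesis rep2 : real_rep M star (fun u => complex.Im (f (emb u))) W omega r F2.

(** The sign cancels the one in [distr_deriv]: the real representation pairs its coefficients with
    derivatives of the test function without sign. *)
Definition complex_coeff (a : multiindex d) : cfun := fun y =>
  ((-1) ^+ mlength a * F1 a y) +i* ((-1) ^+ mlength a * F2 a y).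

Lemma complex_coeff_cont a : ccontinuous_on (thicken W r) (complex_coeff a).
Proof.
have [c1 _ _] := rep1; have [c2 _ _] := rep2.
have key (F : V -> R) y s : {for y, continuous F} -> {for y, continuous (fun z => s * F z)}.
  by move=> cF; apply: continuousM => //; exact: cst_continuous.
by apply/ccontinuous_at => y ty; split; apply: key; [exact: c1|exact: c2].
Qed.

Lemma complex_coeff_bound : coeff_bound_case M star W omega r complex_coeff.
Proof.
have key l C1 C2 : 0 < l -> 0 <= C1 -> 0 <= C2 ->
   (forall x h (al : multiindex d), W x -> enorm h < r ->
     `|F1 al (x + h)| <= C1 * (l ^+ mlength al / M (mlength al)) * omega x) ->
   (forall x h (al : multiindex d), W x -> enorm h < r ->
     `|F2 al (x + h)| <= C2 * (l ^+ mlength al / M (mlength al)) * omega x) ->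
   coeff_bound M W omega r complex_coeff l.
  move=> l0 C10 C20 H1 H2; exists (C1 + C2 + 1) => [|x h a Wx hr].
    by rewrite ltr_wpDl// addr_ge0.
  apply: le_trans (normc_le_sum _) _; rewrite /= !normrM !normr_sign !mul1r.
  apply: le_trans (lerD (H1 x h a Wx hr) (H2 x h a Wx hr)) _.
  rewrite -!mulrDl ler_wpM2r ?(ltW (omega_gt0 Wx))// ler_wpM2r ?lerDl//.
  by rewrite divr_ge0 ?exprn_ge0 ?(ltW l0) ?(ltW (M_gt0 _)).
have mono F l l' : 0 < l -> l <= l' -> rcoeff_bound M W omega r F l -> rcoeff_bound M W omega r F l'.
  move=> l0 ll' [C C0 H]; exists C => // x h al Wx hr; apply: le_trans (H x h al Wx hr) _.
  rewrite ler_wpM2r ?(ltW (omega_gt0 Wx))// ler_wpM2l// ler_pM2r ?invr_gt0//.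
  by rewrite lerXn2r ?nnegrE ?(ltW l0)// (le_trans (ltW l0)).
have [_ b1 _] := rep1; have [_ b2 _] := rep2.
case: star b1 b2 => /= [[l1 l10 B1] [l2 l20 B2]|B1 B2 l l0].
  have l0 : 0 < Num.max l1 l2 by rewrite lt_max l10.
  exists (Num.max l1 l2) => //.
  have [|C1 C10 H1] := mono _ _ (Num.max l1 l2) l10 _ B1; first by rewrite le_max lexx.
  have [|C2 C20 H2] := mono _ _ (Num.max l1 l2) l20 _ B2; first by rewrite le_max lexx orbT.
  exact: key H1 H2.
by have [C1 C10 H1] := B1 l l0; have [C2 C20 H2] := B2 l l0; exact: key H1 H2.
Qed.

Lemma complex_coeff_term phi a : D_space M star (thicken W r) phi ->
  distr_deriv a (complex_coeff a) phi =
   (pairing (F1 a) a (Re_fun phi) - pairing (F2 a) a (Im_fun phi)) +i*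
   (pairing (F1 a) a (Im_fun phi) + pairing (F2 a) a (Re_fun phi)).
Proof.
move=> /(D_cadm M_gt0)[a1 a2]; rewrite (term_pairing complex_coeff_cont)//.
have [c1 _ _] := rep1; have [c2 _ _] := rep2.
set s : R := (-1) ^+ mlength a; have ss : s * s = 1 by rewrite -expr2 sqrr_sign.
have -> : (-1) ^+ mlength a = s%:C by rewrite /s rmorph_sign.
rewrite /cpairing.
rewrite [Re_fun (complex_coeff a)](_ : _ = fun y => s * F1 a y)//.
rewrite [Im_fun (complex_coeff a)](_ : _ = fun y => s * F2 a y)//.
rewrite !(pairing_scale s a (c1 a))// !(pairing_scale s a (c2 a))//.
set x := pairing (F1 a) a (Re_fun phi); set y := pairing (F1 a) a (Im_fun phi).
set z := pairing (F2 a) a (Re_fun phi); set t := pairing (F2 a) a (Im_fun phi).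
apply/eqP; rewrite eq_complex /=; apply/andP; split; apply/eqP.
  by transitivity (s * s * (x - t)); [ring|rewrite ss mul1r].
by transitivity (s * s * (y + z)); [ring|rewrite ss mul1r].
Qed.

Lemma complex_rep : strong_dual_sum M star (thicken W r)
  (fun a phi => distr_deriv a (complex_coeff a) phi) f.
Proof.
apply: (uniform_sum M_gt0 omega_gt0 complex_coeff_cont complex_coeff_bound) => phi Dp eps eps0.
have /(D_spaceP M_gt0)[t1 t2 [K [cK KO sK]]] := Dp.
have [Om Om0 cov] := cover_compact omega_gt0 cK KO.
have cv1 : covered W omega r (Re_fun phi) Om := covered_part (pr := @complex.Re R) erefl Om0 sK cov.
have cv2 : covered W omega r (Im_fun phi) Om := covered_part (pr := @complex.Im R) erefl Om0 sK cov.
have e4 : 0 < eps / 4 by rewrite divr_gt0.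
have [_ _ S1] := rep1; have [_ _ S2] := rep2.
have [m1 H1] := S1 _ _ t1 cv1 _ e4; have [m2 H2] := S1 _ _ t2 cv2 _ e4.
have [m3 H3] := S2 _ _ t1 cv1 _ e4; have [m4 H4] := S2 _ _ t2 cv2 _ e4.
exists (m1 + m2 + m3 + m4)%N => A HA.
have sub m : (m <= m1 + m2 + m3 + m4)%N -> forall al, (mlength al < m)%N -> al \in A.
  by move=> mm al am; apply: HA; exact: leq_trans am mm.
have l1 : (m1 <= m1 + m2 + m3 + m4)%N by rewrite -!addnA leq_addr.
have l2 : (m2 <= m1 + m2 + m3 + m4)%N by rewrite -!addnA addnCA leq_addr.
have l3 : (m3 <= m1 + m2 + m3 + m4)%N by rewrite addnAC leq_addl.
have l4 : (m4 <= m1 + m2 + m3 + m4)%N by rewrite leq_addl.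
have h1 := H1 A (sub _ l1); have h2 := H2 A (sub _ l2).
have h3 := H3 A (sub _ l3); have h4 := H4 A (sub _ l4).
rewrite (eq_bigr _ (fun a _ => complex_coeff_term a Dp)) complex_sum sumrB big_split /=.
have DT : D_space M star setT phi by case: Dp => K' [cK' _] H; exists K'.
rewrite (f_Re_Im M_gt0 hf DT); apply: le_trans (normc_le_sum _) _.
move: h1 h2 h3 h4; rewrite /pairing.
case: (f (emb (Re_fun phi))) (f (emb (Im_fun phi))) => [p q] [p' q'] /=.
set x := \sum_(al <- A) rintegral (fun y => F1 al y * rmderiv al (Re_fun phi) y).
set y := \sum_(al <- A) rintegral (fun y => F1 al y * rmderiv al (Im_fun phi) y).
set z := \sum_(al <- A) rintegral (fun y => F2 al y * rmderiv al (Re_fun phi) y).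
set t := \sum_(al <- A) rintegral (fun y => F2 al y * rmderiv al (Im_fun phi) y).
move=> h1 h2 h3 h4.
have -> : x - t - (0 * p' - 1 * q' + p) = (x - p) - (t - q') by ring.
have -> : y + z - (0 * q' + 1 * p' + q) = (y - p') + (z - q) by ring.
apply: le_trans (lerD (ler_normB _ _) (ler_normD _ _)) _; lra.
Qed.

End Representation.

End Equivalence.

(** * The two implications *)

Section Directions.
Context {R : realType} {d : nat}.
Local Notation V := 'rV[R]_d.
Local Notation cfun := (V -> R[i]).
Variables (star : ultra_case) (M : nat -> R) (W : set V) (omega : V -> R) (f : cfun -> R[i]).
Hypothesis M_gt0 : forall p, 0 < M p.
Hypothesis omega_gt0 : forall h, W h -> 0 < omega h.
Hypothesis hf : ultradistribution M star setT f.

Lemma rep_of_bigO r : weight_M1 M -> weight_M2 M -> weight_M3 M ->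
  bigO_translates M star W omega f ->
  exists g : multiindex d -> cfun, [/\ forall a, ccontinuous_on (thicken W r) (g a),
      coeff_bound_case M star W omega r g &
      strong_dual_sum M star (thicken W r) (fun a phi => distr_deriv a (g a) phi) f].
Proof.
move=> M1 [A [H M2]] [c0 M3] hO.
(* (M.2) leaves the signs and sizes of its constants open; enlarged constants make powers of [H]
   monotone and at least 1. *)
have H1 : 1 <= `|H| + 1 by rewrite lerDr.
have A0 : 0 < `|A| + 1 by rewrite ltr_wpDl.
have M2' p q : M (p + q)%N <= (`|A| + 1) * (`|H| + 1) ^+ (p + q) * M p * M q.
  apply: le_trans (M2 p q) _; do 2 rewrite ler_pM2r//.
  apply: le_trans (ler_norm _) _; rewrite normrM normrX; apply: ler_pM => //.
  - by rewrite lerDl.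
  - by rewrite lerXn2r ?nnegrE ?lerDl// addr_ge0.
have [F1 rep1] := real_rep_exists M_gt0 M1 H1 A0 M2' M3 (ReLlin M_gt0 hf) (ReLcont M_gt0 hf)
  r omega_gt0 (bigO_parts M_gt0 omega_gt0 (@normc_ge_Re R) hO).
have [F2 rep2] := real_rep_exists M_gt0 M1 H1 A0 M2' M3 (ImLlin M_gt0 hf) (ImLcont M_gt0 hf)
  r omega_gt0 (bigO_parts M_gt0 omega_gt0 (@normc_ge_Im R) hO).
exists (complex_coeff F1 F2); split.
- exact: (complex_coeff_cont rep1 rep2).
- exact: (complex_coeff_bound M_gt0 omega_gt0 rep1 rep2).
- exact: (complex_rep M_gt0 omega_gt0 hf rep1 rep2).
Qed.

Lemma common_level (P : R -> Prop) (u v : V -> R) : tcls M star u -> tcls M star v ->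
  for_levels star P -> exists l, exists c1, exists c2, [/\ 0 < l, ub M l u c1, ub M l v c2 & P l].
Proof.
move=> [_ _ lu] [_ _ lv]; case: star lu lv => /= [lu lv [l l0 Pl]|[l1 l10 [c1 h1]] [l2 l20 [c2 h2]] HP].
  by have [c1 h1] := lu l l0; have [c2 h2] := lv l l0; exists l, c1, c2.
have l0 : 0 < Num.max l1 l2 by rewrite lt_max l10.
exists (Num.max l1 l2), c1, c2; split=> //; last exact: HP.
  by apply: ub_mono_l h1; rewrite ?le_max ?lexx// ltW.
by apply: ub_mono_l h2; rewrite ?le_max ?lexx ?orbT// ltW.
Qed.

(** This allows the strong convergence of the series to be evaluated at a single test function. *)
Lemma point_bounded Omega (phi : cfun) : D_space M star Omega phi -> D_bounded M star Omega [set phi].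
Proof.
move=> Dp; split=> [_ -> //|U HU]; have /(D_spaceP M_gt0)[t1 t2 [K [cK KO sK]]] := Dp.
have [l [c1 [c2 [l0 h1 h2 [e e0 He]]]]] := common_level t1 t2 (D_nbhs0_levels cK KO HU).
have c10 := ub_ge0 M_gt0 h1; have c20 := ub_ge0 M_gt0 h2.
pose rho := (c1 + c2 + 1) / e; have rho0 : 0 < rho by rewrite divr_gt0// ltr_wpDl// addr_ge0.
have E1 : Re_fun (fun x => rho^-1%:C * phi x) = fun x => rho^-1 * Re_fun phi x.
  by apply/funext => x; rewrite /Re_fun; case: (phi x) => ? ? /=; ring.
have E2 : Im_fun (fun x => rho^-1%:C * phi x) = fun x => rho^-1 * Im_fun phi x.
  by apply/funext => x; rewrite /Im_fun; case: (phi x) => ? ? /=; ring.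
exists rho => // _ ->; apply: He.
  apply: (tcls_D_compact M_gt0).
  - by rewrite E1; exact: tcls_scale.
  - by rewrite E2; exact: tcls_scale.
  - apply: subset_trans sK; apply: closure_subset => x /=; apply: contra => /eqP ->.
    by rewrite mulr0.
have [s1 _ _] := t1; have [s2 _ _] := t2.
have ri : 0 < rho^-1 by rewrite invr_gt0.
have hc : cub M l K (fun x => rho^-1%:C * phi x) (rho^-1 * c1 + rho^-1 * c2).
  have u1 := ub_scale rho^-1 s1 h1; have u2 := ub_scale rho^-1 s2 h2.
  rewrite (gtr0_norm ri) in u1 u2.
  by apply: ub_cub; rewrite ?E1 ?E2.
apply: le_lt_trans (ultranorm_le M_gt0 l0 hc) _; rewrite lte_fin -mulrDr /rho invf_div.
by rewrite mulrAC ltr_pdivrMr ?ltr_wpDl ?addr_ge0// ltr_pM2l// ltrDl.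
Qed.

Lemma enorm_le (y : V) : enorm y <= d.+1%:R * `|y|.
Proof.
have n0 : 0 <= d.+1%:R * `|y| by rewrite mulr_ge0.
rewrite -[leRHS](ger0_norm n0) -sqrtr_sqr ler_wsqrtr//.
apply: le_trans (_ : \sum_(i < d) `|y| ^+ 2 <= _).
  apply: ler_sum => i _; rewrite -[leLHS]real_normK ?num_real//.
  by rewrite lerXn2r ?nnegrE// normv_coord.
rewrite sumr_const card_ord exprMn -[leLHS]mulr_natl ler_wpM2r ?exprn_ge0//.
by rewrite -natrX ler_nat expnS expn1; apply: leq_trans (leqnSn d) (leq_pmulr _ _).
Qed.

(** For a fixed [phi] one radius [r] suffices: translates of its support by [h] stay within [r] of
    the point [h] itself, so the coefficient bounds give [omega h] directly, with no comparison
    between values of [omega]. *)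
Lemma bigO_of_rep :
  (forall r : R, 0 < r -> exists g : multiindex d -> cfun,
    [/\ forall a, ccontinuous_on (thicken W r) (g a), coeff_bound_case M star W omega r g &
      strong_dual_sum M star (thicken W r) (fun a phi => distr_deriv a (g a) phi) f]) ->
  bigO_translates M star W omega f.
Proof.
move=> Hrep phi /(D_spaceP M_gt0)[t1 t2 [K [cK _ sK]]].
have [L L0 KL] := compact_radius cK.
(* [L] bounds [K] in the sup norm, while neighbourhoods are Euclidean; [d.+1] is a crude comparison
   constant and the added 1 makes the inequality strict. *)
pose r := d.+1%:R * L + 1; have r0 : 0 < r by rewrite ltr_wpDl// mulr_ge0// ltW.
have Kr y : K y -> enorm y < r.
  move=> Ky; apply: le_lt_trans (enorm_le y) _; rewrite /r ltr_pwDr// ler_wpM2l//; exact: KL.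
have [g [cg Hg Hs]] := Hrep r r0.
have Hg' : for_levels star (fun lf => exists2 C, 0 < C & coeff_le M W omega r g C lf).
  by move: Hg; rewrite /coeff_bound_case; case: star.
pose P l := exists lf C, [/\ 0 < lf, 0 < C, coeff_le M W omega r g C lf & lf * l <= 4^-1].
have HP : for_levels star P.
  by apply: levels_product Hg' => lf l lf0 l0 ll [C C0 HC]; exists lf, C.
have [l [c1 [c2 [l0 h1 h2 [lf [C [lf0 C0 HC ll]]]]]]] := common_level t1 t2 HP.
have c10 := ub_ge0 M_gt0 h1; have c20 := ub_ge0 M_gt0 h2.
have Hc : cub M l K phi (c1 + c2) by exact: ub_cub.
have cc0 : 0 <= c1 + c2 by rewrite addr_ge0.
pose D := 4 * ((2 * L) ^+ d * (C * (c1 + c2))).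
have D0 : 0 <= D by rewrite mulr_ge0// mulr_ge0 ?exprn_ge0 ?mulr_ge0 ?(ltW L0) ?(ltW C0).
suff key h : W h -> Normc.normc (f (fun x => phi (x - h))) <= (1 + D * 2 ^+ d) * omega h.
  apply: (@le_lt_trans _ _ (1 + D * 2 ^+ d)%:E); last by rewrite ltry.
  by apply: ge_ereal_sup => _ [h Wh <-]; rewrite lee_fin ler_pdivrMr ?omega_gt0//; exact: key.
move=> Wh; have o0 := omega_gt0 Wh.
have cov y : K y -> exists2 x, W x & enorm (y + h - x) < r /\ omega x <= omega h.
  by move=> /Kr yr; exists h => //; rewrite addrK.
have tb a := term_bound M_gt0 L0 KL lf0 l0 (ltW C0) cc0 (ltW o0) cg HC t1 t2 sK Hc cov a.
have Dh : D_space M star (thicken W r) (fun x => phi (x - h)).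
  apply/(D_spaceP M_gt0); split; [exact: (tcls_shift h t1)|exact: (tcls_shift h t2)|].
  exists ((fun x => x + h) @` K); split.
  - apply: continuous_compact => //; apply: continuous_subspaceT => x.
    by apply: continuousD; [exact: cvg_id|exact: cst_continuous].
  - by move=> _ [y Ky <-]; have [x Wx [yx _]] := cov y Ky; exists x.
  - move=> y sy; exists (y - h); last by rewrite subrK.
    apply: sK; rewrite /supp => B /nbhs_ballP[e e0 He].
    have nB : nbhs y (ball y e) by exact: nbhsx_ballx.
    have [z [/= pz yz]] := sy _ nB; exists (z - h); split=> //; apply: He.
    by move: yz; rewrite -!ball_normE /= opprB addrA subrK.
(* The tolerance is [omega h]: the partial sum over [A0] may depend on [h], but its geometric bound
   does not depend on [A0], and the remainder contributes the summand 1 of the constant. *)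
have [A0 /(_ A0 (fsubset_refl _) _ erefl)] := Hs _ (point_bounded Dh) _ o0.
set S := \sum_(a <- A0) _ => hS.
have Do0 : 0 <= D * omega h := mulr_ge0 D0 (ltW o0).
have hT : Normc.normc S <= D * omega h * 2 ^+ d.
  apply: le_trans (normc_sum _ _) _.
  apply: le_trans (_ : \sum_(a <- A0) (D * omega h) * 4^-1 ^+ mlength a <= _).
    apply: ler_sum => a _; apply: le_trans (tb a) _.
    have -> : 4 * ((2 * L) ^+ d * (C * omega h * (c1 + c2))) = D * omega h by rewrite /D; ring.
    apply: ler_wpM2l; first exact: Do0.
    by rewrite lerXn2r ?nnegrE ?invr_ge0// mulr_ge0// ltW.
  rewrite -big_distrr /=; apply: ler_wpM2l; first exact: Do0.
  have := @fset_tail R d 0 A0 (fun al _ => leq0n _); by rewrite expr0 mul1r.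
have -> : f (fun x => phi (x - h)) = S - (S - f (fun x => phi (x - h))) by rewrite opprB addrC subrK.
apply: le_trans (le_normcD _ _) _; rewrite normcN.
have -> : (1 + D * 2 ^+ d) * omega h = D * omega h * 2 ^+ d + omega h by ring.
by apply: lerD => //; exact: ltW.
Qed.

End Directions.
Theorem theorem2 (R : realType) (d : nat) (star : ultra_case) (M : nat -> R)
    (W : set 'rV[R]_d) (omega : 'rV[R]_d -> R)
    (f : ('rV[R]_d -> R[i]) -> R[i])
    (M_gt0 : forall p, 0 < M p)
    (hM1 : weight_M1 M) (hM2 : weight_M2 M) (hM3 : weight_M3 M)
    (W_unbounded : ~ bounded_set W)
    (omega_gt0 : forall h, W h -> 0 < omega h)
    (hf : ultradistribution M star setT f) :
  bigO_translates M star W omega f <->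
  forall r : R, 0 < r ->
    exists g : multiindex d -> ('rV[R]_d -> R[i]),
      [/\ forall a, ccontinuous_on (thicken W r) (g a),
          coeff_bound_case M star W omega r g &
          strong_dual_sum M star (thicken W r)
            (fun a phi => distr_deriv a (g a) phi) f].
Proof.
split=> [hO r _|].
  exact: (rep_of_bigO M_gt0 omega_gt0 hf r hM1 hM2 hM3 hO).
exact: (bigO_of_rep M_gt0 omega_gt0).
Qed.
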